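(* Let $\Omega\subset\mathbb{R}^d$ be open, $T>0$, and let $u:\Omega\times(0,T)\to\mathbb{R}^d$ be a (measurable) vector field. Let $D^\ell_{\mathrm{DR}}$ and $D^\ell_{\mathrm{CET}}$ be defined as in the context. All function spaces below are understood locally in $\Omega\times(0,T)$, and $p_1,p_2\in[1,\infty]$. (a) $D^\ell_{\mathrm{DR}}\to0$ in $L^1_{\rm loc}(\Omega\times(0,T))$ as $\ell\to0$ under any of the following assumptions: (i) $u\in L^3_tB^{1/3}_{3,VMO}$; (ii) $u\in L^{p_1}_tBD_x\cap L^{p_2}_tC^0_x$ with $\frac1{p_1}+\frac2{p_2}=1$; (iii) $u\in L^{p_2}_tL^\infty_x$ with $Eu:=\frac{\nabla u+\nabla u^T}{2}\in L^{p_1}_tL^1_x$, where $\frac1{p_1}+\frac2{p_2}=1$; (iv) $u\in L^{p_2}_tL^2_x$ with $Eu\in L^{p_1}_tL^\infty_x$, where $\frac1{p_1}+\frac2{p_2}=1$. (b) $D^\ell_{\mathrm{CET}}\to0$ in $L^1_{\rm loc}(\Omega\times(0,T))$ as $\ell\to0$ under any of the following assumptions: (v) $u\in L^3_tB^{1/3}_{3,VMO}$; (vi) $u\in L^{p_1}_tBD_x\cap L^{p_2}_tVMO_x$ with $\frac1{p_1}+\frac2{p_2}=1$; (vii) $u\in L^{p_2}_tL^2_x$ with $Eu\in L^{p_1}_tL^\infty_x$, where $\frac1{p_1}+\frac2{p_2}=1$.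
   Context: Energy-flux approximations. Let $\rho\in C^\infty_c(\mathbb{R}^d)$ be an even mollification kernel supported in the unit ball, $\int\rho=1$, $\rho_\ell(x)=\ell^{-d}\rho(x/\ell)$, $v_\ell=v*\rho_\ell$ (mollification in space only). With $\delta_hu(x,t):=u(x+h,t)-u(x,t)$, for $x$ in a compact subset of $\Omega$ and $\ell$ small, $$D^\ell_{\mathrm{DR}}(x,t):=\int\nabla\rho(z)\cdot\frac{\delta_{\ell z}u(x,t)}{4\ell}\,|\delta_{\ell z}u(x,t)|^2\,dz,\qquad D^\ell_{\mathrm{CET}}:=\big(u_\ell\otimes u_\ell-(u\otimes u)_\ell\big):\nabla u_\ell .$$ Spaces. Here $\nabla$ and $E$ are in the space variable. ''$u\in L^q_tX_x$ locally'' means that for every interval $J\subset\subset(0,T)$ and every compact $K\subset\Omega$ the $X$-norm of $u(\cdot,t)$ on $K$ is in $L^q(J)$ as a function of $t$ (and $u(\cdot,t)\in X$ locally for a.e. $t$). $BD_x$: $L^1$ vector fields $v$ whose distributional symmetric gradient $Ev$ is a finite measure, normed by $\|v\|_{L^1}+|Ev|$ (total mass). $C^0_x$: continuous functions with the sup norm. $BMO$ (local on $K$, for some $0<r<\operatorname{dist}(K,\partial\Omega)$): $\|v\|_{BMO}:=\sup_{x\in K,\,0<\ell<r}\frac{1}{|B_\ell|}\int_{B_\ell(x)}\big|v(y)-\frac1{|B_\ell|}\int_{B_\ell(x)}v\big|\,dy$; $VMO$ is the subspace (with the $BMO$ norm) of $v$ for which, for every compact $K$, $\lim_{\ell\to0}\sup_{x\in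 K}\frac1{|B_\ell|}\int_{B_\ell(x)}\big|v(y)-\frac1{|B_\ell|}\int_{B_\ell(x)}v\big|\,dy=0$. For $\alpha\in(0,1)$, $q\in[1,\infty)$: $\|v\|_{B^\alpha_{q,BMO}}:=\|v\|_{L^q}+\sup_{0<\ell<r}\ell^{-\alpha}\big(\int_K\frac1{|B_\ell|}\int_{B_\ell(0)}|v(x+y)-v(x)|^q\,dy\,dx\big)^{1/q}$, and $B^\alpha_{q,VMO}$ is the subspace (with the same norm) of $v$ for which, for every compact $K$, the quantity $\ell^{-\alpha}\big(\int_K\frac1{|B_\ell|}\int_{B_\ell(0)}|v(x+y)-v(x)|^q\,dy\,dx\big)^{1/q}$ tends to $0$ as $\ell\to0$. *)

(* Defs.v *)
From HB Require Import structures.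
From mathcomp Require Import all_boot all_order all_algebra.
From mathcomp Require Import all_classical all_reals all_analysis.
From mathcomp Require Import measurable_realfun ess_sup_inf.

Set Implicit Arguments.
Unset Strict Implicit.
Unset Printing Implicit Defensive.
Import Order.TTheory GRing.Theory Num.Theory.
Import numFieldNormedType.Exports.
Local Open Scope classical_set_scope.
Local Open Scope ring_scope.

(* R^d is ['rV[R]_d].  Its library norm is the sup norm, so the Euclidean norm
   is defined separately ([enorm] below); the topology is the same. *)

Definition matrix_display : measure_display.
Proof. exact: default_measure_display. Qed.

Section matrix_measurable.
Context (R : realType) (m n : nat).

(* The sigma-algebra generated by the entries, i.e. the Borel sigma-algebra. *)
Definition mx_cylinders : set (set 'M[R]_(m, n)) :=
  [set A | exists i j, exists2 B : set R, measurable B &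
     A = [set M : 'M[R]_(m, n) | B (M i j)]].

Let mx_set0 : <<s mx_cylinders >> set0.
Proof. exact: sigma_algebra0. Qed.

Let mx_setC A : <<s mx_cylinders >> A -> <<s mx_cylinders >> (~` A).
Proof. exact: sigma_algebraC. Qed.

Let mx_bigcup (F : (set 'M[R]_(m, n))^nat) :
  (forall i, <<s mx_cylinders >> (F i)) -> <<s mx_cylinders >> (\bigcup_i (F i)).
Proof. exact: sigma_algebra_bigcup. Qed.

HB.instance Definition _ := @isMeasurable.Build matrix_display
  'M[R]_(m, n) <<s mx_cylinders >> mx_set0 mx_setC mx_bigcup.

Lemma measurable_coord i j :
  measurable_fun [set: 'M[R]_(m, n)] (fun M : 'M[R]_(m, n) => M i j).
Proof.
move=> _ B mB; rewrite setTI; apply: sub_sigma_algebra.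
by exists i, j, B.
Qed.

Lemma measurable_fun_coordP d (T : measurableType d) (D : set T)
    (f : T -> 'M[R]_(m, n)) :
  (forall i j, measurable_fun D (fun x => f x i j)) -> measurable_fun D f.
Proof.
move=> fm mD B; rewrite /measurable/= => mB.
suff : <<s mx_cylinders >> `<=` [set B | measurable (D `&` f @^-1` B)].
  by move=> /(_ _ mB).
apply: smallest_sub.
  split => /=.
  - by rewrite preimage_set0 setI0.
  - move=> A /= mA; rewrite setTD preimage_setC.
    have -> : D `&` ~` (f @^-1` A) = D `\` (D `&` f @^-1` A).
      by rewrite setDIr setDv set0U setDE.
    exact: measurableD.
  - move=> F mF; rewrite preimage_bigcup setI_bigcupr.
    exact: bigcup_measurable.
move=> _ [i [j [C mC ->]]] /=.
exact: (fm i j).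
Qed.

End matrix_measurable.

Section lebesgue_rV.
Context (R : realType).

Definition consrV n (p : R * 'rV[R]_n) : 'rV[R]_n.+1 :=
  \row_(j < n.+1) oapp (fun k => p.2 ord0 k) p.1 (unlift ord0 j).

Definition unconsrV n (v : 'rV[R]_n.+1) : R * 'rV[R]_n :=
  (v ord0 ord0, \row_(j < n) v ord0 (lift ord0 j)).

Lemma consrVK n : cancel (@consrV n) (@unconsrV n).
Proof.
move=> [x v]; rewrite /unconsrV mxE unlift_none /=; congr pair.
by apply/rowP => j; rewrite !mxE liftK.
Qed.

Lemma measurable_consrV n : measurable_fun setT (@consrV n).
Proof.
apply: measurable_fun_coordP => i j; rewrite ord1.
under eq_fun do rewrite mxE.
case: unliftP => [k|] _ /=; last exact: measurable_fst.
apply: (measurableT_comp (measurable_coord ord0 k)).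
exact: measurable_snd.
Qed.

Lemma measurable_unconsrV n : measurable_fun setT (@unconsrV n).
Proof.
apply/measurable_fun_pairP; split => /=.
  exact: measurable_coord.
apply: measurable_fun_coordP => i j.
under eq_fun do rewrite /= mxE.
exact: measurable_coord.
Qed.

Section step.
Context (n : nat) (mu : {sigma_finite_measure set 'rV[R]_n -> \bar R}).

Definition lebesgue_consrV : set 'rV[R]_n.+1 -> \bar R :=
  pushforward (@lebesgue_measure R \x mu)%E (@consrV n).


Let step0 : lebesgue_consrV set0 = 0%E.
Proof. by rewrite /lebesgue_consrV /pushforward preimage_set0 measure0. Qed.

Let step_ge0 A : (0 <= lebesgue_consrV A)%E.
Proof. by rewrite /lebesgue_consrV /pushforward; exact: measure_ge0. Qed.

Let step_sigma_additive : semi_sigma_additive lebesgue_consrV.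
Proof.
move=> F mF tF mUF; rewrite /lebesgue_consrV /pushforward preimage_bigcup.
have mpre B : measurable B -> measurable (@consrV n @^-1` B).
  by move=> mB; rewrite -[X in measurable X]setTI; exact: measurable_consrV.
apply: measure_semi_sigma_additive => [k||].
- by apply: mpre; exact: mF.
- apply/trivIsetP => /= i j _ _ ij; rewrite -preimage_setI.
  by move/trivIsetP : tF => /(_ _ _ _ _ ij) ->//; rewrite preimage_set0.
- by rewrite -preimage_bigcup; exact: mpre.
Qed.

HB.instance Definition _ := isMeasure.Build _ _ _ lebesgue_consrV
  step0 step_ge0 step_sigma_additive.

Let step_sigma_finite : sigma_finite setT lebesgue_consrV.
Proof.
have /sigma_finiteP[F [TF ndF Foo]] := sigma_finiteT (@lebesgue_measure R).
have /sigma_finiteP[G [TG ndG Goo]] := sigma_finiteT mu.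
have mFG k : measurable (F k `*` G k).
  by apply: measurableX; [have [] := Foo k|have [] := Goo k].
exists (fun k => @unconsrV n @^-1` (F k `*` G k)).
  apply/esym/seteqP; split => // v _.
  have [i _ Fi] : (\bigcup_i F i) (unconsrV v).1 by rewrite -TF.
  have [j _ Gj] : (\bigcup_i G i) (unconsrV v).2 by rewrite -TG.
  exists (maxn i j) => //; split => /=.
  - by move: Fi; exact/subsetPset/ndF/leq_maxl.
  - by move: Gj; exact/subsetPset/ndG/leq_maxr.
move=> k; split.
  rewrite -[X in measurable X]setTI.
  by apply: measurable_unconsrV => //; exact: mFG.
rewrite /lebesgue_consrV /pushforward -comp_preimage.
have -> : @unconsrV n \o @consrV n = id by apply/funext => p; exact: consrVK.
rewrite preimage_id; have [mF Fk] := Foo k; have [mG Gk] := Goo k.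
by rewrite product_measure1E// lte_mul_pinfty// ge0_fin_numE.
Qed.

HB.instance Definition _ := Measure_isSigmaFinite.Build _ _ _ lebesgue_consrV
  step_sigma_finite.
End step.

(* Lebesgue measure on R^n, as an iterated product of one-dimensional ones;
   see [lebesgue_rV_box]. *)
Fixpoint lebesgue_rV n : {sigma_finite_measure set 'rV[R]_n -> \bar R} :=
  match n with
  | 0 => \d_(0 : 'rV[R]_0)
  | n'.+1 => lebesgue_consrV (lebesgue_rV n')
  end.

Lemma lebesgue_rV_box n (A : 'I_n -> set R) :
  (forall i, measurable (A i)) ->
  lebesgue_rV n [set v | forall i, A i (v ord0 i)] =
  (\prod_(i < n) lebesgue_measure (A i))%E.
Proof.
elim: n A => [|n IH] A mA /=.
  rewrite big_ord0 diracE mem_set//= => -[]//.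
rewrite big_ord_recl -IH//.
have mbox : measurable
    [set v : 'rV[R]_n | forall i, A (lift ord0 i) (v ord0 i)].
  have -> : [set v : 'rV[R]_n | forall i, A (lift ord0 i) (v ord0 i)] =
      \bigcap_(i in [set: 'I_n])
        ((fun v : 'rV[R]_n => v ord0 i) @^-1` A (lift ord0 i)).
    by apply/seteqP; split => [v /= H i _|v /= H i]; [exact: H|exact: (H i)].
  apply: fin_bigcap_measurable => // i _.
  by rewrite -[X in measurable X]setTI; exact: measurable_coord.
rewrite /lebesgue_consrV /pushforward.
have -> : @consrV n @^-1` [set v | forall i, A i (v ord0 i)] =
    A ord0 `*` [set v : 'rV[R]_n | forall i, A (lift ord0 i) (v ord0 i)].
  apply/seteqP; split => [[x v]/= H|[x v]/= [H0 H] i].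
    split => [|i]; first by have := H ord0; rewrite mxE unlift_none.
    by have := H (lift ord0 i); rewrite mxE liftK.
  by rewrite mxE; case: unliftP => [j ->|->] /=.
rewrite product_measure1E; [by []|exact: mA|exact: mbox].
Qed.

End lebesgue_rV.

Arguments lebesgue_rV {R n}.

(* Measurability with respect to the completion of [mu]. *)
Definition ae_measurable {d1 d2} {T1 : measurableType d1}
    {T2 : measurableType d2} {R : realType} (mu : {measure set T1 -> \bar R})
    (D : set T1) (f : T1 -> T2) : Prop :=
  exists2 g : T1 -> T2, measurable_fun D g & ae_eq mu D f g.

Section euclidean.
Context {R : realType}.

(* Euclidean norm of a vector, Frobenius norm of a matrix. *)
Definition enorm {m n} (M : 'M[R]_(m, n)) : R :=
  Num.sqrt (\sum_i \sum_j M i j ^+ 2).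

(* The scalar product of vectors and the contraction A : B of matrices. *)
Definition mxdot {m n} (A B : 'M[R]_(m, n)) : R :=
  \sum_i \sum_j A i j * B i j.

Context {d : nat}.
Implicit Types (x : 'rV[R]_d) (r : R) (f : 'rV[R]_d -> R) (Om K : set 'rV[R]_d).

Definition eball x r : set 'rV[R]_d := [set y | enorm (y - x) < r].

Definition ball_vol r : R := fine (lebesgue_rV (eball 0 r)).

Definition partial (i : 'I_d) f : 'rV[R]_d -> R := 'D_('e_i) f.

Definition grad f x : 'rV[R]_d := \row_i partial i f x.

Definition smooth f : Prop :=
  forall s : seq 'I_d, continuous (foldr partial f s) /\
    forall (i : 'I_d) x, derivable (foldr partial f s) x ('e_i).

Definition supp f : set 'rV[R]_d := closure [set x | f x != 0].

Definition test_function Om f : Prop :=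
  [/\ smooth f, compact (supp f) & supp f `<=` Om].

(* Non-emptiness only avoids suprema over the empty set, which are -oo. *)
Definition compact_in Om K : Prop := [/\ compact K, K `<=` Om & K !=set0].

Definition dist_boundary Om K : \bar R :=
  ereal_inf [set z | exists x y,
    [/\ K x, (closure Om `\` interior Om) y & z = (enorm (x - y))%:E]].

Definition admissible_radius Om K r : Prop :=
  0 < r /\ (r%:E < dist_boundary Om K)%E.

End euclidean.

Section energy_flux.
Context {R : realType} {d : nat}.
Implicit Types (rho : 'rV[R]_d -> R) (l t : R) (x y z h : 'rV[R]_d).
Implicit Types (u : 'rV[R]_d -> R -> 'rV[R]_d).

Definition mollifier_kernel rho : Prop :=
  [/\ smooth rho,
      supp rho `<=` [set x | enorm x <= 1],
      forall x, rho (- x) = rho x &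
      \int[lebesgue_rV]_x rho x = 1].

Definition rescale rho l x : R := l ^- d * rho (l^-1 *: x).

(* For x at distance more than l from the complement of the domain, only values
   of v inside the domain contribute: the kernel vanishes elsewhere. *)
Definition mollify {m n} rho l (v : 'rV[R]_d -> 'M[R]_(m, n)) x : 'M[R]_(m, n) :=
  \matrix_(i, j) \int[lebesgue_rV]_y (v y i j * rescale rho l (x - y)).

Definition increment u h x t : 'rV[R]_d := u (x + h) t - u x t.

Definition D_DR rho u l x t : R :=
  \int[lebesgue_rV]_z
    (mxdot (grad rho z) ((4 * l)^-1 *: increment u (l *: z) x t)
     * enorm (increment u (l *: z) x t) ^+ 2).

Definition tensor_sq x : 'M[R]_d := x^T *m x.

Definition D_CET rho u l x t : R :=
  let ul := mollify rho l (u ^~ t) in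
  mxdot (tensor_sq (ul x) - mollify rho l (fun y => tensor_sq (u y t)) x)
        (\matrix_(i, j) partial j (fun y => ul y 0 i) x).

Definition spacetime_measure := (@lebesgue_rV R d \x @lebesgue_measure R)%E.

Definition spacetime (Om : set 'rV[R]_d) (T : R) : set ('rV[R]_d * R) :=
  Om `*` `]0, T[.

Definition cvg0_L1loc (Om : set 'rV[R]_d) (T : R)
    (D : R -> 'rV[R]_d -> R -> R) : Prop :=
  forall C : set ('rV[R]_d * R), compact C -> C `<=` spacetime Om T ->
    (\forall l \near 0^'+,
       ae_measurable spacetime_measure C (fun p => D l p.1 p.2)) /\
    (\int[spacetime_measure]_(p in C) `|D l p.1 p.2|%:E)%E @[l --> 0^'+] --> 0%E.

End energy_flux.

(* A space X of fields on Om is given by a membership predicate, for X taken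
   locally in Om, and by the norm (in [\bar R]) on each compact K.  All of them
   are invariant under modification of the field on a null set. *)
Section spaces.
Context {R : realType} {d : nat}.
Implicit Types (Om K : set 'rV[R]_d) (r l al : R) (q : \bar R).

Definition Lq_norm {m n} q K (v : 'rV[R]_d -> 'M[R]_(m, n)) : \bar R :=
  'N[lebesgue_rV]_q[(fun x => (enorm (v x))%:E) \_ K]%E.

Definition Lq_loc {m n} Om q (v : 'rV[R]_d -> 'M[R]_(m, n)) : Prop :=
  ae_measurable lebesgue_rV Om v /\
  forall K, compact_in Om K -> (Lq_norm q K v < +oo)%E.

(* The distribution E_ij v = (d_j v_i + d_i v_j) / 2 tested against phi. *)
Definition symgrad_pairing Om (v : 'rV[R]_d -> 'rV[R]_d) (i j : 'I_d)
    (phi : 'rV[R]_d -> R) : R :=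
  - (2^-1 * \int[lebesgue_rV]_(x in Om)
       (v x 0 i * partial j phi x + v x 0 j * partial i phi x)).

(* Ev is the locally integrable matrix field e. *)
Definition is_symgrad Om (v : 'rV[R]_d -> 'rV[R]_d) (e : 'rV[R]_d -> 'M[R]_d) :
    Prop :=
  Lq_loc Om 1%E e /\
  forall phi, test_function Om phi -> forall i j,
    \int[lebesgue_rV]_(x in Om) (e x i j * phi x) = symgrad_pairing Om v i j phi.

(* Ev is a matrix-valued measure, finite on compact subsets of Om, whose total
   variation |Ev| is mu: it is given by its polar form Ev = sigma mu with
   |sigma| = 1 mu-almost everywhere. *)
Definition is_symgrad_variation Om (v : 'rV[R]_d -> 'rV[R]_d)
    (mu : {measure set 'rV[R]_d -> \bar R}) : Prop :=
  exists sigma : 'rV[R]_d -> 'M[R]_d,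
    [/\ measurable_fun Om sigma,
        forall K, compact_in Om K -> (mu K < +oo)%E,
        {ae mu, forall x, Om x -> enorm (sigma x) = 1} &
        forall phi, test_function Om phi -> forall i j,
          \int[mu]_(x in Om) (sigma x i j * phi x) =
          symgrad_pairing Om v i j phi].

Definition BD_loc Om (v : 'rV[R]_d -> 'rV[R]_d) : Prop :=
  Lq_loc Om 1%E v /\ exists mu, is_symgrad_variation Om v mu.

(* |Ev|(K) does not depend on the choice of mu. *)
Definition BD_norm Om K (v : 'rV[R]_d -> 'rV[R]_d) : \bar R :=
  (Lq_norm 1%E K v +
   ereal_inf [set mu K | mu in is_symgrad_variation Om v])%E.

Definition continuous_version {m n} Om (v w : 'rV[R]_d -> 'M[R]_(m, n)) : Prop :=
  {in Om, continuous w} /\ ae_eq lebesgue_rV Om v w.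

Definition C0_loc {m n} Om (v : 'rV[R]_d -> 'M[R]_(m, n)) : Prop :=
  exists w, continuous_version Om v w.

(* All continuous versions agree on Om. *)
Definition C0_norm {m n} Om K (v : 'rV[R]_d -> 'M[R]_(m, n)) : \bar R :=
  ereal_inf [set ereal_sup [set (enorm (w x))%:E | x in K]
            | w in continuous_version Om v].

Definition ball_mean {m n} (v : 'rV[R]_d -> 'M[R]_(m, n)) x l : 'M[R]_(m, n) :=
  \matrix_(i, j)
    ((@ball_vol R d l)^-1 * \int[lebesgue_rV]_(y in eball x l) v y i j).

Definition mean_osc {m n} (v : 'rV[R]_d -> 'M[R]_(m, n)) x l : \bar R :=
  ((@ball_vol R d l)^-1%:E *
   \int[lebesgue_rV]_(y in eball x l) (enorm (v y - ball_mean v x l))%:E)%E.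

Definition BMO_norm {m n} r K (v : 'rV[R]_d -> 'M[R]_(m, n)) : \bar R :=
  ereal_sup [set z | exists x l, [/\ K x, 0 < l < r & z = mean_osc v x l]].

Definition BMO_loc {m n} Om (v : 'rV[R]_d -> 'M[R]_(m, n)) : Prop :=
  Lq_loc Om 1%E v /\
  forall K, compact_in Om K ->
    exists2 r, admissible_radius Om K r & (BMO_norm r K v < +oo)%E.

Definition VMO_loc {m n} Om (v : 'rV[R]_d -> 'M[R]_(m, n)) : Prop :=
  BMO_loc Om v /\
  forall K, compact_in Om K ->
    ereal_sup [set mean_osc v x l | x in K] @[l --> 0^'+] --> 0%E.

Definition besov_modulus {m n} al (q : R) K (v : 'rV[R]_d -> 'M[R]_(m, n)) l :
    \bar R :=
  ((l `^ (- al))%:E *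
   (\int[lebesgue_rV]_(x in K)
      ((@ball_vol R d l)^-1%:E *
       \int[lebesgue_rV]_(y in eball 0 l)
         (enorm (v (x + y) - v x) `^ q)%:E)) `^ q^-1)%E.

Definition besov_norm {m n} al (q : R) r K (v : 'rV[R]_d -> 'M[R]_(m, n)) :
    \bar R :=
  (Lq_norm q%:E K v +
   ereal_sup [set besov_modulus al q K v l | l in [set l | (0 < l < r)%R]])%E.

Definition besovBMO_loc {m n} al (q : R) Om (v : 'rV[R]_d -> 'M[R]_(m, n)) :
    Prop :=
  Lq_loc Om q%:E v /\
  forall K, compact_in Om K ->
    exists2 r, admissible_radius Om K r & (besov_norm al q r K v < +oo)%E.

Definition besovVMO_loc {m n} al (q : R) Om (v : 'rV[R]_d -> 'M[R]_(m, n)) :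
    Prop :=
  besovBMO_loc al q Om v /\
  forall K, compact_in Om K ->
    besov_modulus al q K v l @[l --> 0^'+] --> 0%E.

End spaces.

Section bochner.
Context {R : realType} {d : nat} {m n : nat}.
Implicit Types (Om : set 'rV[R]_d) (T : R) (p q : \bar R).
Implicit Types (v : 'rV[R]_d -> R -> 'M[R]_(m, n)).

Definition in_Lq_time (J : set R) q (N : R -> \bar R) : Prop :=
  exists g : R -> \bar R,
    [/\ measurable_fun J g, ae_eq lebesgue_measure J N g &
        ('N[lebesgue_measure]_q[g \_ J] < +oo)%E].

(* v is in L^q_t X_x locally in Om x (0, T). *)
Definition in_LtX Om T q (X : ('rV[R]_d -> 'M[R]_(m, n)) -> Prop)
    (N : set 'rV[R]_d -> ('rV[R]_d -> 'M[R]_(m, n)) -> \bar R) v : Prop :=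
  {ae lebesgue_measure, forall t, 0 < t < T -> X (v ^~ t)} /\
  forall (J : set R) (K : set 'rV[R]_d),
    is_interval J -> closure J `<=` `]0, T[ -> compact_in Om K ->
    in_Lq_time J q (fun t => N K (v ^~ t)).

Definition in_LtL Om T p q v : Prop :=
  in_LtX Om T p (Lq_loc Om q) (Lq_norm q) v.

Definition in_LtC0 Om T p v : Prop :=
  in_LtX Om T p (C0_loc Om) (C0_norm Om) v.

(* The radius in the local BMO-type norms may depend on the compact set. *)
Definition in_LtVMO Om T p v : Prop :=
  exists2 rad : set 'rV[R]_d -> R,
    forall K, compact_in Om K -> admissible_radius Om K (rad K) &
    in_LtX Om T p (VMO_loc Om) (fun K => BMO_norm (rad K) K) v.

Definition in_LtBesovVMO Om T p (al q : R) v : Prop :=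
  exists2 rad : set 'rV[R]_d -> R,
    forall K, compact_in Om K -> admissible_radius Om K (rad K) &
    in_LtX Om T p (besovVMO_loc al q Om)
      (fun K => besov_norm al q (rad K) K) v.

End bochner.

Definition in_LtBD {R : realType} {d : nat} (Om : set 'rV[R]_d) (T : R)
    (p : \bar R) (u : 'rV[R]_d -> R -> 'rV[R]_d) : Prop :=
  in_LtX Om T p (BD_loc Om) (BD_norm Om) u.

(* The distribution Eu(., t) is a function in L^q_x, and Eu is in L^p_t L^q_x. *)
Definition symgrad_in_LtL {R : realType} {d : nat} (Om : set 'rV[R]_d) (T : R)
    (p q : \bar R) (u : 'rV[R]_d -> R -> 'rV[R]_d) : Prop :=
  exists2 Eu : 'rV[R]_d -> R -> 'M[R]_d,
    {ae lebesgue_measure, forall t, 0 < t < T -> is_symgrad Om (u ^~ t) (Eu ^~ t)} &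
    in_LtL Om T p q Eu.

(* Main.v *)
(* For a smooth field w the divergence theorem in z gives
     -4 D_DR(x) = \int rho(z) (tr Ew (x + l z) |delta w|^2
                               + 2 Ew (x + l z) : (delta w (x) delta w)) dz,
   and this is applied to mollifications of u, whose strain is Eu * rho_eps.
   For D_CET the tensor u_l (x) u_l - (u (x) u)_l is symmetric, so that only
   E(u_l) = (Eu)_l matters, and it does not change when a constant c is
   subtracted from u, so that it is bounded by a local mean of |u - c|^2.
   Here c = u(x) suits the Besov and the bounded-strain cases (a mean of |delta u|^2
   that vanishes by continuity of translations in L^2), and c = a mean of u suits
   the VMO case, by the John-Nirenberg inequality.  In the Besov case both defects
   are at most C/l times a local mean of |delta u|^3.  When Eu is bounded, u is
   locally bounded, so that D_DR can be mollified as well.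
   At almost every time the L^1_x norm of the defect thus vanishes with l and is at
   most c (N1 + 1) (N2 + 1)^2, where N1, N2 are the norms in the hypothesis; by
   Young's inequality this is integrable in time, and dominated convergence
   concludes. *)

(* The hypotheses are local, while the fluxes are integrals over the whole space. At a fixed time
   the slice is therefore replaced, near [K], by a Borel field that vanishes elsewhere. This cut-off
   destroys the strain at the boundary, so the strain enters only by testing [Eu] against
   [rho_l (x - .)], whose support stays where nothing was cut. Since the given fields are Borel only
   up to null sets, many integrands are not known to be measurable; the comparisons used hold for
   all nonnegative functions. Only L^2 information is wanted from the BMO norm, so John-Nirenberg is
   proved in square form, by a stopping argument on dyadic boxes. Bounded strain is made to bound
   the field without Korn's inequality: along a segment of direction [h] the component [h . v]
   changes by an integral of [h . Ev h]. The [+ 1] added to the norms makes the majorant infinite as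
   soon as one norm is, and leaves room for near-minimisers where a norm is an infimum. *)
Require Import Defs.
From mathcomp Require Import all_boot all_order all_algebra.
From mathcomp Require Import all_classical all_reals all_analysis.
From mathcomp Require Import measurable_realfun ess_sup_inf ring lra.
Import Order.TTheory GRing.Theory Num.Theory.
Import numFieldNormedType.Exports.
Local Open Scope classical_set_scope.
Local Open Scope ring_scope.
Set Implicit Arguments.
Unset Strict Implicit.
Unset Printing Implicit Defensive.

(** * Integrals of functions that need not be measurable *)

Section lower_integral.
Context {d : measure_display} {X : measurableType d} {R : realType}.
Variable mu : {measure set X -> \bar R}.
Local Open Scope ereal_scope.
Import HBNNSimple.

(* [ge0_le_integral] without measurability: for a nonnegative function the
   library integral is the supremum over the simple functions below it. *)
Lemma ae_le_lower_integral (D : set X) (f g : X -> \bar R) :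
  (forall x, D x -> 0 <= f x) -> (forall x, D x -> 0 <= g x) ->
  {ae mu, forall x, D x -> f x <= g x} ->
  \int[mu]_(x in D) f x <= \int[mu]_(x in D) g x.
Proof.
move=> f0 g0 [N [mN N0 fgN]].
have fD0 x : 0 <= (f \_ D) x.
  by rewrite patchE; case: ifPn => // /set_mem; exact: f0.
have gD0 x : 0 <= (g \_ D) x.
  by rewrite patchE; case: ifPn => // /set_mem; exact: g0.
rewrite integral_mkcond [leRHS]integral_mkcond.
rewrite ge0_integralTE// [leRHS]ge0_integralTE//.
apply: ge_ereal_sup => _ [h hf <-].
(* Set to zero on the exceptional null set, the simple function [h] keeps its integral and lies
   below [g] everywhere. *)
pose k := (h \* \1_(~` N))%R.
have mk : measurable_fun setT k.
  by apply: measurable_funM => //; exact/measurable_indic/measurableC.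
have -> : sintegral mu h = \int[mu]_x (k x)%:E.
  rewrite -integralT_nnsfun; apply: ge0_ae_eq_integral => //.
  - exact/measurable_EFinP.
  - exact/measurable_EFinP.
  - by move=> x _; rewrite lee_fin.
  - by move=> x _; rewrite lee_fin /k/= mulr_ge0.
  - exists N; split => // x /= /not_implyP[_ hk]; apply: contrapT => Nx.
    by apply: hk; rewrite /k/= indicE mem_set// mulr1.
pose k' : {nnsfun X >-> R} := mul_nnsfun h (indic_nnsfun R (measurableC mN)).
have -> : (fun x => (k x)%:E) = (fun x => (k' x)%:E) by apply/funext.
rewrite integralT_nnsfun; apply: ereal_sup_ubound; exists k' => //= x.
rewrite -[X in X <= _]/((k x)%:E) /k/= indicE; case: (boolP (x \in ~` N)) => [xN|_] /=; last first.
  by rewrite mulr0.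
rewrite mulr1; apply: le_trans (hf x) _.
rewrite !patchE; case: ifPn => // /set_mem Dx.
apply: contrapT => fgx; move/set_mem : xN; apply; apply: fgN => /=.
by move=> /(_ Dx).
Qed.

Lemma le_lower_integral (D : set X) (f g : X -> \bar R) :
  (forall x, D x -> 0 <= f x) -> (forall x, D x -> f x <= g x) ->
  \int[mu]_(x in D) f x <= \int[mu]_(x in D) g x.
Proof.
move=> f0 fg; apply: ae_le_lower_integral => //; last exact: aeW.
by move=> x Dx; exact: le_trans (f0 _ Dx) (fg _ Dx).
Qed.

(** Positive and negative parts are compared separately, each by monotonicity in both directions.
    This allows a field to be exchanged for a Borel version of it inside an integral. *)
Lemma ae_eq_lower_integral (D : set X) (f g : X -> \bar R) :
  {ae mu, forall x, D x -> f x = g x} ->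
  \int[mu]_(x in D) f x = \int[mu]_(x in D) g x.
Proof.
have main (f' g' : X -> \bar R) : (forall x, 0 <= f' x) ->
    (forall x, 0 <= g' x) -> {ae mu, forall x, D x -> f' x = g' x} ->
    \int[mu]_(x in D) f' x = \int[mu]_(x in D) g' x.
  move=> f0 g0 fg; apply/eqP; rewrite eq_le; apply/andP; split.
    apply: ae_le_lower_integral => //.
    by apply: filterS fg => x /[apply] ->.
  apply: ae_le_lower_integral => //.
  by apply: filterS fg => x /[apply] ->.
move=> fg; rewrite integralE [RHS]integralE; congr (_ - _).
  by apply: main => //; apply: filterS fg => x /[apply] fg; rewrite !funeposE fg.
by apply: main => //; apply: filterS fg => x /[apply] fg; rewrite !funenegE fg.
Qed.

Lemma subset_lower_integral (A B : set X) (f : X -> \bar R) :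
  (forall x, B x -> 0 <= f x) -> A `<=` B ->
  \int[mu]_(x in A) f x <= \int[mu]_(x in B) f x.
Proof.
move=> f0 AB; rewrite integral_mkcond [leRHS]integral_mkcond.
apply: le_lower_integral => x _.
  by rewrite patchE; case: ifPn => // /set_mem /AB; exact: f0.
rewrite !patchE; case: ifPn => [/set_mem/AB xB|_]; first by rewrite mem_set.
by case: ifPn => // /set_mem; exact: f0.
Qed.

Lemma abs_Rintegral_le (D : set X) (f : X -> R) :
  `|(\int[mu]_(x in D) f x)%R|%:E <= \int[mu]_(x in D) `|f x|%:E.
Proof.
rewrite /Rintegral integralE.
set a := \int[mu]_(x in D) _; set b := \int[mu]_(x in D) _.
have a0 : 0 <= a by exact: integral_ge0.
have b0 : 0 <= b by exact: integral_ge0.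
have aI : a <= \int[mu]_(x in D) `|f x|%:E.
  apply: le_lower_integral => // x _.
  by rewrite funeposE ge_max !lee_fin ler_norm normr_ge0.
have bI : b <= \int[mu]_(x in D) `|f x|%:E.
  apply: le_lower_integral => // x _.
  by rewrite funenegE ge_max -EFinN !lee_fin -normrN ler_norm normr_ge0.
have [->|Ify] := eqVneq (\int[mu]_(x in D) `|f x|%:E) +oo.
  by rewrite leey.
have Iy : \int[mu]_(x in D) `|f x|%:E < +oo by rewrite ltey.
have af : a \is a fin_num by rewrite ge0_fin_numE// (le_lt_trans aI).
have bf : b \is a fin_num by rewrite ge0_fin_numE// (le_lt_trans bI).
rewrite fineB//; move: aI bI (fine_ge0 a0) (fine_ge0 b0).
rewrite -{1}(fineK af) -{1}(fineK bf).
case: (\int[mu]_(x in D) `|f x|%:E) Ify Iy => [r _ _|//|//].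
  rewrite !lee_fin => ? ? ? ?; rewrite ler_norml; apply/andP; split; lra.
Qed.

End lower_integral.

(** * Borel sets and affine changes of variables *)

Section borel_rV.
Context {R : realType} {n : nat}.
Implicit Types A : set 'rV[R]_n.

Lemma measurable_ball_rV (x : 'rV[R]_n) e : measurable (ball x e).
Proof.
(* For [n = 0] the intersection used below has no member and gives the whole space, while a ball of
   radius [e <= 0] is empty. *)
have [e0|e0] := leP e 0.
  suff -> : ball x e = set0 by [].
  apply/seteqP; split => // y; rewrite mx_norm_ball /ball_/= => xye.
  by have := le_lt_trans (normr_ge0 _) xye; rewrite ltNge e0.
have -> : ball x e = \bigcap_(i in [set: 'I_n])
    ((fun v : 'rV[R]_n => v ord0 i) @^-1` (ball (x ord0 i) e)).
  apply/seteqP; split => [y [_ xy] i _|y xy]; first exact: xy.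
  by split => // i j; rewrite ord1; exact: xy.
apply: fin_bigcap_measurable => // i _.
rewrite -[X in measurable X]setTI; apply: measurable_coord => //.
by apply: open_measurable; exact: ball_open.
Qed.

(** The balls with rational centre and radius [1 / (k + 1)] contained in [A] are countably many and
    cover [A]; [F] lists them through [unpickle], with [set0] for the codes that do not qualify. *)
Lemma open_measurable_rV A : open A -> measurable A.
Proof.
move=> oA.
pose q (c : 'rV[rat]_n * nat) : set 'rV[R]_n :=
  ball (map_mx ratr c.1 : 'rV[R]_n) c.2.+1%:R^-1.
pose F (i : nat) : set 'rV[R]_n :=
  if @unpickle ('rV[rat]_n * nat)%type i is Some c then
    if `[< q c `<=` A >] then q c else set0 else set0.
suff -> : A = \bigcup_i F i.
  apply: bigcup_measurable => i _; rewrite /F.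
  case: unpickle => [c|//]; case: ifP => _ //.
  exact: measurable_ball_rV.
apply/seteqP; split => [x Ax|x [i _]]; last first.
  by rewrite /F; case: unpickle => // c; case: asboolP => // + qx; exact.
have /nbhs_ballP[e /= e0 xeA] : nbhs x A by exact: open_nbhs_nbhs.
(* Below [e / 2], so that a ball of this radius whose centre is closer than this to [x] stays within
   [e] of [x]. *)
have [k ke] : exists k : nat, k.+1%:R^-1 < e / 2.
  have e20 : 0 < e / 2 by rewrite divr_gt0.
  near \oo => k; exists k.
  by near: k; exact: (near_infty_natSinv_lt (PosNum e20)).
have k0 : (0 : R) < k.+1%:R^-1 by rewrite invr_gt0 ltr0n.
have cP (i : 'I_n) : exists c : rat, `|ratr c - x ord0 i| < k.+1%:R^-1.
  have /rat_in_itvoo[c] : x ord0 i - k.+1%:R^-1 < x ord0 i + k.+1%:R^-1.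
    by rewrite ltrBlDr -addrA ltrDl addr_gt0.
  by rewrite in_itv/= => cx; exists c; rewrite ltr_distl.
have [c cx] := choice cP.
pose C : 'rV[rat]_n := \row_i c i.
have qC y : q (C, k) y <-> forall i, `|ratr (c i) - y ord0 i| < k.+1%:R^-1.
  split => [[_ /(_ ord0) qy] i|qy].
    by have := qy i; rewrite /ball/= /ball_/= !mxE.
  by split => // i j; rewrite ord1 /ball/= /ball_/= !mxE; exact: qy.
exists (pickle (C, k)) => //; rewrite /F pickleK.
have -> : `[< q (C, k) `<=` A >].
  apply/asboolP => y /qC qy; apply: xeA; split => // i j.
  rewrite ord1 /ball/= /ball_/=.
  rewrite -(subrK (ratr (c j)) (x ord0 j)) -addrA (le_lt_trans (ler_normD _ _))//.
  by rewrite (splitr e) ltrD// ?(lt_trans (qy _))// distrC (lt_trans (cx _)).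
exact/qC.
Unshelve. all: end_near. Qed.

Lemma closed_measurable_rV A : closed A -> measurable A.
Proof.
move=> cA; rewrite -(setCK A); apply: measurableC.
by apply: open_measurable_rV; exact: closed_openC.
Qed.

Lemma compact_measurable_rV A : compact A -> measurable A.
Proof.
move=> cA; apply: closed_measurable_rV; apply: compact_closed cA.
exact: norm_hausdorff.
Qed.

Lemma continuous_measurable_rV (f : 'rV[R]_n -> R) :
  continuous f -> measurable_fun setT f.
Proof.
move=> cf; apply: (measurability _ (RGenOInfty.measurableE R)).
move=> _ [_ [a ->] <-]; rewrite setTI; apply: open_measurable_rV.
by move/continuousP : cf; apply; exact: interval_open.
Qed.

Lemma measurable_affine (c : R) (a : 'rV[R]_n) :
  measurable_fun setT (fun x : 'rV[R]_n => c *: x + a).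
Proof.
apply: measurable_fun_coordP => i j; under eq_fun do rewrite !mxE.
apply: measurable_funD => //; apply: measurable_funM => //.
exact: measurable_coord.
Qed.

End borel_rV.

Section affine_change_of_variables.
Context {R : realType}.
Local Open Scope ereal_scope.

(** Lebesgue measure is [|c|] times its image under the affine map: by uniqueness this is checked on
    half-open intervals, where a negative [c] exchanges the open and the closed end but not the
    length. *)
Lemma ge0_integral_affine1 (c a : R) (f : R -> \bar R) : c != 0%R ->
  measurable_fun setT f -> (forall x, 0 <= f x) ->
  \int[lebesgue_measure]_x f (c * x + a)%R =
  `|c|^-1%:E * \int[lebesgue_measure]_x f x.
Proof.
move=> c0 mf f0.
pose phi : measurableTypeR R -> measurableTypeR R := fun x => (c * x + a)%R.
have mphi : measurable_fun setT phi.
  by apply: measurable_funD => //; exact: measurable_funM.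
have c0' : (0 <= `|c|)%R by [].
pose k := NngNum c0'.
pose nu0 := [the measure (measurableTypeR R) R of
  pushforward (@lebesgue_measure R) phi].
pose nu := nu0 mphi.
have nuE (A : set (measurableTypeR R)) : measurable A ->
    lebesgue_measure A = mscale k nu A.
  apply: lebesgue_measure_unique => _ [[x y] _ <-].
  change (lebesgue_measure `]x, y] =
    `|c|%:E * lebesgue_measure (phi @^-1` `]x, y])).
  have [cgt|clt|/eqP] := ltgtP c 0%R; last by rewrite (negbTE c0).
  - have -> : phi @^-1` `]x, y] = `[((y - a) / c)%R, ((x - a) / c)%R[%classic.
      apply/seteqP; split => z; rewrite /phi /= !in_itv/=.
        by rewrite ler_ndivrMr// ltr_ndivlMr//; lra.
      by rewrite ler_ndivrMr// ltr_ndivlMr//; lra.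
    rewrite !lebesgue_measure_itv/= !lte_fin ltr_ndivrMr// mulrVK ?unitfE//.
    rewrite ltrD2r; case: ifPn => _; last by rewrite mule0.
    rewrite -!EFinB -EFinM ltr0_norm//; congr EFin.
    by field.
  - have -> : phi @^-1` `]x, y] = `]((x - a) / c)%R, ((y - a) / c)%R]%classic.
      apply/seteqP; split => z; rewrite /phi /= !in_itv/=.
        by rewrite ltr_pdivrMr// ler_pdivlMr//; lra.
      by rewrite ltr_pdivrMr// ler_pdivlMr//; lra.
    rewrite !lebesgue_measure_itv/= !lte_fin ltr_pM2r ?invr_gt0//.
    rewrite ltrD2r; case: ifPn => _; last by rewrite mule0.
    rewrite -!EFinB -EFinM gtr0_norm//; congr EFin.
    by field.
have -> : \int[lebesgue_measure]_x f (c * x + a)%R = \int[nu]_x f x.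
  by rewrite ge0_integral_pushforward.
rewrite [X in _ * X](@eq_measure_integral _ _ _ _ (mscale k nu)); last first.
  by move=> A mA _; exact: nuE.
rewrite ge0_integral_mscale// muleA -EFinM mulVf ?mul1e//.
by rewrite normr_eq0.
Qed.

Lemma ge0_integral_consrV n (f : 'rV[R]_n.+1 -> \bar R) :
  measurable_fun setT f -> (forall x, 0 <= f x) ->
  \int[lebesgue_rV]_x f x =
  \int[lebesgue_measure]_x \int[lebesgue_rV]_v f (consrV (x, v)).
Proof.
move=> mf f0.
have := @ge0_integral_pushforward _ _ (measurableTypeR R * 'rV[R]_n)%type _ _ _
  (@measurable_consrV R n) (@lebesgue_measure R \x lebesgue_rV)%E
  setT f measurableT mf (fun x _ => f0 x).
rewrite preimage_setT => pE.
transitivity (\int[(@lebesgue_measure R \x lebesgue_rV)%E]_p f (consrV p)).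
  by rewrite -[RHS]pE.
by rewrite fubini_tonelli1//; exact: measurableT_comp (measurable_consrV (n:=n)).
Qed.

(** One coordinate is split off at a time; each contributes a factor [|c|^-1]. *)
Lemma ge0_integral_affine n (c : R) (a : 'rV[R]_n) (f : 'rV[R]_n -> \bar R) :
  c != 0%R -> measurable_fun setT f -> (forall x, 0 <= f x) ->
  \int[lebesgue_rV]_x f (c *: x + a)%R =
  (`|c| ^- n)%:E * \int[lebesgue_rV]_x f x.
Proof.
move=> c0; elim: n a f => [|n IH] a f mf f0.
  by rewrite expr0 invr1 mul1e; apply: eq_integral => x _; rewrite thinmx0 (thinmx0 x).
have mfa : measurable_fun setT (fun x : 'rV[R]_n.+1 => f (c *: x + a)%R).
  exact: measurableT_comp (measurable_affine c a).
rewrite ge0_integral_consrV// ge0_integral_consrV//.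
pose a' : 'rV[R]_n := \row_j a ord0 (lift ord0 j).
have cE x v : (c *: consrV (x, v) + a = consrV (c * x + a ord0 ord0, c *: v + a'))%R.
  apply/rowP => j; rewrite !mxE/=.
  by case: unliftP => [k|] ->; rewrite /= ?mxE.
under eq_integral => x _.
  under eq_integral do rewrite cE.
  rewrite (IH a' (fun v => f (consrV (c * x + a ord0 ord0, v)%R)))//; last first.
    apply: measurableT_comp => //; apply: measurableT_comp.
      exact: measurable_consrV.
    exact: pair1_measurable.
  over.
pose g x := \int[lebesgue_rV]_v f (consrV (x, v) : 'rV[R]_n.+1).
have mg : measurable_fun setT g.
  apply: (@measurable_fun_fubini_tonelli_F _ _ _ _ _ lebesgue_rV
     (fun p : measurableTypeR R * _ => f (consrV p))) => //.
  exact: measurableT_comp (measurable_consrV (n:=n)).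
have g0 x : 0 <= g x by exact: integral_ge0.
transitivity (\int[lebesgue_measure]_x
  ((`|c| ^- n)%:E * g (c * x + a ord0 ord0)%R)) => //.
have mga : measurable_fun setT (fun x : R => g (c * x + a ord0 ord0)%R).
  by apply: (measurableT_comp mg); apply: measurable_funD => //.
rewrite ge0_integralZl//.
rewrite (ge0_integral_affine1 (a ord0 ord0) c0 mg)// muleA -EFinM.
by rewrite exprS invfM mulrC.
Qed.

End affine_change_of_variables.

Section lebesgue_rV_basics.
Context {R : realType} {d : nat}.
Local Notation V := 'rV[R]_d.
Local Notation lam := (@lebesgue_rV R d).
Local Open Scope ereal_scope.

Lemma ge0_integral_shift (a : V) (f : V -> \bar R) :
  measurable_fun setT f -> (forall x, 0 <= f x) ->
  \int[lam]_x f (x + a)%R = \int[lam]_x f x.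
Proof.
move=> mf f0; under eq_integral do rewrite -[X in (X + a)%R]scale1r.
by rewrite ge0_integral_affine ?oner_neq0// normr1 expr1n invr1 mul1e.
Qed.

Lemma measurable_shift (a : V) : measurable_fun setT (fun x : V => x + a)%R.
Proof.
have -> : (fun x : V => x + a)%R = (fun x => 1 *: x + a)%R.
  by apply/funext => x; rewrite scale1r.
exact: measurable_affine.
Qed.

Lemma lebesgue_rV_ball (x : V) (e : R) : (0 < e)%R ->
  lam (ball x e) = ((e *+ 2) ^+ d)%:E.
Proof.
move=> e0.
have -> : ball x e = [set v : V | forall i, ball (x ord0 i) e (v ord0 i)].
  apply/seteqP; split => [y [_ xy] i|y xy]; first exact: xy.
  by split => // i j; rewrite ord1; exact: xy.
rewrite (lebesgue_rV_box (A := fun i => ball (x ord0 i) e)); last first.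
  by move=> i; exact: measurable_ball.
under eq_bigr do rewrite lebesgue_measure_ball ?ltW//.
by rewrite prodEFin prodr_const card_ord.
Qed.

Lemma bounded_lebesgue_lty (A : set V) : measurable A -> bounded_set A ->
  lam A < +oo.
Proof.
move=> mA [M [_ MA]].
have M0 : (0 < `|M| + 2)%R by rewrite ltr_wpDl.
have M1 : (M < `|M| + 1)%R by rewrite (le_lt_trans (ler_norm _))// ltrDl.
apply: (@le_lt_trans _ _ (lam (ball 0%R (`|M| + 2)%R))); last first.
  by rewrite lebesgue_rV_ball// ltry.
apply: le_measure; rewrite ?inE//; first exact: measurable_ball_rV.
move=> x Ax; rewrite -ball_normE/= sub0r normrN.
by apply: le_lt_trans (MA _ M1 x Ax) _; rewrite ltrD2l ltr1n.
Qed.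

Lemma compact_lebesgue_lty (A : set V) : compact A -> lam A < +oo.
Proof.
move=> cA; apply: bounded_lebesgue_lty; first exact: compact_measurable_rV.
exact: compact_bounded.
Qed.

End lebesgue_rV_basics.

(** * Continuity of translations in L^1 *)

Section shift_continuity.
Context {R : realType} {d : nat}.
Local Notation V := 'rV[R]_d.
Local Notation lam := (@lebesgue_rV R d).
Implicit Types (f g : V -> R) (h : V).

Definition shift_cvg f := forall e : R, 0 < e ->
  \forall h \near (0 : V), (\int[lam]_x `|f (x + h)%R - f x|%:E <= e%:E)%E.

Let mshift f h : measurable_fun setT f ->
  measurable_fun setT (fun x : V => f (x + h)).
Proof. by move=> mf; exact: measurableT_comp mf (measurable_shift h). Qed.

Let mdist f g : measurable_fun setT f -> measurable_fun setT g ->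
  measurable_fun setT (fun x : V => `|f x - g x|%:E).
Proof.
move=> mf mg; apply/measurable_EFinP; apply: measurableT_comp => //.
exact: measurable_funB.
Qed.

Lemma shift_cvgD f g : measurable_fun setT f -> measurable_fun setT g ->
  shift_cvg f -> shift_cvg g -> shift_cvg (f \+ g).
Proof.
move=> mf mg cf cg e e0; have e20 : 0 < e / 2 by rewrite divr_gt0.
near=> h.
have fe : (\int[lam]_x `|f (x + h)%R - f x|%:E <= (e / 2)%:E)%E.
  by near: h; exact: cf.
have ge : (\int[lam]_x `|g (x + h)%R - g x|%:E <= (e / 2)%:E)%E.
  by near: h; exact: cg.
rewrite (splitr e) EFinD; apply: le_trans (leeD fe ge).
rewrite -ge0_integralD//; try exact: mdist (mshift h _) _.
apply: le_lower_integral => // x _; rewrite -EFinD lee_fin /=.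
rewrite opprD addrACA; exact: ler_normD.
Unshelve. all: end_near. Qed.

Lemma shift_cvgZ (k : R) f : measurable_fun setT f ->
  shift_cvg f -> shift_cvg (fun x => k * f x).
Proof.
move=> mf cf e e0.
have ek : 0 < e / (`|k| + 1) by rewrite divr_gt0// ltr_pwDr.
have := cf _ ek; apply: filterS => h fe.
apply: (@le_trans _ _ (`|k|%:E * \int[lam]_x `|f (x + h)%R - f x|%:E)%E).
  rewrite -ge0_integralZl//; last exact: mdist (mshift h _) _.
  by apply: le_lower_integral => // x _; rewrite -mulrBr normrM EFinM.
apply: le_trans (lee_wpmul2l _ fe) _ => //.
rewrite -EFinM lee_fin mulrCA ler_piMr ?(ltW e0)//.
by rewrite ler_pdivrMr ?ltr_pwDr// mul1r lerDl.
Qed.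

Lemma shift_cvg_sum (I : Type) (s : seq I) (F : I -> V -> R) :
  (forall i, measurable_fun setT (F i)) -> (forall i, shift_cvg (F i)) ->
  shift_cvg (fun x => \sum_(i <- s) F i x).
Proof.
move=> mF cF; elim: s => [|i s IH].
  move=> e e0; near=> h.
  under eq_integral do rewrite !big_nil subrr normr0.
  by rewrite integral0 lee_fin ltW.
have -> : (fun x => \sum_(j <- i :: s) F j x) =
    F i \+ (fun x => \sum_(j <- s) F j x).
  by apply/funext => x; rewrite big_cons.
by apply: shift_cvgD => //; exact: measurable_sum.
Unshelve. all: end_near. Qed.

(** The increments of [f] and of [g] differ by two integrals of [|f - g|], which are equal by
    translation invariance; hence thirds of [e]. *)
Lemma shift_cvg_approx f : measurable_fun setT f ->
  (forall e : R, 0 < e -> exists g, [/\ measurable_fun setT g, shift_cvg g &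
    (\int[lam]_x `|f x - g x|%:E <= e%:E)%E]) ->
  shift_cvg f.
Proof.
move=> mf fg e e0; have e30 : 0 < e / 3 by rewrite divr_gt0.
have [g [mg cg fge]] := fg _ e30.
have := cg _ e30; apply: filterS => h ge.
have mh : measurable_fun setT (fun x : V => `|f (x + h) - g (x + h)|%:E).
  by apply: mdist; exact: mshift.
have -> : e%:E = ((e / 3)%:E + ((e / 3)%:E + (e / 3)%:E))%E.
  by rewrite -!EFinD; congr EFin; field.
have fgh : (\int[lam]_x `|f (x + h)%R - g (x + h)%R|%:E <= (e / 3)%:E)%E.
  by rewrite (@ge0_integral_shift _ _ h (fun x => `|f x - g x|%:E))//; exact: mdist.
apply: le_trans (leeD fgh (leeD ge fge)).
rewrite -ge0_integralD//; try exact: mdist (mshift h _) _.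
  rewrite -ge0_integralD//.
    apply: le_lower_integral => // x _; rewrite -!EFinD lee_fin.
    rewrite (_ : f (x + h) - f x = (f (x + h) - g (x + h)) +
      ((g (x + h) - g x) + (g x - f x))); last by ring.
    rewrite (le_trans (ler_normD _ _))// lerD2l (le_trans (ler_normD _ _))//.
    by rewrite lerD2l distrC.
  - by move=> x _; rewrite adde_ge0.
  - by apply: emeasurable_funD; [exact: mdist (mshift h _) _|exact: mdist].
exact: mdist.
Qed.

(** The points of [A] at distance at least [1 / (k + 1)] from the complement increase to [A]. A
    shorter shift keeps them in [A], so the indicators at [x] and [x + h] differ only if one of
    these points lies in [A] without belonging to that set. *)
Lemma shift_cvg_open (A : set V) : open A -> (lam A < +oo)%E ->
  shift_cvg \1_A.
Proof.
move=> oA Ay e e0.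
pose F k : set V := [set x | ball x k.+1%:R^-1 `<=` A].
have mF k : measurable (F k).
  rewrite -(setCK (F k)); apply: measurableC; apply: open_measurable_rV.
  rewrite openE => x; rewrite /F/= => /existsNP[y /not_implyP[xy Ay']].
  have : nbhs x (ball y k.+1%:R^-1).
    by apply: open_nbhs_nbhs; split; [exact: ball_open|exact: ball_sym].
  by apply: filterS => z yz /(_ y (ball_sym yz)).
have FA k : F k `<=` A.
  by move=> x; apply; apply: ballxx; rewrite invr_gt0.
have ndF : nondecreasing_seq F.
  move=> m n mn; apply/subsetPset => x Fx y xy; apply: Fx.
  by apply: le_ball xy; rewrite lef_pV2 ?posrE// ler_nat ltnS.
have UF : \bigcup_k F k = A.
  apply/seteqP; split => [x [k _ /FA//]|x Ax].
  have /nbhs_ballP[r /= r0 xrA] : nbhs x A by exact: open_nbhs_nbhs.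
  near \oo => k; exists k => // y xy; apply: xrA; apply: le_ball xy.
  by apply: ltW; near: k; exact: (near_infty_natSinv_lt (PosNum r0)).
have mA : measurable A by exact: open_measurable_rV.
have Fcvg : lam (F n) @[n --> \oo] --> lam A.
  by rewrite -UF; apply: nondecreasing_cvg_mu => //; rewrite UF.
have [k Fk] : exists k, (lam (A `\` F k) <= (e / 2)%:E)%E.
  have Af : lam A \is a fin_num by rewrite ge0_fin_numE.
  have Ff n : lam (F n) \is a fin_num.
    by rewrite ge0_fin_numE// (le_lt_trans _ Ay)// le_measure ?inE.
  move: Fcvg; rewrite -(fineK Af) => /fine_cvgP[_] /cvgrPdist_le/(_ (e / 2)).
  rewrite divr_gt0// => /(_ isT)[k _ /(_ k (leqnn k))] /= ke.
  exists k; rewrite measureD//= setIidr//.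
  rewrite -(fineK Af) -(fineK (Ff k)) -EFinB lee_fin.
  exact: le_trans (ler_norm _) ke.
have mAF : measurable (A `\` F k) by exact: measurableD.
near=> h.
have hk : `|h| < k.+1%:R^-1.
  near: h; apply/nbhs_ballP; exists k.+1%:R^-1 => /=; first by rewrite invr_gt0.
  by move=> z; rewrite -ball_normE/= sub0r normrN.
pose I x := (\1_(A `\` F k) x : R).
have mI : measurable_fun setT (EFin \o I).
  by apply/measurable_EFinP; exact: measurable_indic.
apply: (@le_trans _ _ (\int[lam]_x ((I x)%:E + (I (x + h))%:E))%E).
  apply: le_lower_integral => // x _; rewrite -EFinD lee_fin.
  rewrite /I !indicE !in_setD.
  case: (boolP (x \in A)) => [xA|xA]; case: (boolP (x + h \in A)) => [xhA|xhA];
    rewrite ?subrr ?normr0 ?addr_ge0// ?andbT ?andbF ?addr0 ?add0r ?subr0 ?sub0r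
      ?normrN ?normr1.
  - case: (boolP (x \in F k)) => //= /set_mem Fx; exfalso.
    move/negP : xhA; apply; apply/mem_set/Fx.
    by rewrite -ball_normE/= opprD addNKr normrN.
  - case: (boolP (x + h \in F k)) => //= /set_mem Fx; exfalso.
    move/negP : xA; apply; apply/mem_set/Fx.
    by rewrite -ball_normE/= addrAC subrr add0r.
rewrite ge0_integralD//; first last.
- exact: measurableT_comp mI (measurable_shift h).
- by move=> x _; rewrite lee_fin /I indicE.
- by move=> x _; rewrite lee_fin /I indicE.
rewrite (@ge0_integral_shift _ _ h (EFin \o I))//; last first.
  by move=> x; rewrite lee_fin /I indicE.
rewrite /= integral_indic// setIT.
by rewrite (splitr e) EFinD leeD.
Unshelve. all: end_near. Qed.

(** The sigma-algebra is generated by the entries. As these are continuous, the open sets generate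
    it too, and they are the intersection-stable class from which [shift_cvg_indic] starts. *)
Lemma measurable_rV_opens (A : set V) : measurable A ->
  <<s (@open V) >> A.
Proof.
suff : measurable `<=` <<s (@open V) >> by exact.
apply: smallest_sub; first exact: smallest_sigma_algebra.
move=> _ [i [j [B mB ->]]].
have mc : measurable_fun (setT : set (g_sigma_algebraType (@open V)))
    (fun M : g_sigma_algebraType (@open V) => (M : V) i j).
  apply: (measurability _ (RGenOpens.measurableE R)).
  move=> _ [_ [a [b ->] <-]]; rewrite setTI; apply: sub_sigma_algebra.
  have /continuousP cc : continuous (fun M : V => M i j) by exact: coord_continuous.
  by apply: cc; exact: interval_open.
by have := mc measurableT B mB; rewrite setTI.
Qed.

Let D k : set V := ball 0 k.+1%:R.

Let Dy k : (lam (D k) < +oo)%E.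
Proof. by rewrite /D lebesgue_rV_ball// ltry. Qed.

Let mD k : measurable (D k). Proof. exact: measurable_ball_rV. Qed.

Let ndD : nondecreasing_seq D.
Proof.
by move=> m n mn; apply/subsetPset; apply: le_ball; rewrite ler_nat ltnS.
Qed.

Let UD : \bigcup_k D k = setT.
Proof.
apply/seteqP; split => // x _; exists (Num.truncn `|x|) => //.
by rewrite /D -ball_normE/= sub0r normrN truncnS_gt.
Qed.

Lemma indic_increasing_approx (F : (set V)^nat) (e : R) : 0 < e ->
  (forall k, measurable (F k)) -> nondecreasing_seq F ->
  (lam (\bigcup_k F k) < +oo)%E ->
  exists k, (\int[lam]_x `|\1_(\bigcup_k F k) x - \1_(F k) x|%:E <= e%:E)%E.
Proof.
move=> e0 mF ndF Fy; set U := \bigcup_k F k.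
have mU : measurable U by exact: bigcup_measurable.
have Fcvg : lam (F n) @[n --> \oo] --> lam U by exact: nondecreasing_cvg_mu.
have FU k : F k `<=` U by exact: bigcup_sup.
have Uf : lam U \is a fin_num by rewrite ge0_fin_numE.
have Ff n : lam (F n) \is a fin_num.
  by rewrite ge0_fin_numE// (le_lt_trans _ Fy)// le_measure ?inE.
move: Fcvg; rewrite -(fineK Uf) => /fine_cvgP[_] /cvgrPdist_le/(_ e e0).
move=> [k _ /(_ k (leqnn k))] /= ke; exists k.
have -> : (\int[lam]_x `|\1_U x - \1_(F k) x|%:E = lam (U `\` F k))%E.
  rewrite -[in RHS](setIT (U `\` F k)) -integral_indic//; last exact: measurableD.
  apply: eq_integral => x _; rewrite !indicE in_setD.
  case: (boolP (x \in F k)) => [/set_mem/FU xF|xF] /=.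
    by rewrite mem_set// subrr normr0.
  by rewrite subr0 andbT; case: (x \in U) => /=; rewrite ?normr1 ?normr0.
rewrite measureD//= setIidr// -(fineK Uf) -(fineK (Ff k)) -EFinB lee_fin.
exact: le_trans (ler_norm _) ke.
Qed.

(** Dynkin's argument from open sets, with everything intersected with a ball [D k] so that all
    measures are finite; the ball is removed at the end by approximation in L^1. *)
Lemma shift_cvg_indic (A : set V) : measurable A -> (lam A < +oo)%E ->
  shift_cvg \1_A.
Proof.
move=> mA Ay.
have bnd k : shift_cvg \1_(A `&` D k).
  pose H : set (set V) := [set B | measurable B /\ shift_cvg \1_(B `&` D k)].
  suff : <<s (@open V) >> `<=` H by move=> /(_ A (measurable_rV_opens mA))[].
  apply: lambda_system_subset => //.
  - by move=> B C; exact: openI.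
  - split => //.
    + by split => //; rewrite setTI; apply: shift_cvg_open => //; exact: ball_open.
    + move=> B C CB [mB cB] [mC cC]; split; first exact: measurableD.
      have -> : \1_((B `\` C) `&` D k) =
          (\1_(B `&` D k) : V -> R) \+ (fun x => -1 * \1_(C `&` D k) x).
        apply/funext => x; rewrite /= !indicE in_setI in_setD !in_setI mulN1r.
        case: (boolP (x \in C)) => [/set_mem/CB xC|xC] /=.
          by rewrite mem_set//= subrr.
        by rewrite andbT subr0.
      apply: shift_cvgD => //.
      * by apply: measurable_indic; exact: measurableI.
      * by apply: measurable_funM => //; apply: measurable_indic; exact: measurableI.
      * by apply: shift_cvgZ => //; apply: measurable_indic; exact: measurableI.
    + move=> F ndF FH; split; first by apply: bigcup_measurable => i _; case: (FH i).
      have mF i : measurable (F i `&` D k) by apply: measurableI => //; case: (FH i).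
      apply: shift_cvg_approx.
        apply: measurable_indic; apply: measurableI => //.
        by apply: bigcup_measurable => i _; case: (FH i).
      move=> e e0; rewrite setI_bigcupl.
      have [||i ie] := @indic_increasing_approx (fun i => F i `&` D k) e e0 mF.
      * by move=> m n mn; apply/subsetPset; apply: setSI; exact/subsetPset/ndF.
      * apply: le_lt_trans (Dy k); apply: le_measure; rewrite ?inE//.
          exact: bigcup_measurable.
        by rewrite -setI_bigcupl.
      * exists \1_(F i `&` D k); split => //.
        by case: (FH i).
  - by move=> B oB; split; [exact: open_measurable_rV|
      apply: shift_cvg_open; [apply: openI => //; exact: ball_open|
      apply: le_lt_trans (Dy k); apply: le_measure; rewrite ?inE//;
      apply: measurableI => //; exact: open_measurable_rV]].
apply: shift_cvg_approx; first exact: measurable_indic.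
move=> e e0.
have mAD k : measurable (A `&` D k) by exact: measurableI.
have UA : \bigcup_k (A `&` D k) = A by rewrite -setI_bigcupr UD setIT.
have [||k ke] := @indic_increasing_approx (fun k => A `&` D k) e e0 mAD.
- by move=> m n mn; apply/subsetPset; apply: setIS; exact/subsetPset/ndD.
- by rewrite UA.
exists \1_(A `&` D k); split => //.
by move: ke; rewrite UA.
Qed.

Import HBSimple.

Lemma integrable_shift_cvg f : lam.-integrable setT (EFin \o f) -> shift_cvg f.
Proof.
move=> intf.
have mf : measurable_fun setT f by apply/measurable_EFinP; case/integrableP : intf.
have [g [intg _ gf]] := approximation_sfun_integrable measurableT intf.
apply: shift_cvg_approx => // e e0.
move/fine_cvgP : gf => [[m _ mfin] /cvgrPdist_le/(_ e e0)[n _ ne]].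
pose k := maxn m n.
exists (g k); split => //.
  have gE : g k = (fun x => \sum_(r <- finmap.enum_fset (fset_set (range (g k))))
      r * \1_(g k @^-1` [set r]) x) :> (V -> R).
    apply/funext => x; rewrite [LHS]fimfunE fsbig_finite//=.
  rewrite gE; apply: shift_cvg_sum => r.
    by apply: measurable_funM => //; apply: measurable_indic; exact: measurable_funPTI.
  have mr : measurable (g k @^-1` [set r]) by exact: measurable_funPTI.
  (* Only the level set of the value [0] may have infinite measure, and it contributes nothing; the
     others have finite measure because [|r|] times it is at most the integral of [|g k|]. *)
  have [->|r0] := eqVneq r 0.
    move=> e' e'0; near=> h.
    under eq_integral do rewrite !mul0r subrr normr0.
    by rewrite integral0 lee_fin ltW.
  apply: shift_cvgZ; first exact: measurable_indic.
  apply: shift_cvg_indic => //.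
  have /integrableP[_ gy] := intg k.
  have r0' : 0 < `|r| by rewrite normr_gt0.
  suff : (`|r|%:E * lam (g k @^-1` [set r]) < +oo)%E.
    rewrite !ltey; apply: contra => /eqP ->.
    by rewrite gt0_muley ?lte_fin.
  apply: le_lt_trans gy.
  rewrite -[X in lam X]setIT -integral_indic// -ge0_integralZl//; first last.
  - by apply/measurable_EFinP; exact: measurable_indic.
  apply: le_lower_integral => x _.
    by rewrite mule_ge0// lee_fin.
  rewrite -EFinM lee_fin indicE; case: (boolP (_ \in _)) => [/set_mem/= ->|_].
    by rewrite mulr1.
  by rewrite mulr0.
have kfin := mfin k (leq_maxl m n); have := ne k (leq_maxr m n).
rewrite sub0r normrN /= => ke; rewrite -(fineK kfin) lee_fin.
exact: le_trans (ler_norm _) ke.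
Unshelve. all: end_near. Qed.

End shift_continuity.

(** * Norms and neighbourhoods *)

Section enorm_theory.
Context {R : realType}.

Lemma enorm_ge0 m n (M : 'M[R]_(m, n)) : 0 <= enorm M.
Proof. exact: sqrtr_ge0. Qed.

Lemma enorm_sq m n (M : 'M[R]_(m, n)) :
  enorm M ^+ 2 = \sum_i \sum_j M i j ^+ 2.
Proof.
by rewrite sqr_sqrtr//; apply: sumr_ge0 => i _; apply: sumr_ge0 => j _;
  exact: sqr_ge0.
Qed.

Lemma enorm_rV_sq n (x : 'rV[R]_n) : enorm x ^+ 2 = \sum_i x 0 i ^+ 2.
Proof. by rewrite enorm_sq big_ord1. Qed.

Lemma coord_le_enorm m n (M : 'M[R]_(m, n)) i j : `|M i j| <= enorm M.
Proof.
rewrite -(@ler_pXn2r _ 2)// ?nnegrE ?enorm_ge0// real_normK ?num_real//.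
rewrite enorm_sq (bigD1 i)//= (bigD1 j)//= -addrA lerDl addr_ge0//.
  by apply: sumr_ge0 => *; exact: sqr_ge0.
by apply: sumr_ge0 => *; apply: sumr_ge0 => *; exact: sqr_ge0.
Qed.

Lemma sum_sqr_le (I : Type) (s : seq I) (a : I -> R) : (forall i, 0 <= a i) ->
  \sum_(i <- s) a i ^+ 2 <= (\sum_(i <- s) a i) ^+ 2.
Proof.
move=> a0; elim: s => [|i s IH]; first by rewrite !big_nil expr0n.
rewrite !big_cons; have : 0 <= \sum_(j <- s) a j by exact: sumr_ge0.
by have := a0 i; nra.
Qed.

Lemma enorm_le_sum m n (M : 'M[R]_(m, n)) : enorm M <= \sum_i \sum_j `|M i j|.
Proof.
have S0 i : 0 <= \sum_j `|M i j| by exact: sumr_ge0.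
rewrite -(@ler_pXn2r _ 2)// ?nnegrE ?enorm_ge0//; last exact: sumr_ge0.
rewrite enorm_sq; apply: le_trans (sum_sqr_le _ S0).
apply: ler_sum => i _; apply: le_trans (sum_sqr_le _ _) => //.
by apply: ler_sum => j _; rewrite real_normK ?num_real.
Qed.

Lemma rV_norm_le n (x : 'rV[R]_n) (e : R) : 0 <= e ->
  (forall i, `|x 0 i| <= e) -> `|x| <= e.
Proof.
move=> e0 xe; rewrite [leLHS]/Num.Def.normr/= mx_normrE; apply: bigmax_le => //= -[i j] _.
by rewrite ord1; exact: xe.
Qed.

Lemma coord_le_norm n (x : 'rV[R]_n) i : `|x 0 i| <= `|x|.
Proof.
rewrite [leRHS]/Num.Def.normr/= mx_normrE.
exact: (@le_bigmax _ _ _ 0 (fun p : 'I_1 * 'I_n => `|x p.1 p.2|) (0, i)).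
Qed.

Lemma norm_le_enorm n (x : 'rV[R]_n) : `|x| <= enorm x.
Proof. by apply: rV_norm_le => [|i]; [exact: enorm_ge0|exact: coord_le_enorm]. Qed.

Lemma enormZ m n (c : R) (M : 'M[R]_(m, n)) : enorm (c *: M) = `|c| * enorm M.
Proof.
rewrite /enorm -sqrtr_sqr -sqrtrM ?sqr_ge0//; congr Num.sqrt.
rewrite mulr_sumr; apply: eq_bigr => i _; rewrite mulr_sumr.
by apply: eq_bigr => j _; rewrite mxE exprMn.
Qed.

Lemma measurable_enorm d (T : measurableType d) (D : set T) m n
    (f : T -> 'M[R]_(m, n)) : measurable_fun D f ->
  measurable_fun D (fun x => enorm (f x)).
Proof.
move=> mf.
have ms := continuous_measurable_fun (@sqrt_continuous R).
apply: (measurableT_comp ms).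
apply: measurable_sum => i; apply: measurable_sum => j.
by apply: measurable_funX; exact: measurableT_comp (measurable_coord i j) mf.
Qed.

Lemma measurable_eball n (x : 'rV[R]_n) r : measurable (eball x r).
Proof.
have m1 : measurable_fun setT (fun y : 'rV[R]_n => enorm (y - x)).
  apply: measurable_enorm; apply: measurable_fun_coordP => i j.
  under eq_fun do rewrite !mxE.
  by apply: measurable_funB => //; exact: measurable_coord.
have -> : eball x r = setT `&`
    (fun y : 'rV[R]_n => enorm (y - x)) @^-1` `]-oo, r[%classic.
  by rewrite setTI; apply/seteqP; split => y /=; rewrite /eball/= in_itv.
exact: m1.
Qed.

Lemma eball01_norm n (z : 'rV[R]_n) : eball 0 1 z -> `|z| <= 1.
Proof.
by rewrite /eball/= subr0 => /ltW; apply: le_trans; exact: norm_le_enorm.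
Qed.

Lemma lebesgue_eball_lty n (x : 'rV[R]_n) r : (lebesgue_rV (eball x r) < +oo)%E.
Proof.
apply: bounded_lebesgue_lty; first exact: measurable_eball.
exists (`|x| + `|r|); split; first by rewrite num_real.
move=> M rM y /= xy; apply: ltW; apply: le_lt_trans rM.
rewrite -(subrK x y) addrC (le_trans (ler_normD _ _))// lerD2l.
apply: le_trans (norm_le_enorm _) _.
by apply: le_trans (ltW xy) (ler_norm _).
Qed.

Lemma lebesgue_eball_gt0 n (x : 'rV[R]_n) r : 0 < r ->
  (0 < lebesgue_rV (eball x r))%E.
Proof.
(* Dividing by [n + 1] makes [n * e < r] strict, also for [n = 0]. *)
move=> r0; pose e := r / (n.+1%:R).
have e0 : 0 < e by rewrite divr_gt0.
apply: (@lt_le_trans _ _ (lebesgue_rV (ball x e))).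
  by rewrite lebesgue_rV_ball// lte_fin exprn_gt0// pmulrn_lgt0.
apply: le_measure; rewrite ?inE; [exact: measurable_ball_rV|exact: measurable_eball|].
move=> y; rewrite -ball_normE/= => xy; rewrite /eball/=.
apply: le_lt_trans (enorm_le_sum _) _; rewrite big_ord1.
apply: (@le_lt_trans _ _ (\sum_(j < n) e)).
  apply: ler_sum => j _; apply: le_trans (coord_le_norm _ _) _.
  by rewrite distrC ltW.
rewrite sumr_const card_ord -mulr_natl /e mulrCA gtr_pMr//.
by rewrite ltr_pdivrMr// mul1r ltr_nat.
Qed.

End enorm_theory.

Section neighbourhoods.
Context {R : realType} {d : nat}.
Local Notation V := 'rV[R]_d.
Implicit Types (K Om : set V) (e : R).

(** Closed neighbourhood in the sup norm, compact whenever [K] is. As the Euclidean norm dominates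
    the sup norm, it contains the Euclidean neighbourhood of the same radius. *)
Definition nbd K e : set V := [set x | exists2 y, K y & `|x - y| <= e].

Lemma nbd_sub K e e' : e <= e' -> nbd K e `<=` nbd K e'.
Proof. by move=> ee' x [y Ky xy]; exists y => //; exact: le_trans xy ee'. Qed.

Lemma sub_nbd K e : 0 <= e -> K `<=` nbd K e.
Proof. by move=> e0 x Kx; exists x => //; rewrite subrr normr0. Qed.

Lemma nbd_nbd K e e' : nbd (nbd K e) e' `<=` nbd K (e + e').
Proof.
move=> x [y [z Kz yz] xy]; exists z => //.
by rewrite -(subrK y x) -addrA (le_trans (ler_normD _ _))// [e + _]addrC lerD.
Qed.

Lemma nbdD K e x h : K x -> `|h| <= e -> nbd K e (x + h).
Proof. by move=> Kx he; exists x => //; rewrite addrAC subrr add0r. Qed.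

Lemma nbd_compact K e : compact K -> compact (nbd K e).
Proof.
move=> cK.
have cB : compact [set z : V | `|z| <= e].
  apply: bounded_closed_compact.
    exists e; split; first by rewrite num_real.
    by move=> M eM z /= ze; apply: ltW; exact: le_lt_trans eM.
  have -> : [set z : V | `|z| <= e] = (fun z : V => `|z|) @^-1` [set r | r <= e] by [].
  apply: preimage_closed; last exact: closed_le.
  by move=> z _; exact: norm_continuous.
have -> : nbd K e = (fun p : V * V => p.1 + p.2) @` (K `*` [set z : V | `|z| <= e]).
  apply/seteqP; split => [x [y Ky xy]|x [[y z] /= [Ky ze] <-]].
    by exists (y, x - y) => //=; rewrite addrC subrK.
  exact: nbdD.
apply: continuous_compact; last exact: compact_setX.
apply: continuous_subspaceT => p; exact: add_continuous.
Qed.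

Lemma nbd_in_open K Om : compact K -> open Om -> K `<=` Om ->
  exists2 e, 0 < e & nbd K e `<=` Om.
Proof.
move=> /compact_near_coveringP cK oOm KOm.
have H : \forall e \near 0^'+, K `<=` [set x | forall y : V, `|y - x| <= e -> Om y].
  apply: cK => x Kx.
  have /nbhs_ballP[r /= r0 xr] : nbhs x Om by apply: open_nbhs_nbhs; split => //; exact: KOm.
  have r20 : 0 < r / 2 by rewrite divr_gt0.
  exists (ball x (r / 2), [set e : R | e < r / 2]).
    split => /=; first exact: nbhsx_ballx.
    exact: nbhs_right_lt.
  move=> [y e] [/= xy er] z zy; apply: xr.
  move: xy; rewrite -!ball_normE/= => xy.
  rewrite -(subrK y x) -addrA (le_lt_trans (ler_normD _ _))// (splitr r) ltrD//.
  by rewrite distrC (le_lt_trans zy).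
near (0 : R)^'+ => e; exists e => //.
have He : K `<=` [set x | forall y : V, `|y - x| <= e -> Om y] by near: e.
by move=> x [y Ky xy]; exact: He xy.
Unshelve. all: end_near. Qed.

End neighbourhoods.

Section along_lines.
Context {R : realType} {V : normedModType R}.

Lemma is_derive_line (f : V -> R) (p h : V) (s df : R) :
  is_derive (p + s *: h) h f df -> is_derive s 1 (fun r : R => f (p + r *: h)) df.
Proof.
move=> [dfh dfE].
have E : (fun r : R => r^-1 *: (f (p + (r *: (1 : R) + s) *: h) - f (p + s *: h))) =
         (fun r : R => r^-1 *: (f (r *: h + (p + s *: h)) - f (p + s *: h))).
  apply/funext => r; congr (_ *: (f _ - _)).
  by rewrite scalerDl addrCA; congr (_ *: _ + _); rewrite /GRing.scale/= mulr1.
by split; rewrite /derivable/derive/= E.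
Qed.

End along_lines.

Section affine_derivative.
Context {R : realType} {d : nat}.
Local Notation V := 'rV[R]_d.

(** [f] is only known to have a derivative in the single direction [h], so the chain rule is applied
    to functions of one real variable, along a line. *)
Lemma is_derive_affine (f : V -> R) (a c : R) (b y h : V) (df : R) :
  is_derive (a *: y + b) h f df ->
  is_derive y h (fun x => c * f (a *: x + b)) (c * (a * df)).
Proof.
move=> fd.
have fl : is_derive (0 : R) 1 (fun r : R => f ((a *: y + b) + r *: h)) df.
  by apply: is_derive_line; rewrite scale0r addr0.
have fa : is_derive (0 : R) 1 (fun r : R => f ((a *: y + b) + (a * r) *: h)) (a * df).
  rewrite (mulrC a df).
  have fl' : is_derive (a * 0) 1 (fun r : R => f ((a *: y + b) + r *: h)) df.
    by rewrite mulr0.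
  have da : is_derive (0 : R) 1 ( *%R a) a.
    by apply: is_derive_eq; rewrite /GRing.scale/= mulr1.
  exact: (is_derive1_comp fl' da).
have fc : is_derive (0 : R) 1 (fun r : R => c * f ((a *: y + b) + (a * r) *: h)) (c * (a * df)).
  exact: is_deriveZ.
have E : (fun r : R => r^-1 *: (c * f (a *: (r *: h + y) + b) - c * f (a *: y + b))) =
    (fun r : R => r^-1 *: (c * f ((a *: y + b) + (a * (r *: (1 : R) + 0)) *: h)
                  - c * f ((a *: y + b) + (a * 0) *: h))).
  apply/funext => r; rewrite mulr0 scale0r addr0 addr0.
  congr (_ *: (c * f _ - _)).
  rewrite scalerDr scalerA -addrA addrC; congr (_ + (_ * _) *: _).
  by rewrite /GRing.scale/= mulr1.
case: fc => fc1 fc2; split; move: fc1 fc2; rewrite /derivable /derive/=.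
  by rewrite E.
by rewrite E.
Qed.

End affine_derivative.

(** * The mollification kernel and its convolutions *)

Section integral_tools.
Context {R : realType} {d : nat}.
Local Notation V := 'rV[R]_d.
Local Notation lam := (@lebesgue_rV R d).

Lemma integrable_indic_lty (A : set V) : measurable A -> (lam A < +oo)%E ->
  lam.-integrable setT (EFin \o (\1_A : V -> R)).
Proof.
move=> mA Ay; apply/integrableP; split.
  by apply/measurable_EFinP; exact: measurable_indic.
have -> : (\int[lam]_x `|(EFin \o (\1_A : V -> R)) x| = lam A)%E.
  rewrite -[X in _ = lam X]setIT -integral_indic//.
  by apply: eq_integral => x _; rewrite /= ger0_norm// indicE.
by [].
Qed.

Lemma bounded_mul_integrable (f g : V -> R) (C : R) :
  lam.-integrable setT (EFin \o f) -> measurable_fun setT g ->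
  (forall x, `|g x| <= C) -> lam.-integrable setT (EFin \o (fun x => f x * g x)).
Proof.
move=> intf mg gC.
have mf : measurable_fun setT f by apply/measurable_EFinP; case/integrableP : intf.
have intC : lam.-integrable setT (fun x => (C%:E * (f x)%:E)%E).
  exact: integrableZl.
apply: le_integrable intC => //.
  by apply/measurable_EFinP; exact: measurable_funM.
move=> x _; rewrite /= lee_fin !normrM mulrC ler_wpM2r//.
exact: le_trans (gC x) (ler_norm _).
Qed.

Lemma bounded_support_integrable (g : V -> R) (C r : R) : 
  measurable_fun setT g -> (forall x, `|g x| <= C) ->
  (forall x, g x != 0 -> `|x| <= r) -> lam.-integrable setT (EFin \o g).
Proof.
move=> mg gC gr.
pose A : set V := ball 0 (`|r| + 1).
have r0 : 0 < `|r| + 1 by rewrite ltr_wpDl.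
have mA : measurable A by exact: measurable_ball_rV.
have int1 : lam.-integrable setT (EFin \o (\1_A : V -> R)).
  by apply: integrable_indic_lty => //; rewrite lebesgue_rV_ball// ltry.
have := @bounded_mul_integrable _ g C int1 mg gC.
congr (integrable _ _ _); apply/funext => x /=; congr EFin.
rewrite indicE; case: (boolP (x \in A)) => [_|/negP xA]; first by rewrite mul1r.
rewrite mul0r; apply/esym/eqP; apply: contrapT => /negP/gr xr; apply: xA.
apply/mem_set; rewrite /A -ball_normE/= sub0r normrN.
by rewrite (le_lt_trans xr)// (le_lt_trans (ler_norm r))// ltrDl.
Qed.

Lemma measurable_subr (x : V) (f : V -> R) : measurable_fun setT f ->
  measurable_fun setT (fun y : V => f (x - y)).
Proof.
move=> mf; apply: measurableT_comp => //.
have -> : (fun y : V => x - y) = (fun y => -1 *: y + x).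
  by apply/funext => y; rewrite scaleN1r addrC.
exact: measurable_affine.
Qed.

Lemma Rintegral_affine (c : R) (a : V) (f : V -> R) : c != 0 ->
  measurable_fun setT f ->
  \int[lam]_x f (c *: x + a) = `|c| ^- d * \int[lam]_x f x.
Proof.
move=> c0 mf; rewrite /Rintegral integralE [in RHS]integralE.
have mp : measurable_fun setT (fun x => maxe (f x)%:E 0%E).
  by apply: measurable_maxe => //; exact/measurable_EFinP.
have mn : measurable_fun setT (fun x => maxe (- (f x)%:E)%E 0%E).
  apply: measurable_maxe => //; apply: measurableT_comp => //.
  exact/measurable_EFinP.
under eq_integral do rewrite funeposE.
under [X in (_ - X)%E]eq_integral do rewrite funenegE.
under [X in _ = _ * fine (X - _)%E]eq_integral do rewrite funeposE.
under [X in _ = _ * fine (_ - X)%E]eq_integral do rewrite funenegE.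
rewrite (@ge0_integral_affine _ _ c a (fun x => maxe (f x)%:E 0%E))//; last first.
  by move=> x; rewrite le_max lexx orbT.
rewrite (@ge0_integral_affine _ _ c a (fun x => maxe (- (f x)%:E)%E 0%E))//; last first.
  by move=> x; rewrite le_max lexx orbT.
set A := (\int[_]_x _)%E; set B := (\int[_]_x maxe (- _) _)%E.
have A0 : (0 <= A)%E by apply: integral_ge0 => x _; rewrite le_max lexx orbT.
have B0 : (0 <= B)%E by apply: integral_ge0 => x _; rewrite le_max lexx orbT.
have k0 : 0 < `|c| ^- d by rewrite invr_gt0 exprn_gt0// normr_gt0.
move: (`|c| ^- d) k0 => k k0.
case: A A0 => [a'| |]; case: B B0 => [b'| |] //= _ _.
- by rewrite mulrBr.
- by rewrite gt0_muley ?lte_fin//= mulr0.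
- by rewrite gt0_muley ?lte_fin//= mulr0.
- by rewrite gt0_muley ?lte_fin//= mulr0.
Qed.

(** The derivative is put on the bounded factor [phi], and [C * |f|] dominates the derivative in the
    parameter; of [f] only integrability is asked. *)
Lemma derive_conv (f phi phi' : V -> R) (h x : V) (C : R) :
  lam.-integrable setT (EFin \o f) ->
  measurable_fun setT phi -> (forall y, `|phi y| <= C) ->
  (forall y, is_derive y h phi (phi' y)) -> (forall y, `|phi' y| <= C) ->
  is_derive x h (fun x => \int[lam]_y (f y * phi (x - y)))
                (\int[lam]_y (f y * phi' (x - y))).
Proof.
move=> intf mphi phiC dphi phi'C.
pose F (s : R) (y : V) := f y * phi ((x - y) + s *: h).
have mphis s : measurable_fun setT (fun y : V => phi ((x - y) + s *: h)).
  under eq_fun do rewrite addrAC.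
  exact: measurable_subr.
have intF s : lam.-integrable setT (EFin \o F s).
  by apply: (bounded_mul_integrable intf (mphis s)) => y.
have dF (s : R) y : is_derive s 1 (F ^~ y) (f y * phi' ((x - y) + s *: h)).
  by apply: is_deriveZ; exact: is_derive_line.
have intG : lam.-integrable setT (EFin \o (fun y => C * `|f y|)).
  have := integrable_abse intf => /(integrableZl measurableT C).
  by apply: eq_integrable => // y _.
have C0 : 0 <= C by exact: le_trans (normr_ge0 _) (phiC 0).
have I0 : (`]-1, 1[%classic : set R) 0 by rewrite /= in_itv/= ltrN10 ltr01.
have := @cvg_differentiation_under_integral R _ _ lam F setT measurableT 0 (-1) 1
  I0 (fun s _ => intF s) _ (fun y => C * `|f y|) _ intG.
have der1 s y : @partial1of2 R V F s y = f y * phi' ((x - y) + s *: h).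
  by rewrite partial1of2E; case: (dF s y).
move=> H.
have {}H : h0^-1 *: (\int[lam]_(y in setT) F (h0 + 0) y - \int[lam]_(y in setT) F 0 y)
    @[h0 --> 0^'] --> \int[lam]_(y in setT) @partial1of2 R V F 0 y.
  apply: H.
  - by move=> s y _ _; case: (dF s y).
  - by move=> y; rewrite mulr_ge0.
  - by move=> s y _ _; rewrite der1 normrM mulrC ler_wpM2r.
have E (s : R) : \int[lam]_y F s y = \int[lam]_y (f y * phi ((s *: h + x) - y)).
  apply: eq_Rintegral => y _; rewrite /F; congr (_ * phi _).
  by rewrite addrC addrA.
have E0 : \int[lam]_y F 0 y = \int[lam]_y (f y * phi (x - y)).
  by rewrite E scale0r add0r.
have E1 : \int[lam]_y @partial1of2 R V F 0 y = \int[lam]_y (f y * phi' (x - y)).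
  by apply: eq_Rintegral => y _; rewrite der1 scale0r addr0.
move: H; rewrite E0 E1.
under eq_fun do rewrite addr0 E.
move=> H; split; first by apply/cvg_ex; eexists; exact: H.
exact/cvg_lim.
Qed.

(** The integral of [F (y + s h)] does not depend on [s]; differentiating it at [s = 0] under the
    integral sign gives the integral of [F']. This is the divergence theorem for functions of
    bounded support. *)
Lemma integral_derivative0 (F F' : V -> R) (h : V) (C r : R) :
  measurable_fun setT F -> (forall x, `|F x| <= C) ->
  (forall x, F x != 0 -> `|x| <= r) ->
  (forall x, is_derive x h F (F' x)) -> (forall x, `|F' x| <= C) ->
  measurable_fun setT F' ->
  (forall x, F' x != 0 -> `|x| <= r) -> \int[lam]_x F' x = 0.
Proof.
move=> mF FC Fr dF F'C mF' F'r.
(* Contains the supports of all shifts of [F'] by [s h] with [|s| < 1], so [C] times its indicator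
   dominates. *)
pose A : set V := ball 0 (`|r| + `|h| + 1).
have r0 : 0 < `|r| + `|h| + 1 by rewrite ltr_wpDl// addr_ge0.
have mA : measurable A by exact: measurable_ball_rV.
have int1 : lam.-integrable setT (EFin \o (\1_A : V -> R)).
  by apply: integrable_indic_lty => //; rewrite lebesgue_rV_ball// ltry.
pose G (s : R) (y : V) := F (y + s *: h).
have mG s : measurable_fun setT (G s).
  exact: measurableT_comp mF (measurable_shift _).
have intG s : lam.-integrable setT (EFin \o G s).
  apply: (@bounded_support_integrable _ C (`|r| + `|s *: h|)) => //.
    by move=> x; exact: FC.
  move=> x /Fr xr.
  rewrite -(addrK (s *: h) x) (le_trans (ler_normB _ _))// lerD2r.
  exact: le_trans xr (ler_norm _).
have dG (s : R) y : is_derive s 1 (G ^~ y) (F' (y + s *: h)) by exact: is_derive_line.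
have der1 s y : @partial1of2 R V G s y = F' (y + s *: h).
  by rewrite partial1of2E; case: (dG s y).
have C0 : 0 <= C by exact: le_trans (normr_ge0 _) (FC 0).
have intC : lam.-integrable setT (EFin \o (fun y => C * \1_A y)).
  by have := integrableZl measurableT C int1; apply: eq_integrable => // y _.
have I0 : (`]-1, 1[%classic : set R) 0 by rewrite /= in_itv/= ltrN10 ltr01.
have := @differentiation_under_integral R _ _ lam G setT measurableT 0 (-1) 1
  I0 (fun s _ => intG s) _ (fun y => C * \1_A y) _ intC.
move=> H; have {}H : (fun s : R => \int[lam]_y G s y)^`()%classic 0 =
    \int[lam]_y @partial1of2 R V G 0 y.
  apply: H.
  - by move=> s y _ _; case: (dG s y).
  - by move=> y; rewrite mulr_ge0// indicE.
  - move=> s y; rewrite /= in_itv/= => /andP[s1 s2] _; rewrite der1.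
    rewrite indicE; case: (boolP (y \in A)) => [_|yA].
      by rewrite mulr1.
    rewrite mulr0 normr_le0; apply: contraNT yA => /F'r yr; apply/mem_set.
    rewrite /A -ball_normE/= sub0r normrN -(addrK (s *: h) y).
    rewrite (le_lt_trans (ler_normB _ _))//.
    have sh : `|s *: h| <= `|h|.
      by rewrite normrZ ler_piMl// ler_norml !ltW.
    by have := ler_norm r; lra.
have cst s : \int[lam]_y G s y = \int[lam]_y F y.
  rewrite -[RHS]mul1r -[X in X * _]invr1 -(expr1n _ d) -(normr1 R).
  rewrite -(Rintegral_affine (s *: h) (oner_neq0 R) mF).
  by apply: eq_Rintegral => y _; rewrite scale1r.
have -> : \int[lam]_x F' x = \int[lam]_y @partial1of2 R V G 0 y.
  by apply: eq_Rintegral => y _; rewrite der1 scale0r addr0.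
rewrite -H (_ : (fun s => _) = fun=> \int[lam]_y F y); last exact/funext.
by rewrite derive1_cst.
Qed.

End integral_tools.

Section kernel.
Context {R : realType} {d : nat}.
Local Notation V := 'rV[R]_d.
Local Notation lam := (@lebesgue_rV R d).

(** The value on the sphere is the limit along [r z] with [r] decreasing to [1]. A kernel supported
    in the closed unit ball thus vanishes on the sphere, and integrals against it may be taken over
    the open ball. *)
Lemma vanish_on_sphere (f : V -> R) : continuous f ->
  (forall z, 1 < enorm z -> f z = 0) -> forall z, 1 <= enorm z -> f z = 0.
Proof.
move=> cf f0 z z1.
have c1 : f (r *: z) @[r --> (1 : R)^'+] --> f z.
  rewrite -[X in f X](scale1r z).
  apply: (@cvg_comp _ _ _ (fun r : R => r *: z) f _ (nbhs (1 *: z))); last exact: cf.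
  apply: cvgZr_tmp; apply: cvg_at_right_filter; exact: cvg_id.
have c0 : f (r *: z) @[r --> (1 : R)^'+] --> 0.
  apply: (@cvg_trans _ ((fun=> 0 : R) r @[r --> (1 : R)^'+])); last exact: cvg_cst.
  apply: near_eq_cvg; near=> r; rewrite f0//.
  have r1 : 1 < r by near: r; exact: nbhs_right_gt.
  rewrite enormZ ger0_norm ?(le_trans ler01 (ltW r1))//.
  by rewrite (lt_le_trans r1)// ler_peMr// ltW// (lt_trans ltr01).
exact: (cvg_unique _ c1 c0).
Unshelve. all: end_near. Qed.

Lemma bounded_of_vanish (f : V -> R) : continuous f ->
  (forall z, 1 <= enorm z -> f z = 0) -> exists C, forall z, `|f z| <= C.
Proof.
move=> cf f0.
have cB : compact [set z : V | `|z| <= 1].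
  apply: bounded_closed_compact.
    exists 1; split; first by rewrite num_real.
    by move=> M eM z /= ze; apply: ltW; exact: le_lt_trans eM.
  have -> : [set z : V | `|z| <= 1] = (fun z : V => `|z|) @^-1` [set r | r <= 1] by [].
  apply: preimage_closed; last exact: closed_le.
  by move=> z _; exact: norm_continuous.
have := @continuous_compact _ _ f _ (continuous_subspaceT cf) cB.
move=> /compact_bounded[M [_ MB]]; exists (`|M| + 1) => z.
have M1 : M < `|M| + 1 by rewrite (le_lt_trans (ler_norm _))// ltrDl.
have [z1|z1] := leP 1 (enorm z); first by rewrite f0// normr0 addr_ge0.
apply: MB M1 _ _; exists z => //=.
by apply: le_trans (norm_le_enorm _) _; exact: ltW.
Qed.

Variable rho : V -> R.
Hypothesis rho_kernel : mollifier_kernel rho.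

Lemma kernel_continuous : continuous rho.
Proof. by case: rho_kernel => /(_ [::])[]. Qed.

Lemma kernel_partial_continuous j : continuous (partial j rho).
Proof. by case: rho_kernel => /(_ [:: j])[]. Qed.

Lemma kernel_is_derive j z : is_derive z 'e_j rho (partial j rho z).
Proof. by case: rho_kernel => /(_ [::])[_ /(_ j z)] H _ _ _; split. Qed.

Let supp_rho z : 1 < enorm z -> ~ supp rho z.
Proof.
move=> z1 sz; case: rho_kernel => _ /(_ _ sz) + _ _.
by rewrite /= leNgt z1.
Qed.

Lemma kernel_eq0 z : 1 <= enorm z -> rho z = 0.
Proof.
apply: vanish_on_sphere z; first exact: kernel_continuous.
move=> z /supp_rho z1; apply/eqP; apply: contrapT => /negP rz.
by apply: z1; exact: subset_closure.
Qed.

Lemma kernel_partial_eq0 j z : 1 <= enorm z -> partial j rho z = 0.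
Proof.
apply: vanish_on_sphere z; first exact: kernel_partial_continuous.
move=> z /supp_rho z1; rewrite /partial.
rewrite (@near_eq_derive _ _ _ rho (cst 0)) ?derive_cst//.
have : nbhs z (~` supp rho).
  by apply: open_nbhs_nbhs; split => //; exact/closed_openC/closed_closure.
apply: filterS => y ry; apply/eqP; apply: contrapT => /negP ry0.
by apply: ry; exact: subset_closure.
Qed.

Lemma kernel_bounded : exists C, [/\ 0 < C, forall z, `|rho z| <= C &
  forall j z, `|partial j rho z| <= C].
Proof.
have [C0 HC0] := bounded_of_vanish kernel_continuous kernel_eq0.
have H j := bounded_of_vanish (@kernel_partial_continuous j) (@kernel_partial_eq0 j).
have [C HC] := choice H.
have C0_ge0 : 0 <= C0 by exact: le_trans (normr_ge0 _) (HC0 0).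
have Cj_ge0 j : 0 <= C j by exact: le_trans (normr_ge0 _) (HC j 0).
exists (C0 + \sum_j C j + 1); split.
- by rewrite ltr_wpDl// addr_ge0// sumr_ge0.
- by move=> z; apply: le_trans (HC0 z) _; rewrite -addrA lerDl addr_ge0// sumr_ge0.
- move=> j z; apply: le_trans (HC j z) _.
  rewrite (bigD1 j)//= addrCA -!addrA lerDl !addr_ge0//.
  by rewrite sumr_ge0.
Qed.

Lemma kernel_even z : rho (- z) = rho z.
Proof. by case: rho_kernel. Qed.

Lemma kernel_integral : \int[lam]_x rho x = 1.
Proof. by case: rho_kernel. Qed.

Lemma measurable_kernel : measurable_fun setT rho.
Proof. exact: continuous_measurable_rV kernel_continuous. Qed.

Lemma measurable_kernel_partial j : measurable_fun setT (partial j rho).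
Proof. exact: continuous_measurable_rV (@kernel_partial_continuous j). Qed.

Lemma kernel_smooth : smooth rho.
Proof. by case: rho_kernel. Qed.

End kernel.

Section directional_derivative.
Context {R : realType} {d : nat}.
Local Notation V := 'rV[R]_d.

Let trunc_row (h : V) k : V := \row_j (if (j < k)%N then h 0 j else 0).

Let trunc_rowS h (k : 'I_d) :
  trunc_row h k.+1 = trunc_row h k + h 0 k *: 'e_k.
Proof.
apply/rowP => j; rewrite !mxE eqxx/= ltnS leq_eqVlt.
have [->|jk] := eqVneq j k; first by rewrite eqxx/= ltnn add0r mulr1.
by rewrite (negbTE (_ : (j : nat) != k)) ?(inj_eq val_inj)//= mulr0 addr0.
Qed.

(* Change one coordinate at a time and apply the mean value theorem. *)
Lemma is_derive_partial (f : V -> R) : (forall j x, derivable f x 'e_j) ->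
  (forall j, continuous (partial j f)) ->
  forall x h : V, is_derive x h f (\sum_j h 0 j * partial j f x).
Proof.
move=> df cf x h.
pose L := \sum_j h 0 j * partial j f x.
have line (p : V) (k : 'I_d) (s : R) : exists2 t : R, `|t| <= `|s| &
    f (p + s *: 'e_k) - f p = s * partial k f (p + t *: 'e_k).
  pose g (r : R) := f (p + r *: 'e_k).
  have dg (r : R) : is_derive r 1 g (partial k f (p + r *: 'e_k)).
    by apply: is_derive_line; split.
  have cg : continuous g.
    move=> r; apply: differentiable_continuous; apply/derivable1_diffP.
    by case: (dg r).
  have fE r : f (p + r *: 'e_k) = g r by [].
  have fE0 : f p = g 0 by rewrite /g scale0r addr0.
  have [s0|s0] := leP 0 s.
    have [c] := MVT_segment s0 (fun r _ => dg r) (continuous_subspaceT cg).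
    rewrite in_itv/= subr0 => /andP[c0 cs] gE; exists c.
      by rewrite !ger0_norm.
    by rewrite fE fE0 gE mulrC.
  have [c] := MVT_segment (ltW s0) (fun r _ => dg r) (continuous_subspaceT cg).
  rewrite in_itv/= sub0r => /andP[c0 cs] gE; exists c.
    by rewrite !ler0_norm ?lerN2// ltW.
  by rewrite fE fE0 -opprB gE mulrN opprK mulrC.
suff : (fun r : R => r^-1 *: (f (r *: h + x) - f x)) r @[r --> 0^'] --> L.
  move=> H; split; first by apply/cvg_ex; exists L.
  exact/cvg_lim.
apply/cvgrPdist_le => e e0.
have eh0 : 0 < e / (\sum_j `|h 0 j| + 1).
  by rewrite divr_gt0// ltr_wpDl// sumr_ge0.
have near_x : \forall y \near x, forall j, `|partial j f x - partial j f y| <=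
    e / (\sum_j `|h 0 j| + 1).
  have Hj j : \forall y \near x, `|partial j f x - partial j f y| <=
      e / (\sum_j `|h 0 j| + 1).
    by move/cvgrPdist_le : (cf j x); exact.
  exact: (@filter_forall V 'I_d (fun j y => `|partial j f x - partial j f y|
     <= e / (\sum_j `|h 0 j| + 1)) (nbhs x) _ Hj).
move/nbhs_ballP : near_x => [r0 /= r0_gt0 xr0].
(* The intermediate points are at distance at most [2 * |h| * |r|] from [x]; for [|r|] below this
   bound they stay within [r0]. *)
have hr : 0 < r0 / (2 * `|h| + 1) by rewrite divr_gt0// ltr_wpDl// mulr_ge0.
have : \forall r \near (0 : R)^', `|r| < r0 / (2 * `|h| + 1).
  apply: cvg_within; apply/nbhs_ballP; exists (r0 / (2 * `|h| + 1)) => //= y.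
  by rewrite /ball/= sub0r normrN.
have rn0 : \forall r \near (0 : R)^', r != 0 by exact: nbhs_dnbhs_neq.
apply: filterS2 rn0 => r r_neq0 rr0.
pose p k := x + r *: trunc_row h k.
have p0 : p 0 = x.
  rewrite /p (_ : trunc_row h 0 = 0) ?scaler0 ?addr0//.
  by apply/rowP => j; rewrite !mxE.
have pd : p d = r *: h + x.
  rewrite /p addrC; congr (_ *: _ + _).
  by apply/rowP => j; rewrite !mxE ltn_ord.
have step (k : 'I_d) : exists c, f (p k.+1) - f (p k) = r * h 0 k * c /\
    `|partial k f x - c| <= e / (\sum_j `|h 0 j| + 1).
  have [t tr fE] := line (p k) k (r * h 0 k).
  exists (partial k f (p k + t *: 'e_k)); split.
    by rewrite -fE /p trunc_rowS scalerDr scalerA addrA.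
  apply: xr0; rewrite -ball_normE/= /p -addrA opprD addrA subrr sub0r normrN.
  have hle : `|r *: trunc_row h k + t *: 'e_k| <= 2 * `|h| * `|r|.
    have hk : `|trunc_row h k| <= `|h|.
      apply: rV_norm_le => // j; rewrite mxE.
      by case: ifP => _; [exact: coord_le_norm|rewrite normr0].
    have ek : `|'e_k : V| <= 1.
      apply: rV_norm_le => // j; rewrite mxE eqxx/=.
      by case: (_ == _); rewrite ?normr1 ?normr0.
    apply: le_trans (ler_normD _ _) _; rewrite !normrZ.
    apply: (@le_trans _ _ (`|r| * `|h| + `|r * h 0 k| * 1)).
      by rewrite lerD ?ler_wpM2l// ler_pM.
    have := coord_le_norm h k; rewrite mulr1 normrM => hk'.
    by have := normr_ge0 r; nra.
  apply: le_lt_trans hle _; move: rr0.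
  rewrite ltr_pdivlMr ?ltr_wpDl ?mulr_ge0//.
  by have := normr_ge0 r; nra.
have [c cP] := choice step.
have dE : f (r *: h + x) - f x = r * \sum_k h 0 k * c k.
  rewrite -pd -p0 -(@telescope_sumr _ 0 d (fun k => f (p k)))// big_mkord mulr_sumr.
  by apply: eq_bigr => k _; rewrite (cP k).1 mulrA.
rewrite dE /GRing.scale/= mulKf// /L -sumrB.
apply: le_trans (ler_norm_sum _ _ _) _.
apply: (@le_trans _ _ (\sum_k `|h 0 k| * (e / (\sum_j `|h 0 j| + 1)))).
  by apply: ler_sum => k _; rewrite -mulrBr normrM ler_wpM2l// (cP k).2.
rewrite -mulr_suml mulrCA ler_piMr ?(ltW e0)//.
have S0 : 0 <= \sum_j `|h 0 j| by exact: sumr_ge0.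
by rewrite ler_pdivrMr ?ltr_wpDl// mul1r lerDl.
Qed.

End directional_derivative.

(** * Convolution with a rescaled kernel *)

Section convolution.
Context {R : realType} {d : nat}.
Local Notation V := 'rV[R]_d.
Local Notation lam := (@lebesgue_rV R d).

Definition conv (rho : V -> R) l (f : V -> R) (x : V) : R :=
  \int[lam]_y (f y * rescale rho l (x - y)).

Lemma mollifyE m n rho l (v : V -> 'M[R]_(m, n)) x i j :
  mollify rho l v x i j = conv rho l (fun y => v y i j) x.
Proof. by rewrite mxE. Qed.


(** Tonelli is applied to the positive and the negative part, so the parameter integral is
    measurable even where it does not converge. *)
Lemma measurable_Rintegral d1 d2 (X : measurableType d1) (Y : measurableType d2)
    (mu : {sigma_finite_measure set Y -> \bar R}) (f : X * Y -> R) :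
  measurable_fun setT f ->
  measurable_fun setT (fun x => \int[mu]_y f (x, y)).
Proof.
move=> mf; apply: measurableT_comp => //.
have mp : measurable_fun setT (fun p => maxe (f p)%:E 0%E).
  by apply: measurable_maxe => //; exact/measurable_EFinP.
have mn : measurable_fun setT (fun p => maxe (- (f p)%:E)%E 0%E).
  apply: measurable_maxe => //; apply: measurableT_comp => //.
  exact/measurable_EFinP.
under eq_fun do rewrite integralE.
apply: emeasurable_funB.
  under eq_fun do under eq_integral do rewrite funeposE.
  apply: (measurable_fun_fubini_tonelli_F (m2 := mu)
    (fun p => maxe (f p)%:E 0%E)) => // p.
  by rewrite le_max lexx orbT.
under eq_fun do under eq_integral do rewrite funenegE.
apply: (measurable_fun_fubini_tonelli_F (m2 := mu)
  (fun p => maxe (- (f p)%:E)%E 0%E)) => // p.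
by rewrite le_max lexx orbT.
Qed.

Lemma measurable_fst_subr_snd :
  measurable_fun setT (fun p : V * V => p.1 - p.2).
Proof.
apply: measurable_fun_coordP => i j; under eq_fun do rewrite !mxE.
apply: measurable_funB.
  exact: (measurableT_comp (measurable_coord i j) measurable_fst).
exact: (measurableT_comp (measurable_coord i j) measurable_snd).
Qed.

Definition unit_ball : set V := eball 0 1.
Local Notation B := unit_ball.

Lemma measurable_unit_ball : measurable B.
Proof. exact: measurable_eball. Qed.
Hint Resolve measurable_unit_ball : core.

Variable k : V -> R.
Hypothesis mk : measurable_fun setT k.
Variable C : R.
Hypothesis kC : forall z, `|k z| <= C.
Hypothesis k0 : forall z, 1 <= enorm z -> k z = 0.

Let C_ge0 : 0 <= C. Proof. exact: le_trans (normr_ge0 _) (kC 0). Qed.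

Lemma measurable_rescale (l : R) : measurable_fun setT (rescale k l).
Proof.
apply: measurable_funM => //; apply: measurableT_comp => //.
have -> : ( *:%R l^-1) = (fun y : V => l^-1 *: y + 0).
  by apply/funext => y; rewrite addr0.
exact: measurable_affine.
Qed.

Lemma measurable_rescale_subr (l : R) (x : V) :
  measurable_fun setT (fun y : V => rescale k l (x - y)).
Proof. by apply: measurable_subr; exact: measurable_rescale. Qed.

Lemma rescale_le (l : R) (x : V) : 0 < l -> `|rescale k l x| <= l ^- d * C.
Proof.
move=> l0; rewrite normrM ger0_norm ?invr_ge0 ?exprn_ge0 ?(ltW l0)//.
by rewrite ler_wpM2l// invr_ge0 exprn_ge0// ltW.
Qed.

Lemma rescale_eq0 (l : R) (x : V) : 0 < l -> l <= enorm x -> rescale k l x = 0.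
Proof.
move=> l0 lx; rewrite /rescale k0 ?mulr0// enormZ gtr0_norm ?invr_gt0//.
by rewrite mulrC ler_pdivlMr// mul1r.
Qed.

Lemma conv_integrand_integrable (l : R) (f : V -> R) (x : V) : 0 < l ->
  lam.-integrable setT (EFin \o f) ->
  lam.-integrable setT (EFin \o (fun y => f y * rescale k l (x - y))).
Proof.
move=> l0 intf; apply: (bounded_mul_integrable (C := l ^- d * C) intf).
  exact: measurable_rescale_subr.
by move=> y; exact: rescale_le.
Qed.

(** Change of variables [y = x + l z]. The kernel appears at [- z], since [k] will also be a partial
    derivative of [rho], which is not even. *)
Lemma convE (l : R) (f : V -> R) (x : V) : 0 < l -> lam.-integrable setT (EFin \o f) ->
  conv k l f x = \int[lam]_z (f (x + l *: z) * k (- z)).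
Proof.
move=> l0 intf; pose h y := f y * k (- l^-1 *: y + l^-1 *: x).
have inth : lam.-integrable setT (EFin \o h).
  apply: (bounded_mul_integrable intf) => [|y]; last exact: kC.
  by apply: measurableT_comp => //; exact: measurable_affine.
have mh : measurable_fun setT h by apply/measurable_EFinP; case/integrableP : inth.
have -> : \int[lam]_z (f (x + l *: z) * k (- z)) = \int[lam]_z h (l *: z + x).
  apply: eq_Rintegral => z _; rewrite /h addrC; congr (_ * k _).
  rewrite !scaleNr scalerDr opprD -addrA addNr addr0 scalerA.
  by rewrite mulVf ?gt_eqF// scale1r.
rewrite Rintegral_affine ?gt_eqF// /conv -RintegralZl//.
apply: eq_Rintegral => y _; rewrite /rescale /h gtr0_norm// mulrCA.
by rewrite scalerBr scaleNr addrC.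
Qed.

Lemma kernel_weight_le (g : V -> R) : measurable_fun setT g ->
  (\int[lam]_z `|g z * k z|%:E <= C%:E * \int[lam]_(z in B) `|g z|%:E)%E.
Proof.
move=> mg.
have mg' : measurable_fun B (fun z => `|g z|%:E).
  apply/measurable_EFinP; apply: measurableT_comp => //.
  exact: measurable_funTS.
rewrite -ge0_integralZl// ?lee_fin// [leRHS]integral_mkcond.
apply: le_lower_integral => // z _.
rewrite patchE; case: ifPn => [_|zB].
  by rewrite -EFinM lee_fin normrM mulrC ler_wpM2r.
rewrite k0 ?mulr0 ?normr0//.
rewrite leNgt; apply: contra zB => z1; apply/mem_set.
by rewrite /unit_ball /eball/= subr0.
Qed.

End convolution.

Section convolution_estimates.
Context {R : realType} {d : nat}.
Local Notation V := 'rV[R]_d.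
Local Notation lam := (@lebesgue_rV R d).
Local Notation B := (@unit_ball R d).
Hint Resolve measurable_unit_ball : core.

Variable k : V -> R.
Hypothesis mk : measurable_fun setT k.
Variable C : R.
Hypothesis kC : forall z, `|k z| <= C.
Hypothesis k0 : forall z, 1 <= enorm z -> k z = 0.

Let C_ge0 : 0 <= C. Proof. exact: le_trans (normr_ge0 _) (kC 0). Qed.

Let kN (z : V) := k (- z).
Let kNC z : `|kN z| <= C. Proof. exact: kC. Qed.
Let kN0 z : 1 <= enorm z -> kN z = 0.
Proof. by move=> z1; rewrite /kN k0// -scaleN1r enormZ normrN1 mul1r. Qed.

Lemma measurable_along (f : V -> R) (l : R) (x : V) : measurable_fun setT f ->
  measurable_fun setT (fun z : V => f (x + l *: z)).
Proof.
move=> mf; apply: measurableT_comp => //; under eq_fun do rewrite addrC.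
exact: measurable_affine.
Qed.

Lemma conv_abs_le (l : R) (f : V -> R) (x : V) : 0 < l -> lam.-integrable setT (EFin \o f) ->
  (`|conv k l f x|%:E <= C%:E * \int[lam]_(z in B) `|f (x + l *: z)|%:E)%E.
Proof.
move=> l0 intf; rewrite (convE mk kC)//.
apply: le_trans (abs_Rintegral_le _ _ _) _.
have mf : measurable_fun setT f by apply/measurable_EFinP; case/integrableP : intf.
exact: (kernel_weight_le kNC kN0 (measurable_along l x mf)).
Qed.

Lemma conv_bounded (l : R) (f : V -> R) (x : V) (M : R) : 0 < l -> lam.-integrable setT (EFin \o f) ->
  (forall y, `|f y| <= M) -> `|conv k l f x| <= C * (M * fine (lam B)).
Proof.
move=> l0 intf fM; rewrite -lee_fin.
apply: le_trans (conv_abs_le x l0 intf) _.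
rewrite EFinM lee_wpmul2l ?lee_fin//.
apply: (@le_trans _ _ (\int[lam]_(z in B) (M%:E))%E).
  by apply: le_lower_integral => // z _; rewrite lee_fin.
rewrite -[X in (X <= _)%E]/(\int[lam]_(z in B) cst M%:E z)%E integral_cst;
  last exact: measurable_unit_ball.
rewrite EFinM fineK//.
by rewrite ge0_fin_numE//; exact: lebesgue_eball_lty.
Qed.

Lemma convB (l : R) (f g : V -> R) (x : V) : 0 < l -> lam.-integrable setT (EFin \o f) ->
  lam.-integrable setT (EFin \o g) ->
  conv k l f x - conv k l g x = conv k l (fun y => f y - g y) x.
Proof.
move=> l0 intf intg; rewrite /conv -RintegralB//.
- by apply: eq_Rintegral => y _; rewrite mulrBl.
- exact: (conv_integrand_integrable mk kC x l0 intf).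
- exact: (conv_integrand_integrable mk kC x l0 intg).
Qed.

Lemma conv_shift (l : R) (f : V -> R) (x a : V) : 0 < l -> lam.-integrable setT (EFin \o f) ->
  conv k l f (x + a) = conv k l (fun y => f (y + a)) x.
Proof.
move=> l0 intf; rewrite /conv.
have := @Rintegral_affine R d 1 a (fun y => f y * rescale k l (x + a - y)) (oner_neq0 R).
rewrite normr1 expr1n invr1 mul1r => <-.
  apply: eq_Rintegral => y _; rewrite scale1r; congr (_ * rescale _ _ _).
  by rewrite opprD addrA [x + a - y]addrAC -addrA subrr addr0.
apply/measurable_EFinP.
have := conv_integrand_integrable mk kC (x + a) l0 intf.
by case/integrableP.
Qed.

Lemma measurable_conv (l : R) (f : V -> R) : measurable_fun setT f ->
  measurable_fun setT (conv k l f).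
Proof.
move=> mf.
apply: (@measurable_Rintegral R _ _ V V lam
  (fun p => f p.2 * rescale k l (p.1 - p.2))).
apply: measurable_funM; first exact: measurableT_comp.
apply: (measurableT_comp (measurable_rescale mk l)).
exact: measurable_fst_subr_snd.
Qed.

End convolution_estimates.

Section mollified_derivatives.
Context {R : realType} {d : nat}.
Local Notation V := 'rV[R]_d.
Local Notation lam := (@lebesgue_rV R d).
Local Notation B := (@unit_ball R d).

Lemma smooth_affine (f : V -> R) (a c : R) (b : V) : smooth f ->
  smooth (fun y => c * f (a *: y + b)).
Proof.
move=> sf.
have E s : foldr partial (fun y : V => c * f (a *: y + b)) s =
    (fun y => (c * a ^+ size s) * foldr partial f s (a *: y + b)).
  elim: s => [|j s IH] /=.
    by apply/funext => y; rewrite expr0 mulr1.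
  rewrite IH; apply/funext => y; rewrite /partial.
  have [_ /(_ j (a *: y + b)) df] := sf s.
  have dfa : is_derive (a *: y + b) 'e_j (foldr partial f s)
    ('D_('e_j) (foldr partial f s) (a *: y + b)) by split.
  have [_ ->] := is_derive_affine (c * a ^+ size s) dfa.
  by rewrite mulrA -[_ * _ * a]mulrA -exprSr.
move=> s; rewrite E; split.
  have [cf _] := sf s.
  move=> y; apply: (@continuousM R V (fun=> c * a ^+ size s)
    (fun y => foldr partial f s (a *: y + b))); first exact: cst_continuous.
  apply: (@continuous_comp _ _ _ (fun y : V => a *: y + b)); last exact: cf.
  apply: (@continuousD R V V (fun y => a *: y) (fun=> b)).
    exact: scaler_continuous.
  exact: cst_continuous.
move=> j y; have [_ /(_ j (a *: y + b)) df] := sf s.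
have dfa : is_derive (a *: y + b) 'e_j (foldr partial f s)
  ('D_('e_j) (foldr partial f s) (a *: y + b)) by split.
by have [] := is_derive_affine (c * a ^+ size s) dfa.
Qed.

Variable rho : V -> R.
Hypothesis rho_kernel : mollifier_kernel rho.
Variable C : R.
Hypothesis rhoC : forall z, `|rho z| <= C.
Hypothesis rhoC' : forall j z, `|partial j rho z| <= C.

Let C_ge0 : 0 <= C. Proof. exact: le_trans (normr_ge0 _) (rhoC 0). Qed.

(** The derivative of [rho] in the direction [h], used as a convolution kernel. *)
Definition dkernel (h z : V) : R := \sum_j h 0 j * partial j rho z.

Lemma dkernel_e j : dkernel 'e_j = partial j rho.
Proof.
apply/funext => z; rewrite /dkernel (bigD1 j)//= big1 ?addr0.
  by rewrite mxE !eqxx mul1r.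
by move=> i ij; rewrite mxE eqxx (negbTE ij) mul0r.
Qed.

Lemma measurable_dkernel h : measurable_fun setT (dkernel h).
Proof.
apply: measurable_sum => j; apply: measurable_funM => //.
exact: measurable_kernel_partial.
Qed.

Lemma dkernel_le h z : `|dkernel h z| <= \sum_j `|h 0 j| * C.
Proof.
apply: le_trans (ler_norm_sum _ _ _) _; apply: ler_sum => j _.
by rewrite normrM ler_wpM2l.
Qed.

Lemma is_derive_rescale (l : R) (h x : V) :
  is_derive x h (rescale rho l) (l^-1 * rescale (dkernel h) l x).
Proof.
have dr : is_derive (l^-1 *: x + 0) h rho (dkernel h (l^-1 *: x)).
  rewrite addr0; apply: is_derive_partial => [j y|j].
    by case: (kernel_is_derive rho_kernel j y).
  exact: kernel_partial_continuous.
have := is_derive_affine (l ^- d) dr.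
rewrite /rescale mulrCA; congr (is_derive _ _ _ _).
by apply/funext => y; rewrite addr0.
Qed.

Lemma is_derive_conv (l : R) (f : V -> R) (x h : V) : 0 < l ->
  lam.-integrable setT (EFin \o f) ->
  is_derive x h (conv rho l f) (l^-1 * conv (dkernel h) l f x).
Proof.
move=> l0 intf.
pose C1 := l ^- d * C + l^-1 * (l ^- d * (\sum_j `|h 0 j| * C)).
have ld : 0 <= l ^- d by rewrite invr_ge0 exprn_ge0// ltW.
have li : 0 <= l^-1 by rewrite invr_ge0 ltW.
have S0 : 0 <= \sum_j `|h 0 j| * C by apply: sumr_ge0 => j _; rewrite mulr_ge0.
have C1a : l ^- d * C <= C1 by rewrite lerDl !mulr_ge0.
have C1b : l^-1 * (l ^- d * (\sum_j `|h 0 j| * C)) <= C1 by rewrite lerDr mulr_ge0.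
have := @derive_conv R d f (rescale rho l)
  (fun y => l^-1 * rescale (dkernel h) l y) h x C1 intf.
move=> H; have {}H : is_derive x h (fun x => \int[lam]_y (f y * rescale rho l (x - y)))
   (\int[lam]_y (f y * (l^-1 * rescale (dkernel h) l (x - y)))).
  apply: H.
  - by apply: measurable_rescale; exact: measurable_kernel.
  - by move=> y; apply: le_trans C1a; exact: rescale_le.
  - by move=> y; exact: is_derive_rescale.
  - move=> y; apply: le_trans C1b; rewrite normrM ger0_norm// ler_wpM2l//.
    by apply: rescale_le => // z; exact: dkernel_le.
move: H; congr (is_derive _ _ _ _); rewrite /conv -RintegralZl//.
  by apply: eq_Rintegral => y _; rewrite mulrCA.
exact: (conv_integrand_integrable (measurable_dkernel h) (dkernel_le h)).
Qed.

Lemma partial_conv (l : R) (f : V -> R) (x : V) j : 0 < l ->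
  lam.-integrable setT (EFin \o f) ->
  partial j (conv rho l f) x = l^-1 * conv (partial j rho) l f x.
Proof.
by move=> l0 intf; have [_] := is_derive_conv x 'e_j l0 intf; rewrite dkernel_e.
Qed.

Lemma partial_rescale_subr (l : R) (x y : V) j :
  is_derive y 'e_j (fun y => rescale rho l (x - y))
    (- (l^-1 * rescale (partial j rho) l (x - y))).
Proof.
have := is_derive_rescale l 'e_j (-1 *: y + x).
move=> /(is_derive_affine 1); rewrite dkernel_e !mul1r mulN1r.
rewrite scaleN1r [- y + x]addrC; congr (is_derive _ _ _ _).
by apply/funext => z; rewrite mul1r scaleN1r addrC.
Qed.

(** Where the closed sup-norm ball of radius [l] around [x] stays in [Om], the kernel centred at [x]
    is an admissible test function; so the distribution [Eu] can be evaluated pointwise after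
    mollification. *)
Lemma test_function_kernel (Om : set V) (l : R) (x : V) : 0 < l ->
  (forall y, `|x - y| <= l -> Om y) ->
  test_function Om (fun y => rescale rho l (x - y)).
Proof.
move=> l0 xOm.
have sub : supp (fun y => rescale rho l (x - y)) `<=` [set y | `|x - y| <= l].
  have cl : closed [set y : V | `|x - y| <= l].
    have -> : [set y : V | `|x - y| <= l] = (fun y : V => `|x - y|) @^-1` [set r | r <= l] by [].
    apply: preimage_closed; last exact: closed_le.
    move=> y _; apply: (@continuous_comp _ _ _ (fun y : V => x - y)).
      apply: (@continuousB R V V (fun=> x) id); first exact: cst_continuous.
      exact: cvg_id.
    exact: norm_continuous.
  move=> y; rewrite /supp => cy; apply: cl; move: cy; apply: closureS => z /=.
  apply: contraNle => lxz; apply/eqP; apply: rescale_eq0 => //.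
    exact: kernel_eq0.
  by apply: le_trans (norm_le_enorm _); exact: ltW.
split.
- have -> : (fun y => rescale rho l (x - y)) =
      (fun y : V => l ^- d * rho (- l^-1 *: y + l^-1 *: x)).
    by apply/funext => y; rewrite /rescale scalerBr scaleNr addrC.
  by apply: smooth_affine; exact: kernel_smooth.
- apply: bounded_closed_compact; last exact: closed_closure.
  exists (`|x| + l); split; first by rewrite num_real.
  move=> M lM y /sub /= xy; apply: ltW; apply: le_lt_trans lM.
  rewrite -(subrK x y) addrC (le_trans (ler_normD _ _))// lerD2l.
  by rewrite distrC.
- by move=> y /sub /xOm.
Qed.

(** The entries of the strain of the mollified field. *)
Definition symconv (l : R) (v : V -> V) (i j : 'I_d) (x : V) : R :=
  2^-1 * (partial j (conv rho l (fun y => v y 0 i)) x +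
          partial i (conv rho l (fun y => v y 0 j)) x).

(** Strain and mollification commute: the sign produced by [y |-> rho_l (x - y)] cancels the one in
    the definition of the distribution. The cut-off field [v] may replace [u] because the kernel
    sees only a ball where they agree. *)
Lemma symgrad_pairing_conv (Om S : set V) (u v : V -> V) (l : R) (x : V) i j :
  0 < l -> (forall i, lam.-integrable setT (fun y => (v y 0 i)%:E)) ->
  S `<=` Om -> {ae lam, forall y, S y -> u y = v y} ->
  (forall y, enorm (x - y) < l -> S y) ->
  symgrad_pairing Om u i j (fun y => rescale rho l (x - y)) = symconv l v i j x.
Proof.
move=> l0 intv SOm uv xS.
have pE k y : partial k (fun y => rescale rho l (x - y)) y =
    - (l^-1 * rescale (partial k rho) l (x - y)).
  by have [_] := partial_rescale_subr l x y k.
have int_ik i' k : lam.-integrable setT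
    (EFin \o (fun y => v y 0 i' * rescale (partial k rho) l (x - y))).
  have mpk := measurable_kernel_partial rho_kernel k.
  exact: (conv_integrand_integrable mpk (rhoC' k) x l0 (intv i')).
have intv' i' : lam.-integrable setT (EFin \o (fun y => v y 0 i')) by exact: intv.
rewrite /symgrad_pairing /symconv (partial_conv x j l0 (intv' i)).
rewrite (partial_conv x i l0 (intv' j)) -mulrN; congr (_ * _).
have -> : \int[lam]_(y in Om) (u y 0 i * partial j (fun y => rescale rho l (x - y)) y +
      u y 0 j * partial i (fun y => rescale rho l (x - y)) y) =
    \int[lam]_y (- l^-1 * (v y 0 i * rescale (partial j rho) l (x - y) +
      v y 0 j * rescale (partial i rho) l (x - y))).
  rewrite Rintegral_mkcond /Rintegral; congr fine.
  apply: ae_eq_lower_integral; apply: filterS uv => y uvy _.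
  rewrite patchE !pE; congr EFin.
  have [xyl|lxy] := ltP (enorm (x - y)) l.
    have Sy := xS _ xyl.
    by rewrite mem_set ?(uvy Sy)//; [ring|exact: SOm].
  rewrite !(rescale_eq0 _ l0 lxy); [|exact: kernel_partial_eq0..].
  by rewrite !mulr0 addr0 mulr0 !oppr0 !mulr0 addr0; case: ifP.
rewrite RintegralZl//; last first.
  have := integrableD measurableT (int_ik i j) (int_ik j i).
  by apply: eq_integrable => // y _.
rewrite RintegralD//.
by rewrite mulNr opprK mulrDr.
Qed.

End mollified_derivatives.

Section double_integrals.
Context {R : realType} {d1 d2 : measure_display}.
Context {X : measurableType d1} {Y : measurableType d2}.
Variables (mu : {sigma_finite_measure set X -> \bar R}).
Variables (nu : {sigma_finite_measure set Y -> \bar R}).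
Variables (A : set X) (D : set Y).
Hypotheses (mA : measurable A) (mD : measurable D).
Local Open Scope ereal_scope.

Let patch2 (g : X * Y -> \bar R) p := g p * (\1_A p.1 * \1_D p.2)%:E.

Let patch2_ge0 g p : (forall p, 0 <= g p) -> 0 <= patch2 g p.
Proof. by move=> g0; rewrite mule_ge0// lee_fin mulr_ge0// indicE. Qed.

Let measurable_patch2 g : measurable_fun setT g -> measurable_fun setT (patch2 g).
Proof.
move=> mg; apply: emeasurable_funM => //; apply/measurable_EFinP.
apply: measurable_funM.
  by apply: (measurableT_comp (measurable_indic mA)).
by apply: (measurableT_comp (measurable_indic mD)).
Qed.

Let patch_indicE d (T : measurableType d) (m : {measure set T -> \bar R})
    (S : set T) (f : T -> \bar R) :
  \int[m]_(x in S) f x = \int[m]_x (f x * (\1_S x)%:E).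
Proof.
rewrite integral_mkcond; apply: eq_integral => x _; rewrite patchE indicE.
by case: (x \in S); rewrite ?mule1 ?mule0.
Qed.

Let inner_FE (g : X * Y -> \bar R) : measurable_fun setT g ->
  (forall p, 0 <= g p) -> forall x,
  (\int[nu]_(y in D) g (x, y)) * (\1_A x)%:E = \int[nu]_y patch2 g (x, y).
Proof.
move=> mg g0 x; rewrite patch_indicE -ge0_integralZr//.
- apply: eq_integral => y _; rewrite /patch2/= -muleA -EFinM.
  by rewrite [(\1_D y * _)%R]mulrC.
- apply: emeasurable_funM; first exact: measurableT_comp mg (pair1_measurable x).
  by apply/measurable_EFinP; exact: measurable_indic.
- by move=> y _; rewrite mule_ge0// lee_fin indicE.
Qed.

Let inner_GE (g : X * Y -> \bar R) : measurable_fun setT g ->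
  (forall p, 0 <= g p) -> forall y,
  (\int[mu]_(x in A) g (x, y)) * (\1_D y)%:E = \int[mu]_x patch2 g (x, y).
Proof.
move=> mg g0 y; rewrite patch_indicE -ge0_integralZr//.
- by apply: eq_integral => x _; rewrite /patch2/= -muleA -EFinM.
- apply: emeasurable_funM; first exact: measurableT_comp mg (pair2_measurable y).
  by apply/measurable_EFinP; exact: measurable_indic.
- by move=> x _; rewrite mule_ge0// lee_fin indicE.
Qed.

Lemma tonelli_set (g : X * Y -> \bar R) : measurable_fun setT g ->
  (forall p, 0 <= g p) ->
  \int[mu]_(x in A) \int[nu]_(y in D) g (x, y) =
  \int[nu]_(y in D) \int[mu]_(x in A) g (x, y).
Proof.
move=> mg g0; rewrite patch_indicE [RHS]patch_indicE.
under eq_integral do rewrite inner_FE//.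
under [RHS]eq_integral do rewrite inner_GE//.
have p0 p : 0 <= patch2 g p by exact: patch2_ge0.
exact: (@fubini_tonelli _ _ _ _ _ mu nu (patch2 g) (measurable_patch2 mg) p0).
Qed.

Lemma measurable_integral_set (g : X * Y -> \bar R) : measurable_fun setT g ->
  (forall p, 0 <= g p) ->
  measurable_fun setT (fun x => \int[nu]_(y in D) g (x, y)).
Proof.
move=> mg g0.
have E x : \int[nu]_(y in D) g (x, y) = \int[nu]_y (g (x, y) * (\1_D y)%:E).
  exact: patch_indicE.
under eq_fun do rewrite E.
apply: (measurable_fun_fubini_tonelli_F (m2 := nu)
  (fun p => g p * (\1_D p.2)%:E)) => [|p].
  apply: emeasurable_funM => //; apply/measurable_EFinP.
  by apply: (measurableT_comp (measurable_indic mD)).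
by rewrite mule_ge0// lee_fin indicE.
Qed.

End double_integrals.

Section product_of_averages.
Context {R : realType} {d : measure_display} {X : measurableType d}.
Variable mu : {measure set X -> \bar R}.
Variable B : set X.
Hypothesis mB : measurable B.
Local Open Scope ereal_scope.

(** The pointwise inequality is integrated over [B x B]. With [h] a suitable power this does the
    work of Cauchy-Schwarz and Hoelder on the unit ball, at the price of a factor [2]. *)
Lemma integral_mul_le (f g h : X -> R) :
  measurable_fun B f -> measurable_fun B g -> measurable_fun B h ->
  (forall x, 0 <= f x)%R -> (forall x, 0 <= g x)%R -> (forall x, 0 <= h x)%R ->
  (forall x y, f x * g y <= h x + h y)%R ->
  (\int[mu]_(x in B) (f x)%:E) * (\int[mu]_(x in B) (g x)%:E) <=
  2%:E * (mu B * \int[mu]_(x in B) (h x)%:E).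
Proof.
move=> mf mg mh f0 g0 h0 fgh.
have Ig0 : 0 <= \int[mu]_(x in B) (g x)%:E.
  by apply: integral_ge0 => x _; rewrite lee_fin.
have Ih0 : 0 <= \int[mu]_(x in B) (h x)%:E.
  by apply: integral_ge0 => x _; rewrite lee_fin.
have inner x : (f x)%:E * \int[mu]_(y in B) (g y)%:E <=
    (h x)%:E * mu B + \int[mu]_(y in B) (h y)%:E.
  rewrite -ge0_integralZl ?lee_fin//; last 2 first.
  - exact/measurable_EFinP.
  - by move=> y _; rewrite lee_fin.
  rewrite -integral_cst// -ge0_integralD//; last 3 first.
  - by move=> y _; rewrite lee_fin.
  - by move=> y _; rewrite lee_fin.
  - exact/measurable_EFinP.
  apply: le_lower_integral => y _; first by rewrite -EFinM lee_fin mulr_ge0.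
  by rewrite -EFinM -EFinD lee_fin.
rewrite -ge0_integralZr//; last 2 first.
- exact/measurable_EFinP.
- by move=> x _; rewrite lee_fin.
apply: (@le_trans _ _ (\int[mu]_(x in B) ((h x)%:E * mu B +
    \int[mu]_(y in B) (h y)%:E))).
  by apply: le_lower_integral => x _; [rewrite mule_ge0 ?lee_fin|exact: inner].
rewrite ge0_integralD//; first last.
- apply: emeasurable_funM => //; exact/measurable_EFinP.
- by move=> x _; rewrite mule_ge0 ?lee_fin.
rewrite ge0_integralZr//; last 2 first.
- exact/measurable_EFinP.
- by move=> x _; rewrite lee_fin.
rewrite integral_cst// muleC -mule2n -mule_natl.
by rewrite [X in _ * X <= _]muleC [mu B * _]muleC.
Qed.

End product_of_averages.

(** * The Duchon-Robert defect *)

Section duchon_robert.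
Context {R : realType} {d : nat}.
Local Notation V := 'rV[R]_d.
Local Notation lam := (@lebesgue_rV R d).
Local Notation B := (@unit_ball R d).

Variable rho : V -> R.
Hypothesis rho_kernel : mollifier_kernel rho.
Variable C : R.
Hypothesis rhoC : forall z, `|rho z| <= C.
Hypothesis rhoC' : forall j z, `|partial j rho z| <= C.

Let C_ge0 : 0 <= C. Proof. exact: le_trans (normr_ge0 _) (rhoC 0). Qed.

Lemma integral_supported_le (F G : V -> R) :
  (forall z, 1 <= enorm z -> F z = 0) -> (forall z, `|F z| <= G z) ->
  (\int[lam]_z `|F z|%:E <= \int[lam]_(z in B) (G z)%:E)%E.
Proof.
move=> F0 FG; rewrite [leRHS]integral_mkcond.
apply: le_lower_integral => // z _; rewrite patchE; case: ifPn => [_|zB].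
  by rewrite lee_fin.
rewrite F0 ?normr0// leNgt; apply: contra zB => z1; apply/mem_set.
by rewrite /unit_ball /eball/= subr0.
Qed.

Definition delta (v : V -> V) (l : R) (x z : V) : V := v (x + l *: z) - v x.

Lemma measurable_delta (v : V -> V) (l : R) : measurable_fun setT v ->
  measurable_fun setT (fun p : V * V => delta v l p.1 p.2).
Proof.
move=> mv; apply: measurable_fun_coordP => i j; under eq_fun do rewrite !mxE.
apply: measurable_funB; last first.
  exact: (measurableT_comp (measurableT_comp (measurable_coord i j) mv) measurable_fst).
apply: (measurableT_comp (measurable_coord i j)).
apply: (measurableT_comp mv).
apply: measurable_fun_coordP => i' j'; under eq_fun do rewrite !mxE.
apply: measurable_funD.
  exact: (measurableT_comp (measurable_coord i' j') measurable_fst).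
apply: measurable_funM => //.
exact: (measurableT_comp (measurable_coord i' j') measurable_snd).
Qed.

Lemma measurable_delta1 (v : V -> V) (l : R) (x : V) : measurable_fun setT v ->
  measurable_fun setT (delta v l x).
Proof.
move=> mv.
exact: (measurableT_comp (measurable_delta l mv) (pair1_measurable x)).
Qed.

(** The flux of a field without time. By conversion [D_DR rho u l x t] is the flux of the slice
    [u ^~ t], so all estimates can be made one time at a time. *)
Definition flux_DR (v : V -> V) (l : R) (x : V) : R :=
  D_DR rho (fun y _ => v y) l x 0.

Lemma flux_DRE (v : V -> V) (l : R) (x : V) :
  flux_DR v l x = \int[lam]_z \sum_j ((4 * l)^-1 *
    (partial j rho z * (delta v l x z 0 j * enorm (delta v l x z) ^+ 2))).
Proof.
apply: eq_Rintegral => z _; rewrite /mxdot big_ord1 mulr_suml.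
by apply: eq_bigr => j _; rewrite /delta /increment !mxE; ring.
Qed.

(** Each of the [d] components of the gradient of [rho] is at most [C], and each component of the
    increment is at most its norm. *)
Lemma flux_DR_cubic_le (v : V -> V) (l : R) (x : V) :
  0 < l -> measurable_fun setT v ->
  (`|flux_DR v l x|%:E <= (d%:R * C / (4 * l))%:E *
     \int[lam]_(z in B) (enorm (delta v l x z) ^+ 3)%:E)%E.
Proof.
move=> l0 mv; rewrite flux_DRE; apply: le_trans (abs_Rintegral_le _ _ _) _.
have li : 0 <= (4 * l)^-1 by rewrite invr_ge0 mulr_ge0// ltW.
have mI : measurable_fun B (fun z => (enorm (delta v l x z) ^+ 3)%:E).
  apply/measurable_EFinP; apply: measurable_funX; apply: measurable_enorm.
  by apply: measurable_funTS; exact: measurable_delta1.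
rewrite -ge0_integralZl//; first last.
- by rewrite lee_fin !mulr_ge0.
- by move=> z _; rewrite lee_fin exprn_ge0// enorm_ge0.
- exact: measurable_unit_ball.
apply: integral_supported_le => [z z1|z].
  by apply: big1 => j _; rewrite kernel_partial_eq0// mul0r mulr0.
apply: le_trans (ler_norm_sum _ _ _) _.
set e := enorm _.
have e0 : 0 <= e by exact: enorm_ge0.
apply: (@le_trans _ _ (\sum_(j < d) ((4 * l)^-1 * (C * e ^+ 3)))).
  apply: ler_sum => j _; rewrite normrM ger0_norm// ler_wpM2l//.
  rewrite 2!normrM [`|e ^+ 2|]ger0_norm ?exprn_ge0// ler_pM ?mulr_ge0 ?exprn_ge0//.
  by rewrite [e ^+ 3]exprS ler_wpM2r ?exprn_ge0//; exact: coord_le_enorm.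
rewrite sumr_const card_ord -[_ *+ d]mulr_natl le_eqVlt; apply/orP; left; apply/eqP.
by move: (4 * l)^-1 => k; ring.
Qed.

Lemma Rintegral_sum (I : Type) (s : seq I) (F : I -> V -> R) :
  (forall i, lam.-integrable setT (EFin \o F i)) ->
  lam.-integrable setT (EFin \o (fun x => \sum_(i <- s) F i x)) /\
  \int[lam]_x (\sum_(i <- s) F i x) = \sum_(i <- s) \int[lam]_x F i x.
Proof.
move=> intF; elim: s => [|i s [IH1 IH2]].
  rewrite big_nil; have E : (fun x => \sum_(i <- [::]) F i x) = cst 0.
    by apply/funext => x; rewrite big_nil.
  rewrite E; split; first exact: integrable0.
  by rewrite /Rintegral integral0.
have E : (fun x => \sum_(j <- i :: s) F j x) =
    (fun x => F i x + \sum_(j <- s) F j x).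
  by apply/funext => x; rewrite big_cons.
rewrite E big_cons RintegralD// IH2; split => //.
have := integrableD measurableT (intF i) IH1.
by apply: eq_integrable => // x _.
Qed.

Lemma is_derive_sumf n (h : 'I_n -> V -> R) (dh : 'I_n -> R) (x v : V) :
  (forall i, is_derive x v (h i) (dh i)) ->
  is_derive x v (fun y => \sum_i h i y) (\sum_i dh i).
Proof.
by move=> /is_derive_sum; congr (is_derive _ _ _ _); rewrite fct_sumE.
Qed.

(** * Integration by parts in [z] for a smooth bounded field *)

Section smooth_field.
Variables (w : V -> V) (dw : 'I_d -> 'I_d -> V -> R) (M : R).
Hypothesis mw : measurable_fun setT w.
Hypothesis mdw : forall i j, measurable_fun setT (dw i j).
Hypothesis wM : forall y i, `|w y 0 i| <= M.
Hypothesis dwM : forall i j y, `|dw i j y| <= M.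
Hypothesis dwE : forall i j y, is_derive y 'e_j (fun y => w y 0 i) (dw i j y).
Variables (l : R) (x : V).
Hypothesis l0 : 0 < l.

Let M_ge0 : forall i : 'I_d, 0 <= M.
Proof. by move=> i; exact: le_trans (normr_ge0 _) (wM 0 i). Qed.

(** [N] is the squared norm of the increment, so [G] is the vector field [|delta w|^2 delta w] in
    the variable [z]; [dG j] is its [j]-th component differentiated in [z_j], with a factor [l] from
    [w (x + l z)]. *)
Let D i z : R := delta w l x z 0 i.
Let DW i j z : R := dw i j (x + l *: z).
Let N z : R := \sum_i D i z ^+ 2.
Let S j z : R := \sum_i D i z * DW i j z.
Let G j z : R := D j z * N z.
Let dG j z : R := l * (DW j j z * N z + 2 * (D j z * S j z)).

Let dD i j z : is_derive z 'e_j (D i) (l * DW i j z).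
Proof.
have h1 := is_derive_affine 1 (dwE i j (l *: z + x)).
have : is_derive z 'e_j (fun y => 1 * w (l *: y + x) 0 i + (- w x 0 i))
    (1 * (l * dw i j (l *: z + x)) + 0).
  exact: is_deriveD.
rewrite addr0 mul1r /DW [x + _]addrC; congr (is_derive _ _ _ _).
by apply/funext => y; rewrite /D /delta !mxE mul1r addrC [x + _]addrC addrC.
Qed.

Let dN j z : is_derive z 'e_j N (\sum_i (2 * (D i z * (l * DW i j z)))).
Proof.
apply: is_derive_sumf => i.
have := is_deriveX 2 (dD i j z).
rewrite /GRing.scale/= expr1 -mulrA; congr (is_derive _ _ _ _).
Qed.

Let dGE j z : is_derive z 'e_j (G j) (dG j z).
Proof.
have := is_deriveM (dD j j z) (dN j z).
rewrite /GRing.scale/= => H.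
have -> : dG j z = D j z * (\sum_i 2 * (D i z * (l * DW i j z))) +
    N z * (l * DW j j z).
  rewrite /dG /S mulrDr [_ + N z * _]addrC; congr (_ + _); first by ring.
  rewrite -mulr_sumr.
  have -> : \sum_i D i z * (l * DW i j z) = l * \sum_i (D i z * DW i j z).
    by rewrite mulr_sumr; apply: eq_bigr => i _; rewrite mulrCA.
  by ring.
exact: H.
Qed.

Let dF j z : is_derive z 'e_j (fun z => rho z * G j z)
  (rho z * dG j z + G j z * partial j rho z).
Proof. exact: is_deriveM (kernel_is_derive rho_kernel j z) (dGE j z). Qed.

Let mD i : measurable_fun setT (D i).
Proof. exact: (measurableT_comp (measurable_coord 0 i) (measurable_delta1 l x mw)). Qed.

Let mDW i j : measurable_fun setT (DW i j).
Proof. exact: measurable_along. Qed.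

Let mN : measurable_fun setT N.
Proof. by apply: measurable_sum => i; exact: measurable_funX. Qed.

Let mS j : measurable_fun setT (S j).
Proof. by apply: measurable_sum => i; exact: measurable_funM. Qed.

Let mG j : measurable_fun setT (G j).
Proof. exact: measurable_funM. Qed.

Let mdG j : measurable_fun setT (dG j).
Proof.
apply: measurable_funM => //; apply: measurable_funD; first exact: measurable_funM.
by apply: measurable_funM => //; exact: measurable_funM.
Qed.

Let D_le i z : `|D i z| <= 2 * M.
Proof.
rewrite /D /delta !mxE; apply: le_trans (ler_normB _ _) _.
by rewrite mulr_natl mulr2n lerD.
Qed.

Let N_le z : `|N z| <= d%:R * (2 * M) ^+ 2.
Proof.
apply: le_trans (ler_norm_sum _ _ _) _.
rewrite mulr_natl -[X in _ *+ X]card_ord -sumr_const; apply: ler_sum => i _.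
by rewrite normrX lerXn2r ?nnegrE ?mulr_ge0// (M_ge0 i).
Qed.

Let DW_le i j z : `|DW i j z| <= M. Proof. exact: dwM. Qed.

Let S_le j z : `|S j z| <= d%:R * (2 * M * M).
Proof.
apply: le_trans (ler_norm_sum _ _ _) _.
rewrite mulr_natl -[X in _ *+ X]card_ord -sumr_const; apply: ler_sum => i _.
by rewrite normrM ler_pM.
Qed.

Let bG : R := 2 * M * (d%:R * (2 * M) ^+ 2).
Let bdG : R := l * (M * (d%:R * (2 * M) ^+ 2) + 2 * (2 * M * (d%:R * (2 * M * M)))).

Let G_le j z : `|G j z| <= bG.
Proof. by rewrite normrM ler_pM. Qed.

Let dG_le j z : `|dG j z| <= bdG.
Proof.
rewrite normrM gtr0_norm// ler_wpM2l ?(ltW l0)//.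
apply: le_trans (ler_normD _ _) _; rewrite lerD//; first by rewrite normrM ler_pM ?dwM.
by rewrite normrM ger0_norm// ler_wpM2l// normrM ler_pM.
Qed.

Let supp_le (f : V -> R) z : (1 <= enorm z -> f z = 0) -> f z != 0 -> `|z| <= 1.
Proof.
move=> f0 fz; apply: le_trans (norm_le_enorm _) _.
by rewrite leNgt; apply: contraNN fz => /ltW/f0 ->.
Qed.

Let int_rho_dG j : lam.-integrable setT (EFin \o (fun z => rho z * dG j z)).
Proof.
apply: (@bounded_support_integrable _ _ _ (C * bdG) 1).
- by apply: measurable_funM => //; exact: measurable_kernel.
- by move=> z; rewrite normrM ler_pM.
- move=> z; apply: (@supp_le (fun z => rho z * dG j z)) => z1.
  by rewrite kernel_eq0// mul0r.
Qed.

Let int_drho_G j : lam.-integrable setT (EFin \o (fun z => partial j rho z * G j z)).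
Proof.
apply: (@bounded_support_integrable _ _ _ (C * bG) 1).
- by apply: measurable_funM => //; exact: measurable_kernel_partial.
- by move=> z; rewrite normrM ler_pM.
- move=> z; apply: (@supp_le (fun z => partial j rho z * G j z)) => z1.
  by rewrite kernel_partial_eq0// mul0r.
Qed.

(** [rho * G j] has bounded support, so the integral of its derivative vanishes. *)
Let by_parts j : \int[lam]_z (partial j rho z * G j z) =
  - \int[lam]_z (rho z * dG j z).
Proof.
apply/eqP; rewrite eq_sym -subr_eq0 -opprD oppr_eq0 addrC -RintegralD//; apply/eqP.
have b0 : 0 <= bG by exact: le_trans (normr_ge0 _) (G_le j 0).
have b1 : 0 <= bdG by exact: le_trans (normr_ge0 _) (dG_le j 0).
have E : (fun z => partial j rho z * G j z + rho z * dG j z) =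
  (fun z => rho z * dG j z + G j z * partial j rho z).
  by apply/funext => z; rewrite addrC [G j z * _]mulrC.
apply: (@integral_derivative0 _ _ (fun z => rho z * G j z) _ 'e_j (C * bG + C * bdG) 1).
- by apply: measurable_funM => //; exact: measurable_kernel.
- by move=> z; rewrite normrM (le_trans (ler_pM _ _ (rhoC z) (G_le j z)))// lerDl mulr_ge0.
- move=> z; apply: (@supp_le (fun z => rho z * G j z)) => z1.
  by rewrite kernel_eq0// mul0r.
- move=> z; have := dF j z.
  by rewrite [rho z * dG j z + _]addrC [G j z * _]mulrC.
- move=> z; apply: le_trans (ler_normD _ _) _.
  by rewrite lerD// normrM ler_pM.
- apply: measurable_funD; apply: measurable_funM => //.
    exact: measurable_kernel_partial.
  exact: measurable_kernel.
- move=> z; apply: (@supp_le (fun z => partial j rho z * G j z + rho z * dG j z)) => z1.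
  by rewrite (kernel_eq0 rho_kernel z1) (kernel_partial_eq0 rho_kernel j z1) !mul0r addr0.
Qed.

Lemma flux_DR_smooth : flux_DR w l x =
  - (4^-1 * \int[lam]_z (rho z * \sum_j (DW j j z * N z + 2 * (D j z * S j z)))).
Proof.
have NE z : enorm (delta w l x z) ^+ 2 = N z by rewrite enorm_rV_sq.
rewrite flux_DRE; under eq_Rintegral do under eq_bigr do rewrite NE.
have intL j : lam.-integrable setT (EFin \o (fun z =>
    (4 * l)^-1 * (partial j rho z * (delta w l x z 0 j * N z)))).
  have := integrableZl measurableT (4 * l)^-1 (int_drho_G j).
  by apply: eq_integrable.
rewrite (Rintegral_sum (index_enum 'I_d) intL).2.
have -> : \int[lam]_z (rho z * \sum_j (DW j j z * N z + 2 * (D j z * S j z))) =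
    \int[lam]_z \sum_j (l^-1 * (rho z * dG j z)).
  apply: eq_Rintegral => z _; rewrite mulr_sumr; apply: eq_bigr => j _.
  by rewrite /dG [rho z * (l * _)]mulrCA mulKf// gt_eqF.
have intR j : lam.-integrable setT (EFin \o (fun z => l^-1 * (rho z * dG j z))).
  have := integrableZl measurableT l^-1 (int_rho_dG j).
  by apply: eq_integrable.
rewrite (Rintegral_sum (index_enum 'I_d) intR).2 mulr_sumr -sumrN.
apply: eq_bigr => j _; rewrite RintegralZl// RintegralZl// by_parts.
by rewrite invfM mulrN mulrA.
Qed.

Let sym i j y : R := 2^-1 * (dw i j y + dw j i y).

Lemma flux_DR_smooth_le : (`|flux_DR w l x|%:E <= C%:E *
  \int[lam]_(z in B) ((\sum_i \sum_j `|sym i j (x + l *: z)|)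
                        * enorm (delta w l x z) ^+ 2)%:E)%E.
Proof.
rewrite flux_DR_smooth normrN normrM ger0_norm ?invr_ge0//.
set I := Rintegral _ _ _.
have NE z : enorm (delta w l x z) ^+ 2 = N z by rewrite enorm_rV_sq.
under eq_integral do rewrite NE.
have Sm z : 0 <= \sum_i \sum_j `|sym i j (x + l *: z)|.
  by apply: sumr_ge0 => i _; exact: sumr_ge0.
have N0 z : 0 <= N z by apply: sumr_ge0 => i _; exact: sqr_ge0.
have DN i z : `|D i z| ^+ 2 <= N z.
  rewrite real_normK ?num_real// /N (bigD1 i)//= lerDl.
  by apply: sumr_ge0 => k _; exact: sqr_ge0.
have mE : measurable_fun B (fun z => ((\sum_i \sum_j `|sym i j (x + l *: z)|) * N z)%:E).
  apply/measurable_EFinP; apply: measurable_funTS; apply: measurable_funM => //.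
  apply: measurable_sum => i; apply: measurable_sum => j.
  apply: measurableT_comp => //; apply: measurable_funM => //.
  by apply: measurable_funD; exact: mDW.
(* The trace term is at most [A * N] and the quadratic form contributes [2 * A * N]; their sum is
   absorbed by [4 * A * N], which cancels the prefactor. *)
have -> : C = 4^-1 * (4 * C) by rewrite mulrA mulVf ?mul1r.
rewrite !EFinM -muleA lee_wpmul2l ?lee_fin ?invr_ge0//.
rewrite -EFinM -ge0_integralZl//; first last.
- by rewrite lee_fin mulr_ge0.
- by move=> z _; rewrite lee_fin mulr_ge0.
- exact: measurable_unit_ball.
apply: le_trans (abs_Rintegral_le _ _ _) _.
apply: integral_supported_le => [z z1|z]; first by rewrite kernel_eq0// mul0r.
set A := \sum_i \sum_j _.
(* Averaging the double sum with its transpose leaves only the symmetric part of the gradient. *)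
have quad : \sum_j D j z * S j z = \sum_j \sum_i (D j z * D i z * sym i j (x + l *: z)).
  have E1 : \sum_j D j z * S j z = \sum_j \sum_i (D j z * D i z * DW i j z).
    by apply: eq_bigr => j _; rewrite mulr_sumr; apply: eq_bigr => i _; rewrite mulrA.
  have E2 : \sum_j D j z * S j z = \sum_j \sum_i (D j z * D i z * DW j i z).
    rewrite E1 exchange_big; apply: eq_bigr => j _; apply: eq_bigr => i _.
    by rewrite [D i z * _]mulrC.
  apply: (mulfI (x := 2)) => //; rewrite [LHS]mulr_natl mulr2n {1}E1 E2 -big_split/=.
  rewrite mulr_sumr; apply: eq_bigr => j _; rewrite -big_split mulr_sumr/=.
  apply: eq_bigr => i _; rewrite /sym /DW mulrCA [2 * (2^-1 * _)]mulrA mulfV// mul1r.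
  by rewrite mulrDr.
have quad_le : `|\sum_j D j z * S j z| <= A * N z.
  rewrite quad; apply: le_trans (ler_norm_sum _ _ _) _.
  rewrite /A exchange_big mulr_suml; apply: ler_sum => j _.
  apply: le_trans (ler_norm_sum _ _ _) _; rewrite mulr_suml; apply: ler_sum => i _.
  rewrite normrM mulrC ler_wpM2l// normrM.
  by have := DN i z; have := DN j z; nra.
have diag_le : `|\sum_j DW j j z * N z| <= A * N z.
  rewrite -mulr_suml normrM (ger0_norm (N0 z)) ler_wpM2r//.
  apply: le_trans (ler_norm_sum _ _ _) _; apply: ler_sum => j _.
  rewrite (bigD1 j)//= {1}/sym -mulr2n -[dw j j _ *+ 2]mulr_natl mulrA mulVf// mul1r.
  by rewrite lerDl sumr_ge0.
have sumE : \sum_j (DW j j z * N z + 2 * (D j z * S j z)) =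
    \sum_j DW j j z * N z + 2 * \sum_j D j z * S j z.
  by rewrite big_split/= -mulr_sumr.
rewrite sumE normrM.
apply: (@le_trans _ _ (C * (A * N z + 2 * (A * N z)))).
  rewrite ler_pM// (le_trans (ler_normD _ _))// lerD//.
  by rewrite normrM (ger0_norm (ler0n _ 2)) ler_wpM2l.
have : 0 <= C * (A * N z) by rewrite mulr_ge0// mulr_ge0//; exact: Sm.
by lra.
Qed.

End smooth_field.

End duchon_robert.

(** * Return from mollified fields to bounded fields *)

Section mollified_flux.
Context {R : realType} {d : nat}.
Local Notation V := 'rV[R]_d.
Local Notation lam := (@lebesgue_rV R d).
Local Notation B := (@unit_ball R d).

Lemma unit_ball_lty : (lam B < +oo)%E.
Proof. exact: lebesgue_eball_lty. Qed.

Definition vol_B : R := fine (lam B).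

Lemma vol_BE : lam B = vol_B%:E.
Proof. by rewrite /vol_B fineK// ge0_fin_numE// unit_ball_lty. Qed.

Lemma vol_B_ge0 : 0 <= vol_B.
Proof. by rewrite fine_ge0. Qed.

Lemma integral_cst_B (k : R) : (\int[lam]_(z in B) k%:E = (k * vol_B)%:E)%E.
Proof.
have := integral_cst lam (@measurable_unit_ball R d) k%:E.
by rewrite EFinM -vol_BE.
Qed.

Lemma integrable_affine (f : V -> R) (l : R) (x : V) : l != 0 ->
  lam.-integrable setT (EFin \o f) ->
  lam.-integrable setT (EFin \o (fun z => f (x + l *: z))).
Proof.
move=> l0 /integrableP[mf fy].
have mf' : measurable_fun setT f by apply/measurable_EFinP.
apply/integrableP; split.
  by apply/measurable_EFinP; exact: measurable_along.
have -> : (\int[lam]_z `|(EFin \o (fun z => f (x + l *: z)%R)) z| =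
    \int[lam]_z (fun y => `|f y|%:E) (l *: z + x)%R)%E.
  by apply: eq_integral => z _; rewrite /= addrC.
rewrite (@ge0_integral_affine _ _ l x (fun y => `|f y|%:E))//.
  by rewrite lte_mul_pinfty// lee_fin invr_ge0 exprn_ge0.
by apply/measurable_EFinP; exact: measurableT_comp.
Qed.

Lemma measurable_shift2 (f : V -> R) (l : R) : measurable_fun setT f ->
  measurable_fun setT (fun p : V * V => f (p.1 + l *: p.2)).
Proof.
move=> mf; apply: (measurableT_comp mf).
apply: measurable_fun_coordP => i j; under eq_fun do rewrite !mxE.
apply: measurable_funD.
  exact: (measurableT_comp (measurable_coord i j) measurable_fst).
apply: measurable_funM => //.
exact: (measurableT_comp (measurable_coord i j) measurable_snd).
Qed.

Lemma norm_scale_unit_ball (l : R) (z : V) : 0 < l -> B z -> `|l *: z| <= l.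
Proof.
by move=> l0 /eball01_norm z1; rewrite normrZ gtr0_norm// ler_piMr// ltW.
Qed.

Variable rho : V -> R.
Hypothesis rho_kernel : mollifier_kernel rho.
Variable C : R.
Hypothesis rhoC : forall z, `|rho z| <= C.
Hypothesis rhoC' : forall j z, `|partial j rho z| <= C.

Let C_ge0 : 0 <= C. Proof. exact: le_trans (normr_ge0 _) (rhoC 0). Qed.
Let mrho := measurable_kernel rho_kernel.
Let rho0 := kernel_eq0 rho_kernel.

Lemma integrable_kernel : lam.-integrable setT (EFin \o rho).
Proof.
apply: (bounded_support_integrable (C := C) (r := 1) mrho rhoC) => z rz.
apply: le_trans (norm_le_enorm _) _.
by rewrite leNgt; apply: contraNN rz => /ltW/rho0 ->.
Qed.

(** Since [rho] has integral [1], a constant may be subtracted inside the average. *)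
Lemma conv_sub (l : R) (f : V -> R) (x : V) (c : R) : 0 < l ->
  lam.-integrable setT (EFin \o f) ->
  conv rho l f x - c = \int[lam]_z ((f (x + l *: z) - c) * rho z).
Proof.
move=> l0 intf; rewrite (convE mrho rhoC)//.
under eq_Rintegral do rewrite kernel_even//.
have int1 : lam.-integrable setT (EFin \o (fun z => f (x + l *: z) * rho z)).
  apply: (bounded_mul_integrable _ mrho rhoC).
  by apply: integrable_affine; rewrite ?gt_eqF.
have int2 : lam.-integrable setT (EFin \o (fun z => c * rho z)).
  exact: integrableZl integrable_kernel.
have -> : c = \int[lam]_z (c * rho z).
  by rewrite RintegralZl ?kernel_integral ?mulr1//; exact: integrable_kernel.
rewrite -RintegralB//.
apply: eq_Rintegral => z _; rewrite -mulrBl; congr (_ * _).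
by rewrite RintegralZl ?kernel_integral ?mulr1//; exact: integrable_kernel.
Qed.

Lemma conv_sub_le (l : R) (f : V -> R) (x : V) (c : R) : 0 < l ->
  lam.-integrable setT (EFin \o f) ->
  (`|conv rho l f x - c|%:E <= C%:E * \int[lam]_(z in B) `|f (x + l *: z) - c|%:E)%E.
Proof.
move=> l0 intf; rewrite conv_sub//; apply: le_trans (abs_Rintegral_le _ _ _) _.
apply: (kernel_weight_le rhoC rho0 (g := fun z => f (x + l *: z) - c)).
apply: measurable_funB => //; apply: measurable_along.
by apply/measurable_EFinP; case/integrableP : intf.
Qed.

(** After exchanging the integrals, each [z] in the unit ball gives a translation by at most [l], so
    the inner integral is uniformly small. *)
Lemma integrable_increment_small (f : V -> R) (e : R) : 0 < e ->
  lam.-integrable setT (EFin \o f) -> \forall l \near 0^'+,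
  (\int[lam]_x \int[lam]_(z in B) `|f (x + l *: z)%R - f x|%:E <= e%:E)%E.
Proof.
move=> e0 intf.
have mf : measurable_fun setT f by apply/measurable_EFinP; case/integrableP : intf.
have e1 : 0 < e / (vol_B + 1) by rewrite divr_gt0// ltr_wpDl// vol_B_ge0.
have /nbhs_ballP[r /= r0 fr] := integrable_shift_cvg intf e1.
have l0 : \forall l \near (0 : R)^'+, 0 < l by exact: nbhs_right_gt.
have lr : \forall l \near (0 : R)^'+, l < r by exact: nbhs_right_lt.
apply: filterS2 l0 lr => l l0 lr.
pose g (p : V * V) := `|f (p.1 + l *: p.2) - f p.1|%:E.
have mg : measurable_fun setT g.
  apply/measurable_EFinP; apply: measurableT_comp => //.
  apply: measurable_funB; first exact: measurable_shift2.
  exact: measurableT_comp.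
have mB : measurable B := measurable_unit_ball.
have g0 p : (0 <= g p)%E by rewrite lee_fin.
rewrite (tonelli_set lam lam measurableT mB mg g0).
apply: (@le_trans _ _ (\int[lam]_(z in B) (cst (e / (vol_B + 1))%:E z))%E).
  apply: le_lower_integral => z Bz; first by apply: integral_ge0 => x _; exact: g0.
  have lzr : ball (0 : V) r (l *: z).
    rewrite -ball_normE/= sub0r normrN.
    by apply: le_lt_trans lr; exact: norm_scale_unit_ball.
  exact: (fr _ lzr).
rewrite integral_cst_B lee_fin mulrAC ler_pdivrMr.
  by rewrite ler_wpM2l ?(ltW e0)// lerDl.
by rewrite ltr_wpDl// vol_B_ge0.
Qed.

Lemma conv_cvg_L1 (f : V -> R) (e : R) : 0 < e ->
  lam.-integrable setT (EFin \o f) -> \forall l \near 0^'+,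
  (\int[lam]_x `|conv rho l f x - f x|%:E <= e%:E)%E.
Proof.
move=> e0 intf.
have mf : measurable_fun setT f by apply/measurable_EFinP; case/integrableP : intf.
have e1 : 0 < e / (C + 1) by rewrite divr_gt0// ltr_wpDl.
have l0 : \forall l \near (0 : R)^'+, 0 < l by exact: nbhs_right_gt.
apply: filterS2 l0 (integrable_increment_small e1 intf) => l l0 fl.
pose g (p : V * V) := `|f (p.1 + l *: p.2) - f p.1|%:E.
have mg : measurable_fun setT g.
  apply/measurable_EFinP; apply: measurableT_comp => //.
  apply: measurable_funB; first exact: measurable_shift2.
  exact: measurableT_comp.
apply: (@le_trans _ _ (\int[lam]_x (C%:E *
    \int[lam]_(z in B) `|f (x + l *: z)%R - f x|%:E))%E).
  by apply: le_lower_integral => // x _; exact: conv_sub_le.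
rewrite ge0_integralZl//; first last.
- by move=> x _; apply: integral_ge0 => z _; rewrite lee_fin.
- by apply: (measurable_integral_set lam measurable_unit_ball mg) => p; rewrite lee_fin.
apply: le_trans (lee_wpmul2l _ fl) _; rewrite ?lee_fin//.
rewrite mulrCA ler_piMr ?(ltW e0)// ler_pdivrMr ?ltr_wpDl//.
by rewrite mul1r lerDl.
Qed.

(** [a |-> a_j |a|^2] is Lipschitz on bounded sets: [|a|^2 <= d (2 M)^2] multiplies the first
    difference, while [|b_j| <= 2 M] and [|a_i + b_i| <= 4 M] give [8 M^2]. *)
Let cubic_diff (M : R) (a b : V) j : 0 <= M -> (forall i, `|a 0 i| <= 2 * M) ->
  (forall i, `|b 0 i| <= 2 * M) ->
  `|a 0 j * enorm a ^+ 2 - b 0 j * enorm b ^+ 2| <=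
  (d%:R * (2 * M) ^+ 2 + 8 * M ^+ 2) * \sum_i `|a 0 i - b 0 i|.
Proof.
move=> M0 aM bM; set s := \sum_i _.
have s0 : 0 <= s by exact: sumr_ge0.
have -> : a 0 j * enorm a ^+ 2 - b 0 j * enorm b ^+ 2 =
    (a 0 j - b 0 j) * enorm a ^+ 2 + b 0 j * (enorm a ^+ 2 - enorm b ^+ 2) by ring.
apply: le_trans (ler_normD _ _) _; rewrite [leRHS]mulrDl lerD//.
  rewrite normrM mulrC ler_pM//.
    rewrite ger0_norm ?sqr_ge0// enorm_rV_sq.
    rewrite mulr_natl -[X in _ *+ X]card_ord -sumr_const; apply: ler_sum => i _.
    by rewrite -(@real_normK _ (a 0 i)) ?num_real// lerXn2r ?nnegrE// mulr_ge0.
  by rewrite /s (bigD1 j)//= lerDl sumr_ge0.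
rewrite normrM (_ : 8 * M ^+ 2 * s = (2 * M) * ((4 * M) * s)); last by ring.
rewrite ler_pM// !enorm_rV_sq -sumrB mulr_sumr.
apply: le_trans (ler_norm_sum _ _ _) _; apply: ler_sum => i _.
rewrite subr_sqr normrM mulrC ler_wpM2r//.
apply: le_trans (ler_normD _ _) _.
have := aM i; have := bM i; lra.
Qed.

Let flux_integrand (v : V -> V) (l : R) (x z : V) : R := \sum_j ((4 * l)^-1 *
    (partial j rho z * (delta v l x z 0 j * enorm (delta v l x z) ^+ 2))).

Let measurable_flux_integrand (v : V -> V) (l : R) : measurable_fun setT v ->
  measurable_fun setT (fun p : V * V => flux_integrand v l p.1 p.2).
Proof.
move=> mv; apply: measurable_sum => j; apply: measurable_funM => //.
apply: measurable_funM.
  exact: (measurableT_comp (measurable_kernel_partial rho_kernel j) measurable_snd).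
apply: measurable_funM.
  exact: (measurableT_comp (measurable_coord 0 j) (measurable_delta l mv)).
by apply: measurable_funX; apply: measurable_enorm; exact: measurable_delta.
Qed.

Lemma measurable_flux_DR (v : V -> V) (l : R) : measurable_fun setT v ->
  measurable_fun setT (flux_DR rho v l).
Proof.
move=> mv.
have -> : flux_DR rho v l = fun x => \int[lam]_z flux_integrand v l x z.
  by apply/funext => x; exact: flux_DRE.
exact: (@measurable_Rintegral R _ _ V V lam (fun p => flux_integrand v l p.1 p.2)
  (measurable_flux_integrand l mv)).
Qed.

Let delta_le (v : V -> V) (M l : R) (x z : V) i : (forall y i, `|v y 0 i| <= M) ->
  `|delta v l x z 0 i| <= 2 * M.
Proof.
move=> vM; rewrite /delta !mxE; apply: le_trans (ler_normB _ _) _.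
by rewrite mulr_natl mulr2n lerD.
Qed.

Let integrable_flux (v : V -> V) (M l : R) (x : V) : 0 < l -> 0 <= M ->
  measurable_fun setT v -> (forall y i, `|v y 0 i| <= M) ->
  lam.-integrable setT (EFin \o flux_integrand v l x).
Proof.
move=> l0 M0 mv vM.
apply: (@bounded_support_integrable _ _ _
  (\sum_(j < d) ((4 * l)^-1 * (C * ((2 * M) * (d%:R * (2 * M) ^+ 2))))) 1).
- exact: (measurableT_comp (measurable_flux_integrand l mv) (pair1_measurable x)).
- move=> z; apply: le_trans (ler_norm_sum _ _ _) _; apply: ler_sum => j _.
  have li : 0 <= (4 * l)^-1 by rewrite invr_ge0 mulr_ge0// ltW.
  rewrite normrM ger0_norm// ler_wpM2l// normrM ler_pM// normrM ler_pM//.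
    exact: delta_le.
  rewrite ger0_norm ?sqr_ge0// enorm_rV_sq.
  rewrite mulr_natl -[X in _ *+ X]card_ord -sumr_const; apply: ler_sum => i _.
  rewrite -(@real_normK _ (delta v l x z 0 i)) ?num_real//.
  by rewrite lerXn2r ?nnegrE ?mulr_ge0//; exact: delta_le.
- move=> z fz; apply: le_trans (norm_le_enorm _) _; rewrite leNgt.
  apply: contraNN fz => /ltW z1; apply/eqP; apply: big1 => j _.
  by rewrite (kernel_partial_eq0 rho_kernel j z1) mul0r mulr0.
Qed.

Lemma flux_DR_diff (v w : V -> V) (M l : R) (x : V) : 0 < l -> 0 <= M ->
  measurable_fun setT v -> measurable_fun setT w ->
  (forall y i, `|v y 0 i| <= M) -> (forall y i, `|w y 0 i| <= M) ->
  (`|flux_DR rho v l x - flux_DR rho w l x|%:E <=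
   \int[lam]_(z in B) (d%:R * ((4 * l)^-1 * (C * (d%:R * (2 * M) ^+ 2 + 8 * M ^+ 2))) *
     \sum_i `|delta v l x z 0 i - delta w l x z 0 i|)%:E)%E.
Proof.
move=> l0 M0 mv mw vM wM; rewrite !flux_DRE -RintegralB//; last 2 first.
- exact: (integrable_flux x l0 M0 mv vM).
- exact: (integrable_flux x l0 M0 mw wM).
apply: le_trans (abs_Rintegral_le _ _ _) _.
apply: integral_supported_le => [z z1|z].
  rewrite !big1 ?subrr// => j _.
    by rewrite (kernel_partial_eq0 rho_kernel j z1) mul0r mulr0.
  by rewrite (kernel_partial_eq0 rho_kernel j z1) mul0r mulr0.
rewrite -sumrB; apply: le_trans (ler_norm_sum _ _ _) _.
have li : 0 <= (4 * l)^-1 by rewrite invr_ge0 mulr_ge0// ltW.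
rewrite -(mulrA d%:R) [leRHS]mulr_natl -[X in _ <= _ *+ X]card_ord -[leRHS]sumr_const.
apply: ler_sum => j _; rewrite -!mulrA.
rewrite -mulrBr normrM ger0_norm// ler_wpM2l// -mulrBr normrM ler_pM//.
by apply: cubic_diff => // i; exact: delta_le.
Qed.

(** For fixed [l] the flux is Lipschitz in L^1 on uniformly bounded fields, and mollifications
    converge in L^1. The constant grows like [1 / l], which is harmless as only [eps] moves. *)
Lemma flux_DR_mollify_cvg (v : V -> V) (M l e : R) (K : set V) : 0 < l -> 0 < e ->
  measurable K -> measurable_fun setT v ->
  (forall i, lam.-integrable setT (EFin \o (fun y => v y 0 i))) ->
  (forall y i, `|v y 0 i| <= M) -> 0 <= M -> \forall eps \near 0^'+,
  (\int[lam]_(x in K) `|flux_DR rho v l x -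
     flux_DR rho (mollify rho eps v) l x|%:E <= e%:E)%E.
Proof.
move=> l0 e0 mK mv intv vM M0.
(* A common bound for [v] and all its mollifications. *)
pose M2 := M + C * (M * vol_B).
have M20 : 0 <= M2 by rewrite addr_ge0// !mulr_ge0// vol_B_ge0.
pose Kc := d%:R * ((4 * l)^-1 * (C * (d%:R * (2 * M2) ^+ 2 + 8 * M2 ^+ 2))).
have Kc0 : 0 <= Kc.
  by rewrite !mulr_ge0 ?invr_ge0 ?mulr_ge0 ?addr_ge0 ?mulr_ge0 ?exprn_ge0 ?mulr_ge0// ltW.
(* The [2] counts the two values in an increment, [d] its components, [vol_B] the integral over [z];
   the [+ 1] avoids division by zero. *)
pose D := Kc * (2 * vol_B * d%:R) + 1.
have vB0 := vol_B_ge0.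
have D0 : 0 < D by rewrite ltr_wpDl// mulr_ge0// mulr_ge0// mulr_ge0.
have e1 : 0 < e / D by rewrite divr_gt0.
have Hi i : \forall eps \near 0^'+,
    (\int[lam]_x `|conv rho eps (fun y => v y 0 i) x - v x 0 i|%:E <= (e / D)%:E)%E.
  exact: conv_cvg_L1.
have H : \forall eps \near 0^'+, forall i : 'I_d,
    (\int[lam]_x `|conv rho eps (fun y => v y 0 i) x - v x 0 i|%:E <= (e / D)%:E)%E.
  exact: (@filter_forall R 'I_d (fun i eps => (\int[lam]_x
    `|conv rho eps (fun y => v y 0 i) x - v x 0 i|%:E <= (e / D)%:E)%E) _ _ Hi).
have eps0 : \forall eps \near (0 : R)^'+, 0 < eps by exact: nbhs_right_gt.
apply: filterS2 eps0 H => eps eps0 H.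
set w := mollify rho eps v.
have wE y i : w y 0 i = conv rho eps (fun y => v y 0 i) y by rewrite /w mollifyE.
have mvi i : measurable_fun setT (fun y => v y 0 i).
  exact: (measurableT_comp (measurable_coord 0 i) mv).
have mw : measurable_fun setT w.
  apply: measurable_fun_coordP => i j; rewrite ord1.
  under eq_fun do rewrite wE.
  by apply: measurable_conv => //; exact: mvi.
have wM y i : `|w y 0 i| <= M2.
  rewrite wE; apply: le_trans (conv_bounded mrho rhoC rho0 _ _ _ (fun y => vM y i)) _ => //.
  by rewrite lerDr.
have vM2 y i : `|v y 0 i| <= M2.
  by apply: le_trans (vM _ _) _; rewrite lerDl !mulr_ge0// vol_B_ge0.
pose Q (x : V) := \sum_i `|w x 0 i - v x 0 i|.
have Q0 x : 0 <= Q x by exact: sumr_ge0.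
have mQ : measurable_fun setT Q.
  apply: measurable_sum => i; apply: measurableT_comp => //.
  apply: measurable_funB => //.
  exact: (measurableT_comp (measurable_coord 0 i) mw).
have IQ : (\int[lam]_x (Q x)%:E <= (d%:R * (e / D))%:E)%E.
  under eq_integral do rewrite /Q -sumEFin.
  rewrite ge0_integral_sum//; last first.
    move=> i; apply/measurable_EFinP; apply: measurableT_comp => //.
    apply: measurable_funB => //.
    exact: (measurableT_comp (measurable_coord 0 i) mw).
  apply: (@le_trans _ _ (\sum_(i < d) (e / D)%:E)%E).
    by apply: lee_sum => i _; under eq_integral do rewrite wE; exact: H.
  by rewrite sumEFin sumr_const card_ord mulr_natl.
have mQ2 : measurable_fun setT (fun p : V * V => (Q (p.1 + l *: p.2) + Q p.1)%:E).
  apply/measurable_EFinP; apply: measurable_funD; first exact: measurable_shift2.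
  exact: measurableT_comp.
have mB : measurable B := measurable_unit_ball.
apply: (@le_trans _ _ (\int[lam]_x \int[lam]_(z in B)
    (Kc%:E * (Q (x + l *: z) + Q x)%:E))%E).
  apply: (@le_trans _ _ (\int[lam]_x `|flux_DR rho v l x - flux_DR rho w l x|%:E)%E).
    exact: subset_lower_integral.
  apply: le_lower_integral => // x _.
  apply: le_trans (flux_DR_diff x l0 M20 mv mw vM2 wM) _.
  apply: le_lower_integral => z _.
    by rewrite lee_fin mulr_ge0// sumr_ge0.
  rewrite -EFinM lee_fin ler_wpM2l// /Q -big_split; apply: ler_sum => i _ /=.
  have -> : delta v l x z 0 i - delta w l x z 0 i =
      - (w (x + l *: z) 0 i - v (x + l *: z) 0 i) + (w x 0 i - v x 0 i).
    by rewrite /delta !mxE; ring.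
  by rewrite (le_trans (ler_normD _ _))// normrN.
rewrite (tonelli_set lam lam measurableT mB
  (g := fun p : V * V => (Kc%:E * (Q (p.1 + l *: p.2) + Q p.1)%:E)%E)); first last.
- by move=> p; rewrite mule_ge0 ?lee_fin ?addr_ge0.
- exact: emeasurable_funM.
apply: (@le_trans _ _ (\int[lam]_(z in B) cst (Kc%:E * (2 * (d%:R * (e / D)))%:E) z)%E).
  apply: le_lower_integral => z _.
    by apply: integral_ge0 => x _; rewrite mule_ge0 ?lee_fin ?addr_ge0.
  have m1 : measurable_fun setT (fun x : V => (Q (x + l *: z))%:E).
    apply/measurable_EFinP.
    exact: (measurableT_comp (measurable_shift2 l mQ) (pair2_measurable z)).
  have m2 : measurable_fun setT (fun x : V => (Q x)%:E) by apply/measurable_EFinP.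
  under eq_integral do rewrite EFinD.
  rewrite ge0_integralZl//; first last.
  - by move=> x _; rewrite adde_ge0 ?lee_fin.
  - exact: emeasurable_funD.
  rewrite lee_wpmul2l ?lee_fin// ge0_integralD//=; last 2 first.
  - by move=> x _; rewrite lee_fin.
  - by move=> x _; rewrite lee_fin.
  rewrite (@ge0_integral_shift _ _ (l *: z) (fun x => (Q x)%:E))//.
  by rewrite mulr_natl mulr2n EFinD leeD.
rewrite -EFinM integral_cst_B lee_fin.
rewrite (_ : _ * vol_B = e * (Kc * (2 * vol_B * d%:R) / D)); last by ring.
rewrite ler_piMr ?(ltW e0)// ler_pdivrMr// mul1r /D.
by rewrite lerDl.
Qed.

(** A bound on the mollified fields that is uniform in [eps] passes to the field itself; the
    estimates for smooth fields are needed only there. *)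
Lemma flux_DR_mollify_le (v : V -> V) (M l dl : R) (K : set V) (X : \bar R) :
  0 < l -> 0 < dl -> measurable K -> measurable_fun setT v ->
  (forall i, lam.-integrable setT (EFin \o (fun y => v y 0 i))) ->
  (forall y i, `|v y 0 i| <= M) -> 0 <= M ->
  (forall eps, 0 < eps < dl ->
    (\int[lam]_(x in K) `|flux_DR rho (mollify rho eps v) l x|%:E <= X)%E) ->
  (\int[lam]_(x in K) `|flux_DR rho v l x|%:E <= X)%E.
Proof.
move=> l0 dl0 mK mv intv vM M0 HX.
apply/lee_addgt0Pr => e e0.
have eps0 : \forall eps \near (0 : R)^'+, 0 < eps by exact: nbhs_right_gt.
have epsl : \forall eps \near (0 : R)^'+, eps < dl by exact: nbhs_right_lt.
near (0 : R)^'+ => eps.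
have eps1 : 0 < eps < dl.
  by apply/andP; split; near: eps.
have cvg : (\int[lam]_(x in K) `|flux_DR rho v l x -
     flux_DR rho (mollify rho eps v) l x|%:E <= e%:E)%E.
  near: eps; exact: (flux_DR_mollify_cvg l0 e0 mK mv intv vM M0).
have mw : measurable_fun setT (mollify rho eps v).
  apply: measurable_fun_coordP => i j; rewrite ord1.
  under eq_fun do rewrite mollifyE.
  apply: measurable_conv => //.
  exact: (measurableT_comp (measurable_coord 0 j) mv).
have m1 := measurable_flux_DR l mv.
have m2 := measurable_flux_DR l mw.
apply: le_trans (leeD (HX _ eps1) cvg).
rewrite -ge0_integralD//; last 2 first.
- apply/measurable_EFinP; apply: measurableT_comp => //.
  by apply: measurable_funTS.
- apply/measurable_EFinP; apply: measurableT_comp => //.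
  by apply: measurable_funTS; exact: measurable_funB.
apply: le_lower_integral => // x _; rewrite -EFinD lee_fin.
rewrite -[in leLHS](subrK (flux_DR rho (mollify rho eps v) l x) (flux_DR rho v l x)).
by rewrite addrC; exact: ler_normD.
Unshelve. all: end_near. Qed.

End mollified_flux.

(** * The Constantin-E-Titi defect *)

Lemma sume_const_ord {R : realType} (n : nat) (y : \bar R) :
  (\sum_(i < n) y = n%:R%:E * y)%E.
Proof.
by rewrite mule_natl big_const_ord; elim: n => // n IH; rewrite iterS IH muleS.
Qed.

Section constantin_e_titi.
Context {R : realType} {d : nat}.
Local Notation V := 'rV[R]_d.
Local Notation lam := (@lebesgue_rV R d).
Local Notation B := (@unit_ball R d).
Local Notation vB := (@vol_B R d).

Variable rho : V -> R.
Hypothesis rho_kernel : mollifier_kernel rho.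
Variable C : R.
Hypothesis C_gt0 : 0 < C.
Hypothesis rhoC : forall z, `|rho z| <= C.
Hypothesis rhoC' : forall j z, `|partial j rho z| <= C.

Let C_ge0 : 0 <= C. Proof. exact: ltW. Qed.
Let mrho := measurable_kernel rho_kernel.
Let rho0 := kernel_eq0 rho_kernel.
Let mB : measurable B. Proof. exact: measurable_unit_ball. Qed.

Lemma RintegralZl_gt0 (k : R) (f : V -> R) : 0 < k -> measurable_fun setT f ->
  \int[lam]_x (k * f x) = k * \int[lam]_x f x.
Proof.
move=> k0 mf.
have mp : measurable_fun setT (fun x => maxe (f x)%:E 0%E).
  by apply: measurable_maxe => //; exact/measurable_EFinP.
have mn : measurable_fun setT (fun x => maxe (- (f x)%:E)%E 0%E).
  apply: measurable_maxe => //; apply: measurableT_comp => //.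
  exact/measurable_EFinP.
rewrite /Rintegral integralE [in RHS]integralE.
have Ep x : ((fun x => (k * f x)%:E)^\+ x = k%:E * maxe (f x)%:E 0)%E.
  by rewrite funeposE maxe_pMr ?lee_fin ?ltW// mule0 EFinM.
have En x : ((fun x => (k * f x)%:E)^\- x = k%:E * maxe (- (f x)%:E) 0)%E.
  by rewrite funenegE maxe_pMr ?lee_fin ?ltW// mule0 muleN EFinM.
under eq_integral do rewrite Ep.
under [X in fine (_ - X)%E]eq_integral do rewrite En.
under [X in _ = _ * fine (X - _)%E]eq_integral do rewrite funeposE.
under [X in _ = _ * fine (_ - X)%E]eq_integral do rewrite funenegE.
have p0 x : (0 <= maxe (f x)%:E 0)%E by rewrite le_max lexx orbT.
have n0 x : (0 <= maxe (- (f x)%:E) 0)%E by rewrite le_max lexx orbT.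
rewrite ge0_integralZl//; last by rewrite lee_fin ltW.
rewrite ge0_integralZl//; last by rewrite lee_fin ltW.
have := integral_ge0 lam (D := setT) (fun x _ => p0 x).
have := integral_ge0 lam (D := setT) (fun x _ => n0 x).
set A := (\int[_]_x maxe (f _)%:E _)%E; set A' := (\int[_]_x maxe (- _) _)%E.
case: A => [a| |]; case: A' => [b| |] //= _ _.
- by rewrite mulrBr.
- by rewrite gt0_muley ?lte_fin//= mulr0.
- by rewrite gt0_muley ?lte_fin//= mulr0.
- by rewrite gt0_muley ?lte_fin//= mulr0.
Qed.

(** As [convE], but for functions that are only measurable, because the products [v_i v_j] need not
    be integrable; an integral with an infinite part is [0] on both sides. *)
Lemma conv_measurableE (l : R) (f : V -> R) (x : V) : 0 < l ->
  measurable_fun setT f ->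
  conv rho l f x = \int[lam]_z (f (x + l *: z) * rho z).
Proof.
move=> l0 mf; pose h y := f y * rho (- l^-1 *: y + l^-1 *: x).
have mh : measurable_fun setT h.
  apply: measurable_funM => //; apply: (measurableT_comp mrho).
  exact: measurable_affine.
have -> : \int[lam]_z (f (x + l *: z) * rho z) = \int[lam]_z h (l *: z + x).
  apply: eq_Rintegral => z _; rewrite /h addrC; congr (_ * _).
  rewrite !scaleNr scalerDr opprD -addrA addNr addr0 scalerA.
  by rewrite mulVf ?gt_eqF// scale1r kernel_even.
rewrite Rintegral_affine ?gt_eqF// /conv -RintegralZl_gt0//; last first.
  by rewrite gtr0_norm// invr_gt0 exprn_gt0.
apply: eq_Rintegral => y _; rewrite /rescale /h gtr0_norm// mulrCA.
by rewrite scalerBr scaleNr addrC.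
Qed.

Definition flux_CET (v : V -> V) (l : R) (x : V) : R :=
  D_CET rho (fun y _ => v y) l x 0.

Definition reynolds (v : V -> V) (l : R) (x : V) i j : R :=
  conv rho l (fun y => v y 0 i) x * conv rho l (fun y => v y 0 j) x -
  conv rho l (fun y => v y 0 i * v y 0 j) x.

Lemma flux_CETE_grad (v : V -> V) (l : R) (x : V) : flux_CET v l x =
  \sum_i \sum_j (reynolds v l x i j *
                 partial j (conv rho l (fun y => v y 0 i)) x).
Proof.
apply: eq_bigr => i _; apply: eq_bigr => j _; rewrite !mxE; congr (_ * _).
  rewrite big_ord1 !mxE; congr (_ - _); rewrite /conv.
  by apply: eq_Rintegral => y _; rewrite !mxE big_ord1 !mxE.
by congr (partial j _ x); apply/funext => y; rewrite mollifyE.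
Qed.

Lemma reynoldsC (v : V -> V) (l : R) (x : V) i j :
  reynolds v l x i j = reynolds v l x j i.
Proof.
rewrite /reynolds mulrC; congr (_ - conv _ _ _ _).
by apply/funext => y; rewrite mulrC.
Qed.

Lemma flux_CETE (v : V -> V) (l : R) (x : V) : flux_CET v l x =
  \sum_i \sum_j (reynolds v l x i j * symconv rho l v i j x).
Proof.
rewrite flux_CETE_grad; apply: (mulfI (x := 2)) => //.
rewrite [LHS]mulr_natl mulr2n {1}exchange_big -big_split mulr_sumr/=.
apply: eq_bigr => i _; rewrite -big_split mulr_sumr/=.
apply: eq_bigr => j _; rewrite reynoldsC -mulrDr mulrCA /symconv; congr (_ * _).
by rewrite mulrA mulfV// mul1r addrC.
Qed.

Lemma measurable_along_sub (v : V -> V) (l : R) (x c : V) :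
  measurable_fun setT v -> measurable_fun setT (fun z : V => v (x + l *: z) - c).
Proof.
move=> mv; apply: measurable_fun_coordP => i j; under eq_fun do rewrite !mxE.
apply: measurable_funB => //.
apply: (measurable_along (f := fun y => v y i j)).
exact: (measurableT_comp (measurable_coord i j) mv).
Qed.

(** Write [v = c + b]. As [rho] has integral [1], every term containing [c] cancels and
    [a_i a_j - m] remains, with the averages [a] of [b] and [m] of [b_i b_j]. The latter gives the
    summand [C], the product of the former [2 C^2 vB]. *)
Lemma reynolds_le (v : V -> V) (l : R) (x c : V) i j : 0 < l ->
  measurable_fun setT v ->
  (`|reynolds v l x i j|%:E <= (2 * C ^+ 2 * vB + C)%:E *
     \int[lam]_(z in B) (enorm (v (x + l *: z) - c)%R ^+ 2)%:E)%E.
Proof.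
move=> l0 mv; set I := (\int[lam]_(z in B) _)%E.
have K0 : 0 < 2 * C ^+ 2 * vB + C.
  by rewrite ltr_wpDl// !mulr_ge0 ?(@vol_B_ge0 R d) ?exprn_ge0.
have I0 : (0 <= I)%E by apply: integral_ge0 => z _; rewrite lee_fin sqr_ge0.
(* An infinite [I] makes the right-hand side infinite. Otherwise [b] and [b_i b_j], weighted by
   [rho], are integrable and the averages may be expanded. *)
have [Iy|Iy] := eqVneq I +oo%E.
  by rewrite Iy gt0_muley ?lte_fin// leey.
have If : (I < +oo)%E by rewrite ltey.
pose b i (z : V) := v (x + l *: z) 0 i - c 0 i.
have mvc := measurable_along_sub l x c mv.
have bE i' z : b i' z = (v (x + l *: z) - c) 0 i' by rewrite !mxE.
have mb i' : measurable_fun setT (b i').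
  rewrite (_ : b i' = (fun M : 'rV[R]_d => M 0 i') \o (fun z => v (x + l *: z) - c)).
    exact: (measurableT_comp (measurable_coord 0 i') mvc).
  by apply/funext => z; exact: bE.
have me : measurable_fun setT (fun z : V => enorm (v (x + l *: z) - c)).
  exact: measurable_enorm.
pose e (z : V) := enorm (v (x + l *: z) - c).
have e0 z : 0 <= e z by exact: enorm_ge0.
have be i' z : `|b i' z| <= e z by rewrite bE; exact: coord_le_enorm.
have intw (g : V -> R) : measurable_fun setT g ->
    (forall z, `|g z| <= 1 + e z ^+ 2) -> lam.-integrable setT (EFin \o (fun z => g z * rho z)).
  move=> mg ge; apply/integrableP; split.
    by apply/measurable_EFinP; exact: measurable_funM.
  apply: le_lt_trans (kernel_weight_le rhoC rho0 mg) _.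
  rewrite lte_mul_pinfty ?lee_fin//.
  apply: (@le_lt_trans _ _ (\int[lam]_(z in B) (1 + (e z ^+ 2)%:E))%E).
    by apply: le_lower_integral => z _; rewrite -?EFinD lee_fin.
  rewrite ge0_integralD//; last 2 first.
  - by move=> z _; rewrite lee_fin sqr_ge0.
  - by apply/measurable_EFinP; apply: measurable_funX; exact: measurable_funTS.
  rewrite lte_add_pinfty//.
  have -> : (\int[lam]_(z in B) 1 = vB%:E)%E.
    by rewrite (integral_cst_B 1) mul1r.
  by rewrite ltry.
have int1 i' : lam.-integrable setT (EFin \o (fun z => b i' z * rho z)).
  apply: intw => // z; have := be i' z; have := sqr_ge0 (e z - 1); have := e0 z; nra.
have int2 : lam.-integrable setT (EFin \o (fun z => b i z * b j z * rho z)).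
  apply: intw => [|z]; first exact: measurable_funM.
  rewrite normrM; have := be i z; have := be j z.
  have := normr_ge0 (b i z); have := normr_ge0 (b j z); nra.
have intr := integrable_kernel rho_kernel rhoC.
pose a i' := \int[lam]_z (b i' z * rho z).
pose m := \int[lam]_z (b i z * b j z * rho z).
have convi i' : conv rho l (fun y => v y 0 i') x = a i' + c 0 i'.
  rewrite conv_measurableE//; last exact: (measurableT_comp (measurable_coord 0 i') mv).
  have -> : \int[lam]_z (v (x + l *: z) 0 i' * rho z) =
      \int[lam]_z (b i' z * rho z + c 0 i' * rho z).
    by apply: eq_Rintegral => z _; rewrite /b; ring.
  rewrite RintegralD//; last exact: (integrableZl measurableT _ intr).
  by rewrite (RintegralZl (c 0 i') measurableT intr) (kernel_integral rho_kernel) mulr1.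
have convij : conv rho l (fun y => v y 0 i * v y 0 j) x =
    m + (c 0 i * a j + (c 0 j * a i + c 0 i * c 0 j)).
  rewrite conv_measurableE//; last first.
    by apply: measurable_funM; exact: (measurableT_comp (measurable_coord 0 _) mv).
  have -> : \int[lam]_z (v (x + l *: z) 0 i * v (x + l *: z) 0 j * rho z) =
      \int[lam]_z (b i z * b j z * rho z + (c 0 i * (b j z * rho z) +
        (c 0 j * (b i z * rho z) + c 0 i * c 0 j * rho z))).
    by apply: eq_Rintegral => z _; rewrite /b; ring.
  have i3 : lam.-integrable setT (EFin \o (fun z => c 0 i * c 0 j * rho z)).
    exact: (integrableZl measurableT _ intr).
  have i4 k n : lam.-integrable setT (EFin \o (fun z => c 0 k * (b n z * rho z))).
    exact: (integrableZl measurableT _ (int1 n)).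
  have i5 : lam.-integrable setT (EFin \o (fun z => c 0 j * (b i z * rho z) + c 0 i * c 0 j * rho z)).
    by have := integrableD measurableT (i4 j i) i3; apply: eq_integrable.
  have i6 : lam.-integrable setT (EFin \o (fun z => c 0 i * (b j z * rho z) +
      (c 0 j * (b i z * rho z) + c 0 i * c 0 j * rho z))).
    by have := integrableD measurableT (i4 i j) i5; apply: eq_integrable.
  rewrite RintegralD// RintegralD// RintegralD//.
  rewrite (RintegralZl (c 0 i) measurableT (int1 j)).
  rewrite (RintegralZl (c 0 j) measurableT (int1 i)).
  by rewrite (RintegralZl (c 0 i * c 0 j) measurableT intr) (kernel_integral rho_kernel) mulr1.
have -> : reynolds v l x i j = a i * a j - m.
  by rewrite /reynolds !convi convij; ring.
have aI i' : (`|a i'|%:E <= C%:E * \int[lam]_(z in B) `|b i' z|%:E)%E.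
  by apply: le_trans (abs_Rintegral_le _ _ _) _; exact: (kernel_weight_le rhoC rho0).
have mI : (`|m|%:E <= C%:E * I)%E.
  apply: le_trans (abs_Rintegral_le _ _ _) _.
  apply: le_trans (kernel_weight_le rhoC rho0 (g := fun z => b i z * b j z) _) _.
    exact: measurable_funM.
  rewrite lee_wpmul2l ?lee_fin//; apply: le_lower_integral => // z _.
  by rewrite lee_fin normrM expr2 ler_pM.
have aaI : (`|a i * a j|%:E <= (2 * C ^+ 2 * vB)%:E * I)%E.
  rewrite normrM EFinM; apply: le_trans (lee_pmul _ _ (aI i) (aI j)) _ => //.
  rewrite muleACA -EFinM -expr2.
  have mbn i' : measurable_fun B (fun z => `|b i' z|).
    by apply: measurable_funTS; exact: measurableT_comp.
  have me2 : measurable_fun B (fun z => e z ^+ 2).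
    by apply: measurable_funTS; exact: (measurable_funX 2 me).
  have := @integral_mul_le R _ _ lam B mB (fun z => `|b i z|) (fun z => `|b j z|)
    (fun z => e z ^+ 2) (mbn i) (mbn j) me2.
  move=> H; have {}H := H (fun z => normr_ge0 _) (fun z => normr_ge0 _) (fun z => sqr_ge0 _) _.
  apply: le_trans (lee_wpmul2l _ (H _)) _.
  - by rewrite lee_fin exprn_ge0.
  - move=> y z; apply: (@le_trans _ _ (e y * e z)); first exact: ler_pM.
    by have := sqr_ge0 (e y - e z); have := sqr_ge0 (e y + e z); nra.
  - rewrite [X in (2 * (X * _))%E](_ : _ = vB%:E)%E; last exact: vol_BE.
    rewrite -/I !muleA -!EFinM.
    by rewrite (mulrC (C ^+ 2)).
rewrite EFinD ge0_muleDl ?lee_fin// ?mulr_ge0 ?(@vol_B_ge0 R d) ?exprn_ge0//.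
apply: le_trans (leeD aaI mI); rewrite -EFinD lee_fin.
exact: ler_normB.
Qed.

Lemma integral_kernel_partial_opp j : \int[lam]_z partial j rho (- z) = 0.
Proof.
have mp := measurable_kernel_partial rho_kernel j.
have supp1 (z : V) : 1 < `|z| -> 1 <= enorm z.
  by move=> z1; exact: le_trans (ltW z1) (norm_le_enorm z).
under eq_Rintegral do rewrite -scaleN1r -[-1 *: _]addr0.
rewrite Rintegral_affine ?oppr_eq0//.
suff -> : \int[lam]_z partial j rho z = 0 by rewrite mulr0.
apply: (@integral_derivative0 R d rho _ 'e_j C 1) => //.
- by move=> z; apply: contraNT; rewrite -ltNge => /supp1/rho0 ->.
- by move=> z; exact: kernel_is_derive.
- move=> z; apply: contraNT; rewrite -ltNge => /supp1.
  by move=> /(kernel_partial_eq0 rho_kernel j) ->.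
Qed.

(** A partial derivative of [rho] has integral zero, so a constant may be subtracted from [f]; the
    rescaling produces [1 / l]. *)
Lemma partial_conv_le (l : R) (f : V -> R) (x : V) (c : R) j : 0 < l ->
  lam.-integrable setT (EFin \o f) ->
  (`|partial j (conv rho l f) x|%:E <= (C / l)%:E *
    \int[lam]_(z in B) `|f (x + l *: z) - c|%:E)%E.
Proof.
move=> l0 intf; have mp := measurable_kernel_partial rho_kernel j.
pose k (z : V) := partial j rho (- z).
have mk : measurable_fun setT k.
  apply: (measurableT_comp mp).
  rewrite (_ : -%R = (fun y : V => -1 *: y + 0)); first exact: measurable_affine.
  by apply/funext => y; rewrite scaleN1r addr0.
have kC z : `|k z| <= C by exact: rhoC'.
have k0 z : 1 <= enorm z -> k z = 0.
  move=> z1; apply: (kernel_partial_eq0 rho_kernel).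
  by rewrite -scaleN1r enormZ normrN normr1 mul1r.
have intk : lam.-integrable setT (EFin \o k).
  apply: (bounded_support_integrable (C := C) (r := 1) mk kC) => z.
  apply: contraNT; rewrite -ltNge => z1; rewrite k0//.
  exact: le_trans (ltW z1) (norm_le_enorm z).
have int1 : lam.-integrable setT (EFin \o (fun z => f (x + l *: z) * k z)).
  apply: (bounded_mul_integrable _ mk kC).
  by apply: integrable_affine; rewrite ?gt_eqF.
have int2 : lam.-integrable setT (EFin \o (fun z => c * k z)).
  exact: (integrableZl measurableT _ intk).
rewrite (partial_conv rho_kernel rhoC rhoC')//.
have -> : conv (partial j rho) l f x = \int[lam]_z ((f (x + l *: z) - c) * k z).
  rewrite (convE mp (rhoC' j))//.
  rewrite -[LHS]subr0 -[X in _ - X](mulr0 c) -(integral_kernel_partial_opp j).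
  rewrite -(RintegralZl c measurableT intk) -RintegralB//.
  by apply: eq_Rintegral => z _; rewrite mulrBl.
rewrite normrM gtr0_norm ?invr_gt0// EFinM (mulrC C) EFinM -muleA.
apply: lee_wpmul2l; first by rewrite lee_fin invr_ge0 ltW.
apply: le_trans (abs_Rintegral_le _ _ _) _.
apply: (kernel_weight_le kC k0 (g := fun z => f (x + l *: z) - c)).
apply: measurable_funB => //; apply: measurable_along.
by apply/measurable_EFinP; case/integrableP : intf.
Qed.

Let D : R := 2 * C ^+ 2 * vB + C.
Let D_ge0 : 0 <= D.
Proof. by rewrite addr_ge0 ?mulr_ge0 ?exprn_ge0 ?(@vol_B_ge0 R d). Qed.

Lemma flux_CET_le (v : V -> V) (l : R) (x c : V) : 0 < l ->
  measurable_fun setT v ->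
  (`|flux_CET v l x|%:E <= D%:E *
     (\int[lam]_(z in B) (enorm (v (x + l *: z) - c)%R ^+ 2)%:E *
      (\sum_i \sum_j `|symconv rho l v i j x|)%:E))%E.
Proof.
move=> l0 mv; rewrite flux_CETE; set I := (\int[lam]_(z in B) _)%E.
have I0 : (0 <= I)%E by apply: integral_ge0 => z _; rewrite lee_fin sqr_ge0.
apply: (@le_trans _ _ (\sum_i \sum_j
    (`|reynolds v l x i j|%:E * `|symconv rho l v i j x|%:E))%E).
  under [leRHS]eq_bigr do under eq_bigr do rewrite -EFinM.
  under [leRHS]eq_bigr do rewrite sumEFin.
  rewrite sumEFin lee_fin; apply: le_trans (ler_norm_sum _ _ _) _.
  apply: ler_sum => i _; apply: le_trans (ler_norm_sum _ _ _) _.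
  by apply: ler_sum => j _; rewrite normrM.
rewrite muleA -sumEFin ge0_sume_distrr => [|i _]; last first.
  by rewrite lee_fin; apply: sumr_ge0.
apply: lee_sum => i _; rewrite -sumEFin ge0_sume_distrr//.
apply: lee_sum => j _; apply: lee_wpmul2r; first by rewrite lee_fin.
exact: reynolds_le.
Qed.

(** With [c = v (x)] the tensor is quadratic and the gradient linear in the increments;
    [a^2 b <= a^3 + b^3] turns the product of the two averages into one average of cubes. *)
Lemma flux_CET_cubic_le (v : V -> V) (l : R) (x : V) : 0 < l ->
  measurable_fun setT v ->
  (forall i, lam.-integrable setT (fun y => (v y 0 i)%:E)) ->
  (`|flux_CET v l x|%:E <= (2 * d%:R ^+ 2 * D * C * vB / l)%:E *
     \int[lam]_(z in B) (enorm (delta v l x z) ^+ 3)%:E)%E.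
Proof.
move=> l0 mv intv; rewrite flux_CETE_grad; set J := (\int[lam]_(z in B) _)%E.
have me : measurable_fun setT (fun z => enorm (delta v l x z)).
  by apply: measurable_enorm; exact: measurable_delta1.
have mB1 : measurable_fun B (fun z => enorm (delta v l x z)) by exact: measurable_funTS.
have mB2 := measurable_funX 2 mB1.
have mB3 := measurable_funX 3 mB1.
pose I := (\int[lam]_(z in B) (enorm (delta v l x z) ^+ 2)%:E)%E.
have I0 : (0 <= I)%E by apply: integral_ge0 => z _; rewrite lee_fin sqr_ge0.
have J0 : (0 <= J)%E by apply: integral_ge0 => z _; rewrite lee_fin exprn_ge0// enorm_ge0.
have Cl0 : 0 <= C / l by rewrite divr_ge0// ltW.
pose N := (\int[lam]_(z in B) (enorm (delta v l x z))%:E)%E.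
have N0 : (0 <= N)%E by apply: integral_ge0 => z _; rewrite lee_fin enorm_ge0.
have IN : (I * N <= 2%:E * (vB%:E * J))%E.
  have := @integral_mul_le R _ _ lam B mB _ _ _ mB2 mB1 mB3.
  have e0 z := enorm_ge0 (delta v l x z).
  move=> H; have {}H := H (fun z => sqr_ge0 _) e0 (fun z => exprn_ge0 3 (e0 z)) _.
  have -> : (vB%:E = lam B)%E by rewrite vol_BE.
  apply: H => y z; have := e0 y; have := e0 z; set a := enorm _; set b := enorm _.
  move=> a0 b0; have [ab|/ltW ab] := leP a b.
    have : b ^+ 2 * a <= b ^+ 2 * b by rewrite ler_wpM2l ?sqr_ge0.
    by have := exprn_ge0 3 a0; rewrite [b ^+ 3]exprSr; lra.
  have : b ^+ 2 * a <= a ^+ 2 * a by rewrite ler_wpM2r// lerXn2r.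
  by have := exprn_ge0 3 b0; rewrite [a ^+ 3]exprSr; lra.
have P i j : (`|partial j (conv rho l (fun y => v y 0 i)) x|%:E <= (C / l)%:E * N)%E.
  apply: le_trans (partial_conv_le x (v x 0 i) j l0 (intv i)) _.
  apply: lee_wpmul2l; first by rewrite lee_fin.
  apply: le_lower_integral => // z _; rewrite lee_fin.
  have -> : v (x + l *: z) 0 i - v x 0 i = delta v l x z 0 i by rewrite !mxE.
  exact: coord_le_enorm.
have RI i j : (`|reynolds v l x i j|%:E <= D%:E * I)%E by exact: reynolds_le.
have T i j : (`|reynolds v l x i j|%:E *
      `|partial j (conv rho l (fun y => v y 0 i)) x|%:E <=
    (2 * D * C * vB / l)%:E * J)%E.
  apply: le_trans (lee_pmul _ _ (RI i j) (P i j)) _ => //.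
  rewrite muleACA -EFinM.
  apply: (@le_trans _ _ ((D * (C / l))%:E * (2%:E * (vB%:E * J)))%E).
    by apply: lee_wpmul2l => //; rewrite lee_fin mulr_ge0.
  rewrite !muleA -!EFinM.
  have -> : D * (C / l) * 2 * vB = 2 * D * C * vB / l by ring.
  by [].
apply: (@le_trans _ _ (\sum_(i < d) \sum_(j < d) ((2 * D * C * vB / l)%:E * J))%E).
  apply: (@le_trans _ _ (\sum_i \sum_j (`|reynolds v l x i j|%:E *
      `|partial j (conv rho l (fun y => v y 0 i)) x|%:E))%E); last first.
    by apply: lee_sum => i _; apply: lee_sum => j _; exact: T.
  under [leRHS]eq_bigr do under eq_bigr do rewrite -EFinM.
  under [leRHS]eq_bigr do rewrite sumEFin.
  rewrite sumEFin lee_fin; apply: le_trans (ler_norm_sum _ _ _) _.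
  apply: ler_sum => i _; apply: le_trans (ler_norm_sum _ _ _) _.
  by apply: ler_sum => j _; rewrite normrM.
have K0 : 0 <= 2 * D * C * vB / l.
  by rewrite divr_ge0 ?(ltW l0)// !mulr_ge0 ?(@vol_B_ge0 R d).
rewrite !sume_const_ord !muleA -!EFinM.
have -> : d%:R * d%:R * (2 * D * C * vB / l) = 2 * d%:R ^+ 2 * D * C * vB / l.
  by ring.
by [].
Qed.

End constantin_e_titi.

(** * The John-Nirenberg inequality *)

Section binary_tree.
Context {R : realType} {T : Type}.
Variables (l r : T -> T).
Implicit Types (n : nat) (b : T) (F G : T -> R).

(** The mean of [F] over the [2 ^ n] descendants of [b] at depth [n]. *)
Fixpoint tree_avg n F b : R :=
  if n is n'.+1 then (tree_avg n' F (l b) + tree_avg n' F (r b)) / 2 else F b.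

(** [m] is a martingale on a binary tree whose mean oscillation below every admissible node is at
    most [w]; later [m b] is the mean of a function over a dyadic box. *)
Variables (m : T -> R) (P : T -> Prop) (w : R).
Hypothesis mlr : forall b, P b -> m (l b) + m (r b) = 2 * m b.
Hypothesis Pl : forall b, P b -> P (l b).
Hypothesis Pr : forall b, P b -> P (r b).
Hypothesis w0 : 0 <= w.
Hypothesis osc : forall n b, P b -> tree_avg n (fun b' => `|m b' - m b|) b <= w.

Let A n c b := tree_avg n (fun b' => `|m b' - c|) b.
Let W n c b := tree_avg n (fun b' => (m b' - c) ^+ 2) b.

(** Jensen's inequality for the martingale. *)
Lemma tree_avg_norm_ge n c b : P b -> `|m b - c| <= A n c b.
Proof.
rewrite /A; elim: n b => [//|n IH] b Pb /=; have := mlr Pb.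
have := IH _ (Pl Pb); have := IH _ (Pr Pb).
set a1 := tree_avg _ _ _; set a2 := tree_avg _ _ _ => h1 h2 h.
have -> : m b - c = ((m (l b) - c) + (m (r b) - c)) / 2 by lra.
rewrite normrM (ger0_norm (x := 2^-1))//.
by have := ler_normD (m (l b) - c) (m (r b) - c); lra.
Qed.

Lemma tree_avg_sq_center n c a b : P b ->
  W n c b = W n a b + 2 * (a - c) * (m b - a) + (a - c) ^+ 2.
Proof.
rewrite /W; elim: n b => [|n IH] b Pb /=; first by ring.
rewrite (IH _ (Pl Pb)) (IH _ (Pr Pb)).
have -> : m b = (m (l b) + m (r b)) / 2 by have := mlr Pb; lra.
by field.
Qed.

(** The two children deviate from [m b] by opposite amounts, so the average deviation at depth one
    equals each of them. *)
Lemma tree_jump b : P b -> `|m (l b) - m b| <= w /\ `|m (r b) - m b| <= w.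
Proof.
move=> Pb; have := osc 1 Pb => /=.
have -> : m (r b) - m b = - (m (l b) - m b) by have := mlr Pb; lra.
by rewrite normrN; lra.
Qed.

(* A subtree is left as soon as its mean is further than [2 w] from [c]; there
   the mean square is at most [17 w^2 + (3 w)^2], the first absolute moment at
   least [2 w], whence the factor [13 w = 26 w^2 / (2 w)]. *)
Lemma tree_avg_sq_le n c b : P b -> `|m b - c| <= 2 * w ->
  W n c b <= 4 * w ^+ 2 + 13 * w * A n c b.
Proof.
elim: n c b => [|n IH] c b Pb h.
  rewrite /W /A /= -real_normK ?num_real//.
  have := normr_ge0 (m b - c); move: (`|_|) h => y; nra.
(* The induction hypothesis with [c = m b'], for which the first moment is at most [w]:
   [4 w^2 + 13 w^2]. *)
have IHm b' : P b' -> W n (m b') b' <= 17 * w ^+ 2.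
  move=> Pb'; have := IH (m b') b' Pb'; rewrite subrr normr0 => /(_ _).
  have := osc n Pb'; rewrite -/(A n (m b') b').
  move: (A _ _ _) (W _ _ _) => x y xw H; have {}H := H (mulr_ge0 (ler0n _ 2) w0).
  have : w * x <= w * w by rewrite ler_wpM2l.
  by move: H; rewrite expr2; lra.
have child b' : P b' -> `|m b' - m b| <= w ->
    W n c b' <= 4 * w ^+ 2 + 13 * w * A n c b'.
  move=> Pb' jump; have [h'|h'] := leP `|m b' - c| (2 * w); first exact: IH.
  have := tree_avg_norm_ge n c Pb'.
  rewrite (tree_avg_sq_center n c (m b') Pb'); have := IHm _ Pb'.
  have -> : 2 * (m b' - c) * (m b' - m b') = 0 by ring.
  have : `|m b' - c| <= 3 * w.
    have -> : m b' - c = (m b' - m b) + (m b - c) by ring.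
    by apply: le_trans (ler_normD _ _) _; lra.
  rewrite -(real_normK (num_real (m b' - c))).
  move: (A _ _ _) (W _ _ _) (`|m b' - c|) h' (normr_ge0 (m b' - c)) => x y z; nra.
rewrite /W /A /= -/(W n c (l b)) -/(W n c (r b)) -/(A n c (l b)) -/(A n c (r b)).
have [jl jr] := tree_jump Pb.
by have := child _ (Pl Pb) jl; have := child _ (Pr Pb) jr; lra.
Qed.

Lemma tree_avg_sq n b : P b ->
  tree_avg n (fun b' => (m b' - m b) ^+ 2) b <= 17 * w ^+ 2.
Proof.
move=> Pb; have := tree_avg_sq_le n (c := m b) Pb.
rewrite subrr normr0 /W /A => H; have {}H := H (mulr_ge0 (ler0n _ 2) w0).
move: H (osc n Pb); move: (tree_avg _ _ _) (tree_avg _ _ _) => x y H xw.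
have : w * x <= w * w by rewrite ler_wpM2l.
by move: H; rewrite expr2; lra.
Qed.

End binary_tree.

(** * Dyadic boxes, halved in one coordinate at a time *)

Section boxes.
Local Arguments lebesgue_rV {R n} : simpl never.
Context {R : realType} {d : nat}.
Local Notation D := d.+1.
Local Notation V := 'rV[R]_D.
Local Notation lam := (@lebesgue_rV R D).
Implicit Types (n : nat) (q : V) (i : 'I_D).

(** Starting from side [2], after [n] halvings each coordinate has been halved [n / D] or
    [n / D + 1] times, so all sides lie between [rad n / 2] and [rad n]. *)
Definition rad n : R := 2 / 2 ^+ (n %/ D).

(** The coordinates below [n mod D] have already been halved in the current round. *)
Definition side n i : R := 2 / 2 ^+ (n %/ D + (i < n %% D)%N).

Definition split_dir n : 'I_D := Ordinal (ltn_pmod n (ltn0Sn d)).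

(** Half-open, so that the two halves of a box are disjoint. *)
Definition box n q : set V := [set v | forall i, `[q 0 i, q 0 i + side n i[%classic (v 0 i)].

Definition box_vol n : R := \prod_i side n i.

Definition half n : V := side n.+1 (split_dir n) *: 'e_(split_dir n).

Lemma rad_gt0 n : 0 < rad n. Proof. by rewrite divr_gt0// exprn_gt0. Qed.

Lemma side_gt0 n i : 0 < side n i. Proof. by rewrite divr_gt0// exprn_gt0. Qed.

Lemma side_rad n i : rad n / 2 <= side n i <= rad n.
Proof.
rewrite /rad /side; case: (_ < _)%N; last first.
  by rewrite addn0 lexx andbT ler_pdivrMr// ler_peMr ?divr_ge0 ?exprn_ge0// ler1n.
rewrite addn1 exprSr invfM mulrA lexx/= ler_pdivrMr// ler_peMr ?divr_ge0 ?exprn_ge0//.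
by rewrite ler1n.
Qed.

Lemma side0 i : side 0 i = 2.
Proof. by rewrite /side div0n mod0n ltn0 addn0 expr0 divr1. Qed.

Lemma rad_le2 n : rad n <= 2.
Proof.
rewrite /rad ler_pdivrMr ?exprn_gt0// ler_peMr//.
by rewrite -natrX ler1n expn_gt0.
Qed.

Lemma sideS n i : side n.+1 i = if i == split_dir n then side n i / 2 else side n i.
Proof.
have nD := divn_eq n D; have rD := ltn_pmod n (ltn0Sn d).
set q := (n %/ D)%N in nD *; set r := (n %% D)%N in nD rD *.
have E : (n.+1 %/ D + (i < n.+1 %% D) = q + (i < r) + (i == split_dir n))%N.
  have -> : (i == split_dir n) = (i == r :> nat) by rewrite -val_eqE.
  have iD := ltn_ord i.
  have [rd|rd] := ltnP r.+1 D.
    have -> : (n.+1 %/ D)%N = q by rewrite nD -addnS divnMDl// divn_small ?addn0.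
    have -> : (n.+1 %% D)%N = r.+1 by rewrite nD -addnS modnMDl modn_small.
    by rewrite ltnS; case: (ltngtP i r); rewrite ?addn0.
  have rE : r.+1 = D by apply/eqP; rewrite eqn_leq rD rd.
  have -> : (n.+1 %/ D)%N = q.+1 by rewrite nD -addnS rE divnMDl// divnn addn1.
  have -> : (n.+1 %% D)%N = 0%N by rewrite nD -addnS rE modnMDl modnn.
  have : (i <= r)%N by rewrite -ltnS rE.
  by rewrite ltn0; case: (ltngtP i r); rewrite ?addn0 ?addn1.
rewrite /side E -/q -/r; case: eqP => _; last by rewrite addn0.
by rewrite addn1 exprSr invfM mulrA.
Qed.

Lemma box_vol_gt0 n : 0 < box_vol n.
Proof. by apply: prodr_gt0 => i _; exact: side_gt0. Qed.

Lemma box_volS n : box_vol n = 2 * box_vol n.+1.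
Proof.
rewrite /box_vol (bigD1 (split_dir n))//= [in RHS](bigD1 (split_dir n))//=.
rewrite mulrA sideS eqxx mulrCA divff// mulr1; congr (_ * _).
by apply: eq_bigr => i /negbTE ni; rewrite sideS ni.
Qed.

(** One coordinate at a time gives a binary tree, and the boxes still remain comparable with
    balls. *)
Lemma box_vol_ge n : (rad n / 2) ^+ D <= box_vol n.
Proof.
rewrite -[D in X in X <= _]card_ord -prodr_const; apply: ler_prod => i _.
by rewrite divr_ge0 ?(ltW (rad_gt0 n))//=; case/andP : (side_rad n i).
Qed.

Lemma measurable_box n q : measurable (box n q).
Proof.
have -> : box n q = \bigcap_(i in [set: 'I_D])
    ((fun v : V => v 0 i) @^-1` `[q 0 i, q 0 i + side n i[%classic).
  by apply/seteqP; split => [v h i _|v h i]; [exact: h|exact: (h i)].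
apply: fin_bigcap_measurable => // i _.
by rewrite -[X in measurable X]setTI; apply: measurable_coord => //.
Qed.

Lemma lebesgue_box n q : lam (box n q) = (box_vol n)%:E.
Proof.
rewrite (lebesgue_rV_box (A := fun i => `[q 0 i, q 0 i + side n i[%classic)).
  rewrite /box_vol -prodEFin; apply: eq_bigr => i _.
  rewrite lebesgue_measure_itv/= lte_fin ltrDl side_gt0 -EFinB.
  by rewrite addrAC subrr add0r.
by move=> i; exact: measurable_itv.
Qed.

Lemma box_split n q : box n q = box n.+1 q `|` box n.+1 (q + half n).
Proof.
have hE i : half n 0 i = if i == split_dir n then side n i / 2 else 0.
  rewrite /half !mxE eqxx/=; have [->|ne] := eqVneq i (split_dir n).
    by rewrite mulr1 sideS eqxx.
  by rewrite mulr0.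
apply/seteqP; split => [v h|v [] h i].
- have := h (split_dir n); rewrite /= in_itv/= => /andP[h1 h2].
  have [c|c] := ltP (v 0 (split_dir n)) (q 0 (split_dir n) + side n (split_dir n) / 2).
    left => i /=; rewrite in_itv/= sideS; case: eqP => [->|_]; first by rewrite h1.
    by have := h i; rewrite /= in_itv.
  right => i /=; rewrite in_itv/= sideS mxE hE; case: eqP => [->|_].
    by rewrite c/= -addrA -splitr.
  by rewrite addr0; have := h i; rewrite /= in_itv.
- have := h i; rewrite /= !in_itv/= sideS => /andP[-> h2]/=; apply: lt_le_trans h2 _.
  rewrite lerD2l; case: eqP => // _; rewrite ler_pdivrMr//.
  by have := side_gt0 n i; lra.
- have := h i; rewrite /= !in_itv/= sideS mxE hE; case: eqP => [_|_]; last by rewrite addr0.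
  have := side_gt0 n i; move=> s0 /andP[h1 h2]; apply/andP; split; lra.
Qed.

Lemma box_disjoint n q : [disjoint box n.+1 q & box n.+1 (q + half n)].
Proof.
apply/disj_setPS => v [/(_ (split_dir n))]; rewrite /= in_itv/= => /andP[_ h1].
move=> /(_ (split_dir n)); rewrite /= in_itv/= => /andP[h2 _].
by move: h2; rewrite /half !mxE !eqxx mulr1 leNgt h1.
Qed.

Lemma box_eball n q : box n q `<=` eball q (D.+1%:R * rad n).
Proof.
move=> v h; rewrite /eball/=; apply: le_lt_trans (enorm_le_sum _) _.
rewrite big_ord1; apply: (@le_lt_trans _ _ (\sum_(j < D) rad n)).
  apply: ler_sum => j _; rewrite !mxE; have := h j; rewrite /= in_itv/= => /andP[h1 h2].
  have /andP[_ h3] := side_rad n j; rewrite ger0_norm ?subr_ge0//.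
  by rewrite lerBlDl; apply: le_trans (ltW h2) _; rewrite lerD2l.
by rewrite sumr_const card_ord -[ltLHS]mulr_natl ltr_pM2r ?rad_gt0// ltr_nat.
Qed.

Lemma box_ball n q x y : box n q x -> box n q y -> ball (0 : V) (2 * rad n) (y - x).
Proof.
move=> hx hy; rewrite -ball_normE/= sub0r normrN.
apply: (@le_lt_trans _ _ (rad n)); last by have := rad_gt0 n; lra.
rewrite rV_norm_le ?(ltW (rad_gt0 n))// => j; rewrite !mxE.
have := hx j; have := hy j; rewrite /= !in_itv/= => /andP[a1 a2] /andP[b1 b2].
have /andP[_ h3] := side_rad n j.
by rewrite ler_norml; apply/andP; split; lra.
Qed.

Definition in_cube (b : nat * V) : Prop :=
  forall i, -1 <= b.2 0 i /\ b.2 0 i + side b.1 i <= 1.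

Lemma in_cube_l b : in_cube b -> in_cube (b.1.+1, b.2).
Proof.
move=> h i; have [h1 h2] := h i; split => //=; rewrite sideS; case: eqP => // _.
by have := side_gt0 b.1 i; lra.
Qed.

Lemma in_cube_r b : in_cube b -> in_cube (b.1.+1, b.2 + half b.1).
Proof.
move=> h i; have [h1 h2] := h i; rewrite /half !mxE eqxx/=; have s0 := side_gt0 b.1 i.
rewrite !sideS eqxx; have [E|ne] := eqVneq i (split_dir b.1); last first.
  by rewrite mulr0 addr0.
by rewrite -E mulr1; split; lra.
Qed.

End boxes.

(** * From the tree to functions of bounded mean oscillation *)

Section john_nirenberg.
Local Arguments lebesgue_rV {R n} : simpl never.
Context {R : realType} {d : nat}.
Local Notation D := d.+1.
Local Notation V := 'rV[R]_D.
Local Notation lam := (@lebesgue_rV R D).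
Local Notation node := (nat * V)%type.
Local Notation bvol := (@box_vol R d).
Local Notation rd := (@rad R d).

Variable f : V -> R.
Hypothesis intf : lam.-integrable setT (EFin \o f).

Let mf : measurable_fun setT f.
Proof. by apply/measurable_EFinP; case/integrableP : intf. Qed.

Let bx (b : node) : set V := box b.1 b.2.
Let vol (b : node) : R := bvol b.1.
Let l (b : node) : node := (b.1.+1, b.2).
Let r (b : node) : node := (b.1.+1, b.2 + half b.1).
Let m (b : node) : R := (vol b)^-1 * \int[lam]_(x in bx b) f x.

Let mbx b : measurable (bx b). Proof. exact: measurable_box. Qed.
Let vol0 b : 0 < vol b. Proof. exact: box_vol_gt0. Qed.
Let lamb b : lam (bx b) = (vol b)%:E. Proof. exact: lebesgue_box. Qed.
Let bxS b : bx b = bx (l b) `|` bx (r b). Proof. exact: box_split. Qed.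
Let bxD b : [disjoint bx (l b) & bx (r b)]. Proof. exact: box_disjoint. Qed.
Let volS b : vol b = 2 * vol (l b). Proof. exact: box_volS. Qed.

Let intb (b : node) : lam.-integrable (bx b) (EFin \o f).
Proof. exact: integrableS intf. Qed.

Let integral_node (g : V -> \bar R) (b : node) : measurable_fun setT g ->
  (forall x, 0 <= g x)%E ->
  (\int[lam]_(x in bx b) g x =
   \int[lam]_(x in bx (l b)) g x + \int[lam]_(x in bx (r b)) g x)%E.
Proof.
move=> mg g0; rewrite {1}bxS ge0_integral_setU//; exact: measurable_funTS.
Qed.

Let integral_cst_node b (k : R) :
  (\int[lam]_(x in bx b) k%:E = (k * vol b)%:E)%E.
Proof.
rewrite (integral_cst lam (mbx b) k%:E) EFinM; congr (_ * _)%E; exact: lamb.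
Qed.

Let mean_split b : m (l b) + m (r b) = 2 * m b.
Proof.
rewrite /m (volS b); have -> : vol (r b) = vol (l b) by [].
rewrite -mulrDr -Rintegral_setU//; last by rewrite -bxS.
by rewrite -bxS; field; rewrite gt_eqF.
Qed.

Let mnorm c : measurable_fun setT (fun x : V => `|f x - c|%:E).
Proof.
by apply/measurable_EFinP; apply: measurableT_comp => //; exact: measurable_funB.
Qed.

Let mean_sub b c : vol b * (m b - c) = \int[lam]_(x in bx b) (f x - c).
Proof.
rewrite RintegralB//; last first.
  apply/integrableP; split; first exact/measurable_EFinP.
  by rewrite (integral_cst_node b `|c|) ltry.
have -> : \int[lam]_(x in bx b) c = c * vol b.
  by rewrite /Rintegral integral_cst_node.
by rewrite mulrBr /m mulrA divff ?gt_eqF// mul1r (mulrC c).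
Qed.

Let mean_sub_le b c :
  ((`|m b - c| * vol b)%:E <= \int[lam]_(x in bx b) `|f x - c|%:E)%E.
Proof.
rewrite -{1}(gtr0_norm (vol0 b)) -normrM mulrC mean_sub; exact: abs_Rintegral_le.
Qed.

Let tree_mean_le n c b : ((tree_avg l r n (fun b' => `|m b' - c|) b * vol b)%:E <=
  \int[lam]_(x in bx b) `|f x - c|%:E)%E.
Proof.
elim: n b => [|n IH] b /=; first exact: mean_sub_le.
rewrite integral_node//; apply: le_trans (leeD (IH (l b)) (IH (r b))).
have -> : vol (r b) = vol (l b) by [].
rewrite -EFinD lee_fin -mulrDl (volS b) le_eqVlt; apply/orP; left; apply/eqP.
by field.
Qed.

Variable w : R.
Hypothesis w0 : 0 <= w.
Hypothesis osc : forall (y : V) (s : R), `|y| <= 1 -> 0 < s <= 2 * D.+1%:R ->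
  exists c, (\int[lam]_(x in eball y s) `|f x - c|%:E <= (w * s ^+ D)%:E)%E.

(** Replacing the constant of [osc] by the mean over the box costs the factor [2]; [(2 (D + 1))^D]
    compares the [D]-th power of the radius of a ball containing a box with the volume of the
    box. *)
Let w' : R := 2 * (w * (2 * D.+1%:R) ^+ D).

Let osc_node b : in_cube b ->
  (\int[lam]_(x in bx b) `|f x - m b|%:E <= (w' * vol b)%:E)%E.
Proof.
move=> cb; have r0 := @rad_gt0 R d b.1.
have [|| c oc] := osc (y := b.2) (s := D.+1%:R * rd b.1).
- rewrite rV_norm_le// => i; have [h1 h2] := cb i.
  by have := @side_gt0 R d b.1 i; rewrite ler_norml => s0; apply/andP; split; lra.
- rewrite mulr_gt0//= mulrC ler_pM2r ?ltr0n//; exact: rad_le2.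
have Ic : (\int[lam]_(x in bx b) `|f x - c|%:E <= (w * (D.+1%:R * rd b.1) ^+ D)%:E)%E.
  apply: le_trans oc; apply: ge0_subset_integral => //.
  - exact: measurable_eball.
  - exact: measurable_funTS.
  - exact: box_eball.
apply: (@le_trans _ _ (\int[lam]_(x in bx b) (`|f x - c|%:E + `|m b - c|%:E))%E).
  apply: le_lower_integral => // x _; rewrite -EFinD lee_fin.
  have -> : f x - m b = (f x - c) - (m b - c) by ring.
  exact: ler_normB.
rewrite ge0_integralD//; last exact: measurable_funTS.
have -> : (\int[lam]_(x in bx b) `|m b - c|%:E = (`|m b - c| * vol b)%:E)%E.
  by rewrite integral_cst_node.
apply: (@le_trans _ _ ((w * (D.+1%:R * rd b.1) ^+ D)%:E + (w * (D.+1%:R * rd b.1) ^+ D)%:E)%E).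
  by apply: leeD => //; apply: le_trans (mean_sub_le b c) Ic.
rewrite -EFinD lee_fin -mulr2n -[leLHS]mulr_natl /w' -[leRHS]mulrA ler_pM2l//.
rewrite -mulrA; apply: ler_wpM2l => //.
have -> : D.+1%:R * rd b.1 = (2 * D.+1%:R) * (rd b.1 / 2) by field.
rewrite exprMn; apply: ler_wpM2l; first by rewrite exprn_ge0// mulr_ge0.
exact: box_vol_ge.
Qed.

Let tree_osc n b : in_cube b -> tree_avg l r n (fun b' => `|m b' - m b|) b <= w'.
Proof.
move=> cb; have := le_trans (tree_mean_le n (m b) b) (osc_node cb).
by rewrite lee_fin ler_pM2r.
Qed.

Let H (s : R) (x : V) : \bar R := (\int[lam]_(h in ball (0 : V)%R s) `|f (x + h)%R - f x|%:E)%E.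

Let mdiff : measurable_fun setT (fun p : V * V => `|f (p.1 + p.2)%R - f p.1|%:E).
Proof.
apply/measurable_EFinP; apply: measurableT_comp => //; apply: measurable_funB.
  apply: (measurableT_comp mf).
  apply: measurable_fun_coordP => i j; under eq_fun do rewrite !mxE.
  by apply: measurable_funD;
     [exact: (measurableT_comp (measurable_coord i j) measurable_fst)|
      exact: (measurableT_comp (measurable_coord i j) measurable_snd)].
exact: (measurableT_comp mf measurable_fst).
Qed.

Let mH s : measurable_fun setT (H s).
Proof.
exact: (measurable_integral_set lam (measurable_ball_rV 0 s) mdiff).
Qed.

Let H0 s x : (0 <= H s x)%E.
Proof. exact: integral_ge0. Qed.

(** Stands in for Lebesgue differentiation: the deviation of [f] from its mean over a small box is
    controlled by small increments of [f]. *)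
Let leaf_le b x : bx b x -> ((`|f x - m b| * vol b)%:E <= H (2 * rd b.1) x)%E.
Proof.
move=> bxx; rewrite distrC -{1}(gtr0_norm (vol0 b)) -normrM mulrC mean_sub.
apply: le_trans (abs_Rintegral_le _ _ _) _; rewrite /H.
rewrite integral_mkcond [leRHS]integral_mkcond.
rewrite -(ge0_integral_shift x (f := ((fun y => `|f y - f x|%:E) \_ (bx b))%E)); last 2 first.
- apply/(measurable_restrictT _ (mbx b)); exact: (measurable_funTS (mnorm (f x))).
- by move=> y; rewrite patchE; case: ifP.
apply: le_lower_integral => h _; rewrite !patchE; first by case: ifP.
case: ifPn => [|_]; last first.
  by case: ifP => _; [exact: (abse_ge0 (f (x + h) - f x)%:E)|exact: lexx].
move=> /set_mem bh; rewrite ifT; first by rewrite (addrC x) lexx.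
apply/mem_set; have := box_ball bxx bh.
by rewrite -addrA subrr addr0.
Qed.

(** [f] is not known to be square integrable. For the truncated square, replacing [f] by a box mean
    costs only [2 N] times an L^1 error. *)
Let trunc (N s : R) : R := Num.min `|s| N ^+ 2.

Let trunc_le (N s t : R) : 0 <= N -> trunc N s <= t ^+ 2 + 2 * N * `|s - t|.
Proof.
move=> N0; rewrite /trunc; set a := Num.min _ _.
have a0 : 0 <= a by rewrite le_min normr_ge0.
have aN : a <= N by rewrite ge_min lexx orbT.
have ast : a <= `|s| by rewrite ge_min lexx.
have : `|s| <= `|s - t| + `|t|.
  by have := ler_normD (s - t) t; rewrite subrK.
rewrite -(real_normK (num_real t)); move: `|s - t| `|s| `|t| ast
  (normr_ge0 (s - t)) (normr_ge0 t) => e s' t' ast e0 t0 st.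
have [h|h] := leP a t'; first by have := mulr_ge0 N0 e0; nra.
have : (a - t') * (a + t') <= e * (2 * N) by apply: ler_pM; lra.
by rewrite [leLHS](_ : _ = a ^+ 2 - t' ^+ 2); [lra|ring].
Qed.

Let mtrunc (N c : R) : measurable_fun setT (fun x : V => (trunc N (f x - c))%:E).
Proof.
apply/measurable_EFinP; apply: measurable_funX; apply: measurable_minr => //.
by apply: measurableT_comp => //; exact: measurable_funB.
Qed.

(** The function is replaced by its means on the leaves at depth [n], whose squares the tree
    averages; the remainder contains only increments at the scale of the leaves. *)
Let tree_trunc (N c : R) n b : 0 <= N ->
  (\int[lam]_(x in bx b) (trunc N (f x - c))%:E <=
   (tree_avg l r n (fun b' => (m b' - c) ^+ 2) b * vol b)%:E +
   (2 * N / bvol (b.1 + n))%:E *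
     \int[lam]_(x in bx b) H (2 * rd (b.1 + n)) x)%E.
Proof.
move=> N0; elim: n b => [|n IH] b /=.
  rewrite addn0.
  have K0 : 0 <= 2 * N / vol b by rewrite divr_ge0 ?mulr_ge0 ?(ltW (vol0 b)).
  rewrite -ge0_integralZl ?lee_fin//; last exact: measurable_funTS.
  have -> : ((m b - c) ^+ 2 * vol b)%:E = (\int[lam]_(x in bx b) ((m b - c) ^+ 2)%:E)%E.
    by rewrite integral_cst_node.
  rewrite -ge0_integralD//; last 3 first.
  - by move=> x _; rewrite lee_fin sqr_ge0.
  - by move=> x _; rewrite mule_ge0.
  - by apply: measurable_funeM; exact: measurable_funTS.
  apply: le_lower_integral => x bxx; first by rewrite lee_fin sqr_ge0.
  apply: (@le_trans _ _ ((m b - c) ^+ 2 + 2 * N * `|f x - m b|)%:E).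
    rewrite lee_fin; apply: le_trans (trunc_le _ (m b - c) N0) _.
    by have -> : f x - c - (m b - c) = f x - m b by ring.
  rewrite EFinD; apply: leeD => //.
  apply: le_trans (lee_wpmul2l _ (leaf_le bxx)); last by rewrite lee_fin.
  rewrite -EFinM lee_fin.
  have -> : 2 * N / vol b * (`|f x - m b| * vol b) = 2 * N * `|f x - m b|.
    by field; rewrite gt_eqF.
  by [].
rewrite integral_node//; last by move=> x; rewrite lee_fin sqr_ge0.
rewrite [in leRHS]integral_node//.
apply: le_trans (leeD (IH (l b)) (IH (r b))) _.
have -> : vol (r b) = vol (l b) by [].
have -> : ((l b).1 + n = b.1 + n.+1)%N by rewrite addSnnS.
have I0 b' : (0 <= \int[lam]_(x in bx b') H (2 * rd (b.1 + n.+1)) x)%E.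
  exact: integral_ge0.
rewrite addeACA; apply: leeD; last first.
  by rewrite (ge0_muleDr _ (I0 _) (I0 _)).
rewrite -EFinD lee_fin -mulrDl (volS b).
rewrite le_eqVlt; apply/orP; left; apply/eqP.
by field.
Qed.

Let root : node := (0%N, const_mx (-1)).

Let root_cube : in_cube root.
Proof.
by move=> i; rewrite /root /= side0 mxE; split => //; lra.
Qed.

Let root_trunc (N : R) : 0 <= N ->
  (\int[lam]_(x in bx root) (trunc N (f x - m root))%:E <=
   (17 * w' ^+ 2 * vol root)%:E)%E.
Proof.
move=> N0.
suff approx (e : R) : 0 < e -> (\int[lam]_(x in bx root) (trunc N (f x - m root))%:E <=
    (17 * w' ^+ 2 * vol root)%:E + e%:E)%E by apply/lee_addgt0Pr => e; exact: approx.
move=> e0.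
(* As [(4 rad n)^D <= 8^D * box_vol n], the remainder is at most [k * e1] whatever the depth. *)
pose k : R := 2 * N * 8 ^+ D; have k0 : 0 <= k by rewrite !mulr_ge0 ?exprn_ge0.
pose e1 : R := e / (k + 1); have e10 : 0 < e1 by rewrite divr_gt0// ltr_wpDl.
have /nbhs_ballP[s /= s0 Hs] := integrable_shift_cvg intf e10.
(* A depth at which the leaves are finer than the scale [s] of the translation estimate; it consists
   of whole rounds, hence the multiple of [D]. *)
have [n nP] : exists n, 2 * rd n < s.
  have b0 := archi_boundP (divr_ge0 (ler0n R 4) (ltW s0)).
  exists (Num.bound (4 / s) * D)%N; rewrite /rad mulnK// mulrA.
  have -> : 2 * 2 = 4 :> R by ring.
  rewrite ltr_pdivrMr ?exprn_gt0// mulrC -ltr_pdivrMr//.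
  by apply: lt_trans b0 _; rewrite -natrX ltr_nat ltn_expl.
have n0 := tree_trunc (m root) n root N0; rewrite add0n in n0.
apply: le_trans n0 _; apply: leeD.
  rewrite lee_fin ler_pM2r//.
  apply: (@tree_avg_sq _ _ l r m (@in_cube R d)) => //.
  - exact: in_cube_l.
  - exact: in_cube_r.
  - by rewrite !mulr_ge0 ?exprn_ge0 ?mulr_ge0.
have IH : (\int[lam]_(x in bx root) H (2 * rd n) x <= (e1 * (4 * rd n) ^+ D)%:E)%E.
  have rn0 := @rad_gt0 R d n.
  rewrite (tonelli_set lam lam (mbx root) (measurable_ball_rV 0 (2 * rd n)) mdiff)//.
  apply: (@le_trans _ _ (\int[lam]_(h in ball (0 : V)%R (2 * rd n)%R) cst e1%:E h)%E).
    apply: le_lower_integral => [h _|h hn /=]; first exact: integral_ge0.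
    apply: (@le_trans _ _ (\int[lam]_x `|f (x + h)%R - f x|%:E)%E).
      exact: subset_lower_integral.
    by apply: Hs; move: hn; apply: le_ball; exact: ltW.
  rewrite integral_cst; last exact: measurable_ball_rV.
  have -> : (e1%:E * lam (ball 0%R (2 * rd n)%R) = e1%:E * (((2 * rd n) *+ 2) ^+ D)%:E)%E.
    by congr (_ * _)%E; apply: lebesgue_rV_ball; rewrite mulr_gt0.
  rewrite -EFinM lee_fin.
  have -> : (2 * rd n) *+ 2 = 4 * rd n :> R by rewrite mulr2n; ring.
  by [].
apply: le_trans (lee_wpmul2l _ IH) _.
  by rewrite lee_fin divr_ge0 ?mulr_ge0 ?(ltW (@box_vol_gt0 R d n)).
rewrite -EFinM lee_fin.
have rn0 := @rad_gt0 R d n.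
have -> : 4 * rd n = 8 * (rd n / 2) by field.
rewrite exprMn.
apply: (@le_trans _ _ (e1 * k)); last first.
  rewrite /e1 -mulrA ler_piMr ?(ltW e0)//.
  by rewrite mulrC ler_pdivrMr ?ltr_wpDl// mul1r lerDl.
have Y : (bvol n)^-1 * (8 ^+ D * (rd n / 2) ^+ D) <= 8 ^+ D.
  rewrite mulrCA ler_piMr ?exprn_ge0// mulrC ler_pdivrMr ?box_vol_gt0// mul1r.
  exact: box_vol_ge.
have -> : 2 * N / bvol n * (e1 * (8 ^+ D * (rd n / 2) ^+ D)) =
    e1 * (2 * N * ((bvol n)^-1 * (8 ^+ D * (rd n / 2) ^+ D))) by ring.
apply: ler_wpM2l; first exact: ltW.
by apply: ler_wpM2l => //; rewrite mulr_ge0.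
Qed.

(** The bound for truncated squares is uniform in [N], and monotone convergence removes the
    truncation. [68 = 17 * 2^2], the [2] coming from [w']; [2^D] is the volume of the root cube,
    which contains the unit ball. *)
Lemma john_nirenberg_sq : exists c,
  (\int[lam]_(x in unit_ball) ((f x - c) ^+ 2)%:E <=
   (68 * (w * (2 * D.+1%:R) ^+ D) ^+ 2 * 2 ^+ D)%:E)%E.
Proof.
exists (m root).
have volr : vol root = 2 ^+ D.
  rewrite /vol /box_vol; under eq_bigr do rewrite side0.
  by rewrite prodr_const card_ord.
have -> : 68 * (w * (2 * D.+1%:R) ^+ D) ^+ 2 * 2 ^+ D = 17 * w' ^+ 2 * vol root.
  by rewrite volr /w'; ring.
pose g (N : nat) (x : V) := (trunc N%:R (f x - m root))%:E.
have mg N : measurable_fun (bx root) (g N) by apply: measurable_funTS; exact: mtrunc.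
have msq : measurable_fun setT (fun x : V => ((f x - m root) ^+ 2)%:E).
  by apply/measurable_EFinP; apply: measurable_funX; exact: measurable_funB.
apply: (@le_trans _ _ (\int[lam]_(x in bx root) ((f x - m root) ^+ 2)%:E)%E).
  apply: ge0_subset_integral => //.
  - exact: measurable_unit_ball.
  - exact: measurable_funTS.
  - by move=> x _; rewrite lee_fin sqr_ge0.
  - move=> x; rewrite /unit_ball /eball/= subr0 => x1 i /=.
    rewrite in_itv/= mxE side0.
    have := le_lt_trans (coord_le_enorm x 0 i) x1.
    by rewrite ltr_norml => /andP[h1 h2]; apply/andP; split; lra.
have g0 N x : bx root x -> (0 <= g N x)%E by move=> _; rewrite lee_fin sqr_ge0.
have ndg x : bx root x -> {homo g^~ x : a b / (a <= b)%N >-> (a <= b)%E}.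
  move=> _ a b ab; rewrite lee_fin lerXn2r ?nnegrE ?le_min ?normr_ge0 ?ler0n//.
  by rewrite ge_min lexx/= ge_min ler_nat ab orbT.
apply: (@le_trans _ _ (\int[lam]_(x in bx root) limn (g^~ x))%E).
  apply: le_lower_integral => x bxx; first by rewrite lee_fin sqr_ge0.
  rewrite (cvg_lim _ (ereal_nondecreasing_cvgn (ndg x bxx)))//.
  apply: ereal_sup_ubound; exists (Num.bound `|f x - m root|) => //.
  rewrite /g /trunc min_l ?real_normK ?num_real// ltW//.
  exact: archi_boundP.
rewrite monotone_convergence//; apply: lime_le; last first.
  by apply: nearW => N; exact: root_trunc.
apply: ereal_nondecreasing_is_cvgn => a b ab.
by apply: le_lower_integral => x bxx; [exact: g0|exact: ndg].
Qed.

End john_nirenberg.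

(** * Bounds for mollified fields and their increments *)

Section mollified_bounds.
Context {R : realType} {d : nat}.
Local Notation V := 'rV[R]_d.
Local Notation lam := (@lebesgue_rV R d).
Local Notation B := (@unit_ball R d).
Local Notation vB := (@vol_B R d).

Variable rho : V -> R.
Hypothesis rho_kernel : mollifier_kernel rho.
Variable C : R.
Hypothesis C_gt0 : 0 < C.
Hypothesis rhoC : forall z, `|rho z| <= C.
Hypothesis rhoC' : forall j z, `|partial j rho z| <= C.

Let C_ge0 : 0 <= C. Proof. exact: ltW. Qed.
Let mrho := measurable_kernel rho_kernel.
Let rho0 := kernel_eq0 rho_kernel.
Let mB : measurable B. Proof. exact: measurable_unit_ball. Qed.
Let vB0 : 0 <= vB. Proof. exact: vol_B_ge0. Qed.

Definition quad_incr (v : V -> V) (l : R) : \bar R :=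
  (\int[lam]_x \int[lam]_(z in B) (enorm (delta v l x z) ^+ 2)%:E)%E.

Lemma measurable_shift_pair (l : R) :
  measurable_fun setT (fun p : V * V => p.1 + l *: p.2).
Proof.
apply: measurable_fun_coordP => i j; under eq_fun do rewrite !mxE.
apply: measurable_funD.
  exact: (measurableT_comp (measurable_coord i j) measurable_fst).
apply: measurable_funM => //.
exact: (measurableT_comp (measurable_coord i j) measurable_snd).
Qed.

Lemma measurable_quad_delta (v : V -> V) (l : R) : measurable_fun setT v ->
  measurable_fun setT (fun p : V * V => (enorm (delta v l p.1 p.2) ^+ 2)%:E).
Proof.
move=> mv; apply/measurable_EFinP; apply: measurable_funX.
exact: (measurable_enorm (measurable_delta l mv)).
Qed.

Lemma measurable_mollify (v : V -> V) (eps : R) : measurable_fun setT v ->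
  measurable_fun setT (mollify rho eps v).
Proof.
move=> mv; apply: measurable_fun_coordP => i j; under eq_fun do rewrite mollifyE.
apply: measurable_conv => //.
exact: (measurableT_comp (measurable_coord i j) mv).
Qed.

(** The strain of the mollified field is split as [a + P]: the bounded part [a] is paired with the
    mean square of the increments, the integrable part [P] with a bound [Dl] for their squares. *)
Lemma flux_DR_mollify_bound (v : V -> V) (l eps a Dl M : R) (K : set V)
    (P : V -> \bar R) : 0 < l -> 0 < eps -> measurable K ->
  measurable_fun setT v ->
  (forall i, lam.-integrable setT (EFin \o (fun y => v y 0 i))) ->
  (forall y i, `|v y 0 i| <= M) -> 0 <= a -> 0 <= Dl ->
  measurable_fun setT P -> (forall x, 0 <= P x)%E ->
  (forall i j x z, K x -> B z ->
    `|symconv rho eps v i j (x + l *: z)%R|%:E <= a%:E + P (x + l *: z)%R)%E ->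
  (forall x z, K x -> B z -> enorm (delta (mollify rho eps v) l x z) ^+ 2 <= Dl) ->
  (\int[lam]_(x in K) `|flux_DR rho (mollify rho eps v) l x|%:E <=
   (C * d%:R ^+ 2)%:E * (a%:E * quad_incr (mollify rho eps v) l +
     (Dl * vB)%:E * \int[lam]_x P x))%E.
Proof.
move=> l0 eps0 mK mv intv vM a0 Dl0 mP P0 symP deltaP.
set w := mollify rho eps v.
have mw : measurable_fun setT w by exact: measurable_mollify.
pose dw i j := partial j (conv rho eps (fun y => v y 0 i)).
have mvi i : measurable_fun setT (fun y => v y 0 i).
  exact: (measurableT_comp (measurable_coord 0 i) mv).
have dwE i j : dw i j = fun x => eps^-1 * conv (partial j rho) eps (fun y => v y 0 i) x.
  by apply/funext => x; rewrite /dw (partial_conv rho_kernel rhoC rhoC').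
have mdw i j : measurable_fun setT (dw i j).
  rewrite dwE; apply: measurable_funM => //; apply: measurable_conv => //.
  exact: measurable_kernel_partial.
(* A bound for the mollified field and its derivatives; it depends on [eps], but the conclusion does
   not contain it. *)
pose M1 := C * (M * vB) + eps^-1 * (C * (M * vB)).
have wM y i : `|w y 0 i| <= C * (M * vB).
  rewrite mollifyE; apply: (conv_bounded mrho rhoC) => //.
have dwM i j y : `|dw i j y| <= eps^-1 * (C * (M * vB)).
  rewrite dwE normrM gtr0_norm ?invr_gt0// ler_wpM2l ?invr_ge0 ?(ltW eps0)//.
  apply: (conv_bounded (measurable_kernel_partial rho_kernel j) (rhoC' j)) => //.
  exact: (kernel_partial_eq0 rho_kernel j).
have wM1 y i : `|w y 0 i| <= M1 by apply: le_trans (wM y i) _; rewrite lerDl (le_trans _ (dwM i i y)).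
have dwM1 i j y : `|dw i j y| <= M1.
  by apply: le_trans (dwM i j y) _; rewrite lerDr (le_trans _ (wM y i)).
have dwD i j y : is_derive y 'e_j (fun y => w y 0 i) (dw i j y).
  have -> : (fun y => w y 0 i) = conv rho eps (fun y => v y 0 i).
    by apply/funext => z; rewrite mollifyE.
  rewrite dwE -(dkernel_e rho j).
  exact: (is_derive_conv rho_kernel rhoC rhoC' y 'e_j eps0 (intv i)).
pose e2 (p : V * V) := (enorm (delta w l p.1 p.2) ^+ 2)%:E.
have me2 : measurable_fun setT e2 by exact: measurable_quad_delta.
have e20 p : (0 <= e2 p)%E by rewrite lee_fin sqr_ge0.
pose P2 (p : V * V) := P (p.1 + l *: p.2).
have mP2 : measurable_fun setT P2 by apply: (measurableT_comp mP); exact: measurable_shift_pair.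
have P20 p : (0 <= P2 p)%E by exact: P0.
pose G p := (a%:E * e2 p + Dl%:E * P2 p)%E.
have mG : measurable_fun setT G.
  by apply: emeasurable_funD; apply: measurable_funeM.
have G0 p : (0 <= G p)%E by rewrite adde_ge0// mule_ge0.
have dd0 : 0 <= d%:R ^+ 2 :> R by rewrite exprn_ge0.
have px x : K x -> (`|flux_DR rho w l x|%:E <=
    (C * d%:R ^+ 2)%:E * \int[lam]_(z in B) G (x, z))%E.
  move=> Kx.
  apply: le_trans (flux_DR_smooth_le rho_kernel rhoC rhoC' mw mdw wM1 dwM1 dwD x l0) _.
  rewrite EFinM -muleA; apply: lee_wpmul2l; first by rewrite lee_fin.
  have mGx : measurable_fun B (fun z => G (x, z)).
    by apply: measurable_funTS; exact: (measurableT_comp mG (pair1_measurable x)).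
  rewrite -ge0_integralZl ?lee_fin//.
  apply: le_lower_integral => z Bz.
    by rewrite lee_fin mulr_ge0 ?sqr_ge0//; apply: sumr_ge0 => i _; exact: sumr_ge0.
  have S2 : ((\sum_i \sum_j `|symconv rho eps v i j (x + l *: z)|)%:E <=
      (d%:R ^+ 2)%:E * (a%:E + P (x + l *: z)%R))%E.
    rewrite expr2 EFinM -muleA -!sume_const_ord -sumEFin.
    apply: lee_sum => i _; rewrite -sumEFin; apply: lee_sum => j _; exact: symP.
  rewrite EFinM; apply: le_trans (lee_wpmul2r _ S2) _; first by rewrite lee_fin sqr_ge0.
  rewrite -muleA; apply: lee_wpmul2l; first by rewrite lee_fin.
  rewrite muleC ge0_muleDr ?lee_fin//; apply: leeD; first by rewrite muleC.
  by apply: lee_wpmul2r => //; rewrite lee_fin; exact: deltaP.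
apply: le_trans (le_lower_integral lam _ px) _ => //.
have mGK : measurable_fun setT (fun x => \int[lam]_(z in B) G (x, z))%E.
  exact: (measurable_integral_set lam mB mG G0).
have GK0 x : (0 <= \int[lam]_(z in B) G (x, z))%E by exact: integral_ge0.
have CD0 : 0 <= C * d%:R ^+ 2 by rewrite mulr_ge0.
rewrite ge0_integralZl ?lee_fin//; last exact: measurable_funTS.
apply: lee_wpmul2l; first by rewrite lee_fin.
apply: le_trans (subset_lower_integral lam (B := setT) _ (@subsetT _ K)) _ => //.
have mp1 (g : V * V -> \bar R) x : measurable_fun setT g -> measurable_fun B (fun z => g (x, z)).
  by move=> mg; apply: measurable_funTS; exact: (measurableT_comp mg (pair1_measurable x)).
have Zl (g : V * V -> \bar R) (k : R) x : measurable_fun setT g ->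
    (forall p, 0 <= g p)%E -> 0 <= k ->
    (\int[lam]_(z in B) (k%:E * g (x, z)) = k%:E * \int[lam]_(z in B) g (x, z))%E.
  by move=> mg g0 k0; apply: ge0_integralZl => //; exact: mp1.
have GE x : (\int[lam]_(z in B) G (x, z) = a%:E * (\int[lam]_(z in B) e2 (x, z)) +
    Dl%:E * (\int[lam]_(z in B) P2 (x, z)))%E.
  rewrite ge0_integralD//; last 4 first.
  - by move=> z _; rewrite mule_ge0.
  - by apply: measurable_funeM; exact: mp1.
  - by move=> z _; rewrite mule_ge0.
  - by apply: measurable_funeM; exact: mp1.
  by rewrite (Zl e2)// (Zl P2).
under eq_integral do rewrite GE.
have mI (g : V * V -> \bar R) : measurable_fun setT g -> (forall p, 0 <= g p)%E ->
    measurable_fun setT (fun x => \int[lam]_(z in B) g (x, z))%E.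
  by move=> mg g0; exact: (measurable_integral_set lam mB mg g0).
rewrite ge0_integralD//; last 4 first.
- by move=> x _; rewrite mule_ge0// integral_ge0.
- by apply: measurable_funeM; exact: mI.
- by move=> x _; rewrite mule_ge0// integral_ge0.
- by apply: measurable_funeM; exact: mI.
rewrite !ge0_integralZl ?lee_fin//; last 4 first.
- exact: mI.
- by move=> x _; rewrite integral_ge0.
- exact: mI.
- by move=> x _; rewrite integral_ge0.
apply: leeD => //; rewrite EFinM -muleA; apply: lee_wpmul2l; first by rewrite lee_fin.
rewrite (tonelli_set lam lam measurableT mB mP2)//.
have PE z : (\int[lam]_x P2 (x, z) = \int[lam]_x P x)%E.
  by rewrite -(ge0_integral_shift (l *: z) mP).
under eq_integral do rewrite PE.
have -> : (vB%:E * \int[lam]_x P x = \int[lam]_x P x * lam B)%E.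
  by rewrite muleC; congr (_ * _)%E; rewrite vol_BE.
by rewrite -integral_cst.
Qed.

(** [rho] may change sign, so Jensen's inequality is replaced by the product bound on the unit ball,
    at the price of a constant. *)
Lemma conv_sq_le (g : V -> R) (eps : R) (x : V) : 0 < eps ->
  lam.-integrable setT (EFin \o g) ->
  ((conv rho eps g x ^+ 2)%:E <=
   (2 * C ^+ 2 * vB)%:E * \int[lam]_(y in B) (g (x + eps *: y)%R ^+ 2)%:E)%E.
Proof.
move=> eps0 intg.
have mg : measurable_fun setT g by apply/measurable_EFinP; case/integrableP : intg.
have mgx := measurable_along eps x mg.
rewrite -real_normK ?num_real// expr2 EFinM.
have H := conv_abs_le mrho rhoC rho0 x eps0 intg.
apply: le_trans (lee_pmul _ _ H H) _ => //.
have -> : (2 * C ^+ 2 * vB)%:E = ((C ^+ 2)%:E * (2%:E * vB%:E))%E.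
  by rewrite -!EFinM; congr EFin; ring.
rewrite muleACA -EFinM -expr2 -muleA; apply: lee_wpmul2l; first by rewrite lee_fin exprn_ge0.
have mn : measurable_fun B (fun y => `|g (x + eps *: y)|).
  by apply: measurable_funTS; exact: measurableT_comp.
have m2 : measurable_fun B (fun y => g (x + eps *: y) ^+ 2).
  by apply: measurable_funTS; exact: measurable_funX.
have := @integral_mul_le R _ _ lam B mB _ _ _ mn mn m2.
move=> I; have {}I := I (fun z => normr_ge0 _) (fun z => normr_ge0 _) (fun z => sqr_ge0 _) _.
have -> : (vB%:E = lam B)%E by rewrite vol_BE.
rewrite -muleA; apply: I => y z.
set s := g _; set t := g _; rewrite -(real_normK (num_real s)) -(real_normK (num_real t)).
move: `|s| `|t| (normr_ge0 s) (normr_ge0 t) => {}s {}t s0 t0; nra.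
Qed.

Lemma conv_sq_integral_le (g : V -> R) (eps : R) : 0 < eps ->
  lam.-integrable setT (EFin \o g) ->
  (\int[lam]_x (conv rho eps g x ^+ 2)%:E <=
   (2 * C ^+ 2 * vB ^+ 2)%:E * \int[lam]_x (g x ^+ 2)%:E)%E.
Proof.
move=> eps0 intg.
have mg : measurable_fun setT g by apply/measurable_EFinP; case/integrableP : intg.
have mg2 : measurable_fun setT (fun x => (g x ^+ 2)%:E).
  by apply/measurable_EFinP; exact: measurable_funX.
have mp : measurable_fun setT (fun p : V * V => (g (p.1 + eps *: p.2) ^+ 2)%:E).
  exact: (measurableT_comp mg2 (measurable_shift_pair eps)).
have p0 (p : V * V) : (0 <= (g (p.1 + eps *: p.2)%R ^+ 2)%:E)%E by rewrite lee_fin sqr_ge0.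
have K0 : 0 <= 2 * C ^+ 2 * vB by rewrite !mulr_ge0 ?exprn_ge0.
apply: le_trans (le_lower_integral lam _ (fun x _ => conv_sq_le x eps0 intg)) _.
  by move=> x _; rewrite lee_fin sqr_ge0.
rewrite ge0_integralZl ?lee_fin//; last 2 first.
- exact: (measurable_integral_set lam mB mp p0).
- by move=> x _; apply: integral_ge0 => y _; rewrite lee_fin sqr_ge0.
have -> : (2 * C ^+ 2 * vB ^+ 2)%:E = ((2 * C ^+ 2 * vB)%:E * vB%:E)%E.
  by rewrite -EFinM; congr EFin; ring.
rewrite -muleA; apply: lee_wpmul2l; first by rewrite lee_fin.
rewrite (tonelli_set lam lam measurableT mB mp p0).
have gE z : (\int[lam]_x (g (x + eps *: z)%R ^+ 2)%:E = \int[lam]_x (g x ^+ 2)%:E)%E.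
  rewrite -(ge0_integral_shift (eps *: z) mg2)// => x.
  by rewrite lee_fin sqr_ge0.
under eq_integral do rewrite /= gE.
have -> : (vB%:E * \int[lam]_x (g x ^+ 2)%:E = \int[lam]_x (g x ^+ 2)%:E * lam B)%E.
  by rewrite muleC; congr (_ * _)%E; rewrite vol_BE.
by rewrite -integral_cst.
Qed.

Lemma integrable_shift (f : V -> R) (a : V) : lam.-integrable setT (EFin \o f) ->
  lam.-integrable setT (EFin \o (fun x => f (x + a))).
Proof.
move=> /(integrable_affine a (oner_neq0 R)); apply: eq_integrable => // x _ /=.
by rewrite scale1r addrC.
Qed.

(** Increments commute with convolution, so the L^2 bound for convolutions applies to each of
    them. *)
Lemma quad_incr_mollify (v : V -> V) (l eps : R) : 0 < l -> 0 < eps ->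
  measurable_fun setT v ->
  (forall i, lam.-integrable setT (EFin \o (fun y => v y 0 i))) ->
  (quad_incr (mollify rho eps v) l <= (2 * C ^+ 2 * vB ^+ 2)%:E * quad_incr v l)%E.
Proof.
move=> l0 eps0 mv intv.
have mw : measurable_fun setT (mollify rho eps v) by exact: measurable_mollify.
have mvi i : measurable_fun setT (fun y => v y 0 i).
  exact: (measurableT_comp (measurable_coord 0 i) mv).
rewrite /quad_incr (tonelli_set lam lam measurableT mB (measurable_quad_delta l mw)); last first.
  by move=> p; rewrite lee_fin sqr_ge0.
rewrite (tonelli_set lam lam measurableT mB (measurable_quad_delta l mv)); last first.
  by move=> p; rewrite lee_fin sqr_ge0.
have c0 : 0 <= 2 * C ^+ 2 * vB ^+ 2 by rewrite !mulr_ge0 ?exprn_ge0.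
have mQ (f : V -> V) : measurable_fun setT f -> measurable_fun B
    (fun z => \int[lam]_x (enorm (delta f l x z) ^+ 2)%:E)%E.
  move=> mf; apply: measurable_funTS.
  apply: (measurable_integral_set lam measurableT
    (g := fun p => (enorm (delta f l p.2 p.1) ^+ 2)%:E)).
    exact: (measurableT_comp (measurable_quad_delta l mf) (@measurable_swap _ _ _ _)).
  by move=> p; rewrite lee_fin sqr_ge0.
rewrite -ge0_integralZl ?lee_fin//; last 2 first.
- exact: mQ.
- by move=> z _; apply: integral_ge0 => x _; rewrite lee_fin sqr_ge0.
apply: le_lower_integral => z _ /=.
  by apply: integral_ge0 => x _; rewrite lee_fin sqr_ge0.
pose g i x := v (x + l *: z) 0 i - v x 0 i.
have intg i : lam.-integrable setT (EFin \o g i).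
  have := integrableB measurableT (integrable_shift (l *: z) (intv i)) (intv i).
  by apply: eq_integrable.
have mg i : measurable_fun setT (g i) by apply/measurable_EFinP; case/integrableP : (intg i).
have wE x : enorm (delta (mollify rho eps v) l x z) ^+ 2 =
    \sum_i conv rho eps (g i) x ^+ 2.
  rewrite enorm_rV_sq; apply: eq_bigr => i _; congr (_ ^+ 2).
  rewrite /delta !mxE -!/(conv rho eps (fun y => v y 0 i) _).
  rewrite (conv_shift mrho rhoC _ _ eps0 (intv i)).
  exact: (convB mrho rhoC _ eps0 (integrable_shift (l *: z) (intv i)) (intv i)).
have vE x : enorm (delta v l x z) ^+ 2 = \sum_i g i x ^+ 2.
  by rewrite enorm_rV_sq; apply: eq_bigr => i _; rewrite !mxE.
have sumE (h : 'I_d -> V -> R) : (forall i, measurable_fun setT (h i)) ->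
    (\int[lam]_x (\sum_i h i x ^+ 2)%:E = \sum_i \int[lam]_x (h i x ^+ 2)%:E)%E.
  move=> mh; under eq_integral do rewrite -sumEFin.
  rewrite ge0_integral_sum// => i; last by move=> x _; rewrite lee_fin sqr_ge0.
  by apply/measurable_EFinP; apply: measurable_funX; exact: mh.
under eq_integral do rewrite wE.
under [in leRHS]eq_integral do rewrite vE.
rewrite !sumE//; last by move=> i; exact: measurable_conv.
rewrite ge0_sume_distrr => [|i _]; last by apply: integral_ge0 => x _; rewrite lee_fin sqr_ge0.
by apply: lee_sum => i _; exact: conv_sq_integral_le.
Qed.

Lemma enorm_sqB (a b : V) : enorm (a - b) ^+ 2 <= 2 * enorm a ^+ 2 + 2 * enorm b ^+ 2.
Proof.
rewrite !enorm_rV_sq !mulr_sumr -big_split/=; apply: ler_sum => i _; rewrite !mxE.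
by have := sqr_ge0 (a 0 i + b 0 i); nra.
Qed.

Lemma quad_incr_le (v : V -> V) (l : R) : measurable_fun setT v ->
  (quad_incr v l <= (4 * vB)%:E * \int[lam]_x (enorm (v x) ^+ 2)%:E)%E.
Proof.
move=> mv.
have mv2 : measurable_fun setT (fun x => (enorm (v x) ^+ 2)%:E).
  by apply/measurable_EFinP; apply: measurable_funX; exact: measurable_enorm.
have v20 x : (0 <= (enorm (v x) ^+ 2)%:E)%E by rewrite lee_fin sqr_ge0.
rewrite /quad_incr (tonelli_set lam lam measurableT mB (measurable_quad_delta l mv)); last first.
  by move=> p; rewrite lee_fin sqr_ge0.
set I := (\int[lam]_x (enorm (v x) ^+ 2)%:E)%E.
have I0 : (0 <= I)%E by exact: integral_ge0.
apply: (@le_trans _ _ (\int[lam]_(z in B) (4%:E * I))%E); last first.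
  rewrite integral_cst// muleAC EFinM; apply: lee_wpmul2r => //.
  by rewrite -vol_BE.
apply: le_lower_integral => z _ /=.
  by apply: integral_ge0 => x _; rewrite lee_fin sqr_ge0.
apply: (@le_trans _ _ (\int[lam]_x (2%:E * (enorm (v (x + l *: z)%R) ^+ 2)%:E +
    2%:E * (enorm (v x) ^+ 2)%:E))%E).
  apply: le_lower_integral => x _; first by rewrite lee_fin sqr_ge0.
  by rewrite -!EFinM -EFinD lee_fin; exact: enorm_sqB.
have mvs : measurable_fun setT (fun x : V => (enorm (v (x + l *: z)%R) ^+ 2)%:E).
  exact: (measurableT_comp mv2 (measurable_shift (l *: z))).
rewrite ge0_integralD//; last 4 first.
- by move=> x _; rewrite mule_ge0.
- exact: measurable_funeM.
- by move=> x _; rewrite mule_ge0.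
- exact: measurable_funeM.
rewrite !ge0_integralZl// (ge0_integral_shift (l *: z) mv2)// -/I.
by rewrite -ge0_muleDl// -EFinD; have -> : 2 + 2 = 4 :> R by ring.
Qed.

(** The signed square [s |s|] of a square-integrable function is integrable; this inequality carries
    the continuity of translations from L^1 to L^2. *)
Lemma sqrB_le_normB (s t : R) : (s - t) ^+ 2 <= 2 * `|s * `|s| - t * `|t| |.
Proof.
have [s0|/ltW s0] := leP 0 s; have [t0|/ltW t0] := leP 0 t.
- rewrite (ger0_norm s0) (ger0_norm t0).
  have -> : s * s - t * t = (s - t) * (s + t) by ring.
  rewrite normrM (ger0_norm (addr_ge0 s0 t0)) -real_normK ?num_real//.
  have : `|s - t| <= s + t by rewrite ler_norml; apply/andP; split; lra.
  by move: `|s - t| (normr_ge0 (s - t)) => y; nra.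
- rewrite (ger0_norm s0) (ler0_norm t0) ger0_norm; last by nra.
  by have := sqr_ge0 (s + t); nra.
- rewrite (ler0_norm s0) (ger0_norm t0) ler0_norm; last by nra.
  by have := sqr_ge0 (s + t); nra.
- rewrite (ler0_norm s0) (ler0_norm t0).
  have -> : s * - s - t * - t = (s - t) * - (s + t) by ring.
  have st : 0 <= - (s + t) by lra.
  rewrite normrM (ger0_norm st) -real_normK ?num_real//.
  have : `|s - t| <= - (s + t) by rewrite ler_norml; apply/andP; split; lra.
  by move: `|s - t| (normr_ge0 (s - t)) => y; nra.
Qed.

Lemma quad_incr_small (v : V -> V) (e : R) : 0 < e -> measurable_fun setT v ->
  (\int[lam]_x (enorm (v x) ^+ 2)%:E < +oo)%E ->
  \forall l \near 0^'+, (quad_incr v l <= e%:E)%E.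
Proof.
move=> e0 mv v2y.
pose f i (x : V) := v x 0 i * `|v x 0 i|.
have mvi i : measurable_fun setT (fun y => v y 0 i).
  exact: (measurableT_comp (measurable_coord 0 i) mv).
have mf i : measurable_fun setT (f i).
  by apply: measurable_funM => //; exact: measurableT_comp.
have intf i : lam.-integrable setT (EFin \o f i).
  apply/integrableP; split; first exact/measurable_EFinP.
  apply: le_lt_trans v2y; apply: le_lower_integral => // x _.
  rewrite lee_fin normrM normr_id -expr2 real_normK ?num_real// enorm_rV_sq.
  by rewrite (bigD1 i)//= lerDl; apply: sumr_ge0 => j _; exact: sqr_ge0.
have e10 : 0 < e / (2 * d%:R + 1) by rewrite divr_gt0// ltr_wpDl// mulr_ge0.
have H : \forall l \near (0 : R)^'+, forall i : 'I_d,
   (\int[lam]_x \int[lam]_(z in B) `|f i (x + l *: z)%R - f i x|%:E <=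
      (e / (2 * d%:R + 1))%:E)%E.
  apply: (@filter_forall _ 'I_d (fun i l => (\int[lam]_x \int[lam]_(z in B)
    `|f i (x + l *: z)%R - f i x|%:E <= (e / (2 * d%:R + 1))%:E)%E)) => i.
  exact: integrable_increment_small.
apply: filterS H => l H.
have md i : measurable_fun setT (fun p : V * V => `|f i (p.1 + l *: p.2) - f i p.1|%:E).
  apply/measurable_EFinP; apply: measurableT_comp => //; apply: measurable_funB.
    exact: measurable_shift2.
  exact: (measurableT_comp (mf i) measurable_fst).
have pw x z : enorm (delta v l x z) ^+ 2 <=
    \sum_i 2 * `|f i (x + l *: z) - f i x|.
  rewrite enorm_rV_sq; apply: ler_sum => i _; rewrite !mxE /f.
  exact: sqrB_le_normB.
have mI i : measurable_fun setT (fun x : V => \int[lam]_(z in B) `|f i (x + l *: z)%R - f i x|%:E)%E.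
  exact: (measurable_integral_set lam mB (md i)).
have mIx i (x : V) : measurable_fun B (fun z : V => `|f i (x + l *: z)%R - f i x|%:E).
  by apply: measurable_funTS; exact: (measurableT_comp (md i) (pair1_measurable x)).
apply: (@le_trans _ _ (\int[lam]_x \sum_i 2%:E *
    \int[lam]_(z in B) `|f i (x + l *: z)%R - f i x|%:E)%E).
  apply: le_lower_integral => x _.
    by apply: integral_ge0 => z _; rewrite lee_fin sqr_ge0.
  apply: (@le_trans _ _ (\int[lam]_(z in B) \sum_i 2%:E * `|f i (x + l *: z)%R - f i x|%:E)%E).
    apply: le_lower_integral => z _; first by rewrite lee_fin sqr_ge0.
    under eq_bigr do rewrite -EFinM.
    by rewrite sumEFin lee_fin; exact: pw.
  rewrite ge0_integral_sum//; last by move=> i; apply: measurable_funeM; exact: mIx.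
  by apply: lee_sum => i _; rewrite ge0_integralZl//; exact: mIx.
rewrite ge0_integral_sum//; last 2 first.
- by move=> i; apply: measurable_funeM; exact: mI.
- by move=> i x _; rewrite mule_ge0// integral_ge0.
apply: (@le_trans _ _ (\sum_(i < d) (2 * (e / (2 * d%:R + 1)))%:E)%E).
  apply: lee_sum => i _; rewrite ge0_integralZl//; last by move=> x _; exact: integral_ge0.
  by rewrite EFinM; apply: lee_wpmul2l.
rewrite sume_const_ord -EFinM lee_fin.
have -> : d%:R * (2 * (e / (2 * d%:R + 1))) = e * (2 * d%:R) / (2 * d%:R + 1) by ring.
rewrite ler_pdivrMr ?ltr_wpDl ?mulr_ge0// ler_pM2l//.
by rewrite lerDl.
Qed.

Lemma rescale_norm_integral (eps : R) (s : V) : 0 < eps ->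
  (\int[lam]_y `|rescale rho eps (y - s)|%:E <= (C * vB)%:E)%E.
Proof.
move=> eps0.
have mr : measurable_fun setT (fun y : V => `|rescale rho eps y|%:E).
  apply/measurable_EFinP; apply: measurableT_comp => //.
  exact: measurable_rescale.
rewrite (ge0_integral_shift (- s) mr)//.
have mn : measurable_fun setT (fun y : V => `|rho y|%:E).
  by apply/measurable_EFinP; exact: measurableT_comp.
have -> : (\int[lam]_y `|rescale rho eps y|%:E =
    \int[lam]_y ((eps ^- d)%:E * `|rho (eps^-1 *: y + 0)|%:E))%E.
  apply: eq_integral => y _; rewrite -EFinM addr0 /rescale normrM.
  by rewrite ger0_norm// invr_ge0 exprn_ge0// ltW.
rewrite ge0_integralZl//; last 2 first.
- exact: (measurableT_comp mn (measurable_affine eps^-1 (0 : V))).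
- by rewrite lee_fin invr_ge0 exprn_ge0// ltW.
rewrite (ge0_integral_affine (c := eps^-1) 0 _ mn)//; last first.
  by rewrite invr_eq0 gt_eqF.
rewrite muleA -EFinM gtr0_norm ?invr_gt0// exprVn invrK mulVf ?mul1e; last first.
  by rewrite expf_neq0// gt_eqF.
have := kernel_weight_le rhoC rho0 (g := fun=> 1) (measurable_cst _).
under eq_integral do rewrite mul1r.
by rewrite normr1 (integral_cst_B 1) mul1r -EFinM.
Qed.

(** Tonelli: convolution with [|rho_eps|] increases the mass at most by the bound [C * vB] for the
    L^1 norm of the kernel. It serves both for a strain with density [g] and for the variation
    measure of a singular one. *)
Lemma potential_integral (nu : {sigma_finite_measure set V -> \bar R})
    (S : set V) (g : V -> \bar R) (eps : R) : 0 < eps -> measurable S ->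
  measurable_fun setT g -> (forall s, 0 <= g s)%E ->
  (\int[lam]_y \int[nu]_(s in S) (`|rescale rho eps (y - s)|%:E * g s) <=
   (C * vB)%:E * \int[nu]_(s in S) g s)%E.
Proof.
move=> eps0 mS mg g0.
have CvB0 : 0 <= C * vB by rewrite mulr_ge0.
pose G (p : V * V) := (`|rescale rho eps (p.1 - p.2)%R|%:E * g p.2)%E.
have mr : measurable_fun setT (fun p : V * V => `|rescale rho eps (p.1 - p.2)%R|%:E).
  apply/measurable_EFinP; apply: measurableT_comp => //.
  exact: (measurableT_comp (measurable_rescale mrho eps) measurable_fst_subr_snd).
have mG : measurable_fun setT G.
  by apply: emeasurable_funM => //; exact: (measurableT_comp mg measurable_snd).
have G0 p : (0 <= G p)%E by rewrite mule_ge0.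
rewrite (tonelli_set lam nu measurableT mS mG G0).
rewrite -ge0_integralZl ?lee_fin//; last exact: measurable_funTS.
apply: le_lower_integral => s _ /=; first exact: integral_ge0.
rewrite /G/= ge0_integralZr//.
  by apply: lee_wpmul2r => //; exact: rescale_norm_integral.
exact: (measurableT_comp mr (pair2_measurable s)).
Qed.

End mollified_bounds.

(** * Borel versions of a field *)

Section measure_complements.
Context {R : realType} {dd : measure_display} {X : measurableType dd}.
Variables (mu : {measure set X -> \bar R}) (S : set X).
Hypotheses (mS : measurable S) (muS : (mu S < +oo)%E).
Import HBNNSimple.

(** The variation measure is finite on compact sets, but Tonelli asks for sigma-finiteness on the
    whole space; so it is restricted to [S]. A simple function below [f] on [S] vanishes outside [S]
    and thus has the same integral for both measures. *)
Lemma integral_le_mfrestr (f : X -> \bar R) : (forall x, 0 <= f x)%E ->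
  (\int[mu]_(x in S) f x <= \int[mfrestr mS muS]_(x in S) f x)%E.
Proof.
move=> f0; rewrite integral_mkcond [leRHS]integral_mkcond.
have fS0 x : (0 <= (f \_ S) x)%E by rewrite patchE; case: ifP.
rewrite ge0_integralTE// [leRHS]ge0_integralTE//.
apply: ge_ereal_sup => _ [h hf <-].
have -> : sintegral mu h = sintegral (mfrestr mS muS) h.
  rewrite !sintegralEnnsfun; apply: eq_fsbigr => y; rewrite inE/= => y0.
  congr (_ * _)%E; rewrite /mfrestr /mrestr; congr (mu _).
  apply/esym/setIidPl => x /= hx; apply: contrapT => Sx.
  have := hf x; rewrite patchE memNset// hx => /=.
  (* Outside [S] the extended function takes the default value [point], which is [0]. *)
  by rewrite -[point]/0%E lee_fin leNgt y0.
by apply: ereal_sup_ubound; exists h.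
Qed.

End measure_complements.

Lemma enorm0 {R : realType} m n : enorm (0 : 'M[R]_(m, n)) = 0.
Proof.
rewrite /enorm big1 ?sqrtr0// => i _; rewrite big1// => j _.
by rewrite mxE expr0n.
Qed.

Section null_sets.
Context {R : realType} {d : nat}.
Local Notation V := 'rV[R]_d.
Local Notation lam := (@lebesgue_rV R d).

Lemma ae_affine (P : V -> Prop) (l : R) (x : V) : l != 0 ->
  {ae lam, forall y, P y} -> {ae lam, forall z, P (x + l *: z)}.
Proof.
move=> l0 [N [mN N0 PN]].
have ma : measurable_fun setT (fun z : V => x + l *: z).
  by under eq_fun do rewrite addrC; exact: measurable_affine.
exists ((fun z : V => x + l *: z) @^-1` N); split.
- by rewrite -[X in measurable X]setTI; exact: ma.
- have mI : measurable_fun setT (fun y : V => (\1_N y)%:E : \bar R).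
    by apply/measurable_EFinP; exact: measurable_indic.
  have i0 (y : V) : (0 <= (\1_N y)%:E :> \bar R)%E by rewrite lee_fin.
  have := ge0_integral_affine x l0 mI i0.
  rewrite (integral_indic lam measurableT mN) setIT.
  rewrite [X in (_ * X)%E](_ : _ = 0%E)// mule0 => H.
  rewrite -[X in lam X]setIT -[LHS](integral_indic lam measurableT); last first.
    by rewrite -[X in measurable X]setTI; exact: ma.
  rewrite -[RHS]H; apply: eq_integral => z _; rewrite addrC /=.
  by rewrite !indicE; congr (_%:R%:E); apply/idP/idP => /set_mem h; apply/mem_set.
- by move=> z Pz; apply: PN.
Qed.

Lemma lebesgue_rV_setT_gt0 : (0 < lam setT)%E.
Proof.
apply: lt_le_trans (lebesgue_eball_gt0 (0 : V) (ltr01)) _.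
by apply: le_measure; rewrite ?inE//; exact: measurable_eball.
Qed.

End null_sets.

Section nice_versions.
Context {R : realType} {d m n : nat}.
Local Notation V := 'rV[R]_d.
Local Notation lam := (@lebesgue_rV R d).
Implicit Types (S : set V) (w v : V -> 'M[R]_(m, n)).

Lemma measurable_indic_scale {dX : measure_display} {X : measurableType dX} (E : set X)
    (g : X -> 'M[R]_(m, n)) :
  measurable E -> measurable_fun E g ->
  measurable_fun setT (fun x => (\1_E x : R) *: g x).
Proof.
move=> mE mg; apply: measurable_fun_coordP => i j.
have -> : (fun x => ((\1_E x : R) *: g x) i j) = (fun x => g x i j) \_ E.
  apply/funext => x; rewrite !mxE patchE indicE; case: ifP => xE.
    by rewrite mul1r.
  by rewrite mul0r.
apply/(measurable_restrictT _ mE).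
exact: (measurableT_comp (measurable_coord i j) mg).
Qed.

(** The substitute for [w] in all estimates: integrals over the whole space make sense for [v], and
    norms of [w] over [S] become norms of [v] over the whole space. *)
Definition nice_version S w v : Prop :=
  [/\ measurable_fun setT v, forall x, ~ S x -> v x = 0 &
      {ae lam, forall y, S y -> w y = v y}].

Lemma nice_version_exists S Om w : measurable S -> S `<=` Om -> measurable Om ->
  ae_measurable lam Om w -> exists v, nice_version S w v.
Proof.
move=> mS SOm mOm [g mg wg]; exists (fun x => (\1_S x : R) *: g x); split.
- by apply: measurable_indic_scale => //; exact: measurable_funS mg.
- by move=> x Sx; rewrite indicE memNset// scale0r.
- apply: filterS wg => y wgy Sy; rewrite indicE mem_set// scale1r wgy//.
  exact: SOm.
Qed.

Lemma nice_Lq1 S w v : nice_version S w v ->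
  Lq_norm 1%E S w = (\int[lam]_x (enorm (v x))%:E)%E.
Proof.
move=> [_ v0 wv]; rewrite /Lq_norm Lnorm1; apply: ae_eq_lower_integral.
apply: filterS wv => x wvx _; rewrite patchE; case: ifPn => [/set_mem/wvx ->|].
  by rewrite gee0_abs// lee_fin enorm_ge0.
move=> /negP xS; rewrite v0 => [|Sx]; last by apply: xS; exact: mem_set.
by rewrite abse0 enorm0.
Qed.

Lemma nice_Lq (q : nat) S w v : nice_version S w v ->
  (Lq_norm q.+1%:R%:E S w `^ q.+1%:R = \int[lam]_x (enorm (v x) ^+ q.+1)%:E)%E.
Proof.
move=> [_ v0 wv]; have q0 : q.+1%:R != 0 :> R by rewrite pnatr_eq0.
rewrite /Lq_norm poweR_Lnorm//; apply: ae_eq_lower_integral.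
apply: filterS wv => x wvx _; rewrite patchE; case: ifPn => [/set_mem/wvx ->|].
  by rewrite gee0_abs ?lee_fin ?enorm_ge0// poweR_EFin powR_mulrn// enorm_ge0.
move=> /negP xS; rewrite v0 => [|Sx]; last by apply: xS; exact: mem_set.
rewrite [X in (X `^ _)%E](_ : _ = 0%E); last exact: abse0.
by rewrite poweR0r// enorm0 expr0n.
Qed.

(** Where the essential bound fails the field is set to zero, so that the bound holds at every
    point. *)
Lemma nice_Lqoo S w v (M : R) : 0 <= M -> nice_version S w v ->
  (Lq_norm +oo%E S w <= M%:E)%E ->
  exists2 v', nice_version S w v' & forall x, enorm (v' x) <= M.
Proof.
move=> M0 [mv v0 wv]; rewrite /Lq_norm unlock lebesgue_rV_setT_gt0 => /ess_supP wM.
pose E := [set x | enorm (v x) <= M].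
have mE : measurable E.
  have -> : E = (fun x => enorm (v x)) @^-1` `]-oo, M].
    by apply/seteqP; split => x /=; rewrite in_itv.
  by rewrite -[X in measurable X]setTI; apply: measurable_enorm.
exists (fun x => (\1_E x : R) *: v x).
  split.
  - by apply: measurable_indic_scale => //; exact: measurable_funTS.
  - by move=> x /v0 ->; rewrite scaler0.
  - apply: filterS2 wM wv => x wMx wvx Sx; rewrite wvx//.
    move: wMx; rewrite /= patchE mem_set// wvx// gee0_abs ?lee_fin ?enorm_ge0// => vM.
    by rewrite indicE mem_set// scale1r.
move=> x; rewrite indicE; have [xE|xE] := boolP (x \in E).
  by rewrite scale1r; exact: set_mem xE.
by rewrite scale0r enorm0.
Qed.

End nice_versions.

Section nice_fields.
Context {R : realType} {d : nat}.
Local Notation V := 'rV[R]_d.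
Local Notation lam := (@lebesgue_rV R d).
Implicit Types (S : set V) (w v : V -> V).

Definition integrable_field v := forall i, lam.-integrable setT (EFin \o (fun y => v y 0 i)).

Lemma integrable_field_enorm v : measurable_fun setT v ->
  (\int[lam]_x (enorm (v x))%:E < +oo)%E -> integrable_field v.
Proof.
move=> mv vy i; apply/integrableP; split.
  by apply/measurable_EFinP; exact: (measurableT_comp (measurable_coord 0 i) mv).
apply: le_lt_trans vy; apply: le_lower_integral => // x _.
by rewrite lee_fin; exact: coord_le_enorm.
Qed.

(** [t <= 1 + t^(q + 1)], and [S] has finite measure. *)
Lemma integrable_field_pow (q : nat) S v : measurable S -> (lam S < +oo)%E ->
  measurable_fun setT v -> (forall x, ~ S x -> v x = 0) ->
  (\int[lam]_x (enorm (v x) ^+ q.+1)%:E < +oo)%E -> integrable_field v.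
Proof.
move=> mS Sy mv v0 vy; apply: integrable_field_enorm => //.
have m2 : measurable_fun setT (fun x => (enorm (v x) ^+ q.+1)%:E).
  by apply/measurable_EFinP; apply: measurable_funX; exact: measurable_enorm.
apply: (@le_lt_trans _ _ (\int[lam]_x ((\1_S x)%:E + (enorm (v x) ^+ q.+1)%:E))%E).
  apply: le_lower_integral => x _; first by rewrite lee_fin enorm_ge0.
  rewrite -EFinD lee_fin indicE; case: (boolP (x \in S)) => [_|xS] /=.
    have e0 := enorm_ge0 (v x); have [e1|/ltW e1] := leP (enorm (v x)) 1.
      by apply: le_trans e1 _; rewrite lerDl exprn_ge0.
    by apply: (@le_trans _ _ (enorm (v x) ^+ q.+1)); [exact: ler_eXnr|rewrite lerDr].
  by rewrite v0 ?enorm0 ?expr0n ?addr0// => Sx; move/negP : xS; apply; exact: mem_set.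
rewrite ge0_integralD//; last 2 first.
- by apply/measurable_EFinP; exact: measurable_indic.
- by move=> x _; rewrite lee_fin exprn_ge0// enorm_ge0.
by rewrite lte_add_pinfty// integral_indic// setIT.
Qed.

End nice_fields.

Section flux_congruence.
Context {R : realType} {d : nat}.
Local Notation V := 'rV[R]_d.
Local Notation lam := (@lebesgue_rV R d).
Local Notation B := (@unit_ball R d).

Variable rho : V -> R.
Hypothesis rho_kernel : mollifier_kernel rho.

Lemma conv_congr (S : set V) (f g : V -> R) (l : R) (x : V) : 0 < l ->
  (forall y, enorm (x - y) < l -> S y) ->
  {ae lam, forall y, S y -> f y = g y} -> conv rho l f x = conv rho l g x.
Proof.
move=> l0 xS fg; rewrite /conv /Rintegral; congr fine.
apply: ae_eq_lower_integral; apply: filterS fg => y fgy _.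
have [yl|yl] := ltP (enorm (x - y)) l; first by rewrite fgy//; exact: xS.
by rewrite (rescale_eq0 (kernel_eq0 rho_kernel) l0 yl) !mulr0.
Qed.

Variables (u v : V -> V) (S : set V).
Hypothesis uv : {ae lam, forall y, S y -> u y = v y}.

(** The value at [x] enters the increment for every [z], so agreement almost everywhere is
    complemented by [u x = v x]. *)
Lemma flux_DR_congr (l : R) (x : V) : 0 < l ->
  (forall y, enorm (y - x) < l -> S y) -> u x = v x ->
  flux_DR rho u l x = flux_DR rho v l x.
Proof.
move=> l0 xS uvx; rewrite !flux_DRE /Rintegral; congr fine.
apply: ae_eq_lower_integral.
have lne0 : l != 0 by rewrite gt_eqF.
have := ae_affine x lne0 uv; apply: filterS => z uvz _; congr EFin.
have [z1|z1] := ltP (enorm z) 1.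
  have -> : delta u l x z = delta v l x z.
    rewrite /delta uvx uvz//; apply: xS; rewrite addrAC subrr add0r enormZ.
    by rewrite gtr0_norm// gtr_pMr.
  by [].
rewrite !big1// => j _; rewrite (kernel_partial_eq0 rho_kernel j z1).
  by rewrite mul0r mulr0.
by rewrite mul0r mulr0.
Qed.

(** The margin [e] is for the gradient: the mollified fields must agree near [x] and not only at
    [x]. *)
Lemma flux_CET_congr (l e : R) (x : V) : 0 < l -> 0 < e ->
  (forall y, `|y - x| < l + e -> S y) ->
  flux_CET rho u l x = flux_CET rho v l x.
Proof.
move=> l0 e0 xS; rewrite !flux_CETE_grad.
have uvi i : {ae lam, forall y, S y -> u y 0 i = v y 0 i}.
  by apply: filterS uv => y /[apply] ->.
have near_x (y : V) : `|y - x| < e -> forall z, enorm (y - z) < l -> S z.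
  move=> yx z yz; apply: xS.
  have -> : z - x = (y - x) - (y - z) by rewrite opprB [RHS]addrC addrA subrK.
  apply: le_lt_trans (ler_normB _ _) _; rewrite addrC; apply: ltrD => //.
  exact: le_lt_trans (norm_le_enorm _) yz.
have xx : `|x - x| < e by rewrite subrr normr0.
apply: eq_bigr => i _; apply: eq_bigr => j _; congr (_ * _).
  rewrite /reynolds !(conv_congr l0 (near_x x xx) (uvi _)); congr (_ - _).
  apply: (conv_congr l0 (near_x x xx)).
  by apply: filterS uv => y /[apply] ->.
apply: near_eq_derive; apply/nbhs_ballP; exists e => //= y.
rewrite -ball_normE/= distrC => xy.
exact: (conv_congr l0 (near_x y xy) (uvi i)).
Qed.

End flux_congruence.

(** * The strain of a mollified field *)

Section strain_bounds.
Context {R : realType} {d : nat}.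
Local Notation V := 'rV[R]_d.
Local Notation lam := (@lebesgue_rV R d).

Variable rho : V -> R.
Hypothesis rho_kernel : mollifier_kernel rho.
Variable C : R.
Hypothesis rhoC : forall z, `|rho z| <= C.
Hypothesis rhoC' : forall j z, `|partial j rho z| <= C.
Variables (Om S : set V) (w v : V -> V) (l : R) (y : V).
Hypothesis SOm : S `<=` Om.
Hypothesis wv : nice_version S w v.
Hypothesis intv : integrable_field v.
Hypothesis l0 : 0 < l.
Hypothesis yS : forall s, `|y - s| <= l -> S s.

Let phi (s : V) : R := rescale rho l (y - s).

Let phi_out s : ~ S s -> phi s = 0.
Proof.
move=> Ss; apply: (rescale_eq0 (kernel_eq0 rho_kernel) l0).
rewrite leNgt; apply/negP => ys; apply: Ss; apply: yS.
exact: le_trans (norm_le_enorm _) (ltW ys).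
Qed.

Let pairing_symconv i j : symgrad_pairing Om w i j phi = symconv rho l v i j y.
Proof.
have [_ _ wv'] := wv.
apply: (symgrad_pairing_conv rho_kernel rhoC rhoC' (S := S)) => // s ys.
by apply: yS; exact: le_trans (norm_le_enorm _) (ltW ys).
Qed.

Let phi_test : test_function Om phi.
Proof. by apply: test_function_kernel => // s ys; apply: SOm; exact: yS. Qed.

(** The kernel around [y] vanishes outside [S], so testing [Ew] against it gives the strain of the
    mollified cut-off field, although the cut-off field itself need not have an integrable
    strain. *)
Lemma symconv_le_symgrad (e e' : V -> 'M[R]_d) i j : is_symgrad Om w e ->
  nice_version S e e' ->
  (`|symconv rho l v i j y|%:E <=
   \int[lam]_s (`|rescale rho l (y - s)|%:E * (enorm (e' s))%:E))%E.
Proof.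
move=> [_ eE] [_ e'0 ee']; rewrite -pairing_symconv -(eE _ phi_test).
apply: le_trans (abs_Rintegral_le _ _ _) _.
rewrite integral_mkcond; apply: ae_le_lower_integral.
- by move=> s _; rewrite patchE; case: ifP => // _; rewrite lee_fin.
- by move=> s _; rewrite mule_ge0// lee_fin enorm_ge0.
apply: filterS ee' => s ees _; rewrite patchE; case: ifP => [_|_]; last first.
  by rewrite mule_ge0// lee_fin enorm_ge0.
have [Ss|Ss] := pselect (S s); last first.
  by rewrite phi_out// mulr0 normr0 mule_ge0// lee_fin enorm_ge0.
rewrite ees// -EFinM lee_fin normrM mulrC ler_wpM2l//.
exact: coord_le_enorm.
Qed.

(** In the polar form the density has norm [1], so the strain is at most the kernel integrated
    against the variation [mu]. *)
Lemma symconv_le_variation (mu : {measure set V -> \bar R}) i j :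
  is_symgrad_variation Om w mu ->
  (`|symconv rho l v i j y|%:E <= \int[mu]_(s in S) `|rescale rho l (y - s)|%:E)%E.
Proof.
move=> [sg [_ _ sg1 sgE]]; rewrite -pairing_symconv -(sgE _ phi_test).
apply: le_trans (abs_Rintegral_le _ _ _) _.
rewrite integral_mkcond [leRHS]integral_mkcond; apply: ae_le_lower_integral.
- by move=> s _; rewrite patchE; case: ifP => // _; rewrite lee_fin.
- by move=> s _; rewrite patchE; case: ifP => // _; rewrite lee_fin.
apply: filterS sg1 => s sgs _; rewrite !patchE; case: ifP => [/set_mem Oms|_]; last first.
  by case: ifP => // _; rewrite lee_fin.
case: ifPn => [_|/negP Ss]; last first.
  by rewrite -/(phi s) phi_out ?mulr0 ?normr0// => Ss'; apply: Ss; exact: mem_set.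
rewrite lee_fin normrM mulrC ler_piMr// -(sgs Oms); exact: coord_le_enorm.
Qed.

End strain_bounds.

(** * Estimates at a fixed time *)

Section besov_increments.
Context {R : realType} {d : nat}.
Local Notation V := 'rV[R]_d.
Local Notation lam := (@lebesgue_rV R d).
Local Notation B := (@unit_ball R d).
Local Notation vB := (@vol_B R d).

Lemma mem_eball_scale (x z : V) (l : R) : 0 < l ->
  (l *: z + x \in eball x l) = (z \in B).
Proof.
move=> l0; have E : eball x l (l *: z + x) <-> B z.
  by rewrite /unit_ball /eball/= subr0 addrK enormZ gtr0_norm// gtr_pMr.
by apply/idP/idP => /set_mem/E h; exact/mem_set.
Qed.

Lemma ge0_integral_eball (f : V -> \bar R) (x : V) (l : R) : 0 < l ->
  measurable_fun setT f -> (forall y, 0 <= f y)%E ->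
  (\int[lam]_(y in eball x l) f y =
   (l ^+ d)%:E * \int[lam]_(z in B) f (x + l *: z)%R)%E.
Proof.
move=> l0 mf f0; rewrite integral_mkcond [in RHS]integral_mkcond.
have mfb : measurable_fun setT (f \_ (eball x l)).
  apply/(measurable_restrictT _ (measurable_eball x l)).
  exact: measurable_funTS.
have fb0 y : (0 <= (f \_ (eball x l)) y)%E by rewrite patchE; case: ifP.
have -> : (\int[lam]_z ((fun z => f (x + l *: z)%R) \_ B) z =
    \int[lam]_z (f \_ (eball x l)) (l *: z + x)%R)%E.
  by apply: eq_integral => z _; rewrite !patchE mem_eball_scale// addrC.
rewrite ge0_integral_affine ?gt_eqF// muleA -EFinM gtr0_norm//.
by rewrite divff ?mul1e// expf_neq0// gt_eqF.
Qed.

Lemma ball_volE (l : R) : 0 < l -> ball_vol (d := d) l = l ^+ d * vB.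
Proof.
move=> l0; rewrite /ball_vol -[X in fine X]mul1e -integral_cst; last exact: measurable_eball.
rewrite ge0_integral_eball// [X in (_ * X)%E](_ : _ = vB%:E) -?EFinM//.
by rewrite -[vB]mul1r -integral_cst_B.
Qed.

Lemma vol_B_gt0 : 0 < vB.
Proof.
rewrite /vol_B fine_gt0// unit_ball_lty andbT; exact: lebesgue_eball_gt0.
Qed.

Variables (K : set V) (dl : R) (w v : V -> V).
Hypothesis mK : measurable K.
Hypothesis wv : nice_version (nbd K dl) w v.

Let K_nbd x y : K x -> enorm (y - x) < dl -> nbd K dl y.
Proof.
move=> Kx yx; exists x => //; apply: le_trans (norm_le_enorm _) (ltW yx).
Qed.

(** The third power of the modulus: [l^(-1/3)] becomes [1 / l], and the normalisation of the ball
    becomes [1 / vB] after the substitution [y = l z]. *)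
Lemma besov_cubic_le (l m : R) : 0 < l -> l < dl -> 0 <= m ->
  (besov_modulus 3^-1 3 K w l <= m%:E)%E ->
  (\int[lam]_(x in K) \int[lam]_(z in B) (enorm (delta v l x z) ^+ 3)%:E <=
   (l * vB * m ^+ 3)%:E)%E.
Proof.
move=> l0 ldl m0; rewrite /besov_modulus; set I := (\int[lam]_(x in K) _)%E => Im.
have [mv v0 wvae] := wv.
set Q := (\int[lam]_(x in K) _)%E.
have vB0 := vol_B_gt0.
have mQ : measurable_fun setT (fun x => (\int[lam]_(z in B) (enorm (delta v l x z) ^+ 3)%:E)%E).
  apply: (measurable_integral_set lam (@measurable_unit_ball R d)
    (g := fun p => (enorm (delta v l p.1 p.2) ^+ 3)%:E)).
    apply/measurable_EFinP; apply: measurable_funX.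
    exact: (measurable_enorm (measurable_delta l mv)).
  by move=> p; rewrite lee_fin exprn_ge0// enorm_ge0.
have IQ : I = (vB^-1%:E * Q)%E.
  rewrite /Q -ge0_integralZl//; last 3 first.
  - exact: measurable_funTS.
  - by move=> x _; apply: integral_ge0 => z _; rewrite lee_fin exprn_ge0// enorm_ge0.
  - by rewrite lee_fin invr_ge0 ltW.
  apply: ae_eq_lower_integral; apply: filterS (wvae) => x wvx Kx.
  have dl0 : 0 < dl by exact: lt_trans ldl.
  have -> : (\int[lam]_(y in eball 0 l) (enorm (w (x + y)%R - w x) `^ 3)%:E =
      \int[lam]_(y in eball 0 l) (enorm (v (x + y)%R - v x) ^+ 3)%:E)%E.
    apply: ae_eq_lower_integral.
    have := ae_affine x (oner_neq0 R) wvae; apply: filterS => y; rewrite scale1r => wvy yl.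
    rewrite wvx; last by apply: (K_nbd Kx); rewrite subrr enorm0.
    rewrite wvy ?powR_mulrn ?enorm_ge0//; apply: (K_nbd Kx).
    rewrite addrAC subrr add0r; apply: lt_trans ldl.
    by move: yl; rewrite /eball/= subr0.
  rewrite (@ge0_integral_eball (fun y => (enorm (v (x + y)%R - v x) ^+ 3)%:E) 0)//; last 2 first.
  - apply/measurable_EFinP; apply: measurable_funX; apply: measurable_enorm.
    have := measurable_delta1 1 x mv; rewrite /delta.
    by under eq_fun do rewrite scale1r.
  - by move=> y; rewrite lee_fin exprn_ge0// enorm_ge0.
  rewrite ball_volE// muleA -EFinM invfM mulrAC mulVf ?mul1r; last first.
    by rewrite expf_neq0// gt_eqF.
  congr (_ * _)%E; apply: eq_integral => z _; by rewrite /delta add0r.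
have Q0 : (0 <= Q)%E.
  by do 2 apply: integral_ge0 => ? _; rewrite lee_fin exprn_ge0// enorm_ge0.
have -> : (Q = vB%:E * I)%E.
  by rewrite IQ muleA -EFinM divff ?mul1e// gt_eqF.
have I0 : (0 <= I)%E by rewrite IQ mule_ge0// lee_fin invr_ge0 ltW.
suff I3 : (I <= (l * m ^+ 3)%:E)%E.
  apply: le_trans (lee_wpmul2l _ I3) _; first by rewrite lee_fin ltW.
  by rewrite -EFinM lee_fin mulrCA mulrA.
have l13 : 0 < l `^ (- 3^-1) by rewrite powR_gt0.
have I1 : (I `^ 3^-1 <= (m * l `^ 3^-1)%:E)%E.
  rewrite -lee_pdivlMl// in Im.
  by apply: le_trans Im _; rewrite -EFinM lee_fin powRN invrK mulrC.
have -> : I = ((I `^ 3^-1) `^ 3)%E.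
  by rewrite -poweRrM mulVf ?poweRe1// pnatr_eq0.
apply: le_trans (gt0_ler_poweR _ _ _ I1) _.
- by [].
- by rewrite in_itv/= poweR_ge0 leey.
- by rewrite in_itv/= leey lee_fin mulr_ge0// powR_ge0.
rewrite poweR_EFin lee_fin powR_mulrn; last by rewrite mulr_ge0// powR_ge0.
have E : (l `^ 3^-1) ^+ 3 = l.
  by rewrite -powR_mulrn ?powR_ge0// -powRrM mulVf ?pnatr_eq0// powRr1// ltW.
by rewrite exprMn E mulrC.
Qed.

End besov_increments.

(** * Bounds on both fluxes by the strain *)

Section mollified_case_bounds.
Context {R : realType} {d : nat}.
Local Notation V := 'rV[R]_d.
Local Notation lam := (@lebesgue_rV R d).
Local Notation B := (@unit_ball R d).
Local Notation vB := (@vol_B R d).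

Variable rho : V -> R.
Hypothesis rho_kernel : mollifier_kernel rho.
Variable C : R.
Hypothesis C_gt0 : 0 < C.
Hypothesis rhoC : forall z, `|rho z| <= C.
Hypothesis rhoC' : forall j z, `|partial j rho z| <= C.

Let C_ge0 : 0 <= C. Proof. exact: ltW. Qed.
Let mrho := measurable_kernel rho_kernel.
Let rho0 := kernel_eq0 rho_kernel.
Let vB0 : 0 <= vB. Proof. exact: vol_B_ge0. Qed.

Variables (Om K : set V) (dl : R) (w : V -> V).
Hypothesis dl0 : 0 < dl.
Hypothesis cK : compact K.
Let S := nbd K dl.
Hypothesis SOm : S `<=` Om.

Let mK : measurable K. Proof. exact: compact_measurable_rV. Qed.
Let cS : compact S. Proof. exact: nbd_compact. Qed.
Let mS : measurable S. Proof. exact: compact_measurable_rV. Qed.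
Let Sy : (lam S < +oo)%E. Proof. exact: compact_lebesgue_lty. Qed.

Let in_S (l eps : R) (x z y : V) : 0 < l -> l + eps <= dl -> K x -> B z ->
  `|x + l *: z - y| <= eps -> S y.
Proof.
move=> l0 le_dl Kx; rewrite /unit_ball /eball/= subr0 => z1 xy; exists x => //.
have -> : y - x = l *: z - (x + l *: z - y).
  by rewrite (addrC x) -addrA opprD addrA subrr add0r opprB.
apply: le_trans (ler_normB _ _) _; apply: le_trans le_dl; apply: lerD => //.
rewrite normrZ gtr0_norm// ger_pMr//.
exact: le_trans (norm_le_enorm _) (ltW z1).
Qed.

Lemma nice_bounded_integrable (v : V -> V) (M : R) : nice_version S w v ->
  (forall x, enorm (v x) <= M) -> integrable_field v.
Proof.
move=> [mv v0 _] vM; apply: integrable_field_enorm => //.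
apply: (@le_lt_trans _ _ (\int[lam]_(x in S) (cst M%:E x))%E).
  rewrite [leRHS]integral_mkcond; apply: le_lower_integral => x _.
    by rewrite lee_fin enorm_ge0.
  rewrite patchE; case: ifPn => [_|/negP xS]; first by rewrite lee_fin.
  by rewrite v0 ?enorm0// => Sx; apply: xS; exact: mem_set.
rewrite integral_cst//.
have M0 : 0 <= M by exact: le_trans (enorm_ge0 _) (vM 0).
by rewrite lte_mul_pinfty.
Qed.

Lemma nice_flux_DR_eq (v v' : V -> V) (l : R) : 0 < l -> l < dl ->
  nice_version S w v -> nice_version S w v' ->
  (\int[lam]_(x in K) `|flux_DR rho v l x|%:E =
   \int[lam]_(x in K) `|flux_DR rho v' l x|%:E)%E.
Proof.
move=> l0 ldl [_ _ wv] [_ _ wv']; apply: ae_eq_lower_integral.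
have vv' : {ae lam, forall y, S y -> v y = v' y}.
  by apply: filterS2 wv wv' => y h1 h2 Sy'; rewrite -h1// h2.
apply: filterS (vv') => x vvx Kx; congr (`|_|%:E).
apply: (flux_DR_congr rho_kernel vv') => //.
  by move=> y yx; exists x => //; apply: le_trans (norm_le_enorm _) (ltW (lt_trans yx ldl)).
by apply: vvx; apply: sub_nbd => //; exact: ltW.
Qed.

(* [flux_DR_mollify_bound] applies to [mollify rho eps v] with constants that do
   not depend on [eps]; let [eps -> 0]. *)
Lemma flux_DR_bound (v : V -> V) (l a Dl M : R) (P : R -> V -> \bar R)
    (X : \bar R) : 0 < l -> 2 * l < dl -> nice_version S w v ->
  (forall x, enorm (v x) <= M) -> 0 <= a -> 0 <= Dl ->
  (forall eps : R, 0 < eps < dl / 2 -> measurable_fun setT (P eps)) ->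
  (forall (eps : R) (x : V), 0 <= P eps x)%E ->
  (forall eps : R, 0 < eps < dl / 2 -> (\int[lam]_x P eps x <= X)%E) ->
  (forall (eps : R) (y : V), 0 < eps < dl / 2 -> (forall s, `|y - s| <= eps -> S s) ->
    forall i j, (`|symconv rho eps v i j y|%:E <= a%:E + P eps y)%E) ->
  (forall (eps : R) (x z : V) i, 0 < eps < dl / 2 -> K x -> B z ->
    `|conv rho eps (fun y => v y 0 i) (x + l *: z) -
      conv rho eps (fun y => v y 0 i) x| <= Dl) ->
  (\int[lam]_(x in K) `|flux_DR rho v l x|%:E <=
   (C * d%:R ^+ 2)%:E * ((a * (2 * C ^+ 2 * vB ^+ 2))%:E * quad_incr v l +
     (d%:R * Dl ^+ 2 * vB)%:E * X))%E.
Proof.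
move=> l0 ldl nv vM a0 Dl0 mP P0 PX symP deltaP; have [mv v0 _] := nv.
have intv := nice_bounded_integrable nv vM.
have M0 : 0 <= M by exact: le_trans (enorm_ge0 _) (vM 0).
have vM' y i : `|v y 0 i| <= M by exact: le_trans (coord_le_enorm _ _ _) (vM y).
have dl20 : 0 < dl / 2 by rewrite divr_gt0.
apply: (flux_DR_mollify_le rho_kernel rhoC rhoC' l0 dl20 mK mv intv vM' M0) => eps epsd.
have /andP[eps0 eps1] := epsd.
have Dl20 : 0 <= d%:R * Dl ^+ 2 by rewrite mulr_ge0// exprn_ge0.
apply: le_trans (flux_DR_mollify_bound rho_kernel C_gt0 rhoC rhoC' l0 eps0 mK
  mv intv vM' a0 Dl20 (mP _ epsd) (P0 eps) _ _) _.
- move=> i j x z Kx Bz; apply: symP => // s xs.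
  by apply: (in_S l0 _ Kx Bz xs); lra.
- move=> x z Kx Bz; rewrite enorm_rV_sq.
  apply: (@le_trans _ _ (\sum_(i < d) Dl ^+ 2)).
    apply: ler_sum => i _; rewrite -real_normK ?num_real// lerXn2r ?nnegrE//.
    by rewrite /delta !mxE; exact: deltaP.
  by rewrite sumr_const card_ord -[leLHS]mulr_natl.
apply: lee_wpmul2l; first by rewrite lee_fin mulr_ge0// exprn_ge0.
apply: leeD.
  rewrite EFinM -muleA; apply: lee_wpmul2l; first by rewrite lee_fin.
  exact: quad_incr_mollify.
by apply: lee_wpmul2l; [rewrite lee_fin mulr_ge0|exact: PX].
Qed.

Lemma measurable_potential (nu : {sigma_finite_measure set V -> \bar R})
    (A : set V) (g : V -> \bar R) (eps : R) : measurable A ->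
  measurable_fun setT g -> (forall s, 0 <= g s)%E ->
  measurable_fun setT (fun y : V =>
    \int[nu]_(s in A) (`|rescale rho eps (y - s)%R|%:E * g s))%E.
Proof.
move=> mA mg g0.
have mG : measurable_fun setT (fun p : V * V => (`|rescale rho eps (p.1 - p.2)%R|%:E * g p.2)%E).
  apply: emeasurable_funM; last exact: (measurableT_comp mg measurable_snd).
  apply/measurable_EFinP; apply: measurableT_comp => //.
  exact: (measurableT_comp (measurable_rescale mrho eps) measurable_fst_subr_snd).
by apply: (measurable_integral_set nu mA mG) => p; rewrite mule_ge0.
Qed.

(** Splits an integrable strain into a part bounded by [N] and a tail that is small in L^1 for large
    [N]. *)
Definition above (N : R) (e' : V -> 'M[R]_d) (s : V) : R :=
  if enorm (e' s) <= N then 0 else enorm (e' s).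

Lemma above_ge0 N e' s : 0 <= above N e' s.
Proof. by rewrite /above; case: ifP => // _; exact: enorm_ge0. Qed.

Lemma enorm_le_above (N : R) e' s : 0 <= N -> enorm (e' s) <= N + above N e' s.
Proof. by move=> N0; rewrite /above; case: ifP => [|_]; rewrite ?addr0// lerDr. Qed.

Lemma measurable_above (N : R) e' : measurable_fun setT e' ->
  measurable_fun setT (above N e').
Proof.
move=> me; have mn := measurable_enorm me.
apply: measurable_fun_ifT => //; exact: measurable_fun_ler.
Qed.

Lemma symconv_le_above (v : V -> V) (e e' : V -> 'M[R]_d) (N eps : R) (y : V) i j :
  0 < eps -> (forall s, `|y - s| <= eps -> S s) -> 0 <= N ->
  nice_version S w v -> integrable_field v ->
  is_symgrad Om w e -> nice_version S e e' ->
  (`|symconv rho eps v i j y|%:E <= (N * (C * vB))%:E +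
    \int[lam]_s (`|rescale rho eps (y - s)|%:E * (above N e' s)%:E))%E.
Proof.
move=> eps0 yS N0 nv intv we ne.
apply: le_trans (symconv_le_symgrad rho_kernel rhoC rhoC' SOm nv intv eps0 yS i j we ne) _.
have [me _ _] := ne.
have mr : measurable_fun setT (fun s : V => `|rescale rho eps (y - s)%R|%:E).
  apply/measurable_EFinP; apply: measurableT_comp => //.
  exact: measurable_rescale_subr.
have ma : measurable_fun setT (fun s => (above N e' s)%:E).
  by apply/measurable_EFinP; exact: measurable_above.
apply: (@le_trans _ _ (\int[lam]_s (N%:E * `|rescale rho eps (y - s)|%:E +
    `|rescale rho eps (y - s)|%:E * (above N e' s)%:E))%E).
  apply: le_lower_integral => s _; first by rewrite mule_ge0// lee_fin enorm_ge0.
  rewrite -!EFinM -EFinD lee_fin (mulrC N) -mulrDr ler_wpM2l//.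
  exact: enorm_le_above.
rewrite ge0_integralD//; last 4 first.
- by move=> s _; rewrite mule_ge0.
- exact: measurable_funeM.
- by move=> s _; rewrite mule_ge0// lee_fin above_ge0.
- exact: emeasurable_funM.
apply: leeD => //; rewrite ge0_integralZl// EFinM; apply: lee_wpmul2l; first by rewrite lee_fin.
have := rescale_norm_integral rho_kernel rhoC y eps0.
have rN s : `|rescale rho eps (y - s)| = `|rescale rho eps (s - y)|.
  by rewrite /rescale -(opprB s) scalerN kernel_even.
by under [in X in (_ -> X <= _)%E]eq_integral do rewrite rN.
Qed.

(** The level [N] feeds the constant part of [flux_DR_bound], the tail its potential. Paired with
    the tail, increments are merely bounded by twice the supremum of the mollified field. *)
Lemma flux_DR_symgrad_bound (v : V -> V) (e e' : V -> 'M[R]_d) (N M l : R) :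
  0 < l -> 2 * l < dl -> nice_version S w v -> (forall x, enorm (v x) <= M) ->
  0 <= N -> is_symgrad Om w e -> nice_version S e e' ->
  (\int[lam]_(x in K) `|flux_DR rho v l x|%:E <=
   (C * d%:R ^+ 2)%:E * ((N * (C * vB) * (2 * C ^+ 2 * vB ^+ 2))%:E * quad_incr v l +
     (d%:R * (2 * (C * (M * vB))) ^+ 2 * vB)%:E *
       ((C * vB)%:E * \int[lam]_s (above N e' s)%:E)))%E.
Proof.
move=> l0 ldl nv vM N0 we ne; have [me _ _] := ne.
have intv := nice_bounded_integrable nv vM.
have M0 : 0 <= M by exact: le_trans (enorm_ge0 _) (vM 0).
have ma : measurable_fun setT (fun s => (above N e' s)%:E).
  by apply/measurable_EFinP; exact: measurable_above.
have a0 s : (0 <= (above N e' s)%:E)%E by rewrite lee_fin above_ge0.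
pose P eps y := (\int[lam]_s (`|rescale rho eps (y - s)|%:E * (above N e' s)%:E))%E.
apply: (@flux_DR_bound v l (N * (C * vB)) (2 * (C * (M * vB))) M P) => //.
- by rewrite !mulr_ge0.
- by rewrite !mulr_ge0.
- move=> eps /andP[eps0 _].
  exact: (measurable_potential lam eps measurableT ma a0).
- by move=> eps x; apply: integral_ge0 => s _; rewrite mule_ge0.
- move=> eps /andP[eps0 _].
  exact: (potential_integral rho_kernel C_gt0 rhoC lam eps0 measurableT ma a0).
- by move=> eps y /andP[eps0 _] yS i j; exact: (symconv_le_above i j eps0 yS N0 nv intv we ne).
- move=> eps x z i /andP[eps0 _] _ _.
  have vM' y : `|v y 0 i| <= M by exact: le_trans (coord_le_enorm _ _ _) (vM y).
  apply: le_trans (ler_normB _ _) _; rewrite mulr_natl mulr2n.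
  by apply: lerD; exact: (conv_bounded mrho rhoC rho0).
Qed.

(** A singular strain has no bounded part to split off, so [a = 0]; all smallness has to come from
    the oscillation [W] of the field. *)
Lemma flux_DR_variation_bound (v : V -> V) (mu : {measure set V -> \bar R})
    (W M l : R) : 0 < l -> 2 * l < dl -> nice_version S w v ->
  (forall x, enorm (v x) <= M) -> is_symgrad_variation Om w mu ->
  (mu S < +oo)%E -> 0 <= W ->
  (forall p q, S p -> S q -> `|p - q| <= l -> enorm (v p - v q) <= W) ->
  (\int[lam]_(x in K) `|flux_DR rho v l x|%:E <=
   (C * d%:R ^+ 2)%:E * ((d%:R * (C * (W * vB)) ^+ 2 * vB)%:E *
       ((C * vB)%:E * mu S)))%E.
Proof.
move=> l0 ldl nv vM wmu muS W0 vW; have [mv _ _] := nv.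
have intv := nice_bounded_integrable nv vM.
pose nu := mfrestr mS muS.
have nuS : (\int[nu]_(s in S) cst 1%E s = mu S)%E.
  rewrite integral_cst// mul1e -[RHS](_ : mfrestr mS muS S = mu S)//.
  by rewrite /mfrestr /mrestr setIid.
pose P eps y := (\int[nu]_(s in S) (`|rescale rho eps (y - s)|%:E * cst 1%E s))%E.
have := @flux_DR_bound v l 0 (C * (W * vB)) M P ((C * vB)%:E * mu S)%E.
rewrite mul0r mul0e add0e; apply => //.
- by rewrite !mulr_ge0.
- move=> eps /andP[eps0 _].
  exact: (measurable_potential nu eps mS (measurable_cst _)).
- by move=> eps x; apply: integral_ge0 => s _; rewrite mule_ge0.
- move=> eps /andP[eps0 _]; rewrite -nuS.
  exact: (potential_integral rho_kernel C_gt0 rhoC nu eps0 mS).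
- move=> eps y /andP[eps0 _] yS i j; rewrite add0e.
  apply: le_trans (symconv_le_variation rho_kernel rhoC rhoC' SOm nv intv eps0 yS i j wmu) _.
  rewrite /P; under [leRHS]eq_integral do rewrite mule1.
  by apply: integral_le_mfrestr.
- move=> eps x z i /andP[eps0 eps1] Kx Bz.
  rewrite (conv_shift mrho rhoC _ _ eps0 (intv i)).
  rewrite (convB mrho rhoC _ eps0 (integrable_shift (l *: z) (intv i)) (intv i)).
  rewrite -lee_fin; apply: le_trans (conv_abs_le mrho rhoC rho0 _ eps0 _) _.
    have := integrableB measurableT (integrable_shift (l *: z) (intv i)) (intv i).
    by apply: eq_integrable.
  rewrite EFinM; apply: lee_wpmul2l; first by rewrite lee_fin.
  rewrite -integral_cst_B; apply: le_lower_integral => t Bt; first by rewrite lee_fin.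
  rewrite lee_fin; have zt (r : V) : B r -> `|r| <= 1.
    rewrite /unit_ball /eball/= subr0 => r1.
    exact: le_trans (norm_le_enorm _) (ltW r1).
  apply: (@le_trans _ _ (enorm (v (x + eps *: t + l *: z) - v (x + eps *: t)))).
    by apply: le_trans (coord_le_enorm _ 0 i); rewrite !mxE.
  apply: vW.
  (* [eps] and [l] are both below [dl / 2], so [x + eps t + l z] stays in [S]. *)
  - exists x => //; rewrite -[x + _ + _]addrA [x + _]addrC addrK.
    apply: le_trans (ler_normD _ _) _; rewrite !normrZ !gtr0_norm//.
    have := zt _ Bz; have := zt _ Bt; nra.
  - exists x => //; rewrite addrAC subrr add0r normrZ gtr0_norm//.
    have := zt _ Bt; nra.
  - rewrite addrAC subrr add0r normrZ gtr0_norm// ger_pMr//; exact: zt.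
Qed.

Lemma flux_CET_symgrad_bound (v : V -> V) (e e' : V -> 'M[R]_d) (N l : R) :
  0 < l -> l < dl -> nice_version S w v -> integrable_field v ->
  0 <= N -> (forall x, enorm (e' x) <= N) ->
  is_symgrad Om w e -> nice_version S e e' ->
  (\int[lam]_(x in K) `|flux_CET rho v l x|%:E <=
   ((2 * C ^+ 2 * vB + C) * (d%:R ^+ 2 * (N * (C * vB))))%:E * quad_incr v l)%E.
Proof.
move=> l0 ldl nv intv N0 eN we ne; have [mv _ _] := nv.
have D0 : 0 <= 2 * C ^+ 2 * vB + C by rewrite addr_ge0// !mulr_ge0// exprn_ge0.
have E0 : 0 <= d%:R ^+ 2 * (N * (C * vB)) by rewrite !mulr_ge0// exprn_ge0.
have aboveN s : above N e' s = 0 by rewrite /above eN.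
rewrite -ge0_integralZl ?lee_fin ?mulr_ge0//; last 2 first.
- apply: (measurable_integral_set lam (@measurable_unit_ball R d)
    (g := fun p => (enorm (delta v l p.1 p.2) ^+ 2)%:E)).
    exact: measurable_quad_delta.
  by move=> p; rewrite lee_fin sqr_ge0.
- by move=> x _; apply: integral_ge0 => z _; rewrite lee_fin sqr_ge0.
rewrite [leLHS]integral_mkcond; apply: le_lower_integral => x _.
  by rewrite patchE; case: ifP => // _; rewrite lee_fin.
have I0 : (0 <= \int[lam]_(z in B) (enorm (delta v l x z) ^+ 2)%:E)%E.
  by apply: integral_ge0 => z _; rewrite lee_fin sqr_ge0.
rewrite patchE; case: ifP => [/set_mem Kx|_]; last first.
  by rewrite mule_ge0// lee_fin mulr_ge0.
have := flux_CET_le rho_kernel C_gt0 rhoC x (v x) l0 mv.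
move=> /le_trans; apply.
rewrite EFinM -muleA; apply: lee_wpmul2l; first by rewrite lee_fin.
rewrite muleC; apply: lee_wpmul2r => //; rewrite lee_fin.
have sumc (a : R) : \sum_(i < d) a = d%:R * a by rewrite sumr_const card_ord mulr_natl.
rewrite expr2 -mulrA -!sumc; apply: ler_sum => i _; apply: ler_sum => j _.
have xS s : `|x - s| <= l -> S s.
  by move=> xs; exists x => //; rewrite distrC (le_trans xs)// ltW.
have := symconv_le_above i j l0 xS N0 nv intv we ne.
under eq_integral do rewrite aboveN mule0.
by rewrite integral0 adde0 lee_fin.
Qed.

(** The tensor is controlled by the mean square deviation [Q] from a constant that may depend on
    [x], the strain by its total mass near [K]. *)
Lemma flux_CET_variation_bound (v : V -> V) (mu : {measure set V -> \bar R})
    (Q l : R) : 0 < l -> l < dl -> nice_version S w v -> integrable_field v ->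
  is_symgrad_variation Om w mu -> (mu S < +oo)%E -> 0 <= Q ->
  (forall x, K x -> exists c, (\int[lam]_(z in B)
     (enorm (v (x + l *: z) - c)%R ^+ 2)%:E <= Q%:E)%E) ->
  (\int[lam]_(x in K) `|flux_CET rho v l x|%:E <=
   ((2 * C ^+ 2 * vB + C) * (Q * d%:R ^+ 2))%:E * ((C * vB)%:E * mu S))%E.
Proof.
move=> l0 ldl nv intv wmu muS Q0 HQ; have [mv _ _] := nv.
have D0 : 0 <= 2 * C ^+ 2 * vB + C by rewrite addr_ge0// !mulr_ge0// exprn_ge0.
have E0 : 0 <= (2 * C ^+ 2 * vB + C) * (Q * d%:R ^+ 2) by rewrite !mulr_ge0// exprn_ge0.
pose nu := mfrestr mS muS.
have nuS : (\int[nu]_(s in S) cst 1%E s = mu S)%E.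
  rewrite integral_cst// mul1e -[RHS](_ : mfrestr mS muS S = mu S)//.
  by rewrite /mfrestr /mrestr setIid.
pose P y := (\int[nu]_(s in S) (`|rescale rho l (y - s)|%:E * cst 1%E s))%E.
have P0 y : (0 <= P y)%E by apply: integral_ge0 => s _; rewrite mule_ge0.
have mP : measurable_fun setT P.
  exact: (measurable_potential nu l mS (measurable_cst _)).
apply: (@le_trans _ _ (((2 * C ^+ 2 * vB + C) * (Q * d%:R ^+ 2))%:E * \int[lam]_y P y)%E).
  rewrite -ge0_integralZl ?lee_fin//.
  rewrite [leLHS]integral_mkcond; apply: le_lower_integral => x _.
    by rewrite patchE; case: ifP => // _; rewrite lee_fin.
  rewrite patchE; case: ifP => [/set_mem Kx|_]; last by rewrite mule_ge0.
  have [c cQ] := HQ x Kx.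
  have := flux_CET_le rho_kernel C_gt0 rhoC x c l0 mv.
  move=> /le_trans; apply; rewrite EFinM -muleA; apply: lee_wpmul2l; first by rewrite lee_fin.
  rewrite EFinM -muleA; apply: lee_pmul => //.
  - by apply: integral_ge0 => z _; rewrite lee_fin sqr_ge0.
  - by rewrite lee_fin; apply: sumr_ge0 => i _; exact: sumr_ge0.
  rewrite expr2 EFinM -muleA -!sume_const_ord -sumEFin.
  apply: lee_sum => i _; rewrite -sumEFin; apply: lee_sum => j _.
  have xS s : `|x - s| <= l -> S s.
    by move=> xs; exists x => //; rewrite distrC (le_trans xs)// ltW.
  apply: le_trans (symconv_le_variation rho_kernel rhoC rhoC' SOm nv intv l0 xS i j wmu) _.
  rewrite /P; under [leRHS]eq_integral do rewrite mule1.
  by apply: integral_le_mfrestr.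
apply: lee_wpmul2l; first by rewrite lee_fin.
rewrite -nuS; exact: (potential_integral rho_kernel C_gt0 rhoC nu l0 mS).
Qed.

Lemma conv_dkernelE (f : V -> R) (eps : R) (x h : V) : 0 < eps ->
  lam.-integrable setT (EFin \o f) ->
  eps^-1 * conv (dkernel rho h) eps f x =
  \sum_j h 0 j * partial j (conv rho eps f) x.
Proof.
move=> eps0 intf.
have intj j : lam.-integrable setT (EFin \o (fun y => h 0 j * (f y * rescale (partial j rho) eps (x - y)))).
  exact: (integrableZl measurableT (h 0 j)
    (conv_integrand_integrable (measurable_kernel_partial rho_kernel j) (rhoC' j) x eps0 intf)).
under eq_bigr do rewrite (partial_conv rho_kernel rhoC rhoC')// mulrCA.
rewrite -mulr_sumr; congr (_ * _); rewrite /conv.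
have -> : \int[lam]_y (f y * rescale (dkernel rho h) eps (x - y)) =
    \int[lam]_y \sum_j (h 0 j * (f y * rescale (partial j rho) eps (x - y))).
  apply: eq_Rintegral => y _; rewrite /rescale /dkernel !mulr_sumr.
  by apply: eq_bigr => j _; ring.
rewrite (Rintegral_sum _ intj).2; apply: eq_bigr => j _; rewrite RintegralZl//.
exact: (conv_integrand_integrable (measurable_kernel_partial rho_kernel j) (rhoC' j) x eps0 intf).
Qed.

(** The derivative of [s |-> h . v_eps (x + s h)] is [h . E(v_eps) h], in which only the symmetric
    part of the gradient appears; the mean value theorem concludes. *)
Lemma mollified_strain_le (v : V -> V) (G eps : R) (x h : V) : 0 < eps ->
  integrable_field v ->
  (forall (s : R) i j, 0 <= s <= 1 -> `|symconv rho eps v i j (x + s *: h)| <= G) ->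
  `|\sum_k h 0 k * conv rho eps (fun y => v y 0 k) (x + h) -
    \sum_k h 0 k * conv rho eps (fun y => v y 0 k) x| <= d%:R ^+ 2 * (`|h| ^+ 2 * G).
Proof.
move=> eps0 intv symG; pose ve k y := conv rho eps (fun y => v y 0 k) y.
pose f (y : V) := \sum_k h 0 k * ve k y.
pose df (y : V) := \sum_k h 0 k * \sum_j h 0 j * partial j (ve k) y.
have fd y : is_derive y h f (df y).
  apply: is_derive_sumf => k; apply: is_deriveZ.
  have := is_derive_conv rho_kernel rhoC rhoC' y h eps0 (intv k).
  by rewrite conv_dkernelE.
have dfE y : df y = \sum_k \sum_j h 0 k * h 0 j * symconv rho eps v k j y.
  apply: (mulfI (x := 2)) => //.
  have dfE1 : df y = \sum_k \sum_j h 0 k * h 0 j * partial j (ve k) y.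
    by apply: eq_bigr => k _; rewrite mulr_sumr; apply: eq_bigr => j _; rewrite mulrA.
  rewrite [LHS]mulr_natl mulr2n {1}dfE1 dfE1 {1}exchange_big -big_split mulr_sumr/=.
  apply: eq_bigr => k _; rewrite -big_split mulr_sumr/=.
  apply: eq_bigr => j _; rewrite /symconv (mulrC (h 0 j)) -mulrDr mulrCA; congr (_ * _).
  by rewrite mulrA mulfV// mul1r addrC.
pose g (s : R) := f (x + s *: h).
have gd (s : R) : is_derive s 1 g (df (x + s *: h)) by exact: is_derive_line.
have dgG (s : R) : 0 <= s <= 1 -> `|df (x + s *: h)| <= d%:R ^+ 2 * (`|h| ^+ 2 * G).
  move=> s01; rewrite dfE; apply: le_trans (ler_norm_sum _ _ _) _.
  have sumc (a : R) : \sum_(i < d) a = d%:R * a by rewrite sumr_const card_ord mulr_natl.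
  rewrite expr2 -mulrA -!sumc; apply: ler_sum => k _.
  apply: le_trans (ler_norm_sum _ _ _) _; apply: ler_sum => j _.
  rewrite normrM (normrM (h 0 k)) expr2; apply: ler_pM; [by rewrite mulr_ge0|by []| |exact: symG].
  by apply: ler_pM => //; exact: coord_le_norm.
have gc : {within `[0, 1], continuous g}.
  apply: continuous_subspaceT => s; apply: differentiable_continuous.
  by apply/derivable1_diffP; have [] := gd s.
have [c c01 gE] := MVT_segment ler01 (fun s _ => gd s) gc.
have -> : \sum_k h 0 k * conv rho eps (fun y => v y 0 k) (x + h) = g 1.
  by rewrite /g scale1r.
have -> : \sum_k h 0 k * conv rho eps (fun y => v y 0 k) x = g 0.
  by rewrite /g scale0r addr0.
by rewrite gE subr0 mulr1; apply: dgG; move: c01; rewrite in_itv.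
Qed.

(* Writing [r e_i = h1 - h2] with [h1 = r e_i + r y] and [h2 = r y], each
   [h . v_eps (x)] is comparable to [h . v_eps (x + h)]; averaging over [y] in
   the unit ball bounds [v_eps] pointwise by its L^1 norm. *)
Lemma mollified_bounded (v : V -> V) (e e' : V -> 'M[R]_d) (N : R) i :
  nice_version S w v -> integrable_field v -> 0 <= N ->
  (forall x, enorm (e' x) <= N) -> is_symgrad Om w e -> nice_version S e e' ->
  exists2 M : R, 0 <= M & \forall eps \near 0^'+, forall x, nbd K (dl / 2) x ->
    `|conv rho eps (fun y => v y 0 i) x| <= M.
Proof.
move=> nv intv N0 eN we ne; have [mv _ _] := nv.
have mB : measurable B by exact: measurable_unit_ball.
have mvk k : measurable_fun setT (fun y => v y 0 k).
  exact: (measurableT_comp (measurable_coord 0 k) mv).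
(* Eighths of [dl]: [x] is within [4 r] of [K], a step [h] has length at most [2 r], and the kernel
   has radius below [r]. *)
have [r r0 rdl] : exists2 r : R, 0 < r & dl = 8 * r.
  by exists (dl / 8); [rewrite divr_gt0|field].
pose G := d%:R ^+ 2 * ((2 * r) ^+ 2 * (N * (C * vB))).
have G0 : 0 <= G.
  apply: mulr_ge0; first exact: exprn_ge0.
  by apply: mulr_ge0; [exact: sqr_ge0|rewrite !mulr_ge0].
(* Bounds the L^1 norm of the mollified field for small [eps]; each [+ 1] covers the distance of a
   component from that of [v]. *)
pose J := \sum_k (fine (\int[lam]_x `|v x 0 k|%:E) + 1).
have J0 : 0 <= J.
  by apply: sumr_ge0 => k _; rewrite addr_ge0// fine_ge0// integral_ge0.
have vBgt0 : 0 < vB by exact: vol_B_gt0.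
(* Solves the inequality obtained by integrating [key] over the unit ball, whose left-hand side
   becomes [r * vB] times the mollified component at [x]. *)
pose M := (2 * G * vB + 4 * r * (r ^- d * J)) / (r * vB).
have M0 : 0 <= M.
  by rewrite divr_ge0 ?addr_ge0 ?mulr_ge0 ?invr_ge0 ?exprn_ge0 ?(ltW r0).
exists M => //.
have L1 : \forall eps \near (0 : R)^'+, forall k : 'I_d,
    (\int[lam]_x `|conv rho eps (fun y => v y 0 k) x - v x 0 k|%:E <= 1%:E)%E.
  apply: (@filter_forall _ 'I_d (fun k eps =>
    (\int[lam]_x `|conv rho eps (fun y => v y 0 k) x - v x 0 k|%:E <= 1%:E)%E)) => k.
  exact: (conv_cvg_L1 rho_kernel rhoC ltr01 (intv k)).
have e0 : \forall eps \near (0 : R)^'+, 0 < eps by exact: nbhs_right_gt.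
have e8 : \forall eps \near (0 : R)^'+, eps < r by exact: nbhs_right_lt.
apply: filterS3 L1 e0 e8 => eps L1 eps0 epsr x xK.
pose ve k y := conv rho eps (fun y => v y 0 k) y.
have mve k : measurable_fun setT (ve k) by exact: measurable_conv.
pose F y := \sum_k `|ve k y|.
have mF : measurable_fun setT (fun y => (F y)%:E).
  apply/measurable_EFinP; apply: measurable_sum => k; exact: measurableT_comp.
have F0 y : (0 <= (F y)%:E)%E by rewrite lee_fin; exact: sumr_ge0.
have FJ : (\int[lam]_y (F y)%:E <= J%:E)%E.
  have -> : (\int[lam]_y (F y)%:E = \sum_k \int[lam]_y `|ve k y|%:E)%E.
    rewrite -ge0_integral_sum//; last first.
      by move=> k; apply/measurable_EFinP; exact: measurableT_comp.
    by apply: eq_integral => y _; rewrite sumEFin.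
  rewrite -sumEFin; apply: lee_sum => k _.
  have vky : (\int[lam]_x `|v x 0 k|%:E < +oo)%E by have /integrableP[] := intv k.
  rewrite EFinD fineK ?ge0_fin_numE ?integral_ge0//.
  apply: (@le_trans _ _ (\int[lam]_y (`|v y 0 k|%:E + `|ve k y - v y 0 k|%:E))%E).
    apply: le_lower_integral => // y _; rewrite -EFinD lee_fin.
    by have := ler_normD (v y 0 k) (ve k y - v y 0 k); rewrite addrC subrK.
  rewrite ge0_integralD//; last 2 first.
  - by apply/measurable_EFinP; exact: measurableT_comp.
  - by apply/measurable_EFinP; apply: measurableT_comp => //; exact: measurable_funB.
  by apply: leeD => //; exact: L1.
have FB p : (\int[lam]_(y in B) (F (p + r *: y)%R)%:E <= (r ^- d * J)%:E)%E.
  apply: le_trans (subset_lower_integral lam (B := setT) _ (@subsetT _ B)) _ => //.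
  under eq_integral do rewrite addrC.
  rewrite (ge0_integral_affine (c := r) p _ mF) ?gt_eqF// gtr0_norm// EFinM.
  by apply: lee_wpmul2l => //; rewrite lee_fin invr_ge0 exprn_ge0// ltW.
have near_S (h : V) (s : R) t : `|h| <= 2 * r -> 0 <= s <= 1 ->
    `|x + s *: h - t| <= eps -> S t.
  move=> hr /andP[s0 s1] xt; have [y Ky xy] := xK; exists y => //.
  have -> : t - y = (x - y) + s *: h - (x + s *: h - t).
    by apply/rowP => k; rewrite !mxE; ring.
  have : `|s *: h| <= 2 * r.
    by rewrite normrZ ger0_norm//; apply: le_trans hr; rewrite ler_piMl.
  have := ler_normB (x - y + s *: h) (x + s *: h - t).
  have := ler_normD (x - y) (s *: h); move: epsr xt xy; rewrite rdl; lra.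
have symG (h : V) (s : R) k j : `|h| <= 2 * r -> 0 <= s <= 1 ->
    `|symconv rho eps v k j (x + s *: h)| <= N * (C * vB).
  move=> hr s01; rewrite -lee_fin.
  have aboveN t : above N e' t = 0 by rewrite /above eN.
  have := symconv_le_above k j eps0 (fun t => near_S h s t hr s01) N0 nv intv we ne.
  by under eq_integral do rewrite aboveN mule0; rewrite integral0 adde0.
have dirG (h : V) : `|h| <= 2 * r ->
    `|\sum_k h 0 k * ve k x| <= 2 * r * F (x + h) + G.
  move=> hr.
  have := mollified_strain_le eps0 intv (fun s k j => symG h s k j hr).
  set a := \sum_k _ * conv _ _ _ (x + h); rewrite -/(\sum_k h 0 k * ve k x).
  set b := \sum_k _ * ve k x => ab.
  have aF : `|a| <= 2 * r * F (x + h).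
    rewrite mulr_sumr; apply: le_trans (ler_norm_sum _ _ _) _.
    apply: ler_sum => k _; rewrite normrM ler_wpM2r//.
    by apply: (le_trans _ hr); exact: coord_le_norm.
  have hG : d%:R ^+ 2 * (`|h| ^+ 2 * (N * (C * vB))) <= G.
    apply: ler_wpM2l; first by rewrite exprn_ge0.
    by apply: ler_wpM2r; [rewrite !mulr_ge0|rewrite lerXn2r ?nnegrE// mulr_ge0// ltW].
  have : b = a - (a - b) by ring.
  move=> ->; apply: le_trans (ler_normB _ _) _; lra.
have key y : B y -> r * `|ve i x| <=
    2 * r * (F (x + r *: 'e_i + r *: y) + F (x + r *: y)) + 2 * G.
  move=> By; have y1 : `|y| <= 1.
    move: By; rewrite /unit_ball /eball/= subr0 => y1.
    exact: le_trans (norm_le_enorm _) (ltW y1).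
  have e1 : `|('e_i : V)| <= 1.
    rewrite rV_norm_le// => k; rewrite mxE eqxx/=; case: eqP => _ /=.
      by rewrite normr1.
    by rewrite normr0.
  have h2 : `|r *: y| <= 2 * r.
    by rewrite normrZ gtr0_norm//; move: (`|y|) y1 => a a1; nra.
  have h1 : `|r *: 'e_i + r *: y| <= 2 * r.
    apply: le_trans (ler_normD _ _) _; rewrite !normrZ gtr0_norm//.
    by move: `|y| `|('e_i : V)| y1 e1 => a b a1 b1; nra.
  have -> : r * `|ve i x| = `|\sum_k (r *: 'e_i + r *: y : V) 0 k * ve k x -
      \sum_k (r *: y : V) 0 k * ve k x|.
    rewrite -sumrB (bigD1 i)//= big1 ?addr0.
      by rewrite !mxE !eqxx/= mulr1 -mulrBl addrK normrM gtr0_norm.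
    move=> k ki; rewrite !mxE eqxx/= (negbTE ki) mulr0 add0r subrr.
    by [].
  apply: le_trans (ler_normB _ _) _.
  have := dirG _ h1; have := dirG _ h2; rewrite addrA; lra.
rewrite /M ler_pdivlMr ?mulr_gt0// -/(ve i x) [leLHS]mulrA (mulrC _ r) -lee_fin.
rewrite -(integral_cst_B (r * `|ve i x|)).
have mFs p : measurable_fun B (fun y => (F (p + r *: y)%R)%:E).
  apply: measurable_funTS; apply: (measurableT_comp mF).
  by under eq_fun do rewrite addrC; exact: measurable_affine.
apply: (@le_trans _ _ (\int[lam]_(y in B) ((2 * r)%:E * ((F (x + r *: 'e_i + r *: y)%R)%:E +
    (F (x + r *: y)%R)%:E) + (2 * G)%:E))%E).
  apply: le_lower_integral => y By; first by rewrite lee_fin mulr_ge0// ltW.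
  exact: key.
have r20 : 0 <= 2 * r by rewrite mulr_ge0// ltW.
rewrite ge0_integralD//; last 3 first.
- by move=> y _; rewrite mule_ge0// adde_ge0.
- by apply: measurable_funeM; exact: emeasurable_funD.
- by move=> y _; rewrite lee_fin mulr_ge0.
rewrite ge0_integralZl//; last 2 first.
- exact: emeasurable_funD.
- by move=> y _; rewrite adde_ge0.
rewrite ge0_integralD// integral_cst_B.
have -> : (2 * G * vB + 4 * r * (r ^- d * J))%:E =
    ((2 * r)%:E * ((r ^- d * J)%:E + (r ^- d * J)%:E) + (2 * G * vB)%:E)%E.
  by rewrite -!EFinD; congr EFin; ring.
apply: leeD => //; apply: lee_wpmul2l; first by rewrite lee_fin.
by apply: leeD; exact: FB.
Qed.

(** The mollified components are at most [M], so the integral of the excess of [|v_i|] over [M] is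
    at most the L^1 distance to the mollification. It vanishes as [eps] tends to [0]. *)
Lemma strain_bounded (v : V -> V) (e e' : V -> 'M[R]_d) (N : R) :
  nice_version S w v -> integrable_field v -> 0 <= N ->
  (forall x, enorm (e' x) <= N) -> is_symgrad Om w e -> nice_version S e e' ->
  exists2 M : R, 0 <= M & {ae lam, forall x, nbd K (dl / 2) x -> enorm (v x) <= M}.
Proof.
move=> nv intv N0 eN we ne; have [mv _ _] := nv.
pose A := nbd K (dl / 2).
have mA : measurable A by apply: compact_measurable_rV; exact: nbd_compact.
have comp i : exists M : R, 0 <= M /\ {ae lam, forall x, A x -> `|v x 0 i| <= M}.
  have mvi : measurable_fun setT (fun y => v y 0 i).
    exact: (measurableT_comp (measurable_coord 0 i) mv).
  have [M M0 HM] := mollified_bounded i nv intv N0 eN we ne.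
  exists M; split => //.
  pose p x : R := Num.max 0 (`|v x 0 i| - M).
  have p0 x : 0 <= p x by rewrite le_max lexx.
  have mp : measurable_fun A (fun x => (p x)%:E).
    apply: measurable_funTS; apply/measurable_EFinP; apply: measurable_maxr => //.
    by apply: measurable_funB => //; exact: measurableT_comp.
  have I0 : (\int[lam]_(x in A) `|(p x)%:E| = 0)%E.
    apply/eqP; rewrite eq_le integral_ge0// andbT.
    have small (a : R) : 0 < a -> (\int[lam]_(x in A) `|(p x)%:E| <= 0%:E + a%:E)%E.
      move=> a0; rewrite add0e.
      near (0 : R)^'+ => eps.
      have H1 : forall x, A x -> `|conv rho eps (fun y => v y 0 i) x| <= M by near: eps.
      have H2 : (\int[lam]_x `|conv rho eps (fun y => v y 0 i) x - v x 0 i|%:E <= a%:E)%E.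
        near: eps; exact: (conv_cvg_L1 rho_kernel rhoC a0 (intv i)).
      apply: le_trans H2.
      apply: (@le_trans _ _ (\int[lam]_(x in A) `|conv rho eps (fun y => v y 0 i) x - v x 0 i|%:E)%E).
        apply: le_lower_integral => // x Ax.
        rewrite gee0_abs lee_fin// /p ge_max normr_ge0/= lerBlDr.
        have := ler_normB (conv rho eps (fun y => v y 0 i) x) (conv rho eps (fun y => v y 0 i) x - v x 0 i).
        by rewrite subKr; have := H1 x Ax; lra.
      exact: subset_lower_integral.
    by apply/lee_addgt0Pr => a; exact: small.
  have := (ae_eq_integral_abs lam mA mp).1 I0; apply: filterS => x px Ax.
  have := px Ax; rewrite /cst => -[p00]; have : `|v x 0 i| - M <= p x by rewrite le_max lexx orbT.
  by rewrite p00; lra.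
have [Mf HM] := choice comp.
exists (\sum_i Mf i); first by apply: sumr_ge0 => i _; have [] := HM i.
have H : {ae lam, forall x, forall i : 'I_d, A x -> `|v x 0 i| <= Mf i}.
  apply: (@filter_forall _ 'I_d (fun i x => A x -> `|v x 0 i| <= Mf i)) => i.
  by have [] := HM i.
apply: filterS H => x H Ax; apply: le_trans (enorm_le_sum _) _; rewrite big_ord1.
by apply: ler_sum => i _; exact: H.
Unshelve. all: end_near.
Qed.

End mollified_case_bounds.

Section mean_oscillation.
Context {R : realType}.

Lemma john_nirenberg (d : nat) (f : 'rV[R]_d -> R) (w : R) :
  lebesgue_rV.-integrable setT (EFin \o f) -> 0 <= w ->
  (forall (y : 'rV[R]_d) (s : R), `|y| <= 1 -> 0 < s <= 2 * d.+1%:R ->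
    exists c, (\int[lebesgue_rV]_(x in eball y s) `|f x - c|%:E <= (w * s ^+ d)%:E)%E) ->
  exists c, (\int[lebesgue_rV]_(x in unit_ball) ((f x - c) ^+ 2)%:E <=
    (68 * (w * (2 * d.+1%:R) ^+ d) ^+ 2 * 2 ^+ d)%:E)%E.
Proof.
(* In dimension [0] the space is a single point, and [c = f 0] makes the left-hand side vanish. *)
case: d f => [|d] f intf w0 osc; last exact: john_nirenberg_sq.
exists (f 0).
have f0 (x : 'rV[R]_0) : ((f x - f 0) ^+ 2)%:E = 0%E.
  have -> : x = 0 by apply/rowP => -[].
  by rewrite subrr expr0n.
under eq_integral do rewrite f0.
by rewrite integral0 lee_fin !mulr_ge0// sqr_ge0.
Qed.

Context {d : nat}.
Local Notation V := 'rV[R]_d.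
Local Notation lam := (@lebesgue_rV R d).
Local Notation B := (@unit_ball R d).
Local Notation vB := (@vol_B R d).

Definition jn_const (om : R) : R :=
  d%:R * (68 * (vB * om * (2 * d.+1%:R) ^+ d) ^+ 2 * 2 ^+ d).

(** John-Nirenberg for [z |-> v (x + l z)]: the balls of radius at most [2 (d + 1)] around points of
    the unit cube are scaled by [l]. The factor [vB] undoes the normalisation of the mean
    oscillation. *)
Lemma mean_osc_quad (S : set V) (w v : V -> V) (l om : R) (x : V) : 0 < l ->
  nice_version S w v -> integrable_field v -> 0 <= om ->
  (forall y s, `|y - x| <= l -> 0 < s <= 2 * d.+1%:R * l ->
    eball y s `<=` S /\ (mean_osc w y s <= om%:E)%E) ->
  exists c, (\int[lam]_(z in B) (enorm (v (x + l *: z) - c)%R ^+ 2)%:E <=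
    (jn_const om)%:E)%E.
Proof.
move=> l0 [mv v0 wv] intv om0 osc.
have vB0 : 0 < vB by exact: vol_B_gt0.
have mvi i : measurable_fun setT (fun y => v y 0 i).
  exact: (measurableT_comp (measurable_coord 0 i) mv).
have mvl i : measurable_fun setT (fun z : V => v (x + l *: z) 0 i).
  exact: (measurable_along l x (mvi i)).
have comp i : exists c, (\int[lam]_(z in B) ((v (x + l *: z)%R 0 i - c) ^+ 2)%:E <=
    (68 * (vB * om * (2 * d.+1%:R) ^+ d) ^+ 2 * 2 ^+ d)%:E)%E.
  apply: (@john_nirenberg d (fun z => v (x + l *: z) 0 i)).
  - by apply: (integrable_affine (f := fun y => v y 0 i)); rewrite ?gt_eqF.
  - by rewrite mulr_ge0// ltW.
  move=> p s p1 /andP[s0 s1].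
  have lpx : `|x + l *: p - x| <= l.
    by rewrite addrAC subrr add0r normrZ gtr0_norm// ger_pMr.
  have ls : 0 < l * s <= 2 * d.+1%:R * l.
    by rewrite mulr_gt0//= mulrC ler_pM2r.
  have ls0 : 0 < l * s by rewrite mulr_gt0.
  have [ballS oscle] := osc _ _ lpx ls.
  exists (ball_mean w (x + l *: p) (l * s) 0 i); set c := ball_mean _ _ _ 0 i.
  pose h (y : V) := `|v y 0 i - c|%:E.
  have mh : measurable_fun setT h.
    by apply/measurable_EFinP; apply: measurableT_comp => //; exact: measurable_funB.
  have h0 y : (0 <= h y)%E by rewrite lee_fin.
  have hl : measurable_fun setT (fun z : V => h (x + l *: z)).
    by apply: (measurableT_comp mh); under eq_fun do rewrite addrC; exact: measurable_affine.
  rewrite -[X in (X <= _)%E]/(\int[lam]_(z in eball p s) h (x + l *: z)%R)%E.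
  rewrite (ge0_integral_eball _ s0 hl)//.
  have -> : (\int[lam]_(z in B) h (x + l *: (p + s *: z))%R =
      \int[lam]_(z in B) h (x + l *: p + (l * s) *: z)%R)%E.
    by apply: eq_integral => z _; rewrite scalerDr scalerA addrA.
  have := ge0_integral_eball (x + l *: p) ls0 mh h0.
  set I := (\int[lam]_(z in B) _)%E => E.
  have hI : (\int[lam]_(y in eball (x + l *: p)%R (l * s)%R) h y <=
      (om * ((l * s) ^+ d * vB))%:E)%E.
    move: oscle; rewrite /mean_osc lee_pdivrMl; last first.
      by rewrite ball_volE// mulr_gt0// exprn_gt0.
    rewrite ball_volE// muleC -EFinM => oscle; apply: le_trans oscle.
    apply: ae_le_lower_integral => //.
      by move=> y _; rewrite lee_fin enorm_ge0.
    apply: filterS wv => y wvy yb; rewrite lee_fin -wvy; last exact: ballS.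
    have -> : w y 0 i - c = (w y - ball_mean w (x + l *: p) (l * s)) 0 i.
      by rewrite [RHS]mxE [X in _ = _ + X]mxE.
    exact: coord_le_enorm.
  have lsd : 0 < (l * s) ^+ d by rewrite exprn_gt0.
  have IE : (I <= (om * vB)%:E)%E.
    rewrite -(@lee_pmul2l _ ((l * s) ^+ d)%:E) ?lte_fin//.
    rewrite -E; apply: le_trans hI _.
    by rewrite -EFinM lee_fin mulrCA.
  apply: le_trans (lee_wpmul2l _ IE) _; first by rewrite lee_fin exprn_ge0// ltW.
  by rewrite -EFinM lee_fin mulrC (mulrC om).
have [c Hc] := choice comp.
exists (\row_i c i).
have -> : (\int[lam]_(z in B) (enorm (v (x + l *: z) - \row_i c i)%R ^+ 2)%:E =
    \sum_i \int[lam]_(z in B) ((v (x + l *: z)%R 0 i - c i) ^+ 2)%:E)%E.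
  rewrite -ge0_integral_sum//; last 3 first.
  - exact: measurable_unit_ball.
  - move=> i; apply/measurable_EFinP; apply: measurable_funTS.
    by apply: measurable_funX; exact: measurable_funB.
  - by move=> i z _; rewrite lee_fin sqr_ge0.
  apply: eq_integral => z _; rewrite sumEFin enorm_rV_sq; congr EFin.
  by apply: eq_bigr => i _; rewrite !mxE.
rewrite /jn_const EFinM -sume_const_ord; exact: lee_sum.
Qed.

End mean_oscillation.

(** * Vanishing fluxes with a majorant *)

Section vanishing.
Context {R : realType}.

Lemma cvge0_near_le {T : Type} (F : set_system T) {FF : Filter F} (f : T -> \bar R) (e : R) :
  f x @[x --> F] --> 0%E -> 0 < e -> \forall x \near F, (f x <= e%:E)%E.
Proof.
move=> f0 e0; apply: (f0 [set y | (y <= e%:E)%E]).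
change (nbhs (0 : R) (fun x : R => (x%:E <= e%:E)%E)).
apply/nbhs_ballP; exists e => //= x; rewrite -ball_normE/= sub0r normrN => xe.
by rewrite lee_fin (le_trans (ler_norm _))// ltW.
Qed.

Lemma near_le_cvge0 {T : Type} (F : set_system T) {FF : Filter F} (f : T -> \bar R) :
  (forall x, (0 <= f x)%E) ->
  (forall e : R, 0 < e -> \forall x \near F, (f x <= e%:E)%E) ->
  f x @[x --> F] --> 0%E.
Proof.
move=> f0 fe A /= nA.
have /nbhs_ballP[r /= r0 rA] : nbhs (0 : R) (fun x : R => A x%:E) by exact: nA.
have r20 : 0 < r / 2 by rewrite divr_gt0.
have := fe _ r20; apply: filterS => x fxr; change (A (f x)).
move: fxr; have := f0 x; case: (f x) => [y| |]//=; rewrite !lee_fin => y0 yr; apply: rA.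
rewrite -ball_normE/= sub0r normrN ger0_norm// (le_lt_trans yr)//.
by rewrite ltr_pdivrMr// ltr_pMr// ltr1n.
Qed.

(** The two inputs of dominated convergence in time: a bound uniform in small [l], and convergence
    to zero. *)
Definition dominated_vanishing (F : R -> \bar R) (l0 : R) (G : \bar R) : Prop :=
  (forall l : R, 0 < l < l0 -> (F l <= G)%E) /\
  (forall e : R, 0 < e -> \forall l \near 0^'+, (F l <= e%:E)%E).

Definition envelope (c : R) (N1 N2 : \bar R) : \bar R :=
  (c%:E * ((N1 + 1) * ((N2 + 1) * (N2 + 1))))%E.

(** The added [1] excludes products of [0] with infinity, so an infinite norm gives an infinite
    majorant and only finite norms remain to be treated. *)
Lemma envelope_ge (c : R) (N1 N2 X : \bar R) : 0 < c ->
  (0 <= N1)%E -> (0 <= N2)%E ->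
  (forall n1 n2 : R, 0 <= n1 -> 0 <= n2 -> N1 = n1%:E -> N2 = n2%:E ->
    (X <= (c * ((n1 + 1) * ((n2 + 1) * (n2 + 1))))%:E)%E) ->
  (X <= envelope c N1 N2)%E.
Proof.
move=> c0; case: N1 => [n1| |]//; case: N2 => [n2| |]// n10 n20 H.
- by have := H n1 n2 n10 n20 erefl erefl.
- by rewrite /envelope /= !(gt0_mulye, gt0_muley) ?leey ?lte_fin// ?adde_gt0 ?lte_fin ?ltr_wpDl//.
- by rewrite /envelope /= !(gt0_mulye, gt0_muley) ?leey ?lte_fin// ?mulr_gt0 ?lte_fin ?ltr_wpDl//.
- by rewrite /envelope /= !(gt0_mulye, gt0_muley) ?leey ?lte_fin// ?adde_gt0 ?lte_fin ?ltr_wpDl//.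
Qed.

End vanishing.

Section uniform_continuity.
Context {R : realType} {d : nat}.
Local Notation V := 'rV[R]_d.

Lemma continuous_open_measurable (Om : set V) (w : V -> V) : open Om ->
  {in Om, continuous w} -> measurable_fun Om w.
Proof.
move=> oOm cw; apply: measurable_fun_coordP => i j.
apply: (measurability _ (RGenOInfty.measurableE R)).
move=> _ [_ [a ->] <-]; apply: open_measurable_rV.
rewrite openE => x [Omx /=]; rewrite in_itv/= andbT => ax.
have cx : {for x, continuous (fun y => w y i j)}.
  apply: (@continuous_comp _ _ _ w (fun M : V => M i j)).
    by apply: cw; exact/mem_set.
  exact: coord_continuous.
rewrite /interior; near=> y; split; first by near: y; exact: open_nbhs_nbhs.
rewrite /= in_itv/= andbT; near: y.
exact: (cx (fun y => a < y) (lt_nbhsr ax)).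
Unshelve. all: end_near. Qed.

Lemma compact_uniform (Om S : set V) (w : V -> V) (e : R) : compact S ->
  S `<=` Om -> {in Om, continuous w} -> 0 < e ->
  exists2 h, 0 < h & forall p q, S p -> S q -> `|p - q| <= h -> enorm (w p - w q) <= e.
Proof.
move=> /compact_near_coveringP cS SOm cw e0.
(* The Euclidean norm is at most the sum of [d] components, each bounded by the sup norm. *)
have e1 : 0 < e / (d%:R + 1) by rewrite divr_gt0// ltr_wpDl.
have H : \forall h \near 0^'+, S `<=` [set x | forall y : V, `|y - x| <= h ->
    `|w y - w x| <= e / (d%:R + 1)].
  apply: cS => x Sx.
  have cx : {for x, continuous w} by apply: cw; apply/mem_set; exact: SOm.
  have e2 : 0 < e / (d%:R + 1) / 2 by rewrite divr_gt0.
  have /nbhs_ballP[r /= r0 xr] : nbhs x [set y | `|w x - w y| < e / (d%:R + 1) / 2].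
    have := cx _ (nbhsx_ballx (w x) _ e2); rewrite nbhs_simpl/=.
    by apply: filterS => y; rewrite -ball_normE.
  have r20 : 0 < r / 2 by rewrite divr_gt0.
  exists (ball x (r / 2), [set h : R | h < r / 2]).
    split => /=; first exact: nbhsx_ballx.
    exact: nbhs_right_lt.
  move=> [y h] [/= xy hr] z zy.
  have wy : `|w x - w y| < e / (d%:R + 1) / 2.
    apply: xr; apply: le_ball xy; rewrite ler_pdivrMr//; lra.
  have wz : `|w x - w z| < e / (d%:R + 1) / 2.
    apply: xr; move: xy; rewrite -!ball_normE/= => xy.
    rewrite -(subrK y x) -addrA (le_lt_trans (ler_normD _ _))// (splitr r) ltrD//.
    by rewrite distrC (le_lt_trans zy).
  have -> : w z - w y = (w x - w y) - (w x - w z) by apply/rowP => k; rewrite !mxE; ring.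
  apply: le_trans (ler_normB _ _) _; lra.
near (0 : R)^'+ => h; exists h => // p q Sp Sq pq.
have Hh : S `<=` [set x | forall y : V, `|y - x| <= h ->
    `|w y - w x| <= e / (d%:R + 1)] by near: h.
have wpq := Hh q Sq p pq.
apply: le_trans (enorm_le_sum _) _; rewrite big_ord1.
apply: (@le_trans _ _ (\sum_(i < d) (e / (d%:R + 1)))).
  by apply: ler_sum => i _; apply: (le_trans _ wpq); exact: coord_le_norm.
rewrite sumr_const card_ord -[leLHS]mulr_natl mulrCA ler_piMr ?(ltW e0)//.
by rewrite ler_pdivrMr ?ltr_wpDl// mul1r lerDl.
Unshelve. all: end_near. Qed.

Lemma compact_bounded_enorm (Om S : set V) (w : V -> V) : compact S ->
  S `<=` Om -> {in Om, continuous w} ->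
  exists2 M, 0 <= M & forall p, S p -> enorm (w p) <= M.
Proof.
move=> cS SOm cw.
have : compact (w @` S).
  apply: continuous_compact => //; apply: continuous_in_subspaceT => x /set_mem Sx.
  by apply: cw; apply/mem_set; exact: SOm.
move=> /compact_bounded[M [_ HM]].
have HM1 := HM (`|M| + 1) (le_lt_trans (ler_norm M) (ltr_pwDr ltr01 (lexx _))).
exists (d%:R * (`|M| + 1)); first by rewrite mulr_ge0// addr_ge0.
move=> p Sp; apply: le_trans (enorm_le_sum _) _; rewrite big_ord1.
have wp : `|w p| <= `|M| + 1 by apply: HM1; exists p.
apply: (@le_trans _ _ (\sum_(i < d) (`|M| + 1))).
  by apply: ler_sum => i _; apply: (le_trans _ wp); exact: coord_le_norm.
by rewrite sumr_const card_ord -[leLHS]mulr_natl.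
Qed.

End uniform_continuity.

Section above_small.
Context {R : realType} {d : nat}.
Local Notation V := 'rV[R]_d.
Local Notation lam := (@lebesgue_rV R d).

Lemma above_small (e' : V -> 'M[R]_d) (b : R) : measurable_fun setT e' ->
  (\int[lam]_s (enorm (e' s))%:E < +oo)%E -> 0 < b ->
  exists2 N : R, 0 <= N & (\int[lam]_s (above N e' s)%:E <= b%:E)%E.
Proof.
move=> me ie b0.
have H : (\int[lam]_s (above n%:R e' s)%:E)%E @[n --> \oo] -->
    (\int[lam]_s (cst 0%E s))%E.
  apply: (@dominated_cvg _ _ _ lam setT measurableT
    (fun (n : nat) s => (above n%:R e' s)%:E) (cst 0%E) (fun s => (enorm (e' s))%:E)) => //.
  - by move=> n; apply/measurable_EFinP; exact: measurable_above.
  - move=> s _; apply: cvg_near_cst; near=> n; rewrite /above ifT//.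
    by near: n; exact: nbhs_infty_ger.
  - apply/integrableP; split; first by apply/measurable_EFinP; exact: measurable_enorm.
    by under eq_integral do rewrite gee0_abs ?lee_fin ?enorm_ge0//.
  - move=> n s _; rewrite gee0_abs ?lee_fin ?above_ge0//.
    by rewrite /above; case: ifP => // _; exact: enorm_ge0.
rewrite integral_cst// mul0e in H.
have [n _ Hn] : \forall n \near \oo, (\int[lam]_s (above n%:R e' s)%:E <= b%:E)%E.
  exact: cvge0_near_le.
by exists n%:R => //; apply: Hn => /=.
Unshelve. all: end_near. Qed.

End above_small.

Section restriction.
Context {R : realType} {d m n : nat}.
Local Notation V := 'rV[R]_d.
Implicit Types (w v : V -> 'M[R]_(m, n)) (A S : set V).

Lemma nice_restrict S (S' : set V) A w v : nice_version S w v -> measurable A ->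
  S' `<=` S -> A `<=` S' -> {ae @lebesgue_rV R d, forall x, S' x -> A x} ->
  nice_version S' w (fun x => (\1_A x : R) *: v x).
Proof.
move=> [mv v0 wv] mA S'S AS' S'A; split.
- by apply: measurable_indic_scale => //; exact: measurable_funTS.
- move=> x S'x; rewrite indicE memNset ?scale0r// => /AS'; exact: S'x.
- apply: filterS2 wv S'A => x wvx Ax S'x.
  by rewrite indicE mem_set ?scale1r; [apply: wvx; exact: S'S|exact: Ax].
Qed.

Lemma enorm_indic_le A v x : enorm ((\1_A x : R) *: v x) <= enorm (v x).
Proof.
by rewrite indicE; case: (x \in A); rewrite ?scale1r// scale0r enorm0 enorm_ge0.
Qed.

End restriction.

Section norms_ge0.
Context {R : realType} {d : nat}.
Local Notation V := 'rV[R]_d.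
Implicit Types (Om K : set V) (w : V -> V).

Lemma besov_norm_ge0 (al q r : R) K w : 0 < r -> (0 <= besov_norm al q r K w)%E.
Proof.
move=> r0; apply: (@le_trans _ _ (besov_modulus al q K w (r / 2))).
  by rewrite mule_ge0 ?lee_fin ?powR_ge0 ?poweR_ge0.
rewrite /besov_norm; apply: (@le_trans _ _ (ereal_sup
  [set besov_modulus al q K w l | l in [set l | (0 < l < r)%R]])).
  apply: ereal_sup_ubound; exists (r / 2) => //=.
  by rewrite divr_gt0//= ltr_pdivrMr// ltr_pMr// ltr1n.
by rewrite leeDr// Lnorm_ge0.
Qed.

Lemma BD_norm_ge0 Om K w : (0 <= BD_norm Om K w)%E.
Proof.
rewrite adde_ge0 ?Lnorm_ge0//; apply: le_ereal_inf_tmp => _ [mu _ <-].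
exact: measure_ge0.
Qed.

Lemma C0_norm_ge0 Om K w : K !=set0 -> (0 <= C0_norm Om K w)%E.
Proof.
move=> [x Kx]; apply: le_ereal_inf_tmp => _ [w' _ <-].
apply: (@le_trans _ _ (enorm (w' x))%:E); first by rewrite lee_fin enorm_ge0.
by apply: ereal_sup_ubound; exists x.
Qed.

Lemma BMO_norm_ge0 (r : R) K w : 0 < r -> K !=set0 -> (0 <= BMO_norm r K w)%E.
Proof.
move=> r0 [x Kx]; apply: (@le_trans _ _ (mean_osc w x (r / 2))).
  apply: mule_ge0; first by rewrite lee_fin invr_ge0 fine_ge0.
  by apply: integral_ge0 => y _; rewrite lee_fin enorm_ge0.
apply: ereal_sup_ubound; exists x, (r / 2); split => //.
by rewrite divr_gt0// ltr_pdivrMr// ltr_pMr// ltr1n.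
Qed.

End norms_ge0.

(** * The cases of the theorem at a fixed time *)

Section per_time_cases.
Context {R : realType} {d : nat}.
Local Notation V := 'rV[R]_d.
Local Notation lam := (@lebesgue_rV R d).
Local Notation B := (@unit_ball R d).
Local Notation vB := (@vol_B R d).

Variable rho : V -> R.
Hypothesis rho_kernel : mollifier_kernel rho.
Variable C : R.
Hypothesis C_gt0 : 0 < C.
Hypothesis rhoC : forall z, `|rho z| <= C.
Hypothesis rhoC' : forall j z, `|partial j rho z| <= C.

Let C_ge0 : 0 <= C. Proof. exact: ltW. Qed.
Let vB0 : 0 <= vB. Proof. exact: vol_B_ge0. Qed.

Variables (Om K : set V) (dl : R).
Hypothesis dl0 : 0 < dl.
Hypothesis K0 : K !=set0.
Hypothesis cK : compact K.
Let S := nbd K dl.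
Hypothesis SOm : S `<=` Om.

Let KS : K `<=` S. Proof. by apply: sub_nbd; exact: ltW. Qed.
Let mK : measurable K. Proof. exact: compact_measurable_rV. Qed.
Let cS : compact S. Proof. exact: nbd_compact. Qed.
Let mS : measurable S. Proof. exact: compact_measurable_rV. Qed.
Let Sy : (lam S < +oo)%E. Proof. exact: compact_lebesgue_lty. Qed.
Let S_in : compact_in Om S.
Proof. by split => //; have [x Kx] := K0; exists x; exact: KS. Qed.
Variables (w v : V -> V).
Hypothesis nv : nice_version S w v.

Let int_DR l : \bar R := (\int[lam]_(x in K) `|flux_DR rho v l x|%:E)%E.
Let int_CET l : \bar R := (\int[lam]_(x in K) `|flux_CET rho v l x|%:E)%E.

Let Lq_integrable (q : nat) : (Lq_norm q.+1%:R%:E S w < +oo)%E -> integrable_field v.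
Proof.
move=> wq; have [mv v0 _] := nv; apply: (integrable_field_pow (q := q) mS Sy mv v0).
by rewrite -(nice_Lq q nv); exact: poweR_lty.
Qed.

Let cube_small (c e : R) : 0 <= c -> 0 < e ->
  exists2 m : R, 0 < m & c * m ^+ 3 <= e.
Proof.
move=> c0 e0; exists (Num.min 1 (e / (c + 1))).
  by rewrite lt_min ltr01 divr_gt0// ltr_wpDl.
set m := Num.min _ _.
have m0 : 0 <= m by rewrite le_min ler01 divr_ge0 ?(ltW e0)// addr_ge0.
have m1 : m <= 1 by rewrite ge_min lexx.
have me : m <= e / (c + 1) by rewrite ge_min lexx orbT.
apply: (@le_trans _ _ (c * m)).
  by apply: ler_wpM2l => //; rewrite exprSr ler_piMl// exprn_ile1.
apply: le_trans (ler_wpM2l c0 me) _.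
by rewrite mulrCA ler_piMr ?(ltW e0)// ler_pdivrMr ?ltr_wpDl// mul1r lerDl.
Qed.

Let square_small (c e : R) : 0 <= c -> 0 < e ->
  exists2 m : R, 0 < m & c * m ^+ 2 <= e.
Proof.
move=> c0 e0; exists (Num.min 1 (e / (c + 1))).
  by rewrite lt_min ltr01 divr_gt0// ltr_wpDl.
set m := Num.min _ _.
have m0 : 0 <= m by rewrite le_min ler01 divr_ge0 ?(ltW e0)// addr_ge0.
have m1 : m <= 1 by rewrite ge_min lexx.
have me : m <= e / (c + 1) by rewrite ge_min lexx orbT.
apply: (@le_trans _ _ (c * m)).
  by apply: ler_wpM2l => //; rewrite expr2 ler_piMl.
apply: le_trans (ler_wpM2l c0 me) _.
by rewrite mulrCA ler_piMr ?(ltW e0)// ler_pdivrMr ?ltr_wpDl// mul1r lerDl.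
Qed.

(** The Besov norm plays the part of both [N1] and [N2], since [n^3 <= (n + 1)(n + 1)^2];
    convergence comes from the modulus itself. *)
Let cubic_dominated (F : R -> \bar R) (c r : R) : 0 <= c -> 0 < r ->
  (forall l m : R, 0 < l -> l < dl -> 0 <= m ->
    (besov_modulus 3^-1 3 K w l <= m%:E)%E -> (F l <= (c * m ^+ 3)%:E)%E) ->
  besov_modulus 3^-1 3 K w l @[l --> 0^'+] --> 0%E ->
  dominated_vanishing F (Num.min dl r)
    (envelope (c + 1) (besov_norm 3^-1 3 r K w) (besov_norm 3^-1 3 r K w)).
Proof.
move=> c0 r0 HF w0; split.
  move=> l /andP[l0]; rewrite lt_min => /andP[ldl lr].
  have mod0 : (0 <= besov_modulus 3^-1 3 K w l)%E.
    by rewrite mule_ge0 ?lee_fin ?powR_ge0 ?poweR_ge0.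
  have mod_norm : (besov_modulus 3^-1 3 K w l <= besov_norm 3^-1 3 r K w)%E.
    rewrite /besov_norm; apply: (@le_trans _ _ (ereal_sup
      [set besov_modulus 3^-1 3 K w l | l in [set l | (0 < l < r)%R]])).
      by apply: ereal_sup_ubound; exists l => //=; rewrite l0 lr.
    by rewrite leeDr// Lnorm_ge0.
  have N0 := le_trans mod0 mod_norm.
  apply: envelope_ge => //; first by rewrite ltr_wpDl.
  move=> n n2 n0 _ nE; rewrite nE => -[<-].
  have mn : (besov_modulus 3^-1 3 K w l <= n%:E)%E by rewrite -nE.
  apply: le_trans (HF l n l0 ldl n0 mn) _; rewrite lee_fin.
  apply: ler_pM => //; first by rewrite exprn_ge0.
    by rewrite lerDl.
  have nn : n <= n + 1 by rewrite lerDl.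
  rewrite exprS expr2; apply: ler_pM => //; first by rewrite mulr_ge0.
  by apply: ler_pM.
move=> e e0; have [m m0 me] := cube_small c0 e0.
have H1 : \forall l \near 0^'+, (besov_modulus 3^-1 3 K w l <= m%:E)%E.
  exact: cvge0_near_le.
have H2 : \forall l \near (0 : R)^'+, 0 < l by exact: nbhs_right_gt.
have H3 : \forall l \near (0 : R)^'+, l < dl by exact: nbhs_right_lt.
apply: filterS3 H1 H2 H3 => l lm l0 ldl.
by apply: le_trans (HF l m l0 ldl (ltW m0) lm) _; rewrite lee_fin.
Qed.

(** The [1 / l] of the flux cancels the [l] of [besov_cubic_le]: this is what makes the exponent
    [1/3] critical. *)
Lemma besov_DR (r : R) : 0 < r ->
  besov_modulus 3^-1 3 K w l @[l --> 0^'+] --> 0%E ->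
  dominated_vanishing int_DR (Num.min dl r)
    (envelope (d%:R * C * vB / 4 + 1) (besov_norm 3^-1 3 r K w) (besov_norm 3^-1 3 r K w)).
Proof.
move=> r0 w0; have [mv _ _] := nv.
have c0 : 0 <= d%:R * C * vB / 4 by rewrite !mulr_ge0.
apply: cubic_dominated => // l m l0 ldl m0 lm.
have mQ : measurable_fun setT (fun x => (\int[lam]_(z in B) (enorm (delta v l x z) ^+ 3)%:E)%E).
  apply: (measurable_integral_set lam (@measurable_unit_ball R d)
    (g := fun p => (enorm (delta v l p.1 p.2) ^+ 3)%:E)).
    apply/measurable_EFinP; apply: measurable_funX.
    exact: (measurable_enorm (measurable_delta l mv)).
  by move=> p; rewrite lee_fin exprn_ge0// enorm_ge0.
have cl0 : 0 <= d%:R * C / (4 * l) by rewrite divr_ge0 ?mulr_ge0// ltW.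
apply: (@le_trans _ _ (\int[lam]_(x in K) ((d%:R * C / (4 * l))%:E *
    \int[lam]_(z in B) (enorm (delta v l x z) ^+ 3)%:E))%E).
  by apply: le_lower_integral => // x _; exact: (flux_DR_cubic_le rho_kernel rhoC rhoC').
rewrite ge0_integralZl//; last 2 first.
- exact: measurable_funTS.
- by move=> x _; apply: integral_ge0 => z _; rewrite lee_fin exprn_ge0// enorm_ge0.
apply: le_trans (lee_wpmul2l _ (besov_cubic_le mK nv l0 ldl m0 lm)) _; first by rewrite lee_fin.
rewrite -EFinM lee_fin le_eqVlt; apply/orP; left; apply/eqP.
by field; rewrite gt_eqF.
Qed.

Lemma besov_CET (r : R) : 0 < r -> (Lq_norm 3%:E S w < +oo)%E ->
  besov_modulus 3^-1 3 K w l @[l --> 0^'+] --> 0%E ->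
  dominated_vanishing int_CET (Num.min dl r)
    (envelope (2 * d%:R ^+ 2 * (2 * C ^+ 2 * vB + C) * C * vB * vB + 1)
      (besov_norm 3^-1 3 r K w) (besov_norm 3^-1 3 r K w)).
Proof.
move=> r0 w3 w0; have [mv _ _] := nv.
have intv : integrable_field v by exact: (Lq_integrable (q := 2)).
have D0 : 0 <= 2 * C ^+ 2 * vB + C by rewrite addr_ge0// !mulr_ge0// exprn_ge0.
have c0 : 0 <= 2 * d%:R ^+ 2 * (2 * C ^+ 2 * vB + C) * C * vB.
  by rewrite !(mulr_ge0 _ vB0, mulr_ge0 _ C_ge0, mulr_ge0 _ D0)// mulr_ge0// exprn_ge0.
apply: cubic_dominated => // [|l m l0 ldl m0 lm]; first by rewrite mulr_ge0.
have mQ : measurable_fun setT (fun x => (\int[lam]_(z in B) (enorm (delta v l x z) ^+ 3)%:E)%E).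
  apply: (measurable_integral_set lam (@measurable_unit_ball R d)
    (g := fun p => (enorm (delta v l p.1 p.2) ^+ 3)%:E)).
    apply/measurable_EFinP; apply: measurable_funX.
    exact: (measurable_enorm (measurable_delta l mv)).
  by move=> p; rewrite lee_fin exprn_ge0// enorm_ge0.
have cl0 : 0 <= 2 * d%:R ^+ 2 * (2 * C ^+ 2 * vB + C) * C * vB / l by rewrite divr_ge0// ltW.
apply: (@le_trans _ _ (\int[lam]_(x in K) ((2 * d%:R ^+ 2 * (2 * C ^+ 2 * vB + C) * C * vB / l)%:E *
    \int[lam]_(z in B) (enorm (delta v l x z) ^+ 3)%:E))%E).
  by apply: le_lower_integral => // x _; exact: (flux_CET_cubic_le rho_kernel C_gt0 rhoC rhoC').
rewrite ge0_integralZl//; last 2 first.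
- exact: measurable_funTS.
- by move=> x _; apply: integral_ge0 => z _; rewrite lee_fin exprn_ge0// enorm_ge0.
apply: le_trans (lee_wpmul2l _ (besov_cubic_le mK nv l0 ldl m0 lm)) _; first by rewrite lee_fin.
rewrite -EFinM lee_fin le_eqVlt; apply/orP; left; apply/eqP.
by field; rewrite gt_eqF.
Qed.

Hypothesis Om_open : open Om.
Let mOm : measurable Om. Proof. exact: open_measurable_rV. Qed.

Let Lq_fin (m n : nat) (q : \bar R) (f : V -> 'M[R]_(m, n)) :
  (Lq_norm q S f < +oo)%E -> exists2 r : R, 0 <= r & Lq_norm q S f = r%:E.
Proof.
move=> fy; have f0 : (0 <= Lq_norm q S f)%E by exact: Lnorm_ge0.
exists (fine (Lq_norm q S f)); first exact: fine_ge0.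
by rewrite fineK// ge0_fin_numE.
Qed.

(** The majorant comes from bounding increments by twice the L^2 norm, the convergence from the
    continuity of translations in L^2. *)
Let quad_dominated (F : R -> \bar R) (u : V -> V) (a n1 n2 r : R) :
  measurable_fun setT u -> 0 <= a -> 0 <= n1 -> 0 <= n2 -> 0 < r ->
  (\int[lam]_x (enorm (u x) ^+ 2)%:E <= (n2 ^+ 2)%:E)%E ->
  (forall l, 0 < l -> l < r -> (F l <= (a * n1)%:E * quad_incr u l)%E) ->
  dominated_vanishing F r (envelope (a * (4 * vB) + 1) n1%:E n2%:E).
Proof.
move=> mu a0 n10 n20 r0 un2 HF.
have an0 : 0 <= a * n1 by rewrite mulr_ge0.
split.
  move=> l /andP[l0 lr]; apply: le_trans (HF l l0 lr) _.
  apply: le_trans (lee_wpmul2l _ (quad_incr_le l mu)) _; first by rewrite lee_fin.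
  rewrite muleA; apply: le_trans (lee_wpmul2l _ un2) _.
    by rewrite lee_fin mulr_ge0// mulr_ge0.
  rewrite /envelope -!EFinD -!EFinM lee_fin -mulrA (mulrAC a) -!mulrA mulrA.
  rewrite [leLHS](_ : _ = a * (4 * vB) * (n1 * (n2 * n2))); last by ring.
  have b0 : 0 <= a * (4 * vB) by rewrite !mulr_ge0.
  by rewrite !ler_pM ?mulr_ge0 ?lerDl.
move=> e e0; have e1 : 0 < e / (a * n1 + 1) by rewrite divr_gt0// ltr_wpDl.
have H1 := quad_incr_small e1 mu (le_lt_trans un2 (ltry _)).
have H2 : \forall l \near (0 : R)^'+, 0 < l by exact: nbhs_right_gt.
have H3 : \forall l \near (0 : R)^'+, l < r by exact: nbhs_right_lt.
apply: filterS3 H1 H2 H3 => l ql l0 lr; apply: le_trans (HF l l0 lr) _.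
apply: le_trans (lee_wpmul2l _ ql) _; first by rewrite lee_fin.
rewrite -EFinM lee_fin mulrCA ler_piMr ?(ltW e0)//.
by rewrite ler_pdivrMr ?ltr_wpDl// mul1r lerDl.
Qed.

Let Lq2_sq (n2 : R) : 0 <= n2 -> Lq_norm 2%:E S w = n2%:E ->
  (\int[lam]_x (enorm (v x) ^+ 2)%:E = (n2 ^+ 2)%:E)%E.
Proof.
move=> n20 w2; rewrite -(nice_Lq 1 nv) [X in (X `^ _)%E](_ : _ = n2%:E)//.
by rewrite poweR_EFin powR_mulrn.
Qed.

Lemma strain_CET (e : V -> 'M[R]_d) : (Lq_norm 2%:E S w < +oo)%E ->
  is_symgrad Om w e -> Lq_loc Om +oo%E e ->
  dominated_vanishing int_CET dl
    (envelope ((2 * C ^+ 2 * vB + C) * (d%:R ^+ 2 * (C * vB)) * (4 * vB) + 1)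
      (Lq_norm +oo%E S e) (Lq_norm 2%:E S w)).
Proof.
move=> w2 we [me ey]; have [mv _ _] := nv.
have intv : integrable_field v by exact: (Lq_integrable (q := 1)).
have [n1 n10 e1] := Lq_fin (ey _ S_in); have [n2 n20 wn2] := Lq_fin w2.
have [e2 ne2] := nice_version_exists mS SOm mOm me.
have [|e' ne' e'n] := nice_Lqoo n10 ne2; first by rewrite e1.
rewrite e1 wn2; apply: (quad_dominated (u := v)) => //.
- by rewrite !mulr_ge0 ?exprn_ge0// addr_ge0 ?mulr_ge0 ?exprn_ge0.
- by rewrite (Lq2_sq n20 wn2).
move=> l l0 ldl.
have := flux_CET_symgrad_bound rho_kernel C_gt0 rhoC rhoC' SOm l0 ldl nv intv n10 e'n we ne'.
move=> /le_trans; apply; rewrite le_eqVlt; apply/orP; left; apply/eqP.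
by congr ((_)%:E * _)%E; ring.
Qed.

Lemma bounded_DR (e : V -> 'M[R]_d) : Lq_loc Om +oo%E w ->
  is_symgrad Om w e ->
  dominated_vanishing int_DR (dl / 2)
    (envelope (C * d%:R ^+ 2 * (d%:R * (2 * (C * vB)) ^+ 2 * vB * (C * vB)) + 1)
      (Lq_norm 1%E S e) (Lq_norm +oo%E S w)).
Proof.
move=> [_ wy] we; have [[me ey] _] := we.
have [n1 n10 e1] := Lq_fin (ey _ S_in); have [n2 n20 wn2] := Lq_fin (wy _ S_in).
have [e' ne'] := nice_version_exists mS SOm mOm me; have [me' _ _] := ne'.
have [|v' nv' v'n] := nice_Lqoo n20 nv; first by rewrite wn2.
have [mv' v'0 _] := nv'.
have bound (N l : R) : 0 <= N -> 0 < l -> l < dl / 2 -> (int_DR l <=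
   (C * d%:R ^+ 2)%:E * ((N * (C * vB) * (2 * C ^+ 2 * vB ^+ 2))%:E * quad_incr v' l +
     (d%:R * (2 * (C * (n2 * vB))) ^+ 2 * vB)%:E *
       ((C * vB)%:E * \int[lam]_s (above N e' s)%:E)))%E.
  move=> N0 l0 ldl; have ldl' : l < dl by lra.
  rewrite /int_DR (nice_flux_DR_eq rho_kernel dl0 l0 ldl' nv nv').
  apply: (flux_DR_symgrad_bound rho_kernel C_gt0 rhoC rhoC' dl0 cK SOm l0 _ nv' v'n N0 we ne').
  lra.
have int_e' : (\int[lam]_s (enorm (e' s))%:E = n1%:E)%E by rewrite -(nice_Lq1 ne').
pose a := C * d%:R ^+ 2 * (d%:R * (2 * (C * vB)) ^+ 2 * vB * (C * vB)).
have a0 : 0 <= a by rewrite !mulr_ge0 ?exprn_ge0 ?mulr_ge0.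
have Cd0 : 0 <= C * d%:R ^+ 2 by rewrite mulr_ge0 ?exprn_ge0.
have abound (N : R) : ((C * d%:R ^+ 2)%:E * ((d%:R * (2 * (C * (n2 * vB))) ^+ 2 * vB)%:E *
       ((C * vB)%:E * \int[lam]_s (above N e' s)%:E)) =
   (a * n2 ^+ 2)%:E * \int[lam]_s (above N e' s)%:E)%E.
  by rewrite !muleA -!EFinM; congr ((_)%:E * _)%E; rewrite /a; ring.
have above_le (N : R) s : above N e' s <= enorm (e' s).
  by rewrite /above; case: ifP => // _; exact: enorm_ge0.
split.
  (* For the majorant the level is [0]: the bounded part disappears and the tail is the whole
     strain. *)
  move=> l /andP[l0 ldl]; apply: le_trans (bound 0 l (lexx 0) l0 ldl) _.
  rewrite !mul0r mul0e add0e abound e1 wn2.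
  apply: (@le_trans _ _ ((a * n2 ^+ 2)%:E * n1%:E)%E).
    apply: lee_wpmul2l; first by rewrite lee_fin mulr_ge0// exprn_ge0.
    rewrite -int_e'; apply: le_lower_integral => s _; rewrite lee_fin//.
    exact: above_ge0.
  rewrite /envelope -!EFinD -!EFinM lee_fin -/a -mulrA (mulrC _ n1) expr2.
  by rewrite !ler_pM ?mulr_ge0 ?lerDl.
move=> ep ep0.
(* For the convergence [N] is chosen first, making the tail small; then [l] makes the increments
   small at this level. *)
have [N N0 HN] : exists2 N : R, 0 <= N &
    ((a * n2 ^+ 2)%:E * \int[lam]_s (above N e' s)%:E <= (ep / 2)%:E)%E.
  have an0 : 0 <= a * n2 ^+ 2 by rewrite mulr_ge0// exprn_ge0.
  have ep1 : 0 < ep / 2 / (a * n2 ^+ 2 + 1) by rewrite !divr_gt0// ltr_wpDl.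
  have [|N N0 HN] := above_small me' _ ep1; first by rewrite int_e' ltry.
  exists N => //; apply: le_trans (lee_wpmul2l _ HN) _; first by rewrite lee_fin.
  rewrite -EFinM lee_fin mulrCA ler_piMr ?divr_ge0 ?(ltW ep0)//.
  by rewrite ler_pdivrMr ?ltr_wpDl// mul1r lerDl.
pose b := C * d%:R ^+ 2 * (N * (C * vB) * (2 * C ^+ 2 * vB ^+ 2)).
have b0 : 0 <= b by rewrite !mulr_ge0 ?exprn_ge0.
have v'2 : (\int[lam]_x (enorm (v' x) ^+ 2)%:E < +oo)%E.
  apply: (@le_lt_trans _ _ (\int[lam]_(x in S) (cst (n2 ^+ 2)%:E x))%E).
    rewrite [leRHS]integral_mkcond; apply: le_lower_integral => x _.
      by rewrite lee_fin sqr_ge0.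
    rewrite patchE; case: ifPn => [_|/negP xS].
      by rewrite lee_fin lerXn2r ?nnegrE ?enorm_ge0.
    by rewrite v'0 ?enorm0 ?expr0n// => Sx; apply: xS; exact: mem_set.
  by rewrite integral_cst// lte_mul_pinfty// lee_fin sqr_ge0.
have ep2 : 0 < ep / 2 / (b + 1) by rewrite !divr_gt0// ltr_wpDl.
have H1 := quad_incr_small ep2 mv' v'2.
have H2 : \forall l \near (0 : R)^'+, 0 < l by exact: nbhs_right_gt.
have H3 : \forall l \near (0 : R)^'+, l < dl / 2 by apply: nbhs_right_lt; rewrite divr_gt0.
apply: filterS3 H1 H2 H3 => l ql l0 lr; apply: le_trans (bound N l N0 l0 lr) _.
have I0 : (0 <= \int[lam]_s (above N e' s)%:E)%E.
  by apply: integral_ge0 => s _; rewrite lee_fin above_ge0.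
have q0 : (0 <= quad_incr v' l)%E.
  by do 2 apply: integral_ge0 => ? _; rewrite lee_fin sqr_ge0.
rewrite ge0_muleDr; last 2 first.
- by rewrite mule_ge0// lee_fin !mulr_ge0// exprn_ge0.
- by rewrite !mule_ge0// lee_fin ?mulr_ge0// exprn_ge0.
rewrite abound muleA -EFinM -/b (splitr ep) EFinD; apply: leeD => //.
apply: le_trans (lee_wpmul2l _ ql) _; first by rewrite lee_fin.
rewrite -EFinM lee_fin mulrCA ler_piMr ?divr_ge0 ?(ltW ep0)//.
by rewrite ler_pdivrMr ?ltr_wpDl// mul1r lerDl.
Qed.

(** [w] is only square integrable, but its bounded strain makes it bounded on the smaller
    neighbourhood [S']; at the level of the strain bound the tail is zero. The range of [l] is
    halved once for [S'] and once for the condition [2 * l < dl] of the flux bound. *)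
Lemma strain_DR (e : V -> 'M[R]_d) : (Lq_norm 2%:E S w < +oo)%E ->
  is_symgrad Om w e -> Lq_loc Om +oo%E e ->
  dominated_vanishing int_DR (dl / 4)
    (envelope (C * d%:R ^+ 2 * (C * vB * (2 * C ^+ 2 * vB ^+ 2)) * (4 * vB) + 1)
      (Lq_norm +oo%E S e) (Lq_norm 2%:E S w)).
Proof.
move=> w2 we [me ey]; have [mv v0 wv] := nv.
have intv : integrable_field v by exact: (Lq_integrable (q := 1)).
have [n1 n10 e1] := Lq_fin (ey _ S_in); have [n2 n20 wn2] := Lq_fin w2.
have [e2 ne2] := nice_version_exists mS SOm mOm me.
have [|e' ne' e'n] := nice_Lqoo n10 ne2; first by rewrite e1.
have [M M0 vM] := strain_bounded rho_kernel C_gt0 rhoC rhoC' dl0 cK SOm nv intv n10 e'n we ne'.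
pose S' := nbd K (dl / 2).
have dl2l : dl / 2 <= dl by rewrite ler_pdivrMr// ler_peMr ?(ltW dl0)// ler1n.
have S'S : S' `<=` S by exact: nbd_sub.
have mS' : measurable S'.
  by apply: compact_measurable_rV; apply: nbd_compact.
pose A := S' `&` [set x | enorm (v x) <= M].
have mA : measurable A.
  apply: measurableI => //; rewrite -[X in measurable X]setTI.
  rewrite [X in _ `&` X](_ : _ = (fun x : V => enorm (v x)) @^-1` `]-oo, M]); last first.
    by apply/seteqP; split => x; rewrite /= in_itv.
  exact: (measurable_enorm mv).
have AS' : A `<=` S' by move=> x [].
have [me' _ _] := ne'.
(* The bounded version [v2] equals the cut-off [v1] of [v] on [S'] only almost everywhere: the
   fluxes of [v] and [v1] are compared at every point of [K], those of [v1] and [v2] under the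
   integral. *)
pose v2 x : V := (\1_A x : R) *: v x; pose v1 x : V := (\1_S' x : R) *: v x.
pose e1' x : 'M[R]_d := (\1_S' x : R) *: e' x.
have nv1 : nice_version S' w v1 by apply: nice_restrict nv mS' S'S _ _ => //; exact: aeW.
have nv2 : nice_version S' w v2.
  apply: nice_restrict nv mA S'S AS' _; apply: filterS vM => x vMx S'x.
  by split => //; exact: vMx.
have ne1 : nice_version S' e e1' by apply: nice_restrict ne' mS' S'S _ _ => //; exact: aeW.
have [mv2 _ _] := nv2.
have v2v x : enorm (v2 x) <= enorm (v x) by exact: enorm_indic_le.
have v2M x : enorm (v2 x) <= M.
  rewrite /v2 indicE; case: (asboolP (A x)) => [Ax|Ax].
    by rewrite mem_set// scale1r; case: Ax.
  by rewrite memNset// scale0r enorm0.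
have e1n x : enorm (e1' x) <= n1 by exact: le_trans (enorm_indic_le _ _ _) _.
have S'Om : S' `<=` Om by move=> x /S'S /SOm.
have a0 : 0 <= C * d%:R ^+ 2 * (C * vB * (2 * C ^+ 2 * vB ^+ 2)).
  by rewrite !mulr_ge0 ?exprn_ge0 ?mulr_ge0 ?exprn_ge0.
rewrite e1 wn2; apply: (quad_dominated (u := v2)) => //.
- by rewrite divr_gt0.
- rewrite -(Lq2_sq n20 wn2); apply: le_lower_integral => x _; rewrite lee_fin ?sqr_ge0//.
  by rewrite lerXn2r ?nnegrE ?enorm_ge0.
move=> l l0 ldl; have dl2 : 0 < dl / 2 by rewrite divr_gt0.
have ldl2 : l < dl / 2 by lra.
have -> : int_DR l = (\int[lam]_(x in K) `|flux_DR rho v2 l x|%:E)%E.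
  rewrite -(nice_flux_DR_eq rho_kernel dl2 l0 ldl2 nv1 nv2).
  apply: eq_integral => x /set_mem Kx; congr (`|_|%:E).
  apply: (flux_DR_congr (S := S') rho_kernel) => //.
  - by apply: aeW => y S'y; rewrite /v1 indicE mem_set// scale1r.
  - move=> y yx; exists x => //; apply: le_trans (norm_le_enorm _) (ltW (lt_trans yx ldl2)).
  - by rewrite /v1 indicE mem_set ?scale1r//; apply: sub_nbd => //; exact: ltW.
have := flux_DR_symgrad_bound rho_kernel C_gt0 rhoC rhoC' dl2 cK S'Om l0 _ nv2 v2M n10 we ne1.
move=> H; apply: le_trans (H _) _; first by lra.
rewrite [X in (_ * (_ + _ * (_ * X)))%E](_ : _ = 0%E); last first.
  apply: integral0_eq => s _; rewrite /above ifT//; exact: e1n.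
rewrite !mule0 adde0 muleA -EFinM le_eqVlt; apply/orP; left; apply/eqP.
by congr ((_)%:E * _)%E; ring.
Qed.

Let C0_version (w' : V -> V) : continuous_version Om w w' ->
  let v' := fun x => (\1_S x : R) *: w' x in
  nice_version S w v' /\ exists M, forall x, enorm (v' x) <= M.
Proof.
move=> [cw' ww']; split.
  split.
  - apply: measurable_indic_scale => //.
    by apply: measurable_funS (continuous_open_measurable Om_open cw').
  - by move=> x Sx; rewrite indicE memNset ?scale0r.
  - apply: filterS ww' => x wx Sx; rewrite indicE mem_set// scale1r; apply: wx; exact: SOm.
have [M M0 wM] := compact_bounded_enorm cS SOm cw'; exists M => x.
rewrite indicE; case: (asboolP (S x)) => [Sx|Sx].
  by rewrite mem_set// scale1r; exact: wM.
by rewrite memNset// scale0r enorm0.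
Qed.

(** For the majorant the oscillation is bounded by twice the supremum; for the convergence a version
    and a variation measure are fixed, and uniform continuity on the compact [S] is used. *)
Lemma BD_C0_DR : BD_loc Om w -> C0_loc Om w ->
  dominated_vanishing int_DR (dl / 2)
    (envelope (C * d%:R ^+ 2 * (d%:R * (2 * (C * vB)) ^+ 2 * vB * (C * vB)) + 1)
      (BD_norm Om S w) (C0_norm Om S w)).
Proof.
move=> [_ [mu0 wmu0]] [w0 ww0].
set a := C * d%:R ^+ 2 * _.
have a0 : 0 <= a by rewrite !mulr_ge0 ?exprn_ge0 ?mulr_ge0.
(* The oscillation is written as [2 * W], so that a bound for the supremum can itself serve as
   [W]. *)
have key (w' : V -> V) (mu : {measure set V -> \bar R}) (W l : R) :
    continuous_version Om w w' -> is_symgrad_variation Om w mu -> 0 <= W ->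
    0 < l -> 2 * l < dl ->
    (forall p q, S p -> S q -> `|p - q| <= l -> enorm (w' p - w' q) <= 2 * W) ->
    (int_DR l <= (a * W ^+ 2)%:E * mu S)%E.
  move=> ww' wmu W0 l0 ldl osc; have [nv' [M v'M]] := C0_version ww'.
  have ldl' : l < dl by lra.
  rewrite /int_DR (nice_flux_DR_eq rho_kernel dl0 l0 ldl' nv nv').
  have muS : (mu S < +oo)%E by have [sg [_ muK _ _]] := wmu; exact: muK.
  have W20 : 0 <= 2 * W by rewrite mulr_ge0.
  have H := flux_DR_variation_bound rho_kernel C_gt0 rhoC rhoC' dl0 cK SOm l0 ldl nv' v'M wmu muS W20.
  apply: le_trans (H _) _.
    by move=> p q Sp Sq pq; rewrite !indicE !mem_set// !scale1r; exact: osc.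
  rewrite !muleA -!EFinM le_eqVlt; apply/orP; left; apply/eqP.
  by congr ((_)%:E * _)%E; rewrite /a; ring.
split.
  move=> l /andP[l0 ldl]; have ldl' : 2 * l < dl by lra.
  apply: envelope_ge; first by rewrite ltr_wpDl.
  - exact: BD_norm_ge0.
  - by apply: C0_norm_ge0; have [] := S_in.
  move=> n1 n2 n10 n20 BD1 C02.
  (* Both norms involve infima over representatives; one within [1] of the infimum exists because
     the norms are finite here. *)
  have [_ [mu wmu <-] mun] : exists2 y, [set mu S | mu in is_symgrad_variation Om w] y & (y < (n1 + 1)%:E)%E.
    apply: ereal_inf_lt; apply: (@le_lt_trans _ _ n1%:E); last by rewrite lte_fin ltrDl.
    by rewrite -BD1 /BD_norm leeDr// Lnorm_ge0.
  have [_ [w' ww' <-] w'n] : exists2 y, [set ereal_sup [set (enorm (w' x))%:E | x in S]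
            | w' in continuous_version Om w] y & (y < (n2 + 1)%:E)%E.
    apply: ereal_inf_lt; rewrite -/(C0_norm Om S w) C02 lte_fin ltrDl//.
  have W0 : 0 <= n2 + 1 by rewrite addr_ge0.
  apply: le_trans (key w' mu (n2 + 1) l ww' wmu W0 l0 ldl' _) _.
    have w'le x : S x -> enorm (w' x) <= n2 + 1.
      move=> Sx; rewrite -lee_fin; apply: le_trans (ltW w'n).
      by apply: ereal_sup_ubound; exists x.
    move=> p q Sp Sq _; rewrite -ler_sqr ?nnegrE ?enorm_ge0 ?mulr_ge0//.
    apply: le_trans (enorm_sqB _ _) _.
    have sq_le x : S x -> enorm (w' x) ^+ 2 <= (n2 + 1) ^+ 2.
      by move=> Sx; rewrite lerXn2r ?nnegrE ?enorm_ge0// w'le.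
    by have := sq_le p Sp; have := sq_le q Sq; nra.
  apply: le_trans (lee_wpmul2l _ (ltW mun)) _.
    by rewrite lee_fin mulr_ge0// exprn_ge0.
  rewrite -EFinM lee_fin -mulrA (mulrC _ (n1 + 1)) expr2.
  by rewrite ler_pM ?mulr_ge0 ?lerDl ?addr_ge0.
move=> e e0.
have muS : (mu0 S < +oo)%E by have [sg [_ muK _ _]] := wmu0; exact: muK.
pose mS0 := fine (mu0 S).
have mS0E : mu0 S = mS0%:E by rewrite /mS0 fineK// ge0_fin_numE.
have mS00 : 0 <= mS0 by rewrite fine_ge0.
have am0 : 0 <= a * mS0 by rewrite mulr_ge0.
have [W W0 HW] := square_small am0 e0.
have W20 : 0 < 2 * W by rewrite mulr_gt0.
have [h h0 Hh] := compact_uniform cS SOm ww0.1 W20.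
have H1 : \forall l \near (0 : R)^'+, l < h by exact: nbhs_right_lt.
have H2 : \forall l \near (0 : R)^'+, 0 < l by exact: nbhs_right_gt.
have H3 : \forall l \near (0 : R)^'+, l < dl / 2 by apply: nbhs_right_lt; rewrite divr_gt0.
apply: filterS3 H1 H2 H3 => l lh l0 lr.
apply: le_trans (key w0 mu0 W l ww0 wmu0 (ltW W0) l0 _ _) _.
- by lra.
- by move=> p q Sp Sq pq; apply: Hh => //; exact: le_trans pq (ltW lh).
by rewrite mS0E -EFinM lee_fin mulrAC.
Qed.

(** The balls entering John-Nirenberg have centres in [nbd K (dl / 2)] and radii up to
    [2 (d + 1) l]; the bound on [l] keeps the radii below [r] and the balls inside [S]. *)
Lemma VMO_CET (r : R) : 0 < r -> BD_loc Om w ->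
  ereal_sup [set mean_osc w x l | x in nbd K (dl / 2)] @[l --> 0^'+] --> 0%E ->
  dominated_vanishing int_CET (Num.min dl r / (4 * d.+1%:R))
    (envelope ((2 * C ^+ 2 * vB + C) * (@jn_const R d 1 * d%:R ^+ 2) * (C * vB) + 1)
      (BD_norm Om S w) (BMO_norm r (nbd K (dl / 2)) w)).
Proof.
move=> r0 [[mw w1] [mu0 wmu0]] osc0.
have intv : integrable_field v by exact: (Lq_integrable (q := 0) (w1 _ S_in)).
have jn_ge0 (om : R) : 0 <= om -> 0 <= @jn_const R d om.
  by move=> om0; rewrite !mulr_ge0 ?exprn_ge0 ?mulr_ge0.
have D0 : 0 <= 2 * C ^+ 2 * vB + C by rewrite addr_ge0// !mulr_ge0 ?exprn_ge0.
set a := (_ * _ * (C * vB)).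
have a0 : 0 <= a by rewrite !mulr_ge0 ?exprn_ge0// jn_ge0.
set K' := nbd K (dl / 2).
have K'0 : K' !=set0.
  by have [x Kx] := K0; exists x; apply: sub_nbd Kx; rewrite divr_ge0// ltW.
have d1 : 0 < d.+1%:R :> R by rewrite ltr0n.
have d11 : 1 <= d.+1%:R :> R by rewrite ler1n.
have key (mu : {measure set V -> \bar R}) (om l : R) :
    is_symgrad_variation Om w mu -> 0 <= om -> 0 < l -> 4 * d.+1%:R * l < dl ->
    (forall y s, K' y -> 0 < s <= 2 * d.+1%:R * l -> (mean_osc w y s <= om%:E)%E) ->
    (int_CET l <= (a * om ^+ 2)%:E * mu S)%E.
  move=> wmu om0 l0 ldl osc.
  have muS : (mu S < +oo)%E by have [sg [_ muK _ _]] := wmu; exact: muK.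
  have ldl' : 4 * l < dl.
    by apply: le_lt_trans ldl; rewrite -mulrA ler_wpM2l// ler_peMl ?(ltW l0).
  have ldl1 : l < dl by lra.
  have H := flux_CET_variation_bound rho_kernel C_gt0 rhoC rhoC' cK SOm
    l0 ldl1 nv intv wmu muS (jn_ge0 _ om0).
  apply: le_trans (H _) _.
    move=> x Kx; apply: (mean_osc_quad l0 nv intv om0) => y s yx sl.
    have K'y : K' y by exists x => //; apply: le_trans yx _; lra.
    split; last exact: osc.
    move=> z zy; apply: (@nbd_sub _ _ _ (dl / 2 + dl / 2)); first by lra.
    apply: nbd_nbd; exists y => //; apply: le_trans (norm_le_enorm _) _.
    apply: le_trans (ltW zy) _; have /andP[_] := sl; lra.
  rewrite !muleA -!EFinM le_eqVlt; apply/orP; left; apply/eqP.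
  (* [jn_const] is quadratic in its argument. *)
  by congr ((_)%:E * _)%E; rewrite /a /jn_const; ring.
have d40 : 0 < 4 * d.+1%:R :> R by rewrite mulr_gt0.
split.
  move=> l /andP[l0]; rewrite ltr_pdivlMr// lt_min (mulrC l) => /andP[ldl lr].
  have N20 : (0 <= BMO_norm r K' w)%E by exact: BMO_norm_ge0.
  apply: envelope_ge => //; first by rewrite ltr_wpDl.
    exact: BD_norm_ge0.
  move=> n1 n2 n10 n20 BD1 BMO2.
  have [_ [mu wmu <-] mun] : exists2 y, [set mu S | mu in is_symgrad_variation Om w] y & (y < (n1 + 1)%:E)%E.
    apply: ereal_inf_lt; apply: (@le_lt_trans _ _ n1%:E); last by rewrite lte_fin ltrDl.
    by rewrite -BD1 /BD_norm leeDr// Lnorm_ge0.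
  apply: le_trans (key mu n2 l wmu n20 l0 ldl _) _.
    move=> y s K'y /andP[s0 sl]; rewrite -BMO2.
    apply: ereal_sup_ubound; exists y, s; split => //; rewrite s0 /=.
    apply: le_lt_trans sl _; apply: le_lt_trans lr.
    by rewrite -!mulrA ler_wpM2r ?mulr_ge0 ?ler_nat// ltW.
  apply: le_trans (lee_wpmul2l _ (ltW mun)) _.
    by rewrite lee_fin mulr_ge0// exprn_ge0.
  rewrite -EFinM lee_fin -mulrA (mulrC _ (n1 + 1)) expr2.
  have n2_le : (n1 + 1) * (n2 * n2) <= (n1 + 1) * ((n2 + 1) * (n2 + 1)).
    by rewrite ler_wpM2l ?addr_ge0// ler_pM ?lerDl.
  apply: ler_pM => //; last by rewrite lerDl.
  by rewrite mulr_ge0 ?addr_ge0 ?mulr_ge0.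
move=> e e0.
have muS : (mu0 S < +oo)%E by have [sg [_ muK _ _]] := wmu0; exact: muK.
pose mS0 := fine (mu0 S).
have mS0E : mu0 S = mS0%:E by rewrite /mS0 fineK// ge0_fin_numE.
have mS00 : 0 <= mS0 by rewrite fine_ge0.
have am0 : 0 <= a * mS0 by rewrite mulr_ge0.
have [om om0 Hom] := square_small am0 e0.
have : \forall s \near (0 : R)^'+, (ereal_sup [set mean_osc w x s | x in K'] <= om%:E)%E.
  exact: cvge0_near_le.
move=> /nbhs_ballP[h /= h0 Hh].
have H1 : \forall l \near (0 : R)^'+, l < h / (4 * d.+1%:R).
  by apply: nbhs_right_lt; rewrite divr_gt0.
have H2 : \forall l \near (0 : R)^'+, 0 < l by exact: nbhs_right_gt.
have H3 : \forall l \near (0 : R)^'+, l < dl / (4 * d.+1%:R).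
  by apply: nbhs_right_lt; rewrite divr_gt0.
apply: filterS3 H1 H2 H3 => l; rewrite !ltr_pdivlMr// !(mulrC l) => lh l0 lr.
apply: le_trans (key mu0 om l wmu0 (ltW om0) l0 lr _) _.
  move=> y s K'y /andP[s0 sl].
  apply: (@le_trans _ _ (ereal_sup [set mean_osc w x s | x in K'])).
    by apply: ereal_sup_ubound; exists y.
  apply: Hh => //; rewrite -ball_normE/= sub0r normrN gtr0_norm//.
  apply: le_lt_trans sl _; apply: le_lt_trans lh.
  by rewrite -!mulrA ler_wpM2r ?mulr_ge0 ?ler_nat// ltW.
by rewrite mS0E -EFinM lee_fin mulrAC.
Qed.

End per_time_cases.

(** * Integration in time *)

Section joint_measurability.
Context {R : realType} {d : nat} {dY : measure_display} {Y : measurableType dY}.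
Local Notation V := 'rV[R]_d.
Local Notation lam := (@lebesgue_rV R d).
Variable rho : V -> R.
Hypothesis rho_kernel : mollifier_kernel rho.
Variable U : V * Y -> V.
Hypothesis mU : measurable_fun setT U.

Let measurable_fst_fst_snd :
  measurable_fun setT (fun q : (V * Y) * V => (q.1.1, q.2)).
Proof.
apply/measurable_fun_pairP; split => /=; last exact: measurable_snd.
exact: (measurableT_comp measurable_fst measurable_fst).
Qed.

Lemma measurable_flux_DR_slices (l : R) :
  measurable_fun setT (fun p : V * Y => flux_DR rho (fun y => U (y, p.2)) l p.1).
Proof.
pose D (q : (V * Y) * V) : V := U (q.1.1 + l *: q.2, q.1.2) - U (q.1.1, q.1.2).
have mD : measurable_fun setT D.
  have mU1 : measurable_fun setT (fun q : (V * Y) * V => U (q.1.1, q.1.2)).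
    apply: (measurableT_comp mU); apply/measurable_fun_pairP; split => /=.
      exact: (measurableT_comp measurable_fst measurable_fst).
    exact: (measurableT_comp measurable_snd measurable_fst).
  have mU2 : measurable_fun setT (fun q : (V * Y) * V => U (q.1.1 + l *: q.2, q.1.2)).
    apply: (measurableT_comp mU); apply/measurable_fun_pairP; split => /=.
      exact: (measurableT_comp (measurable_shift_pair l) measurable_fst_fst_snd).
    exact: (measurableT_comp measurable_snd measurable_fst).
  apply: measurable_fun_coordP => i j; rewrite /D; under eq_fun do rewrite !mxE.
  apply: measurable_funB; first exact: (measurableT_comp (measurable_coord i j) mU2).
  exact: (measurableT_comp (measurable_coord i j) mU1).
pose G (q : (V * Y) * V) : R :=
  \sum_j (4 * l)^-1 * (partial j rho q.2 * (D q 0 j * enorm (D q) ^+ 2)).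
have mG : measurable_fun setT G.
  apply: measurable_sum => j; apply: measurable_funM => //; apply: measurable_funM.
    by apply: measurableT_comp measurable_snd; exact: measurable_kernel_partial.
  apply: measurable_funM; first exact: (measurableT_comp (measurable_coord 0 j) mD).
  by apply: measurable_funX; exact: measurable_enorm.
have -> : (fun p : V * Y => flux_DR rho (fun y => U (y, p.2)) l p.1) =
    (fun p => \int[lam]_z G (p, z)) by apply/funext => p; rewrite flux_DRE.
exact: measurable_Rintegral.
Qed.

Lemma measurable_conv_slices (k : V -> R) (F : V * Y -> R) (l : R) :
  measurable_fun setT k -> measurable_fun setT F ->
  measurable_fun setT (fun p : V * Y => conv k l (fun y => F (y, p.2)) p.1).
Proof.
move=> mk mF.
apply: (@measurable_Rintegral R _ _ (V * Y)%type V lam (fun q : (V * Y) * V =>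
  F (q.2, q.1.2) * rescale k l (q.1.1 - q.2))).
apply: measurable_funM.
  apply: (measurableT_comp mF); apply/measurable_fun_pairP; split => /=.
    exact: measurable_snd.
  exact: (measurableT_comp measurable_snd measurable_fst).
apply: (measurableT_comp (measurable_rescale mk l)).
exact: (measurableT_comp measurable_fst_subr_snd measurable_fst_fst_snd).
Qed.

(** The gradient is rewritten as a convolution with [partial j rho], a parameter integral and hence
    jointly measurable; the integrable slices serve this rewriting. *)
Lemma measurable_flux_CET_slices (l : R) : 0 < l ->
  (forall y, integrable_field (fun x => U (x, y))) ->
  measurable_fun setT (fun p : V * Y => flux_CET rho (fun y => U (y, p.2)) l p.1).
Proof.
move=> l0 intU; have [C [C0 rhoC rhoC']] := kernel_bounded rho_kernel.
under eq_fun do rewrite flux_CETE_grad.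
have mrho := measurable_kernel rho_kernel.
have mUi i : measurable_fun setT (fun p => U p 0 i).
  exact: (measurableT_comp (measurable_coord 0 i) mU).
apply: measurable_sum => i; apply: measurable_sum => j; apply: measurable_funM.
  apply: measurable_funB; first apply: measurable_funM.
  - exact: (measurable_conv_slices (F := fun p => U p 0 i)).
  - exact: (measurable_conv_slices (F := fun p => U p 0 j)).
  - apply: (measurable_conv_slices (F := fun p => U p 0 i * U p 0 j)) => //.
    exact: measurable_funM.
have -> : (fun p : V * Y => partial j (conv rho l (fun y => U (y, p.2) 0 i)) p.1) =
    (fun p => l^-1 * conv (partial j rho) l (fun y => U (y, p.2) 0 i) p.1).
  apply/funext => p; apply: (partial_conv rho_kernel rhoC rhoC') => //.
  exact: intU.
apply: measurable_funM => //.
apply: (measurable_conv_slices (F := fun p => U p 0 i)) => //.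
exact: measurable_kernel_partial.
Qed.

End joint_measurability.

Section product_slices.
Context {R : realType} {d1 d2 : measure_display}.
Context {X : measurableType d1} {Y : measurableType d2}.
Variables (mu : {sigma_finite_measure set X -> \bar R}).
Variables (nu : {sigma_finite_measure set Y -> \bar R}).

(** The measures of the slices of a measurable null superset integrate to zero. *)
Lemma negligible_slices (N : set (X * Y)) : (mu \x nu)%E.-negligible N ->
  {ae nu, forall y, mu.-negligible [set x | N (x, y)]}.
Proof.
move=> [M [mM M0 NM]].
have mI : measurable_fun setT (EFin \o \1_M : X * Y -> \bar R) by exact/measurable_EFinP.
have I0 : (\int[nu]_y `|mu (ysection M y)| = 0)%E.
  under eq_integral do rewrite gee0_abs//.
  rewrite -M0 -[in RHS](setIT M) -(integral_indic _ measurableT mM).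
  rewrite fubini_tonelli2//.
  by rewrite indic_fubini_tonelli_GE.
have mf : measurable_fun setT (fun y => mu (ysection M y)) by exact: measurable_fun_ysection.
have /(ae_eq_integral_abs nu measurableT mf) := I0; apply: filterS => y /(_ I) /= My.
exists (ysection M y); split => //; first exact: measurable_ysection.
by move=> x /NM Mxy; rewrite /ysection /=; exact: mem_set.
Qed.

Lemma negligible_snd (N : set Y) : nu.-negligible N ->
  (mu \x nu)%E.-negligible [set p | N p.2].
Proof.
move=> [M [mM M0 NM]]; exists (setT `*` M); split.
- exact: measurableX.
- by rewrite product_measure1E//= M0 mule0.
- by move=> p /NM.
Qed.

(** Tonelli on the product set, after enlarging [E] to it, as is allowed for nonnegative [g]. *)
Lemma integral_prod_set_le (A : set X) (D : set Y) (E : set (X * Y)) (g : X * Y -> \bar R) :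
  measurable A -> measurable D -> E `<=` A `*` D -> measurable_fun setT g ->
  (forall p, (0 <= g p)%E) ->
  (\int[mu \x nu]_(p in E) g p <= \int[nu]_(y in D) \int[mu]_(x in A) g (x, y))%E.
Proof.
move=> mA mD EAD mg g0.
pose h (p : X * Y) : \bar R := (g p * (\1_A p.1 * \1_D p.2)%:E)%E.
have h0 p : (0 <= h p)%E by rewrite mule_ge0// lee_fin mulr_ge0.
have mh : measurable_fun setT h.
  apply: emeasurable_funM => //; apply/measurable_EFinP; apply: measurable_funM.
    exact: (measurableT_comp (measurable_indic mA)).
  exact: (measurableT_comp (measurable_indic mD)).
apply: (@le_trans _ _ (\int[mu \x nu]_p h p)%E).
  rewrite integral_mkcond; apply: le_lower_integral => p _.
    by apply: erestrict_ge0 => q _.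
  rewrite patchE; case: ifPn => // /set_mem /EAD [Ap Dp].
  by rewrite /h !indicE !mem_set// !mulr1 mule1.
rewrite fubini_tonelli2// [leRHS]integral_mkcond.
apply: le_lower_integral => y _; first by apply: integral_ge0.
rewrite patchE; case: ifPn => Dy.
  rewrite [leRHS]integral_mkcond; apply: le_lower_integral => x _ //.
  rewrite patchE /h /= !indicE Dy mulr1; case: ifPn => _; first by rewrite mule1.
  by rewrite mule0.
rewrite /fubini_G integral0_eq// => x _.
by rewrite /h /= !indicE (negbTE Dy) mulr0 mule0.
Qed.

End product_slices.

(** * Integrability of the majorant in time *)

Section time_integrability.
Context {R : realType} {dT : measure_display} {T : measurableType dT}.
Variables (mu : {measure set T -> \bar R}) (J : set T).
Hypothesis mJ : measurable J.
Hypothesis Jy : (mu J < +oo)%E.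
Hypothesis muT : (0 < mu setT)%E.

Let poweRD1_le (P : R) (x : \bar R) : 1 <= P -> (0 <= x)%E ->
  ((x + 1) `^ P <= (2 `^ P)%:E * (x `^ P + 1))%E.
Proof.
move=> P1; have P0 : 0 < P by exact: lt_le_trans P1.
have c0 : 0 < 2 `^ P :> R by rewrite powR_gt0.
case: x => [x| |]// x0.
  rewrite -EFinD !poweR_EFin -EFinD -EFinM lee_fin mulrDr mulr1.
  rewrite lee_fin in x0.
  have [x1|x1] := leP x 1.
    apply: (@le_trans _ _ (2 `^ P)).
      by apply: ge0_ler_powR; rewrite ?nnegrE ?addr_ge0 ?(ltW P0)//; lra.
    by rewrite lerDr mulr_ge0 ?powR_ge0.
  apply: (@le_trans _ _ ((2 * x) `^ P)).
    by apply: ge0_ler_powR; rewrite ?nnegrE ?addr_ge0 ?mulr_ge0 ?(ltW P0)//; lra.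
  by rewrite powRM// lerDl powR_ge0.
by rewrite !poweRyr ?gt_eqF// addye// gt0_muley ?lte_fin// leey.
Qed.

Lemma Lnorm_fin_power (g : T -> \bar R) (P : R) : 1 <= P ->
  measurable_fun J g -> ('N[mu]_P%:E[g \_ J] < +oo)%E ->
  (\int[mu]_(t in J) (`|g t| + 1) `^ P < +oo)%E.
Proof.
move=> P1 mg gy; have P0 : 0 < P by exact: lt_le_trans P1.
have mg' : measurable_fun J (fun t => `|g t|)%E by exact: measurableT_comp.
have mgP : measurable_fun J (fun t => `|g t| `^ P)%E.
  exact: (measurableT_comp (measurable_poweR P)).
have Pn0 : P != 0 by rewrite gt_eqF.
have c0 : 0 <= 2 `^ P :> R by exact: powR_ge0.
apply: (@le_lt_trans _ _ (\int[mu]_(t in J) ((2 `^ P)%:E * (`|g t| `^ P + 1)))%E).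
  by apply: le_lower_integral => t _; [exact: poweR_ge0|exact: poweRD1_le].
rewrite ge0_integralZl//; last 2 first.
- exact: emeasurable_funD.
- by move=> t _; rewrite adde_ge0 ?poweR_ge0.
rewrite lte_mul_pinfty// ge0_integralD//; last first.
  by move=> t _; exact: poweR_ge0.
rewrite integral_cst// mul1e lte_add_pinfty//.
have := poweR_lty P gy; rewrite poweR_Lnorm// => /le_lt_trans; apply.
rewrite integral_mkcond; apply: le_lower_integral => t _.
  by apply: erestrict_ge0 => x _; exact: poweR_ge0.
by rewrite !patchE; case: ifPn => // _; exact: poweR_ge0.
Qed.

Lemma Lnorm_fin_bound (g : T -> \bar R) : ('N[mu]_+oo[g \_ J] < +oo)%E ->
  exists2 M : R, 0 <= M & {ae mu, forall t, J t -> (`|g t| <= M%:E)%E}.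
Proof.
rewrite unlock muT => gy; exists `|fine (ess_sup mu (abse \o g \_ J))| => //.
have /ess_supP := lexx (ess_sup mu (abse \o g \_ J)).
apply: filterS => t /=; rewrite patchE => gt Jt; rewrite mem_set// in gt.
apply: le_trans gt _; case: (ess_sup _ _) gy => [r| |]//= _.
  by rewrite lee_fin ler_norm.
by rewrite leNye.
Qed.

(** Young's inequality for [a] and [b^2] with exponents [P] and [Q / 2], whose weights [1 / P] and
    [2 / Q] are at most [1]. *)
Let young3 (P Q : R) (a b : \bar R) : 0 < P -> 0 < Q -> P^-1 + 2 / Q = 1 ->
  (1 <= a)%E -> (1 <= b)%E -> (a * (b * b) <= a `^ P + b `^ Q)%E.
Proof.
move=> P0 Q0 PQ; case: a => [a| |]//; case: b => [b| |]// a1 b1.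
- rewrite !lee_fin in a1 b1; rewrite !poweR_EFin -!EFinM -EFinD lee_fin.
  have a0 : 0 <= a by exact: le_trans a1.
  have b0 : 0 <= b by exact: le_trans b1.
  have Q20 : 0 < Q / 2 by rewrite divr_gt0.
  have PQ' : P^-1 + (Q / 2)^-1 = 1 by rewrite invf_div.
  apply: le_trans (conjugate_powR a0 (mulr_ge0 b0 b0) P0 Q20 PQ') _.
  have P1 : P^-1 <= 1 by rewrite -PQ lerDl divr_ge0// ltW.
  have Q1 : (Q / 2)^-1 <= 1 by rewrite -[leRHS]PQ' lerDr invr_ge0 ltW.
  have -> : (b * b) `^ (Q / 2) = b `^ Q.
    rewrite -expr2 -powR_mulrn// -powRrM; congr (_ `^ _).
    by rewrite mulrCA mulfV ?mulr1.
  by apply: lerD; rewrite ler_piMr ?powR_ge0.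
- by rewrite poweRyr ?gt_eqF// addey ?leey// poweR_EFin.
- by rewrite poweRyr ?gt_eqF// addye ?leey// poweR_EFin.
- by rewrite !poweRyr ?gt_eqF ?leey.
Qed.

Lemma envelope_integrable (c : R) (g1 g2 : T -> \bar R) (p1 p2 : \bar R) :
  0 <= c -> (1 <= p1)%E -> (1 <= p2)%E -> (p1^-1 + 2%:E * p2^-1 = 1)%E ->
  measurable_fun J g1 -> measurable_fun J g2 ->
  ('N[mu]_p1[g1 \_ J] < +oo)%E -> ('N[mu]_p2[g2 \_ J] < +oo)%E ->
  (\int[mu]_(t in J) envelope c `|g1 t|%E `|g2 t|%E < +oo)%E.
Proof.
move=> c0 p11 p21 pq mg1 mg2 g1y g2y; rewrite /envelope.
have mg1' : measurable_fun J (fun t => `|g1 t| + 1)%E.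
  by apply: emeasurable_funD => //; exact: measurableT_comp.
have mg2' : measurable_fun J (fun t => `|g2 t| + 1)%E.
  by apply: emeasurable_funD => //; exact: measurableT_comp.
have ge1 (x : \bar R) : (1 <= `|x| + 1)%E by rewrite leeDr.
have ge0 (x : \bar R) : (0 <= `|x| + 1)%E by exact: le_trans (ge1 x).
have m12 : measurable_fun J (fun t => ((`|g1 t| + 1) * ((`|g2 t| + 1) * (`|g2 t| + 1)))%E).
  by apply: emeasurable_funM => //; exact: emeasurable_funM.
rewrite ge0_integralZl//; last by move=> t _; rewrite !mule_ge0.
rewrite lte_mul_pinfty//.
case: p1 p11 g1y pq => [P| |]// P1 g1y; case: p2 p21 g2y => [Q| |]// Q1 g2y.
- rewrite !lee_fin in P1 Q1; have P0 : 0 < P by exact: lt_le_trans P1.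
  have Q0 : 0 < Q by exact: lt_le_trans Q1.
  rewrite !inver (gt_eqF P0) (gt_eqF Q0) -EFinM -EFinD => -[PQ].
  apply: (@le_lt_trans _ _ (\int[mu]_(t in J) ((`|g1 t| + 1) `^ P + (`|g2 t| + 1) `^ Q))%E).
    by apply: le_lower_integral => t _; [rewrite !mule_ge0|exact: young3].
  rewrite ge0_integralD//; [|by move=> t _; exact: poweR_ge0| |by move=> t _; exact: poweR_ge0|].
  - by rewrite lte_add_pinfty// Lnorm_fin_power.
  - exact: (measurableT_comp (measurable_poweR P)).
  - exact: (measurableT_comp (measurable_poweR Q)).
(* An infinite [p2] forces [p1 = 1]; the second factor is then bounded. *)
- rewrite invey mule0 adde0 => p1E.
  have {p1E} PE : P = 1.
    by move/eqP: p1E; rewrite inve_eq1 => /eqP[].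
  rewrite {}PE in P1 g1y; have [M M0 gM] := Lnorm_fin_bound g2y.
  have I1 := Lnorm_fin_power P1 mg1 g1y.
  have M1 : 0 <= (M + 1) * (M + 1) by rewrite mulr_ge0 ?addr_ge0.
  apply: (@le_lt_trans _ _ (\int[mu]_(t in J) (((M + 1) * (M + 1))%:E * (`|g1 t| + 1) `^ 1))%E).
    apply: ae_le_lower_integral => [t _|t _|]; first by rewrite !mule_ge0.
      by rewrite mule_ge0 ?poweR_ge0.
    apply: filterS gM => t gMt Jt; rewrite poweRe1// muleC.
    apply: lee_wpmul2r => //; rewrite EFinM.
    by apply: lee_pmul => //; rewrite EFinD leeD2r ?gMt.
  rewrite ge0_integralZl//; first by rewrite lte_mul_pinfty.
    exact: (measurableT_comp (measurable_poweR 1)).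
  by move=> t _; exact: poweR_ge0.
(* An infinite [p1] forces [p2 = 2]; the first factor is then bounded. *)
- rewrite invey add0e => p2E.
  have {p2E} QE : Q = 2.
    rewrite lee_fin in Q1; have Q0 : 0 < Q by exact: lt_le_trans Q1.
    move: p2E; rewrite inver (gt_eqF Q0) -EFinM => -[QE].
    have : 2 / Q * Q = 1 * Q by rewrite QE.
    by rewrite -mulrA mulVf ?gt_eqF// mulr1 mul1r.
  rewrite {}QE in Q1 g2y; have [M M0 gM] := Lnorm_fin_bound g1y.
  have I2 := Lnorm_fin_power Q1 mg2 g2y.
  have M1 : 0 <= M + 1 by rewrite addr_ge0.
  apply: (@le_lt_trans _ _ (\int[mu]_(t in J) ((M + 1)%:E * (`|g2 t| + 1) `^ 2))%E).
    apply: ae_le_lower_integral => [t _|t _|]; first by rewrite !mule_ge0.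
      by rewrite mule_ge0 ?poweR_ge0.
    apply: filterS gM => t gMt Jt.
    have -> : ((`|g2 t| + 1) * (`|g2 t| + 1) = (`|g2 t| + 1) `^ 2)%E.
      have := ge1 (g2 t); case: (`|g2 t| + 1)%E => [x| |]//.
        rewrite lee_fin => x1; rewrite poweR_EFin -EFinM -expr2 powR_mulrn//.
        exact: le_trans x1.
      by rewrite poweRyr.
    by apply: lee_wpmul2r; rewrite ?poweR_ge0// EFinD leeD2r ?gMt.
  rewrite ge0_integralZl//; first by rewrite lte_mul_pinfty.
    exact: (measurableT_comp (measurable_poweR 2)).
  by move=> t _; exact: poweR_ge0.
- by rewrite invey mule0 adde0 => -[] /eqP; rewrite eq_sym oner_eq0.
Qed.

End time_integrability.

Section near_right.
Context {R : realType}.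

(** Dominated convergence concerns sequences. If [P] failed near [0], a counterexample below
    [1 / (n + 1)] for each [n] would give a sequence along which it never holds. *)
Lemma near_right_seq (P : R -> Prop) (l0 : R) : 0 < l0 ->
  (forall u : nat -> R, (forall n, 0 < u n < l0) -> u n @[n --> \oo] --> 0^'+ ->
    \forall n \near \oo, P (u n)) ->
  \forall l \near 0^'+, P l.
Proof.
move=> l00 H; apply: contrapT => nP.
have ex n : exists l : R, [/\ 0 < l < l0, l < n.+1%:R^-1 & ~ P l].
  apply: contrapT => /forallNP nex; apply: nP.
  have H1 : \forall l \near (0 : R)^'+, 0 < l by exact: nbhs_right_gt.
  have H2 : \forall l \near (0 : R)^'+, l < l0 by exact: nbhs_right_lt.
  have H3 : \forall l \near (0 : R)^'+, l < n.+1%:R^-1.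
    by apply: nbhs_right_lt; rewrite invr_gt0.
  apply: filterS3 H1 H2 H3 => l h1 h2 h3.
  by apply: contrapT => nPl; apply: (nex l); split; rewrite ?h1.
have [u Hu] := choice ex.
have u0 n : 0 < u n < l0 by have [] := Hu n.
have uc : u n @[n --> \oo] --> 0.
  apply: (@squeeze_cvgr _ _ _ _ (cst 0) (fun n => n.+1%:R^-1)).
  - by near=> n; have [/andP[/ltW -> _] /ltW -> _] := Hu n.
  - exact: cvg_cst.
  - exact: cvg_harmonic.
have uc' : u n @[n --> \oo] --> 0^'+.
  move=> A hA.
  have H1 : \forall n \near \oo, 0 < u n -> A (u n) by exact: (uc _ hA).
  have H2 : \forall n \near \oo, A (u n).
    by apply: filterS H1 => n; apply; have /andP[] := u0 n.
  exact: H2.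
have [N _ HN] := H u u0 uc'.
by have [_ _] := Hu N; apply; apply: HN => /=.
Unshelve. all: end_near. Qed.

Lemma envelope_ge0 (c : R) (N1 N2 : \bar R) : 0 <= c -> (0 <= N1)%E ->
  (0 <= N2)%E -> (0 <= envelope c N1 N2)%E.
Proof. by move=> c0 N10 N20; rewrite !mule_ge0 ?adde_ge0. Qed.

End near_right.

Section integrable_fields.
Context {R : realType} {d : nat}.
Local Notation V := 'rV[R]_d.
Local Notation lam := (@lebesgue_rV R d).

Lemma integrable_field_lty (v : V -> V) : integrable_field v ->
  (\int[lam]_x (enorm (v x))%:E < +oo)%E.
Proof.
move=> intv.
have mv i : measurable_fun setT (fun x => `|v x 0 i|%:E).
  have /integrableP[mvi _] := intv i; apply/measurable_EFinP.
  by apply: measurableT_comp => //; exact/measurable_EFinP.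
apply: (@le_lt_trans _ _ (\int[lam]_x (\sum_i `|v x 0 i|%:E))%E).
  apply: le_lower_integral => x _; first by rewrite lee_fin enorm_ge0.
  by rewrite sumEFin lee_fin; apply: le_trans (enorm_le_sum _) _; rewrite big_ord1.
rewrite ge0_integral_sum//; apply/lte_sum_pinfty => i _.
by have /integrableP[_] := intv i.
Qed.

End integrable_fields.

#[local] Instance lebesgue_ae_filter (R : realType) :
  Filter (nbhs (almost_everywhere (@lebesgue_measure R))).
Proof. exact: ae_filter_ringOfSetsType. Qed.

(** * Dominated convergence in time *)

Section time_dependence.
Context {R : realType} {d : nat}.
Local Notation V := 'rV[R]_d.
Local Notation lam := (@lebesgue_rV R d).
Local Notation leb := (@lebesgue_measure R).
Local Notation st := (lam \x leb)%E.

(** Both fluxes are treated at once: what counts is locality in the field and joint measurability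
    for Borel fields with integrable slices. *)
Variable flux : (V -> V) -> R -> V -> R.
Hypothesis flux_congr : forall (K : set V) (dl l : R) (u v : V -> V) (x : V),
  0 < l < dl -> {ae lam, forall y, nbd K dl y -> u y = v y} -> K x -> u x = v x ->
  flux u l x = flux v l x.
Hypothesis flux_meas : forall (l : R) (U : V * R -> V), 0 < l ->
  measurable_fun setT U -> (forall t, integrable_field (fun x => U (x, t))) ->
  measurable_fun setT (fun p : V * R => flux (fun y => U (y, p.2)) l p.1).

Variables (Om : set V) (T : R) (u : V -> R -> V).
Hypothesis Om_open : open Om.
Hypothesis u_meas : ae_measurable st (spacetime Om T) (fun p => u p.1 p.2).

Variables (K : set V) (dl a b : R).
Hypothesis cK : compact K.
Hypothesis dl0 : 0 < dl.
Let S := nbd K dl.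
Let J : set R := `[a, b].
Hypothesis SOm : S `<=` Om.
Hypothesis a0 : 0 < a.
Hypothesis bT : b < T.

Variables (l0 c : R) (N1 N2 : R -> \bar R) (p1 p2 : \bar R).
Hypothesis l00 : 0 < l0.
Hypothesis c0 : 0 <= c.
Hypothesis N10 : forall t, (0 <= N1 t)%E.
Hypothesis N20 : forall t, (0 <= N2 t)%E.
Hypothesis p11 : (1 <= p1)%E.
Hypothesis p21 : (1 <= p2)%E.
Hypothesis p12 : (p1^-1 + 2%:E * p2^-1 = 1)%E.
Hypothesis N1p : in_Lq_time J p1 N1.
Hypothesis N2p : in_Lq_time J p2 N2.
Hypothesis vanishing : {ae leb, forall t, 0 < t < T ->
  forall v, nice_version S (u ^~ t) v -> integrable_field v /\
    dominated_vanishing (fun l => \int[lam]_(x in K) `|flux v l x|%:E)%E l0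
      (envelope c (N1 t) (N2 t))}.

#[local] Instance st_ae_filter : Filter (nbhs (almost_everywhere st)).
Proof. exact: ae_filter_ringOfSetsType. Qed.

Let mK : measurable K. Proof. exact: compact_measurable_rV. Qed.
Let mS : measurable S. Proof. by apply: compact_measurable_rV; exact: nbd_compact. Qed.
Let mJ : measurable J. Proof. exact: measurable_itv. Qed.
Let JT t : J t -> 0 < t < T.
Proof.
by rewrite /J /= in_itv/= => /andP[at' tb]; rewrite (lt_le_trans a0)//= (le_lt_trans tb).
Qed.

Let slice_measurable (m n : nat) (U : V * R -> 'M[R]_(m, n)) t : measurable_fun setT U ->
  measurable_fun setT (fun x => U (x, t)).
Proof. by move=> mU; exact: (measurableT_comp mU (measurable_pair2 t)). Qed.

Let measurable_transpose : measurable_fun setT (fun p : R * V => (p.2, p.1)).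
Proof.
apply/measurable_fun_pairP; split => /=; first exact: measurable_snd.
exact: measurable_fst.
Qed.

(* A Borel version of [u], cut off outside [S `*` J] and at the times where the
   slice is not integrable, so that every slice is an integrable Borel field. *)
Let regular_version : exists U : V * R -> V,
  [/\ measurable_fun setT U, forall t, integrable_field (fun x => U (x, t)),
      {ae leb, forall t, J t -> nice_version S (u ^~ t) (fun x => U (x, t))} &
      {ae st, forall p, (K `*` J) p -> u p.1 p.2 = U p}].
Proof.
have [g mg ug] := u_meas.
have mA : measurable (S `*` J) by exact: measurableX.
have ASt : S `*` J `<=` spacetime Om T.
  by move=> p [/SOm Sp /JT Jp]; split => //=; rewrite in_itv.
pose U0 (p : V * R) : V := (\1_(S `*` J) p : R) *: g p.
have mU0 : measurable_fun setT U0.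
  apply: measurable_indic_scale => //; apply: measurable_funS mg => //.
  by apply: measurableX => //; exact: open_measurable_rV.
pose I t := (\int[lam]_x (enorm (U0 (x, t)))%:E)%E.
have mI : measurable_fun setT I.
  apply: (measurable_integral_set lam measurableT
    (g := fun p : R * V => (enorm (U0 (p.2, p.1)))%:E)) => [|p].
    apply/measurable_EFinP; apply: measurable_enorm.
    exact: (measurableT_comp mU0 measurable_transpose).
  by rewrite lee_fin enorm_ge0.
pose G := [set t | (I t < +oo)%E].
have mG : measurable G.
  rewrite -[G]setTI; exact: emeasurable_fun_infty_o.
pose U (p : V * R) : V := (\1_([set: V] `*` G) p : R) *: U0 p.
have mU : measurable_fun setT U.
  apply: measurable_indic_scale; first exact: measurableX.
  exact: measurable_funTS.
have UG t : G t -> (fun x => U (x, t)) = (fun x => U0 (x, t)).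
  by move=> Gt; apply/funext => x; rewrite /U indicE mem_set// scale1r.
have intU t : integrable_field (fun x => U (x, t)).
  have [Gt|Gt] := asboolP (G t).
    rewrite UG//; apply: integrable_field_enorm => //.
    exact: slice_measurable.
  move=> i; rewrite [X in _.-integrable _ X](_ : _ = cst 0%E); first exact: integrable0.
  by apply/funext => x; rewrite /U /= indicE memNset ?scale0r ?mxE// => -[].
have niceU0 : {ae leb, forall t, J t -> nice_version S (u ^~ t) (fun x => U0 (x, t))}.
  apply: filterS (negligible_slices ug) => t ut Jt; split.
  - exact: slice_measurable.
  - by move=> x Sx; rewrite /U0 indicE memNset ?scale0r// => -[].
  - have ut' : {ae lam, forall x, spacetime Om T (x, t) -> u x t = g (x, t)} by exact: ut.
    apply: filterS ut' => x ux Sx; rewrite /U0 indicE mem_set// scale1r; apply: ux.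
    exact: ASt.
have JG : {ae leb, forall t, J t -> G t}.
  apply: filterS2 niceU0 vanishing => t nt vt Jt.
  have [intv _] := vt (JT Jt) _ (nt Jt); exact: integrable_field_lty.
exists U; split => //.
- by apply: filterS2 niceU0 JG => t nt Gt Jt; rewrite UG; [exact: nt|exact: Gt].
- have JG' : {ae st, forall p, J p.2 -> G p.2}.
    exact: (negligible_snd lam JG).
  apply: filterS2 ug JG' => -[x t] /= uxt Gt [Kx Jt].
  have Sx : S x by apply: sub_nbd Kx; exact: ltW.
  have -> : U (x, t) = U0 (x, t) by exact: (congr1 (fun h => h x) (UG t (Gt Jt))).
  by rewrite /U0 indicE mem_set// scale1r; apply: uxt; exact: ASt.
Qed.

(** [F], built from the Borel version, is measurable in time. The norms [N1] and [N2] need not be,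
    and are replaced by the measurable [g1] and [g2] that equal them almost everywhere on [J]. *)
Theorem time_dominated (E : set (V * R)) : E `<=` K `*` J ->
  (\forall l \near 0^'+, ae_measurable st E (fun p => flux (u ^~ p.2) l p.1)) /\
  (\int[st]_(p in E) `|flux (u ^~ p.2) l p.1|%:E)%E @[l --> 0^'+] --> 0%E.
Proof.
move=> EKJ; have [U [mU intU niceU uU]] := regular_version.
have mf (l : R) : 0 < l -> measurable_fun setT (fun p : V * R => flux (fun y => U (y, p.2)) l p.1).
  by move=> l_gt0; exact: flux_meas.
(* The quantifier over [l] stands inside: the exceptional set does not depend on [l]. *)
have uUf : {ae st, forall p, E p -> forall l : R, 0 < l -> l < dl ->
    flux (u ^~ p.2) l p.1 = flux (fun y => U (y, p.2)) l p.1}.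
  have niceU' := negligible_snd lam niceU.
  apply: filterS2 uU niceU' => -[x t] /= uxt nt Ext l l_gt0 ldl.
  have [Kx Jt] := EKJ _ Ext; have [_ _ uUt] := nt Jt.
  apply: (flux_congr _ uUt) => //; first by rewrite l_gt0.
  exact: (uxt (conj Kx Jt)).
pose F (l t : R) := (\int[lam]_(x in K) `|flux (fun y => U (y, t)) l x|%:E)%E.
have F0 l t : (0 <= F l t)%E by apply: integral_ge0.
have mF (l : R) : 0 < l -> measurable_fun setT (F l).
  move=> l_gt0; apply: (measurable_integral_set lam mK
    (g := fun p : R * V => `|flux (fun y => U (y, p.1)) l p.2|%:E)) => [|p].
    apply/measurable_EFinP; apply: measurableT_comp => //.
    exact: (measurableT_comp (mf l l_gt0) measurable_transpose).
  by rewrite lee_fin.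
have bound (l : R) : 0 < l -> l < dl ->
    (\int[st]_(p in E) `|flux (u ^~ p.2) l p.1|%:E <= \int[leb]_(t in J) F l t)%E.
  move=> l_gt0 ldl.
  apply: (@le_trans _ _ (\int[st]_(p in E) `|flux (fun y => U (y, p.2)) l p.1|%:E)%E).
    apply: ae_le_lower_integral => // ; apply: filterS uUf => p up Ep.
    by rewrite up.
  have g0 (p : V * R) : (0 <= `|flux (fun y => U (y, p.2)) l p.1|%:E)%E by [].
  have mg : measurable_fun setT (fun p : V * R => `|flux (fun y => U (y, p.2)) l p.1|%:E).
    by apply/measurable_EFinP; apply: measurableT_comp => //; exact: mf.
  have H := integral_prod_set_le lam leb mK mJ EKJ mg g0.
  exact H.
split.
  have H1 : \forall l \near (0 : R)^'+, 0 < l by exact: nbhs_right_gt.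
  have H2 : \forall l \near (0 : R)^'+, l < dl by exact: nbhs_right_lt.
  apply: filterS2 H1 H2 => l l_gt0 ldl.
  exists (fun p => flux (fun y => U (y, p.2)) l p.1).
    by apply: measurable_funTS; exact: mf.
  by apply: filterS uUf => p up Ep; exact: up.
apply: near_le_cvge0 => [l|e e0]; first by apply: integral_ge0.
have H2 : \forall l \near (0 : R)^'+, (\int[leb]_(t in J) F l t <= e%:E)%E.
  apply: (near_right_seq l00) => s s0 sc.
  have [g1 [mg1 Ng1 g1y]] := N1p; have [g2 [mg2 Ng2 g2y]] := N2p.
  have sc0 n : 0 < s n by have /andP[] := s0 n.
  have main : {ae leb, forall t, J t ->
      (forall n, (F (s n) t <= envelope c `|g1 t|%E `|g2 t|%E)%E) /\
      F (s n) t @[n --> \oo] --> 0%E}.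
    have NG1 : {ae leb, forall t, J t -> N1 t = g1 t} by exact: Ng1.
    have NG2 : {ae leb, forall t, J t -> N2 t = g2 t} by exact: Ng2.
    have H4 := @filterI _ _ (lebesgue_ae_filter R) _ _ niceU vanishing.
    have H5 := @filterI _ _ (lebesgue_ae_filter R) _ _ NG1 NG2.
    apply: filterS2 H4 H5 => t [nt vt] [h1 h2] Jt.
    have [_ [Fle Fcvg]] := vt (JT Jt) _ (nt Jt).
    have envE : envelope c `|g1 t|%E `|g2 t|%E = envelope c (N1 t) (N2 t).
      by rewrite -h1// -h2// !gee0_abs.
    split => [n|]; first by rewrite envE; exact: Fle.
    apply: near_le_cvge0 => // e' e'0; exact: (sc _ (Fcvg _ e'0)).
  have [] := @dominated_convergence _ _ _ leb J mJ (fun n t => F (s n) t) (cst 0%E)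
    (fun t => envelope c `|g1 t|%E `|g2 t|%E).
  - by move=> n; apply: measurable_funTS; exact: mF.
  - exact: measurable_cst.
  - by apply: filterS main => t Ht Jt; exact: (Ht Jt).2.
  - have mN g : measurable_fun J g -> measurable_fun J (fun t => (`|g t| + 1)%E).
      by move=> mg; apply: emeasurable_funD => //; exact: measurableT_comp.
    apply/integrableP; split.
      apply: emeasurable_funM => //; apply: emeasurable_funM; first exact: mN.
      by apply: emeasurable_funM; exact: mN.
    under eq_integral do rewrite gee0_abs ?envelope_ge0//.
    have Jy : (leb J < +oo)%E.
      by rewrite /J lebesgue_measure_itv/=; case: ifP => _; rewrite ?ltry// -EFinB ltry.
    have lebT : (0 < leb setT)%E.
      apply: (@lt_le_trans _ _ (leb `[0, 1])).
        by rewrite lebesgue_measure_itv/= lte01 oppr0 adde0.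
      by apply: le_measure; rewrite ?inE.
    exact (@envelope_integrable R _ _ (leb : {measure set _ -> \bar R}) J mJ Jy lebT c g1 g2
      p1 p2 c0 p11 p21 p12 mg1 mg2 g1y g2y).
  - by apply: filterS main => t Ht n Jt; rewrite gee0_abs//; exact: (Ht Jt).1.
  move=> _ _; rewrite integral_cst// mul0e => h.
  exact: cvge0_near_le.
have H1 : \forall l \near (0 : R)^'+, 0 < l by exact: nbhs_right_gt.
have H3 : \forall l \near (0 : R)^'+, l < dl by exact: nbhs_right_lt.
by apply: filterS3 H1 H2 H3 => l h1 h2 h3; exact: le_trans (bound l h1 h3) h2.
Qed.

End time_dependence.

Section locally_controlled.
Context {R : realType} {d : nat}.
Local Notation V := 'rV[R]_d.
Local Notation lam := (@lebesgue_rV R d).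
Local Notation leb := (@lebesgue_measure R).

Variables (Om : set V) (T : R) (u : V -> R -> V).
Hypothesis Om_open : open Om.
Hypothesis u_meas : ae_measurable spacetime_measure (spacetime Om T)
  (fun p => u p.1 p.2).

(** What a compact [K] must provide for [time_dominated], with constants and radii that do not
    depend on the time interval. *)
Definition controlled (flux : (V -> V) -> R -> V -> R) (p1 p2 : \bar R)
    (K : set V) : Prop :=
  exists (dl l0 c : R) (N1 N2 : R -> \bar R),
    [/\ [/\ 0 < dl, nbd K dl `<=` Om, 0 < l0 & 0 <= c],
        (forall t, 0 <= N1 t)%E /\ (forall t, 0 <= N2 t)%E,
        forall a b : R, 0 < a -> b < T ->
          in_Lq_time `[a, b] p1 N1 /\ in_Lq_time `[a, b] p2 N2 &
        {ae leb, forall t, 0 < t < T ->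
          forall v, nice_version (nbd K dl) (u ^~ t) v -> integrable_field v /\
            dominated_vanishing (fun l => \int[lam]_(x in K) `|flux v l x|%:E)%E
              l0 (envelope c (N1 t) (N2 t))}].

Lemma in_LtX_itv {m n : nat} (q : \bar R) X N (v : V -> R -> 'M[R]_(m, n)) (K : set V) (a b : R) :
  in_LtX Om T q X N v -> compact_in Om K -> 0 < a -> b < T ->
  in_Lq_time `[a, b] q (fun t => N K (v ^~ t)).
Proof.
move=> [_ vN] KOm a0 bT; apply: vN => //; first exact: interval_is_interval.
rewrite -(closure_id _).1; last exact: itv_closed.
move=> t /=; rewrite !in_itv/= => /andP[ta tb].
by rewrite (lt_le_trans a0)//= (le_lt_trans tb).
Qed.

(** The extreme times are attained by compactness, so they lie strictly inside []0, T[]. *)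
Lemma compact_box (E : set (V * R)) : compact E -> E `<=` spacetime Om T ->
  E !=set0 -> exists (K : set V) (a b : R),
    [/\ compact_in Om K, 0 < a, b < T & E `<=` K `*` `[a, b]].
Proof.
move=> cE EOm E0.
have cfst : {within E, continuous (fun p : V * R => p.1)}.
  by apply: continuous_subspaceT => p; exact: cvg_fst.
have csnd : {within E, continuous (fun p : V * R => p.2)}.
  by apply: continuous_subspaceT => p; exact: cvg_snd.
have [p /set_mem Ep pmin] := compact_EVT_min E0 cE csnd.
have [q /set_mem Eq qmax] := compact_EVT_max E0 cE csnd.
have := EOm _ Ep; have := EOm _ Eq; rewrite /spacetime /= !in_itv/=.
move=> [_ /andP[_ qT]] [_ /andP[p0 _]].
exists [set r.1 | r in E], p.2, q.2; split => //.
- split.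
  + exact: continuous_compact.
  + by move=> _ [r Er <-]; have [] := EOm _ Er.
  + by exists p.1, p.
- move=> r Er; split; first by exists r.
  by rewrite /= in_itv/= pmin ?inE// qmax ?inE.
Qed.

Lemma controlled_cvg0 (flux : (V -> V) -> R -> V -> R) (p1 p2 : \bar R) :
  (forall (K : set V) (dl l : R) (u v : V -> V) (x : V),
    0 < l < dl -> {ae lam, forall y, nbd K dl y -> u y = v y} -> K x -> u x = v x ->
    flux u l x = flux v l x) ->
  (forall (l : R) (U : V * R -> V), 0 < l ->
    measurable_fun setT U -> (forall t, integrable_field (fun x => U (x, t))) ->
    measurable_fun setT (fun p : V * R => flux (fun y => U (y, p.2)) l p.1)) ->
  (1 <= p1)%E -> (1 <= p2)%E -> (p1^-1 + 2%:E * p2^-1 = 1)%E ->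
  (forall K, compact_in Om K -> controlled flux p1 p2 K) ->
  cvg0_L1loc Om T (fun l x t => flux (u ^~ t) l x).
Proof.
move=> fluxC fluxM p11 p21 p12 HK E cE EOm.
(* [compact_in] asks for non-empty sets, so the empty [E] is treated apart. *)
have [->|E0] := eqVneq E set0.
  split; last by under eq_fun do rewrite integral_set0; exact: cvg_cst.
  by near=> l; exists (fun _ => 0) => // ; apply: aeW.
have [K [a [b [KOm a0 bT EKJ]]]] := compact_box cE EOm ((set0P _).1 E0).
have [cK _ _] := KOm.
have [dl [l0 [c [N1 [N2 [[dl0 SOm l00 c0] [N10 N20] Np van]]]]]] := HK K KOm.
have [N1p N2p] := Np a b a0 bT.
exact (@time_dominated R d flux fluxC fluxM Om T u Om_open u_meas K dl a b cK dl0
  SOm a0 bT l0 c N1 N2 p1 p2 l00 c0 N10 N20 p11 p21 p12 N1p N2p van E EKJ).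
Unshelve. all: end_near. Qed.

End locally_controlled.

Section flux_properties.
Context {R : realType} {d : nat}.
Local Notation V := 'rV[R]_d.
Local Notation lam := (@lebesgue_rV R d).
Variable rho : V -> R.
Hypothesis rho_kernel : mollifier_kernel rho.

Lemma flux_DR_nbd_congr (K : set V) (dl l : R) (u v : V -> V) (x : V) :
  0 < l < dl -> {ae lam, forall y, nbd K dl y -> u y = v y} -> K x -> u x = v x ->
  flux_DR rho u l x = flux_DR rho v l x.
Proof.
move=> /andP[l0 ldl] uv Kx uvx; apply: (flux_DR_congr rho_kernel uv l0 _ uvx) => y yx.
by exists x => //; apply: le_trans (norm_le_enorm _) (ltW (lt_trans yx ldl)).
Qed.

Lemma flux_CET_nbd_congr (K : set V) (dl l : R) (u v : V -> V) (x : V) :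
  0 < l < dl -> {ae lam, forall y, nbd K dl y -> u y = v y} -> K x -> u x = v x ->
  flux_CET rho u l x = flux_CET rho v l x.
Proof.
move=> /andP[l0 ldl] uv Kx uvx.
have e0 : 0 < dl - l by rewrite subr_gt0.
apply: (flux_CET_congr rho_kernel uv l0 e0) => y; rewrite subrKC => yx.
by exists x => //; exact: ltW.
Qed.

End flux_properties.

#[local] Existing Instance lebesgue_ae_filter.

(** * Each hypothesis of the theorem provides the control *)

Section controlled_cases.
Context {R : realType} {d : nat}.
Local Notation V := 'rV[R]_d.
Local Notation lam := (@lebesgue_rV R d).
Local Notation leb := (@lebesgue_measure R).
Local Notation vB := (@vol_B R d).
Variable rho : V -> R.
Hypothesis rho_kernel : mollifier_kernel rho.

Variables (Om : set V) (T : R) (u : V -> R -> V).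
Hypothesis Om_open : open Om.

Let vB0 : 0 <= vB. Proof. exact: vol_B_ge0. Qed.

Lemma nice_Lq_integrable (q : nat) (S : set V) (w v : V -> V) : compact S ->
  nice_version S w v -> (Lq_norm q.+1%:R%:E S w < +oo)%E -> integrable_field v.
Proof.
move=> cS nv wq; have [mv v0 _] := nv.
apply: (integrable_field_pow (q := q) (compact_measurable_rV cS) (compact_lebesgue_lty cS) mv v0).
by rewrite -(nice_Lq q nv); exact: poweR_lty.
Qed.

Lemma compact_nbd_in (K : set V) (dl : R) : compact_in Om K -> 0 <= dl ->
  nbd K dl `<=` Om -> compact_in Om (nbd K dl).
Proof.
move=> [cK _ [x Kx]] dl0 SOm; split => //; first exact: nbd_compact.
by exists x; exact: sub_nbd.
Qed.

Lemma controlled_besov_DR (K : set V) : in_LtBesovVMO Om T 3%:E 3^-1 3 u ->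
  compact_in Om K -> controlled Om T u (flux_DR rho) 3%:E 3%:E K.
Proof.
move=> [rad radP uX] KOm; have [cK sK K0] := KOm.
have [C [C0 rhoC rhoC']] := kernel_bounded rho_kernel.
have [dl dl0 SOm] := nbd_in_open cK Om_open sK.
have [r0 _] := radP K KOm.
pose N t := besov_norm 3^-1 3 (rad K) K (u ^~ t).
have N0 t : (0 <= N t)%E by exact: besov_norm_ge0.
exists dl, (Num.min dl (rad K)), (d%:R * C * vB / 4 + 1), N, N; split => //.
- split => //; first by rewrite lt_min dl0.
  by rewrite addr_ge0// !mulr_ge0// ltW.
- by move=> a b a0 bT; split; exact: (in_LtX_itv uX KOm a0 bT).
apply: filterS uX.1 => t ut tT v nv; have [[[_ w3] _] wV] := ut tT.
split; last exact: (besov_DR rho_kernel C0 rhoC rhoC' dl0 cK nv r0 (wV K KOm)).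
apply: (nice_Lq_integrable (q := 2) (nbd_compact cK) nv).
exact: (w3 _ (compact_nbd_in KOm (ltW dl0) SOm)).
Qed.

Lemma controlled_besov_CET (K : set V) : in_LtBesovVMO Om T 3%:E 3^-1 3 u ->
  compact_in Om K -> controlled Om T u (flux_CET rho) 3%:E 3%:E K.
Proof.
move=> [rad radP uX] KOm; have [cK sK K0] := KOm.
have [C [C0 rhoC rhoC']] := kernel_bounded rho_kernel.
have [dl dl0 SOm] := nbd_in_open cK Om_open sK.
have [r0 _] := radP K KOm.
pose N t := besov_norm 3^-1 3 (rad K) K (u ^~ t).
have N0 t : (0 <= N t)%E by exact: besov_norm_ge0.
exists dl, (Num.min dl (rad K)), (2 * d%:R ^+ 2 * (2 * C ^+ 2 * vB + C) * C *
  vB * vB + 1), N, N; split => //.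
- split => //; first by rewrite lt_min dl0.
  by rewrite addr_ge0// !mulr_ge0 ?exprn_ge0 ?addr_ge0 ?mulr_ge0 ?exprn_ge0 ?(ltW C0).
- by move=> a b a0 bT; split; exact: (in_LtX_itv uX KOm a0 bT).
apply: filterS uX.1 => t ut tT v nv; have [[[_ w3] _] wV] := ut tT.
have wS := w3 _ (compact_nbd_in KOm (ltW dl0) SOm).
split; last exact: (besov_CET rho_kernel C0 rhoC rhoC' dl0 cK nv r0 wS (wV K KOm)).
exact: (nice_Lq_integrable (q := 2) (nbd_compact cK) nv).
Qed.

Lemma controlled_BD_C0_DR (p1 p2 : \bar R) (K : set V) : in_LtBD Om T p1 u ->
  in_LtC0 Om T p2 u -> compact_in Om K -> controlled Om T u (flux_DR rho) p1 p2 K.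
Proof.
move=> uBD uC0 KOm; have [cK sK K0] := KOm.
have [C [C0 rhoC rhoC']] := kernel_bounded rho_kernel.
have [dl dl0 SOm] := nbd_in_open cK Om_open sK.
have SinOm := compact_nbd_in KOm (ltW dl0) SOm; have [cS _ S0] := SinOm.
exists dl, (dl / 2), (C * d%:R ^+ 2 * (d%:R * (2 * (C * vB)) ^+ 2 * vB * (C * vB)) + 1),
  (fun t => BD_norm Om (nbd K dl) (u ^~ t)), (fun t => C0_norm Om (nbd K dl) (u ^~ t)); split => //.
- split => //; first by rewrite divr_gt0.
  by rewrite addr_ge0// !mulr_ge0 ?exprn_ge0 ?mulr_ge0 ?(ltW C0).
- by split => t; [exact: BD_norm_ge0|exact: C0_norm_ge0].
- by move=> a b a0 bT; split; [exact: (in_LtX_itv uBD)|exact: (in_LtX_itv uC0)].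
apply: filterS2 uBD.1 uC0.1 => t ut1 ut2 tT v nv.
have wBD := ut1 tT; have [[_ w1] _] := wBD.
split; last exact: (BD_C0_DR rho_kernel C0 rhoC rhoC' dl0 K0 cK SOm nv Om_open wBD (ut2 tT)).
exact: (nice_Lq_integrable (q := 0) cS nv (w1 _ SinOm)).
Qed.

(** The BMO norm and its radius are taken on the neighbourhood [K'] of [K], since the balls of the
    oscillation argument are centred there. *)
Lemma controlled_VMO_CET (p1 p2 : \bar R) (K : set V) : in_LtBD Om T p1 u ->
  in_LtVMO Om T p2 u -> compact_in Om K -> controlled Om T u (flux_CET rho) p1 p2 K.
Proof.
move=> uBD [rad radP uV] KOm; have [cK sK K0] := KOm.
have [C [C0 rhoC rhoC']] := kernel_bounded rho_kernel.
have [dl dl0 SOm] := nbd_in_open cK Om_open sK.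
have SinOm := compact_nbd_in KOm (ltW dl0) SOm; have [cS _ S0] := SinOm.
pose K' := nbd K (dl / 2).
have dl20 : 0 <= dl / 2 by rewrite divr_ge0// ltW.
have dl2 : dl / 2 <= dl by rewrite ler_pdivrMr// ler_peMr ?(ltW dl0)// ler1n.
have K'Om : compact_in Om K'.
  by apply: compact_nbd_in => //; apply: subset_trans SOm; exact: nbd_sub.
have [_ _ K'0] := K'Om; have [r0 _] := radP K' K'Om.
have jn0 : 0 <= @jn_const R d 1 by rewrite !mulr_ge0 ?exprn_ge0 ?mulr_ge0.
exists dl, (Num.min dl (rad K') / (4 * d.+1%:R)), ((2 * C ^+ 2 * vB + C) *
  (@jn_const R d 1 * d%:R ^+ 2) * (C * vB) + 1),
  (fun t => BD_norm Om (nbd K dl) (u ^~ t)), (fun t => BMO_norm (rad K') K' (u ^~ t)); split => //.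
- split => //; first by rewrite divr_gt0 ?mulr_gt0 ?ltr0n// lt_min dl0.
  by rewrite addr_ge0// !mulr_ge0 ?exprn_ge0 ?addr_ge0 ?mulr_ge0 ?exprn_ge0 ?(ltW C0).
- by split => t; [exact: BD_norm_ge0|exact: BMO_norm_ge0].
- move=> a b a0 bT; split; first exact: (in_LtX_itv uBD).
  exact: (in_LtX_itv (N := fun K => BMO_norm (rad K) K) uV).
apply: filterS2 uBD.1 uV.1 => t ut1 ut2 tT v nv.
have wBD := ut1 tT; have [[_ w1] _] := wBD; have [_ wV] := ut2 tT.
split; last exact: (VMO_CET rho_kernel C0 rhoC rhoC' dl0 K0 cK SOm nv r0 wBD (wV _ K'Om)).
exact: (nice_Lq_integrable (q := 0) cS nv (w1 _ SinOm)).
Qed.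

Lemma controlled_bounded_DR (p1 p2 : \bar R) (K : set V) : in_LtL Om T p2 +oo%E u ->
  symgrad_in_LtL Om T p1 1%E u -> compact_in Om K ->
  controlled Om T u (flux_DR rho) p1 p2 K.
Proof.
move=> uL [Eu Eusym EuL] KOm; have [cK sK K0] := KOm.
have [C [C0 rhoC rhoC']] := kernel_bounded rho_kernel.
have [dl dl0 SOm] := nbd_in_open cK Om_open sK.
have SinOm := compact_nbd_in KOm (ltW dl0) SOm; have [cS _ S0] := SinOm.
exists dl, (dl / 2), (C * d%:R ^+ 2 * (d%:R * (2 * (C * vB)) ^+ 2 * vB * (C * vB)) + 1),
  (fun t => Lq_norm 1%E (nbd K dl) (Eu ^~ t)), (fun t => Lq_norm +oo%E (nbd K dl) (u ^~ t)); split => //.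
- split => //; first by rewrite divr_gt0.
  by rewrite addr_ge0// !mulr_ge0 ?exprn_ge0 ?mulr_ge0 ?(ltW C0).
- by split => t; exact: Lnorm_ge0.
- by move=> a b a0 bT; split; [exact: (in_LtX_itv EuL)|exact: (in_LtX_itv uL)].
apply: filterS2 uL.1 Eusym => t ut1 ut2 tT v nv.
have wL := ut1 tT; have [_ wy] := wL; have w0y := wy _ SinOm.
split; last exact: (bounded_DR rho_kernel C0 rhoC rhoC' dl0 K0 cK SOm nv Om_open wL (ut2 tT)).
have [mv _ _] := nv; apply: integrable_field_enorm => //.
have w00 : (0 <= Lq_norm +oo%E (nbd K dl) (u ^~ t))%E by exact: Lnorm_ge0.
(* The bounded version is integrable, being supported in a compact set, and has the same L^1 norm as
   [v]. *)
have [|v' nv' v'M] := nice_Lqoo (fine_ge0 w00) nv; first by rewrite fineK// ge0_fin_numE.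
rewrite -(nice_Lq1 nv) (nice_Lq1 nv').
exact: (integrable_field_lty (nice_bounded_integrable cK nv' v'M)).
Qed.

Lemma controlled_strain_DR (p1 p2 : \bar R) (K : set V) : in_LtL Om T p2 2%:E u ->
  symgrad_in_LtL Om T p1 +oo%E u -> compact_in Om K ->
  controlled Om T u (flux_DR rho) p1 p2 K.
Proof.
move=> uL [Eu Eusym EuL] KOm; have [cK sK K0] := KOm.
have [C [C0 rhoC rhoC']] := kernel_bounded rho_kernel.
have [dl dl0 SOm] := nbd_in_open cK Om_open sK.
have SinOm := compact_nbd_in KOm (ltW dl0) SOm; have [cS _ S0] := SinOm.
exists dl, (dl / 4), (C * d%:R ^+ 2 * (C * vB * (2 * C ^+ 2 * vB ^+ 2)) * (4 * vB) + 1),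
  (fun t => Lq_norm +oo%E (nbd K dl) (Eu ^~ t)), (fun t => Lq_norm 2%:E (nbd K dl) (u ^~ t)); split => //.
- split => //; first by rewrite divr_gt0.
  by rewrite addr_ge0// !mulr_ge0 ?exprn_ge0 ?mulr_ge0 ?exprn_ge0 ?(ltW C0).
- by split => t; exact: Lnorm_ge0.
- by move=> a b a0 bT; split; [exact: (in_LtX_itv EuL)|exact: (in_LtX_itv uL)].
apply: filterS3 uL.1 EuL.1 Eusym => t ut1 ut2 ut3 tT v nv.
have [_ wy] := ut1 tT; have w2 := wy _ SinOm.
split; last exact: (strain_DR rho_kernel C0 rhoC rhoC' dl0 K0 cK SOm nv Om_open w2 (ut3 tT) (ut2 tT)).
exact: (nice_Lq_integrable (q := 1) cS nv w2).
Qed.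

Lemma controlled_strain_CET (p1 p2 : \bar R) (K : set V) : in_LtL Om T p2 2%:E u ->
  symgrad_in_LtL Om T p1 +oo%E u -> compact_in Om K ->
  controlled Om T u (flux_CET rho) p1 p2 K.
Proof.
move=> uL [Eu Eusym EuL] KOm; have [cK sK K0] := KOm.
have [C [C0 rhoC rhoC']] := kernel_bounded rho_kernel.
have [dl dl0 SOm] := nbd_in_open cK Om_open sK.
have SinOm := compact_nbd_in KOm (ltW dl0) SOm; have [cS _ S0] := SinOm.
exists dl, dl, ((2 * C ^+ 2 * vB + C) * (d%:R ^+ 2 * (C * vB)) * (4 * vB) + 1),
  (fun t => Lq_norm +oo%E (nbd K dl) (Eu ^~ t)), (fun t => Lq_norm 2%:E (nbd K dl) (u ^~ t)); split => //.
- split => //.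
  by rewrite addr_ge0// !mulr_ge0 ?exprn_ge0 ?addr_ge0 ?mulr_ge0 ?exprn_ge0 ?(ltW C0).
- by split => t; exact: Lnorm_ge0.
- by move=> a b a0 bT; split; [exact: (in_LtX_itv EuL)|exact: (in_LtX_itv uL)].
apply: filterS3 uL.1 EuL.1 Eusym => t ut1 ut2 ut3 tT v nv.
have [_ wy] := ut1 tT; have w2 := wy _ SinOm.
split; last exact: (strain_CET rho_kernel C0 rhoC rhoC' dl0 K0 cK SOm nv Om_open w2 (ut3 tT) (ut2 tT)).
exact: (nice_Lq_integrable (q := 1) cS nv w2).
Qed.

End controlled_cases.

Unset Implicit Arguments.

Theorem corollary3p3 (R : realType) (d : nat) (Om : set 'rV[R]_d) (T : R)
    (u : 'rV[R]_d -> R -> 'rV[R]_d) (rho : 'rV[R]_d -> R) (p1 p2 : \bar R)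
    (Om_open : open Om) (T_gt0 : 0 < T)
    (u_meas : ae_measurable spacetime_measure (spacetime Om T)
                (fun p => u p.1 p.2))
    (rho_kernel : mollifier_kernel rho)
    (p1_ge1 : (1 <= p1)%E) (p2_ge1 : (1 <= p2)%E) :
  ([\/ in_LtBesovVMO Om T 3%:E 3^-1 3 u,
       [/\ in_LtBD Om T p1 u, in_LtC0 Om T p2 u
         & (p1^-1 + 2%:E * p2^-1 = 1)%E],
       [/\ in_LtL Om T p2 +oo%E u, symgrad_in_LtL Om T p1 1%E u
         & (p1^-1 + 2%:E * p2^-1 = 1)%E]
     | [/\ in_LtL Om T p2 2%:E u, symgrad_in_LtL Om T p1 +oo%E u
         & (p1^-1 + 2%:E * p2^-1 = 1)%E]] ->
   cvg0_L1loc Om T (D_DR rho u)) /\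
  ([\/ in_LtBesovVMO Om T 3%:E 3^-1 3 u,
       [/\ in_LtBD Om T p1 u, in_LtVMO Om T p2 u
         & (p1^-1 + 2%:E * p2^-1 = 1)%E]
     | [/\ in_LtL Om T p2 2%:E u, symgrad_in_LtL Om T p1 +oo%E u
         & (p1^-1 + 2%:E * p2^-1 = 1)%E]] ->
   cvg0_L1loc Om T (D_CET rho u)).
Proof.
(* In the Besov case [1/3 + 2/3 = 1], so the general statement applies with both exponents equal to
   [3]. *)
have three_ge1 : (1 <= 3%:E :> \bar R)%E by rewrite lee_fin ler1n.
have three_conj : ((3%:E)^-1 + 2%:E * (3%:E)^-1 = 1 :> \bar R)%E.
  by rewrite inver pnatr_eq0 /= -EFinM -EFinD; congr (_%:E); lra.
(* The fluxes of the slices are [D_DR] and [D_CET] by conversion, so the conclusions below are those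
   of the theorem. *)
have DR := @controlled_cvg0 R d Om T u Om_open u_meas (flux_DR rho) _ _
  (flux_DR_nbd_congr rho_kernel)
  (fun l U _ mU _ => measurable_flux_DR_slices rho_kernel mU l).
have CET := @controlled_cvg0 R d Om T u Om_open u_meas (flux_CET rho) _ _
  (flux_CET_nbd_congr rho_kernel)
  (fun l U l0 mU intU => measurable_flux_CET_slices rho_kernel mU l0 intU).
split=> [[uX|[uX uY p12]|[uX uY p12]|[uX uY p12]]|[uX|[uX uY p12]|[uX uY p12]]].
- by apply: (DR _ _ three_ge1 three_ge1 three_conj) => K; exact: controlled_besov_DR.
- by apply: (DR _ _ p1_ge1 p2_ge1 p12) => K; exact: controlled_BD_C0_DR.
- by apply: (DR _ _ p1_ge1 p2_ge1 p12) => K; exact: controlled_bounded_DR.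
- by apply: (DR _ _ p1_ge1 p2_ge1 p12) => K; exact: controlled_strain_DR.
- by apply: (CET _ _ three_ge1 three_ge1 three_conj) => K; exact: controlled_besov_CET.
- by apply: (CET _ _ p1_ge1 p2_ge1 p12) => K; exact: controlled_VMO_CET.
- by apply: (CET _ _ p1_ge1 p2_ge1 p12) => K; exact: controlled_strain_CET.
Qed.
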